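(* Let $N>1$ be a prime power, let $\chi$ be a primitive quadratic Dirichlet character of conductor $N$, let $k\ge 2$ be an integer and let $\epsilon$ be a sign vector. Assume that for every integer $m$ for which the reduced modular form $f_m$ of order $m$ in $A^\epsilon(N,k,\chi)$ exists, $s(m)f_m$ has integral Fourier coefficients. Let $f_0=\sum_n a_0(n)q^n\in A^\epsilon(N,k,\chi)$ be the reduced modular form of order $0$, and let $n>0$ be an integer. (1) Assume $N=p>2$ is prime, $p^\nu\,\|\,k$ (that is, $p^\nu\mid k$ and $p^{\nu+1}\nmid k$), and $t$ is a primitive root modulo $p$. Then $p^{\nu+1}\mid s(0)a_0(n)$ if either - $\chi(t)=1$ and $(p-1)\mid k$, or - $\chi(t)=-1$ and $\gcd(p-1,k)=\frac{p-1}{2}$. (2) If $N=4$ and $2\nmid k$, then $2\mid s(0)a_0(n)$.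
   Context: Write $\chi=\prod_{p\mid N}\chi_p$, where $\chi_p$ is a primitive character modulo the exact power of $p$ dividing $N$. For $k\in\mathbb Z$, $A(N,k,\chi)$ is the space of weakly holomorphic modular forms: functions $f$ holomorphic on the upper half plane, meromorphic at the cusps, with $f\left(\frac{a\tau+b}{c\tau+d}\right)=\chi(d)(c\tau+d)^kf(\tau)$ for all $\begin{pmatrix}a&b\\c&d\end{pmatrix}\in\Gamma_0(N)$; write $f=\sum_n a(n)q^n$ with $q=e^{2\pi i\tau}$. A sign vector is $\epsilon=(\epsilon_p)_{p\mid N}$ with $\epsilon_p\in\{\pm1\}$. The space $A^\epsilon(N,k,\chi)$ consists of those $f=\sum_n a(n)q^n\in A(N,k,\chi)$ with $a(n)=0$ whenever $\chi_p(n)=-\epsilon_p$ for some prime $p\mid N$. For $m\in\mathbb Z$, $s(m)=2^{\omega(\gcd(m,N))}$, where $\omega(x)$ is the number of distinct prime divisors of $x$ (so $s(0)=2^{\omega(N)}$). A reduced modular form of order $m\in\mathbb Z$ in $A^\epsilon(N,k,\chi)$ is a form $f_m=\sum_n a_m(n)q^n=\frac{1}{s(m)}q^m+O(q^{m+1})$ in $A^\epsilon(N,k,\chi)$ such that for each $n>m$ with $a_m(n)\ne0$ there is no $g\in A^\epsilon(N,k,\chi)$ with $g=q^n+O(q^{n+1})$. It is unique if it exists. *)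

(* Defs.v *)
From Stdlib Require Import Reals ZArith Znumtheory List.
From Coquelicot Require Import Coquelicot.
Import ListNotations.

Open Scope Z_scope.

Definition ZtoC (n : Z) : C := RtoC (IZR n).

Definition prime_power (N : Z) : Prop :=
  exists p e : Z, prime p /\ 0 < e /\ N = p ^ e.

Definition exactly_divides (p nu n : Z) : Prop :=
  0 <= nu /\ (p ^ nu | n) /\ ~ (p ^ (nu + 1) | n).

Definition prime_divisors (n : Z) : list Z :=
  filter (fun p => if prime_dec p then if Zdivide_dec p n then true else false
                   else false)
         (map Z.of_nat (seq 1 (Z.to_nat (Z.abs n)))).

(** Used only for [n <> 0]; [prime_divisors 0] is empty. *)
Definition omega (n : Z) : nat := length (prime_divisors n).

Definition s (N m : Z) : Z := 2 ^ Z.of_nat (omega (Z.gcd m N)).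

Definition primitive_root (n t : Z) : Prop :=
  Z.gcd t n = 1 /\
  forall a : Z, Z.gcd a n = 1 -> exists j : Z, 0 <= j /\ (n | t ^ j - a).

(** [d] divides the complex number [x], which is thereby a rational integer. *)
Definition int_divides (d : Z) (x : C) : Prop :=
  exists z : Z, x = ZtoC z /\ (d | z).

(** [chi 1 = 1] follows from multiplicativity and [chi 1 <> 0]. *)
Definition dirichlet_character (N : Z) (chi : Z -> C) : Prop :=
  (forall a b : Z, chi (a * b) = (chi a * chi b)%C) /\
  (forall a : Z, chi (a + N) = chi a) /\
  (forall a : Z, chi a <> RtoC 0 <-> Z.gcd a N = 1).

(** [d] is an induced modulus of the character [chi] modulo [N]. *)
Definition induced_modulus (N : Z) (chi : Z -> C) (d : Z) : Prop :=
  0 < d /\ (d | N) /\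
  forall a : Z, Z.gcd a N = 1 -> (d | a - 1) -> chi a = RtoC 1.

Definition primitive_character (N : Z) (chi : Z -> C) : Prop :=
  dirichlet_character N chi /\
  forall d : Z, induced_modulus N chi d -> d = N.

(** [chi] has order exactly two in the group of characters modulo [N]. *)
Definition quadratic_character (N : Z) (chi : Z -> C) : Prop :=
  dirichlet_character N chi /\
  (forall a : Z, Z.gcd a N = 1 -> (chi a * chi a)%C = RtoC 1) /\
  (exists a : Z, Z.gcd a N = 1 /\ chi a <> RtoC 1).

(** [chi] is the product over the primes [p | N] of the [chip p], where
    [chip p] is primitive modulo the exact power of [p] dividing [N].  The value
    of [chip] at other indices is irrelevant. *)
Definition local_components (N : Z) (chi : Z -> C) (chip : Z -> Z -> C) : Prop :=
  (forall p nu : Z, prime p -> (p | N) -> exactly_divides p nu N ->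
     primitive_character (p ^ nu) (chip p)) /\
  (forall n : Z,
     chi n = fold_right Cmult (RtoC 1) (map (fun p => chip p n) (prime_divisors N))).

Definition sign_vector (N : Z) (eps : Z -> Z) : Prop :=
  forall p : Z, prime p -> (p | N) -> eps p = 1 \/ eps p = -1.

(** A function on the upper half plane is represented by a function [C -> C]
    whose values outside the half plane are never used. *)

Definition in_H (tau : C) : Prop := (0 < Im tau)%R.

Definition holomorphic_on_H (f : C -> C) : Prop :=
  forall tau : C, in_H tau ->
    ex_derive (K := C_AbsRing) (V := C_NormedModule) f tau.

Definition Cexp (z : C) : C :=
  ((exp (Re z) * cos (Im z))%R, (exp (Re z) * sin (Im z))%R).

(** [exp (2 pi i z)] *)
Definition e2pi (z : C) : C := Cexp (RtoC (2 * PI) * Ci * z)%C.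

Definition Cpow_Z (z : C) (k : Z) : C :=
  match k with
  | Z0 => RtoC 1
  | Zpos n => Cpow z (Pos.to_nat n)
  | Zneg n => Cinv (Cpow z (Pos.to_nat n))
  end.

Definition automorphy (c d : Z) (tau : C) : C := (ZtoC c * tau + ZtoC d)%C.

Definition moebius (a b c d : Z) (tau : C) : C :=
  ((ZtoC a * tau + ZtoC b) / automorphy c d tau)%C.

Definition slash (k a b c d : Z) (f : C -> C) (tau : C) : C :=
  (Cpow_Z (automorphy c d tau) (- k) * f (moebius a b c d tau))%C.

(** [g tau = sum_n b(n) exp (2 pi i n tau / h)] on the upper half plane, where
    only finitely many [b(n)] with [n < 0] are nonzero. *)
Definition laurent_expansion (h : Z) (g : C -> C) (b : Z -> C) : Prop :=
  exists n0 : Z,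
    (forall n : Z, n < n0 -> b n = RtoC 0) /\
    forall tau : C, in_H tau ->
      is_series (K := C_AbsRing) (V := C_NormedModule)
        (fun j : nat => let n := n0 + Z.of_nat j in
                        (b n * e2pi (ZtoC n * tau / ZtoC h))%C)
        (g tau).

Definition q_expansion (f : C -> C) (a : Z -> C) : Prop := laurent_expansion 1 f a.

(** All [f | gamma], for [gamma] in SL_2(Z), are Laurent series in
    [exp (2 pi i tau / N)].  The parameter with denominator [N] serves at every
    cusp: a form of level [N] and character modulo [N] is invariant under
    Gamma(N), which is normal in SL_2(Z). *)
Definition meromorphic_at_cusps (N k : Z) (f : C -> C) : Prop :=
  forall a b c d : Z, a * d - b * c = 1 ->
    exists bn : Z -> C, laurent_expansion N (slash k a b c d f) bn.

Definition weakly_holomorphic_form (N k : Z) (chi : Z -> C) (f : C -> C) : Prop :=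
  holomorphic_on_H f /\
  meromorphic_at_cusps N k f /\
  forall a b c d : Z, a * d - b * c = 1 -> (N | c) ->
    forall tau : C, in_H tau ->
      f (moebius a b c d tau)
        = (chi d * Cpow_Z (automorphy c d tau) k * f tau)%C.

(** [f = sum_n a(n) q^n] lies in A^eps(N, k, chi). *)
Definition in_A_eps (N k : Z) (chi : Z -> C) (chip : Z -> Z -> C) (eps : Z -> Z)
    (f : C -> C) (a : Z -> C) : Prop :=
  weakly_holomorphic_form N k chi f /\
  q_expansion f a /\
  forall n p : Z, prime p -> (p | N) ->
    chip p n = ZtoC (- eps p) -> a n = RtoC 0.

Definition reduced_form (N k : Z) (chi : Z -> C) (chip : Z -> Z -> C) (eps : Z -> Z)
    (m : Z) (f : C -> C) (a : Z -> C) : Prop :=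
  in_A_eps N k chi chip eps f a /\
  (forall n : Z, n < m -> a n = RtoC 0) /\
  a m = (RtoC 1 / ZtoC (s N m))%C /\
  forall n : Z, m < n -> a n <> RtoC 0 ->
    ~ exists (g : C -> C) (b : Z -> C),
        in_A_eps N k chi chip eps g b /\
        (forall j : Z, j < n -> b j = RtoC 0) /\ b n = RtoC 1.

(* Main.v *)
Require Import Defs.
From Stdlib Require Import Reals ZArith Znumtheory Zpow_facts List Lra Lia Psatz Classical FunctionalExtensionality.
From Coquelicot Require Import Coquelicot.

(** The congruence comes from an Eisenstein series [E] in A^eps(N, k, chi) with
    rational integral coefficients, constant term prime to the modulus [d] of the
    congruence and all other coefficients divisible by [d].

    Linear algebra ([reduced_divisibility]).  Call [m] leading if the space
    contains a form [q^m + O(q^(m+1))].  Reduced forms vanish at the leading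
    exponents beyond their order, so a form [x] of the space is the sum of
    [x(m) s(m) f_m] over the leading [m], and the [s(m) f_m] are integral by
    assumption.  The form [x = E - E_0 s(0) f_0] has coefficient [0] at [q^0] and
    the coefficient [E_m] at every other leading exponent [m].  These are
    divisible by [d], hence all coefficients of [x] are, hence so is
    [E_0 s(0) a_0(n)] for [n > 0].

    The sum over [m] is finite because leading exponents are bounded above: a
    form of the space that vanishes to high order is zero ([vanishing]).  For
    this, [|f| Im^(k/2)] is shown to be bounded, and then to be at most half of
    any of its bounds, by Cauchy's estimate for the coefficients.  That requires
    control of [f] at every cusp by the coefficients at infinity alone, and this
    is what the sign condition provides ([cusp_controlled_prime],
    [cusp_controlled_4]): the sums [Theta = sum_j chi(j) f((tau + j)/N)] and
    [Psi], its analogue over all units [j], are exchanged by [tau -> -1/tau], and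
    the sign condition relates [f(tau/N)] to them.

    The Eisenstein series.  With [icot z = i cot(pi z)], the sums
    [A(z, tau) = sum_m icot(z + m tau)] give the functions of weight one
    [eis_(i,j)(tau) = A((i tau + j)/N, tau) - 2i/N], which SL_2(Z) permutes up to
    the factor [c tau + d] ([eis_SL2]); the essential case is [tau -> -1/tau]
    ([cot_sum_inversion]).  Put
    [H = sum_(u,v) chi(v) eis_(u,v)^k + eps g sum_u chi(u) eis_(u,0)^k] with the
    Gauss sum [g].  Then [H(N tau)] has weight [k] and character [chi], and the
    second sum is chosen so that the coefficient at [q^n] contains the factor
    [1 + eps chi(n)] for [n] prime to [N], that is, so that the sign condition
    holds ([form_coef_expn], [form_coef_sign]).

    Divisibility.  Let [N = p] and let [p^nu] divide [k].  For [0 < u < p] the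
    series [p eis_(u,0)] is [p - 2u] plus [2p] times an integral series, and
    raising [y + p X] to a power divisible by [p^nu] makes the nonconstant
    coefficients divisible by [p^(nu+1)] ([split_pow_ideal]).  The constant term
    of [p^k H / (eps g)] is congruent to [sum_u chi(u) (-2u)^k] modulo [p].  The
    condition [gcd(p-1, k) = (p-1)/2] says that [chi(u) u^k] is congruent to [1],
    so this is [-(-2)^k], prime to [p].  The alternative [chi(t) = 1] never
    occurs, since [chi] would be trivial.  For [N = 4] and odd [k] the form
    [2^k H / (eps g)] has constant term in [2 + 4Z] and all other coefficients in
    [4Z], so its half is of the required kind. *)

Open Scope R_scope.

(** * Sums, limits and absolutely convergent series of complex numbers *)

Fixpoint rsum (b : nat -> R) (n : nat) : R :=
  match n with O => 0 | S m => rsum b m + b m end.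

Fixpoint csum (a : nat -> C) (n : nat) : C :=
  match n with O => RtoC 0 | S m => (csum a m + a m)%C end.

Definition clim (u : nat -> C) (l : C) : Prop :=
  forall e, 0 < e -> exists K, forall n, (K <= n)%nat -> Cmod (u n - l) < e.

Definition cser (a : nat -> C) (l : C) : Prop := clim (csum a) l.

(** Absolute convergence in the form in which it is used: a nonnegative
    majorant with bounded partial sums. *)
Definition summable (b : nat -> R) : Prop :=
  (forall n, 0 <= b n) /\ exists B, forall n, rsum b n <= B.

Lemma Cmod_sub_sym : forall x y : C, Cmod (x - y) = Cmod (y - x).
Proof. intros. rewrite <- Cmod_opp. f_equal. ring. Qed.

Lemma Cmod_triangle3 : forall x y z : C, Cmod (x - z) <= Cmod (x - y) + Cmod (y - z).
Proof.
  intros. replace (x - z)%C with ((x - y) + (y - z))%C by ring. apply Cmod_triangle.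
Qed.

Lemma Cmod_small_0 : forall x : C, (forall e, 0 < e -> Cmod x < e) -> x = RtoC 0.
Proof.
  intros x H. apply Cmod_eq_0. destruct (Cmod_ge_0 x) as [h|h]; [|now symmetry].
  specialize (H _ h). lra.
Qed.

Lemma csum_ext : forall a b n, (forall i, (i < n)%nat -> a i = b i) -> csum a n = csum b n.
Proof. induction n; intros H; simpl; auto. rewrite IHn, H; auto. Qed.

Lemma csum_plus : forall a b n, csum (fun i => a i + b i)%C n = (csum a n + csum b n)%C.
Proof. induction n; simpl. ring. rewrite IHn. ring. Qed.

Lemma csum_scal : forall c a n, csum (fun i => c * a i)%C n = (c * csum a n)%C.
Proof. induction n; simpl. ring. rewrite IHn. ring. Qed.

Lemma csum_zero : forall n, csum (fun _ => RtoC 0) n = RtoC 0.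
Proof. induction n; simpl; auto. rewrite IHn. ring. Qed.

Lemma csum_eq0 : forall a n, (forall i, (i < n)%nat -> a i = RtoC 0) -> csum a n = RtoC 0.
Proof. intros. rewrite (csum_ext _ (fun _ => RtoC 0)); auto. apply csum_zero. Qed.

Lemma csum_const : forall c n, csum (fun _ => c) n = (RtoC (INR n) * c)%C.
Proof. induction n. simpl. ring. simpl csum. rewrite IHn, S_INR, RtoC_plus. ring. Qed.

Lemma csum_swap : forall (a : nat -> nat -> C) m n,
  csum (fun i => csum (a i) n) m = csum (fun j => csum (fun i => a i j) m) n.
Proof.
  induction m; intros; simpl.
  - now rewrite csum_zero.
  - rewrite IHm, csum_plus. reflexivity.
Qed.

Lemma csum_S_l : forall a n, csum a (S n) = (a 0%nat + csum (fun i => a (S i)) n)%C.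
Proof. induction n. simpl. ring. simpl in *. rewrite IHn. ring. Qed.

Lemma csum_add : forall a m n, csum a (m + n) = (csum a m + csum (fun i => a (m + i)%nat) n)%C.
Proof.
  induction n; simpl. rewrite Nat.add_0_r. ring.
  rewrite Nat.add_succ_r. simpl. rewrite IHn. ring.
Qed.

Lemma csum_single : forall a n i, (i < n)%nat ->
  (forall j, (j < n)%nat -> j <> i -> a j = RtoC 0) -> csum a n = a i.
Proof.
  induction n; intros i Hi H. lia. simpl.
  destruct (Nat.eq_dec i n) as [->|Hn].
  - rewrite csum_eq0. ring. intros; apply H; lia.
  - rewrite (IHn i), (H n); try lia. ring. intros; apply H; lia.
Qed.

Lemma rsum_scal : forall c a n, rsum (fun i => c * a i) n = c * rsum a n.
Proof. induction n; simpl. ring. rewrite IHn. ring. Qed.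

Lemma rsum_le : forall a b n, (forall i, (i < n)%nat -> a i <= b i) -> rsum a n <= rsum b n.
Proof. induction n; intros; simpl. lra. apply Rplus_le_compat; auto. Qed.

Lemma rsum_ge0 : forall a n, (forall i, 0 <= a i) -> 0 <= rsum a n.
Proof. induction n; intros; simpl. lra. specialize (IHn H). specialize (H n). lra. Qed.

Lemma rsum_add : forall a m n, rsum a (m + n) = rsum a m + rsum (fun i => a (m + i)%nat) n.
Proof.
  induction n; simpl. rewrite Nat.add_0_r. ring.
  rewrite Nat.add_succ_r. simpl. rewrite IHn. ring.
Qed.

Lemma rsum_mono : forall b m n, (forall i, 0 <= b i) -> (m <= n)%nat -> rsum b m <= rsum b n.
Proof.
  intros. replace n with (m + (n - m))%nat by lia. rewrite rsum_add.
  assert (0 <= rsum (fun i => b (m + i)%nat) (n - m)) by (apply rsum_ge0; auto). lra.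
Qed.

Lemma rsum_term : forall b n i, (forall i, 0 <= b i) -> (i < n)%nat -> b i <= rsum b n.
Proof.
  intros. assert (rsum b (S i) <= rsum b n) by (apply rsum_mono; auto; lia).
  simpl in *. assert (0 <= rsum b i) by (apply rsum_ge0; auto). lra.
Qed.

Lemma Cmod_csum : forall a n, Cmod (csum a n) <= rsum (fun i => Cmod (a i)) n.
Proof.
  induction n; simpl. rewrite Cmod_0; lra.
  eapply Rle_trans. apply Cmod_triangle. lra.
Qed.

Lemma Cmod_csum_le : forall a b n, (forall i, (i < n)%nat -> Cmod (a i) <= b i) ->
  Cmod (csum a n) <= rsum b n.
Proof. intros. eapply Rle_trans. apply Cmod_csum. now apply rsum_le. Qed.

Lemma rsum_const : forall c n, rsum (fun _ => c) n = INR n * c.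
Proof. induction n. simpl; ring. simpl rsum. rewrite IHn, S_INR. ring. Qed.

Lemma clim_unique : forall u l l', clim u l -> clim u l' -> l = l'.
Proof.
  intros u l l' H H'.
  assert (l - l' = RtoC 0)%C.
  { apply Cmod_small_0. intros e He.
    destruct (H (e/2)) as [K HK]; [lra|]. destruct (H' (e/2)) as [K' HK']; [lra|].
    specialize (HK (K + K')%nat ltac:(lia)). specialize (HK' (K + K')%nat ltac:(lia)).
    eapply Rle_lt_trans. apply (Cmod_triangle3 l (u (K + K')%nat) l').
    rewrite Cmod_sub_sym. lra. }
  replace l with ((l - l') + l')%C by ring. rewrite H0. ring.
Qed.

Lemma clim_const : forall c, clim (fun _ => c) c.
Proof.
  intros c e He. exists 0%nat. intros. replace (c - c)%C with (RtoC 0) by ring.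
  now rewrite Cmod_0.
Qed.

Lemma clim_ext : forall u v l, (exists K, forall n, (K <= n)%nat -> u n = v n) -> clim u l -> clim v l.
Proof.
  intros u v l [K HK] H e He. destruct (H e He) as [K' HK'].
  exists (K + K')%nat. intros. rewrite <- HK by lia. apply HK'. lia.
Qed.

Lemma clim_plus : forall u v l m, clim u l -> clim v m -> clim (fun n => u n + v n)%C (l + m)%C.
Proof.
  intros u v l m H H' e He.
  destruct (H (e/2)) as [K HK]; [lra|]. destruct (H' (e/2)) as [K' HK']; [lra|].
  exists (K + K')%nat. intros n Hn.
  specialize (HK n ltac:(lia)). specialize (HK' n ltac:(lia)).
  replace (u n + v n - (l + m))%C with ((u n - l) + (v n - m))%C by ring.
  eapply Rle_lt_trans. apply Cmod_triangle. lra.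
Qed.

Lemma clim_scal : forall c u l, clim u l -> clim (fun n => c * u n)%C (c * l)%C.
Proof.
  intros c u l H e He.
  assert (0 <= Cmod c) by apply Cmod_ge_0.
  destruct (H (e / (Cmod c + 1))) as [K HK]. apply Rdiv_lt_0_compat; lra.
  exists K. intros n Hn. specialize (HK n Hn).
  replace (c * u n - c * l)%C with (c * (u n - l))%C by ring. rewrite Cmod_mult.
  assert (0 <= Cmod (u n - l)) by apply Cmod_ge_0.
  assert (Cmod (u n - l) * (Cmod c + 1) < e).
  { apply Rmult_lt_compat_r with (r := Cmod c + 1) in HK; [|lra].
    unfold Rdiv in HK. rewrite Rmult_assoc, Rinv_l, Rmult_1_r in HK; lra. }
  nra.
Qed.

Lemma clim_le : forall u l B, clim u l -> (forall n, Cmod (u n) <= B) -> Cmod l <= B.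
Proof.
  intros u l B H HB. apply Rnot_lt_le. intros Hl.
  destruct (H (Cmod l - B)) as [K HK]; [lra|].
  specialize (HK K (le_n _)). specialize (HB K).
  assert (Cmod l <= Cmod (l - u K) + Cmod (u K)).
  { replace l with ((l - u K) + u K)%C at 1 by ring. apply Cmod_triangle. }
  rewrite Cmod_sub_sym in H0. lra.
Qed.

Lemma clim_shift : forall u l m, clim u l -> clim (fun n => u (n + m)%nat) l.
Proof. intros u l m H e He. destruct (H e He) as [K HK]. exists K. intros. apply HK. lia. Qed.

Lemma clim_unshift : forall u l m, clim (fun n => u (n + m)%nat) l -> clim u l.
Proof.
  intros u l m H e He. destruct (H e He) as [K HK]. exists (K + m)%nat. intros.
  replace n with ((n - m) + m)%nat by lia. apply HK. lia.
Qed.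

Lemma cser_unique : forall a l l', cser a l -> cser a l' -> l = l'.
Proof. intros a l l'. apply clim_unique. Qed.

Lemma cser_ext : forall a b l, (forall n, a n = b n) -> cser a l -> cser b l.
Proof.
  intros a b l H. apply clim_ext. exists 0%nat. intros. apply csum_ext. auto.
Qed.

Lemma cser_plus : forall a b l m, cser a l -> cser b m -> cser (fun n => a n + b n)%C (l + m)%C.
Proof.
  intros. apply (clim_ext (fun n => csum a n + csum b n)%C).
  exists 0%nat; intros; now rewrite csum_plus. now apply clim_plus.
Qed.

Lemma cser_scal : forall c a l, cser a l -> cser (fun n => c * a n)%C (c * l)%C.
Proof.
  intros. apply (clim_ext (fun n => c * csum a n)%C).
  exists 0%nat; intros; now rewrite csum_scal. now apply clim_scal.
Qed.

Lemma cser_zero : cser (fun _ => RtoC 0) (RtoC 0).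
Proof.
  apply (clim_ext (fun _ => RtoC 0)). exists 0%nat; intros; now rewrite csum_zero.
  apply clim_const.
Qed.

Lemma cser_csum : forall (a : nat -> nat -> C) (l : nat -> C) n,
  (forall i, (i < n)%nat -> cser (a i) (l i)) ->
  cser (fun j => csum (fun i => a i j) n) (csum l n).
Proof.
  induction n; intros H; simpl. apply cser_zero. apply cser_plus; auto.
Qed.

Lemma cser_head : forall a l m, cser (fun n => a (m + n)%nat) l -> cser a (csum a m + l)%C.
Proof.
  intros a l m H. apply (clim_unshift _ _ m).
  apply (clim_ext (fun n => csum a m + csum (fun i => a (m + i)%nat) n)%C).
  exists 0%nat; intros. rewrite Nat.add_comm, csum_add. reflexivity.
  apply clim_plus. apply clim_const. apply H.
Qed.

Lemma cser_tail : forall a l m, cser a l -> cser (fun n => a (m + n)%nat) (l - csum a m)%C.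
Proof.
  intros a l m H.
  apply (clim_ext (fun n => csum a (n + m) + (- csum a m))%C).
  exists 0%nat; intros. rewrite Nat.add_comm, csum_add. ring.
  apply clim_plus. now apply (clim_shift (csum a)). apply clim_const.
Qed.

Lemma summable_tail : forall b, summable b ->
  forall e, 0 < e -> exists K, forall m n, (K <= m <= n)%nat -> rsum b n - rsum b m < e.
Proof.
  intros b [Hb [B HB]] e He.
  destruct (completeness (fun x => exists n, x = rsum b n)) as [L [HL1 HL2]].
  - exists B. intros x [n ->]. apply HB.
  - exists 0, 0%nat. reflexivity.
  - destruct (classic (exists K, L - e < rsum b K)) as [[K HK]|HN].
    + exists K. intros m n [H1 H2].
      assert (rsum b n <= L) by (apply HL1; eauto).
      assert (rsum b K <= rsum b m) by (apply rsum_mono; auto). lra.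
    + exfalso. assert (L <= L - e); [|lra]. apply HL2. intros x [n ->].
      apply Rnot_lt_le. intros h. apply HN; eauto.
Qed.

Lemma summable_le : forall a b, (forall n, 0 <= a n <= b n) -> summable b -> summable a.
Proof.
  intros a b H [Hb [B HB]]. split. intros; apply H. exists B. intros n.
  eapply Rle_trans; [|apply (HB n)]. apply rsum_le. intros; apply H.
Qed.

Lemma summable_scal : forall c b, 0 <= c -> summable b -> summable (fun n => c * b n).
Proof.
  intros c b Hc [Hb [B HB]]. split. intros; apply Rmult_le_pos; auto.
  exists (c * B). intros. rewrite rsum_scal. now apply Rmult_le_compat_l.
Qed.

Lemma summable_shift : forall b m, summable b -> summable (fun n => b (m + n)%nat).
Proof.
  intros b m [Hb [B HB]]. split; auto. exists B. intros n.
  specialize (HB (m + n)%nat). rewrite rsum_add in HB.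
  assert (0 <= rsum b m) by (apply rsum_ge0; auto). lra.
Qed.

Lemma cauchy_cv : forall u : nat -> C,
  (forall e, 0 < e -> exists K, forall m n, (K <= m <= n)%nat -> Cmod (u n - u m) < e) ->
  exists l, clim u l.
Proof.
  intros u H.
  assert (forall (f : C -> R), (forall x y, Rabs (f x - f y) <= Cmod (x - y)) ->
    exists l, forall e, 0 < e -> exists K, forall n, (K <= n)%nat -> Rabs (f (u n) - l) < e) as Hf.
  { intros f Hlip. destruct (Rcomplete.R_complete (fun n => f (u n))) as [l Hl].
    - intros e He. destruct (H e He) as [K HK]. exists K. intros n m Hn Hm.
      unfold Rdist.
      destruct (Nat.le_ge_cases n m).
      + rewrite Rabs_minus_sym. eapply Rle_lt_trans. apply Hlip. apply HK. lia.
      + eapply Rle_lt_trans. apply Hlip. apply HK. lia.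
    - exists l. intros e He. destruct (Hl e He) as [K HK]. exists K. intros. apply HK. lia. }
  destruct (Hf fst) as [l1 H1].
  { intros. change (fst x - fst y) with (fst (x - y)%C).
    eapply Rle_trans; [|apply Rmax_Cmod]. apply Rmax_l. }
  destruct (Hf snd) as [l2 H2].
  { intros. change (snd x - snd y) with (snd (x - y)%C).
    eapply Rle_trans; [|apply Rmax_Cmod]. apply Rmax_r. }
  exists (l1, l2). intros e He.
  destruct (H1 (e/2)) as [K1 HK1]; [lra|]. destruct (H2 (e/2)) as [K2 HK2]; [lra|].
  exists (K1 + K2)%nat. intros n Hn.
  specialize (HK1 n ltac:(lia)). specialize (HK2 n ltac:(lia)).
  eapply Rle_lt_trans. apply Cmod_2Rmax. simpl.
  assert (sqrt 2 <= 2).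
  { rewrite <- (sqrt_square 2) at 2 by lra. apply sqrt_le_1; lra. }
  assert (0 <= sqrt 2) by apply sqrt_pos.
  unfold Rminus in *.
  assert (Rmax (Rabs (fst (u n) + - l1)) (Rabs (snd (u n) + - l2)) < e / 2) by (apply Rmax_lub_lt; auto).
  assert (0 <= Rmax (Rabs (fst (u n) + - l1)) (Rabs (snd (u n) + - l2))).
  { eapply Rle_trans; [|apply Rmax_l]. apply Rabs_pos. }
  nra.
Qed.

Lemma abs_cv : forall a b, summable b -> (forall n, Cmod (a n) <= b n) -> exists l, cser a l.
Proof.
  intros a b Hb Hab. apply cauchy_cv. intros e He.
  destruct (summable_tail b Hb e He) as [K HK]. exists K. intros m n Hmn.
  eapply Rle_lt_trans; [|apply (HK m n Hmn)].
  replace n with (m + (n - m))%nat by lia. rewrite csum_add, rsum_add.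
  replace (csum a m + csum (fun i => a (m + i)%nat) (n - m) - csum a m)%C
    with (csum (fun i => a (m + i)%nat) (n - m)) by ring.
  replace (rsum b m + rsum (fun i : nat => b (m + i)%nat) (n - m) - rsum b m)
    with (rsum (fun i : nat => b (m + i)%nat) (n - m)) by ring.
  apply Cmod_csum_le. auto.
Qed.

Lemma cser_le : forall a b l B, cser a l -> (forall n, Cmod (a n) <= b n) ->
  (forall n, rsum b n <= B) -> Cmod l <= B.
Proof.
  intros. eapply clim_le; [apply H|]. intros n. eapply Rle_trans; [|apply (H1 n)].
  apply Cmod_csum_le; auto.
Qed.

Lemma cser_tail_le : forall a b l m e, cser a l -> (forall n, Cmod (a n) <= b n) ->
  (forall n, (m <= n)%nat -> rsum b n - rsum b m <= e) -> Cmod (l - csum a m) <= e.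
Proof.
  intros. apply (cser_le (fun n => a (m + n)%nat) (fun n => b (m + n)%nat)).
  now apply cser_tail. auto. intros n. specialize (H1 (m + n)%nat ltac:(lia)).
  rewrite rsum_add in H1. lra.
Qed.

Lemma clim_csum : forall (T : nat -> nat -> C) (t : nat -> C) n,
  (forall i, (i < n)%nat -> clim (fun M => T M i) (t i)) ->
  clim (fun M => csum (T M) n) (csum t n).
Proof.
  induction n; intros H; simpl. apply clim_const.
  apply (clim_plus (fun M => csum (T M) n) (fun M => T M n)); auto.
Qed.

(** Dominated convergence for series: cut at an index beyond which the
    majorant is small, and use termwise convergence below it. *)
Lemma tannery : forall (T : nat -> nat -> C) (t : nat -> C) b (sT : nat -> C) s,
  summable b -> (forall M n, Cmod (T M n) <= b n) ->
  (forall n, clim (fun M => T M n) (t n)) ->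
  (forall M, cser (T M) (sT M)) -> cser t s -> clim sT s.
Proof.
  intros T t b sT s Hb HT Ht HsT Hs e He.
  destruct (summable_tail b Hb (e/4)) as [K HK]; [lra|].
  assert (forall n, Cmod (t n) <= b n) as Htb.
  { intros n. eapply clim_le. apply Ht. intros; simpl; apply HT. }
  destruct (clim_csum T t K (fun i _ => Ht i) (e/4)) as [M0 HM0]; [lra|].
  exists M0. intros M HM. specialize (HM0 M HM).
  assert (Cmod (sT M - csum (T M) K) <= e/4).
  { apply (cser_tail_le (T M) b); auto. intros. left. apply HK. lia. }
  assert (Cmod (s - csum t K) <= e/4).
  { apply (cser_tail_le t b); auto. intros. left. apply HK. lia. }
  pose proof (Cmod_triangle3 (sT M) (csum (T M) K) s).
  pose proof (Cmod_triangle3 (csum (T M) K) (csum t K) s).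
  rewrite (Cmod_sub_sym (csum t K) s) in H2. simpl in *. lra.
Qed.

(** A majorant of product form makes both iterated sums absolutely convergent;
    interchanging them is dominated convergence for the partial column sums. *)
Lemma fubini : forall (a : nat -> nat -> C) (r c : nat -> C) u v s,
  summable u -> summable v -> (forall m n, Cmod (a m n) <= u m * v n) ->
  (forall m, cser (a m) (r m)) -> (forall n, cser (fun m => a m n) (c n)) ->
  cser r s -> cser c s.
Proof.
  intros a r c u v s Hu Hv Ha Hr Hc Hs.
  destruct Hu as [Hu0 [U HU]].
  apply (clim_ext (fun M => csum c M)). exists 0%nat; auto.
  assert (summable v) as Hv' by exact Hv.
  destruct Hv' as [Hv0 [V HV]].
  assert (0 <= V) by (specialize (HV 0%nat); simpl in HV; lra).
  apply (tannery (fun M m => csum (a m) M) r (fun m => V * u m)); auto.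
  - apply summable_scal; auto. split; eauto.
  - intros M m. apply Rle_trans with (rsum (fun n => u m * v n) M).
    apply Cmod_csum_le. auto. rewrite rsum_scal, Rmult_comm.
    apply Rmult_le_compat_r; auto.
  - intros M. apply (cser_csum (fun n m => a m n)). auto.
Qed.

Lemma cser_re_im : forall a l, cser a l <->
  (is_series (fun n => fst (a n)) (fst l) /\ is_series (fun n => snd (a n)) (snd l)).
Proof.
  assert (forall a n, sum_n (fun k => fst (a k)) n = fst (csum a (S n))) as F1.
  { intros a n. induction n. rewrite sum_O. simpl. ring.
    rewrite sum_Sn, IHn. simpl. reflexivity. }
  assert (forall a n, sum_n (fun k => snd (a k)) n = snd (csum a (S n))) as F2.
  { intros a n. induction n. rewrite sum_O. simpl. ring.
    rewrite sum_Sn, IHn. simpl. reflexivity. }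
  intros a l. split.
  - intros H. split;
    [change (is_lim_seq (sum_n (fun n => fst (a n))) (fst l))
    |change (is_lim_seq (sum_n (fun n => snd (a n))) (snd l))];
    apply is_lim_seq_spec; intros e; destruct (H e (cond_pos e)) as [K HK];
    exists K; intros n Hn; [rewrite F1|rewrite F2];
    (eapply Rle_lt_trans; [|apply (HK (S n)); lia]);
    (eapply Rle_trans; [|apply Rmax_Cmod]).
    + apply (Rmax_l (Rabs (fst (csum a (S n) - l)%C))).
    + apply (Rmax_r _ (Rabs (snd (csum a (S n) - l)%C))).
  - intros [H1 H2].
    change (is_lim_seq (sum_n (fun n => fst (a n))) (fst l)) in H1.
    change (is_lim_seq (sum_n (fun n => snd (a n))) (snd l)) in H2.
    apply is_lim_seq_spec in H1. apply is_lim_seq_spec in H2.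
    intros e He. assert (0 < e/2) as He2 by lra.
    destruct (H1 (mkposreal _ He2)) as [K1 HK1]. destruct (H2 (mkposreal _ He2)) as [K2 HK2].
    exists (S (K1 + K2)). intros n Hn. destruct n as [|n]; [lia|].
    specialize (HK1 n ltac:(lia)). specialize (HK2 n ltac:(lia)).
    rewrite F1 in HK1. rewrite F2 in HK2. simpl pos in *.
    eapply Rle_lt_trans. apply Cmod_2Rmax.
    change (fst (csum a (S n) - l)%C) with (fst (csum a (S n)) - fst l).
    change (snd (csum a (S n) - l)%C) with (snd (csum a (S n)) - snd l).
    assert (sqrt 2 <= 2).
    { rewrite <- (sqrt_square 2) at 2 by lra. apply sqrt_le_1; lra. }
    assert (0 <= sqrt 2) by apply sqrt_pos.
    assert (Rmax (Rabs (fst (csum a (S n)) - fst l)) (Rabs (snd (csum a (S n)) - snd l)) < e / 2) by (apply Rmax_lub_lt; auto).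
    assert (0 <= Rmax (Rabs (fst (csum a (S n)) - fst l)) (Rabs (snd (csum a (S n)) - snd l))).
    { eapply Rle_trans; [|apply Rmax_l]. apply Rabs_pos. }
    nra.
Qed.

Lemma sum_n_csum : forall (a : nat -> C) n,
  sum_n (G := C_AbelianMonoid) a n = csum a (S n).
Proof.
  intros a n. induction n. rewrite sum_O. simpl. ring.
  rewrite sum_Sn, IHn. reflexivity.
Qed.

(** The balls of the normed module C are squares, comparable with the discs of
    [Cmod] up to the factor [sqrt 2]; the partial sums are those of [csum]
    shifted by one. *)
Lemma is_series_cser : forall a l,
  is_series (K := C_AbsRing) (V := C_NormedModule) a l <-> cser a l.
Proof.
  intros a l. unfold is_series. split.
  - intros H e He.
    assert (0 < e / 2) as He2 by lra.
    specialize (H (ball (M := C_UniformSpace) l (mkposreal _ He2))).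
    destruct H as [K HK]. { exists (mkposreal _ He2). auto. }
    exists (S K). intros n Hn. destruct n as [|n]; [lia|].
    specialize (HK n ltac:(lia)).
    change (ball (M := C_UniformSpace) l (mkposreal _ He2) (sum_n (G := C_AbelianMonoid) a n)) in HK.
    rewrite (sum_n_csum a n) in HK.
    apply C_NormedModule_mixin_compat2 in HK.
    eapply Rlt_le_trans. apply HK. simpl.
    assert (sqrt 2 <= 2).
    { rewrite <- (sqrt_square 2) at 2 by lra. apply sqrt_le_1; lra. }
    nra.
  - intros H P [e He]. destruct (H e (cond_pos e)) as [K HK]. exists K. intros n Hn.
    change (P (sum_n (G := C_AbelianMonoid) a n)). rewrite (sum_n_csum a n).
    apply He. apply C_NormedModule_mixin_compat1. apply HK. lia.
Qed.

(** * The exponential function [e(z) = exp(2 pi i z)] *)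

Lemma Cexp_add : forall z w, Cexp (z + w)%C = (Cexp z * Cexp w)%C.
Proof.
  intros [a b] [c d]. unfold Cexp. simpl. rewrite exp_plus, cos_plus, sin_plus.
  unfold Cmult; simpl. f_equal; ring.
Qed.

Lemma Cexp_0 : Cexp (RtoC 0) = RtoC 1.
Proof. unfold Cexp. simpl. rewrite exp_0, cos_0, sin_0. unfold RtoC; f_equal; ring. Qed.

Lemma Cmod_Cexp : forall z, Cmod (Cexp z) = exp (Re z).
Proof.
  intros [a b]. unfold Cexp, Cmod. simpl.
  replace (exp a * cos b * (exp a * cos b * 1) + exp a * sin b * (exp a * sin b * 1))
    with (exp a * exp a * ((sin b)² + (cos b)²)) by (unfold Rsqr; ring).
  rewrite sin2_cos2, Rmult_1_r. apply sqrt_square. left; apply exp_pos.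
Qed.

Lemma e2pi_add : forall z w, e2pi (z + w)%C = (e2pi z * e2pi w)%C.
Proof. intros. unfold e2pi. rewrite <- Cexp_add. f_equal. ring. Qed.

Lemma e2pi_0 : e2pi (RtoC 0) = RtoC 1.
Proof. unfold e2pi. rewrite <- Cexp_0. f_equal. ring. Qed.

Lemma Cmod_e2pi : forall z, Cmod (e2pi z) = exp (- (2 * PI * Im z)).
Proof. intros [a b]. unfold e2pi. rewrite Cmod_Cexp. f_equal. simpl. ring. Qed.

Lemma Cmod_pos_neq : forall z, 0 < Cmod z -> z <> RtoC 0.
Proof. intros z H. now apply Cmod_gt_0. Qed.

Lemma e2pi_neq0 : forall z, e2pi z <> RtoC 0.
Proof. intros z. apply Cmod_pos_neq. rewrite Cmod_e2pi. apply exp_pos. Qed.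

Lemma e2pi_opp : forall z, e2pi (- z)%C = (/ e2pi z)%C.
Proof.
  intros z. assert (e2pi (-z) * e2pi z = 1)%C.
  { rewrite <- e2pi_add. replace (-z + z)%C with (RtoC 0) by ring. apply e2pi_0. }
  pose proof (e2pi_neq0 z).
  transitivity (e2pi (- z) * e2pi z * / e2pi z)%C; [field; auto|]. rewrite H. ring.
Qed.

Lemma e2pi_1 : e2pi (RtoC 1) = RtoC 1.
Proof.
  unfold e2pi, Cexp. simpl. 
  replace ((2 * PI * 0 - 0 * 1) * 1 - (2 * PI * 1 + 0 * 0) * 0) with 0 by ring.
  replace ((2 * PI * 0 - 0 * 1) * 0 + (2 * PI * 1 + 0 * 0) * 1) with (2 * PI) by ring.
  rewrite exp_0, cos_2PI, sin_2PI. unfold RtoC; f_equal; ring.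
Qed.

Lemma ZtoC_add : forall a b, ZtoC (a + b) = (ZtoC a + ZtoC b)%C.
Proof. intros. unfold ZtoC. now rewrite plus_IZR, RtoC_plus. Qed.
Lemma ZtoC_mul : forall a b, ZtoC (a * b) = (ZtoC a * ZtoC b)%C.
Proof. intros. unfold ZtoC. now rewrite mult_IZR, RtoC_mult. Qed.
Lemma ZtoC_opp : forall a, ZtoC (- a) = (- ZtoC a)%C.
Proof. intros. unfold ZtoC. now rewrite opp_IZR, RtoC_opp. Qed.
Lemma ZtoC_sub : forall a b, ZtoC (a - b) = (ZtoC a - ZtoC b)%C.
Proof. intros. unfold ZtoC. now rewrite minus_IZR, RtoC_minus. Qed.
Lemma ZtoC_inj : forall a b, ZtoC a = ZtoC b -> a = b.
Proof. intros a b H. apply RtoC_inj in H. now apply eq_IZR in H. Qed.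
Lemma ZtoC_0 : ZtoC 0 = RtoC 0. Proof. reflexivity. Qed.
Lemma ZtoC_1 : ZtoC 1 = RtoC 1. Proof. reflexivity. Qed.
Lemma ZtoC_nat : forall n, ZtoC (Z.of_nat n) = RtoC (INR n).
Proof. intros. unfold ZtoC. now rewrite <- INR_IZR_INZ. Qed.
Lemma ZtoC_neq0 : forall a, a <> 0%Z -> ZtoC a <> RtoC 0.
Proof. intros a H E. apply H. now apply ZtoC_inj. Qed.
Lemma e2pi_nat : forall n, e2pi (RtoC (INR n)) = RtoC 1.
Proof.
  induction n. apply e2pi_0. rewrite S_INR, RtoC_plus, e2pi_add, IHn, e2pi_1. ring.
Qed.

Lemma e2pi_Z : forall n, e2pi (ZtoC n) = RtoC 1.
Proof.
  intros n. destruct (Z.le_ge_cases 0 n).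
  - rewrite <- (Z2Nat.id n) by lia. rewrite ZtoC_nat. apply e2pi_nat.
  - replace n with (- - n)%Z by lia. rewrite ZtoC_opp, e2pi_opp.
    rewrite <- (Z2Nat.id (-n)) by lia. rewrite ZtoC_nat, e2pi_nat. field.
Qed.

Lemma e2pi_addZ : forall z n, e2pi (z + ZtoC n)%C = e2pi z.
Proof. intros. rewrite e2pi_add, e2pi_Z. ring. Qed.

Lemma e2pi_pow : forall z n, e2pi (RtoC (INR n) * z)%C = (e2pi z ^ n)%C.
Proof.
  induction n. simpl. replace (0 * z)%C with (RtoC 0) by ring. apply e2pi_0.
  rewrite S_INR, RtoC_plus. replace ((INR n + 1) * z)%C with (INR n * z + z)%C by ring.
  rewrite e2pi_add, IHn. simpl. ring.
Qed.

Lemma exp_est : forall x, Rabs (exp x - 1 - x) <= x * x * exp (Rabs x).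
Proof.
  intros x. pose proof (exp_ineq1_le x). pose proof (exp_ineq1_le (-x)).
  assert (exp x * exp (-x) = 1) as E by (rewrite <- exp_plus, Rplus_opp_r, exp_0; auto).
  pose proof (exp_pos x). rewrite Rabs_pos_eq by lra.
  assert (exp x - 1 <= x * exp x) by nra.
  destruct (Rle_dec 0 x).
  - rewrite Rabs_pos_eq by lra. nra.
  - rewrite (Rabs_left x) by lra. pose proof (exp_ineq1_le (-x)).
    assert (1 <= exp (-x)) by lra. nra.
Qed.

Lemma sin_le_abs : forall y, Rabs (sin y) <= Rabs y.
Proof.
  assert (forall y, 0 <= y -> Rabs (sin y) <= y) as H.
  { intros y Hy. pose proof PI_4. pose proof PI2_1. 
    destruct (Rle_dec y 1).
    - rewrite Rabs_pos_eq. destruct Hy as [Hy| <-]. left; now apply sin_lt_x. rewrite sin_0; lra.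
      apply sin_ge_0; lra.
    - pose proof (SIN_bound y). apply Rabs_le. lra. }
  intros y. destruct (Rle_dec 0 y). rewrite (Rabs_pos_eq y) by lra. auto.
  rewrite <- (Rabs_Ropp (sin y)), <- sin_neg, (Rabs_left y) by lra. apply H; lra.
Qed.

Lemma sin_lower : forall y, 0 <= y <= 4 -> y - y * y * y / 6 <= sin y.
Proof.
  intros y [H1 H2]. destruct (pre_sin_bound y 0 H1 H2) as [H _].
  unfold sin_approx, sin_term in H. simpl in H. lra.
Qed.

Lemma sin_est : forall y, Rabs (sin y - y) <= y * y.
Proof.
  assert (forall y, 0 <= y -> Rabs (sin y - y) <= y * y) as H.
  { intros y Hy. pose proof (sin_le_abs y) as Hs. rewrite (Rabs_pos_eq y) in Hs by lra.
    apply Rabs_le_between in Hs. apply Rabs_le.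
    destruct (Rle_dec y 2). pose proof (sin_lower y). split; nra. split; nra. }
  intros y. destruct (Rle_dec 0 y). auto.
  replace (sin y - y) with (- (sin (-y) - - y)) by (rewrite sin_neg; ring).
  rewrite Rabs_Ropp. replace (y * y) with (-y * -y) by ring. apply H. lra.
Qed.

Lemma cos_est : forall y, Rabs (cos y - 1) <= y * y.
Proof.
  intros y. replace (cos y) with (cos (2 * (y/2))) by (f_equal; field).
  rewrite cos_2a_sin.
  pose proof (sin_le_abs (y/2)). assert (Rabs (y/2) * Rabs (y/2) = y * y / 4).
  { rewrite <- Rabs_mult. rewrite Rabs_pos_eq; nra. }
  assert (Rabs (sin (y/2)) * Rabs (sin (y/2)) = sin (y/2) * sin (y/2)).
  { rewrite <- Rabs_mult. rewrite Rabs_pos_eq; nra. }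
  pose proof (Rabs_pos (sin (y/2))). pose proof (Rabs_pos (y/2)).
  apply Rabs_le. nra.
Qed.

Lemma Cmod_le_sum : forall z : C, Cmod z <= Rabs (fst z) + Rabs (snd z).
Proof.
  intros [a b]. unfold Cmod. simpl.
  apply Rsqr_incr_0_var. 2: pose proof (Rabs_pos a); pose proof (Rabs_pos b); lra.
  rewrite Rsqr_sqrt by nra. unfold Rsqr.
  assert (Rabs a * Rabs a = a * a) by (rewrite <- Rabs_mult; apply Rabs_pos_eq; nra).
  assert (Rabs b * Rabs b = b * b) by (rewrite <- Rabs_mult; apply Rabs_pos_eq; nra).
  pose proof (Rabs_pos a); pose proof (Rabs_pos b). nra.
Qed.

(** The quadratic remainder of the exponential, from the real estimates for
    exp, sin and cos; the derivative of a [q]-series is read off from it term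
    by term. *)
Lemma Cexp_est : forall w, Cmod (Cexp w - 1 - w)%C <= 4 * (Cmod w * Cmod w) * exp (Cmod w).
Proof.
  intros w. eapply Rle_trans. apply Cmod_le_sum.
  pose proof (Rmax_Cmod w) as HM.
  assert (Rabs (fst w) <= Cmod w) as Hx by (eapply Rle_trans; [apply Rmax_l|apply HM]).
  assert (Rabs (snd w) <= Cmod w) as Hy by (eapply Rle_trans; [apply Rmax_r|apply HM]).
  clear HM. pose proof (Cmod_ge_0 w) as Hm. set (m := Cmod w) in *. destruct w as [x y]. simpl in *.
  assert (exp (Rabs x) <= exp m) as He1 by (destruct Hx as [Hx|Hx]; [left; now apply exp_increasing|rewrite Hx; lra]).
  assert (exp x <= exp (Rabs x)) as He2.
  { destruct (Rle_abs x) as [h|h]; [left; now apply exp_increasing|rewrite <- h; lra]. }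
  pose proof (exp_est x) as H1. pose proof (sin_est y) as H2. pose proof (cos_est y) as H3.
  pose proof (exp_pos x). pose proof (exp_pos m).
  assert (x * x <= m * m) as Hxx.
  { replace (x * x) with (Rabs x * Rabs x) by (rewrite <- Rabs_mult; apply Rabs_pos_eq; nra).
    pose proof (Rabs_pos x). nra. }
  assert (y * y <= m * m) as Hyy.
  { replace (y * y) with (Rabs y * Rabs y) by (rewrite <- Rabs_mult; apply Rabs_pos_eq; nra).
    pose proof (Rabs_pos y). nra. }
  assert (0 <= m * m) by nra.
  assert (x * x * exp (Rabs x) <= m * m * exp m) as Hq.
  { apply Rmult_le_compat; try nra. }
  assert (y * y * exp x <= m * m * exp m) as Hq2.
  { apply Rmult_le_compat; try nra. }
  replace (exp x * cos y + - (1) + - x) with ((exp x - 1 - x) + exp x * (cos y - 1)) by ring.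
  replace (exp x * sin y + - 0 + - y) with (exp x * (sin y - y) + (exp x - 1) * y) by ring.
  assert (Rabs (exp x * (cos y - 1)) <= m * m * exp m).
  { rewrite Rabs_mult, (Rabs_pos_eq (exp x)) by lra. nra. }
  assert (Rabs (exp x * (sin y - y)) <= m * m * exp m).
  { rewrite Rabs_mult, (Rabs_pos_eq (exp x)) by lra. nra. }
  assert (Rabs ((exp x - 1) * y) <= m * m * exp m).
  { rewrite Rabs_mult.
    assert (Rabs (exp x - 1) <= Rabs x * exp (Rabs x)).
    { pose proof (exp_ineq1_le x). pose proof (exp_ineq1_le (-x)).
      assert (exp x * exp (-x) = 1) as E by (rewrite <- exp_plus, Rplus_opp_r, exp_0; auto).
      destruct (Rle_dec 0 x).
      - rewrite (Rabs_pos_eq x) in * by lra. rewrite Rabs_pos_eq by lra. nra.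
      - rewrite (Rabs_left x) by lra. assert (1 <= exp (-x)) by lra.
        assert (exp x <= 1) by nra. rewrite Rabs_left1 by lra. nra. }
    pose proof (Rabs_pos x). pose proof (Rabs_pos y). pose proof (Rabs_pos (exp x - 1)).
    apply Rle_trans with (Rabs x * exp (Rabs x) * Rabs y). apply Rmult_le_compat_r; auto.
    replace (m * m * exp m) with (m * exp m * m) by ring.
    apply Rmult_le_compat; auto. apply Rmult_le_pos; auto. left; apply exp_pos.
    apply Rmult_le_compat; auto. left; apply exp_pos. }
  pose proof (Rabs_triang (exp x - 1 - x) (exp x * (cos y - 1))).
  pose proof (Rabs_triang (exp x * (sin y - y)) ((exp x - 1) * y)).
  lra.
Qed.

Definition tpi : C := (RtoC (2 * PI) * Ci)%C.

Lemma tpi_neq0 : tpi <> RtoC 0.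
Proof.
  intros E. apply (f_equal snd) in E. simpl in E. pose proof PI_RGT_0. lra.
Qed.

Lemma Cmod_tpi : Cmod tpi = 2 * PI.
Proof.
  unfold tpi. rewrite Cmod_mult, Cmod_R, Cmod_Ci, Rmult_1_r. apply Rabs_pos_eq.
  pose proof PI_RGT_0; lra.
Qed.

Lemma e2pi_est : forall h, Cmod h <= 1 -> Cmod (e2pi h - 1 - tpi * h)%C <= 4 * (2 * PI) ^ 2 * exp (2 * PI) * Cmod h ^ 2.
Proof.
  intros h Hh. pose proof (Cexp_est (tpi * h)%C) as H. unfold e2pi. fold tpi.
  eapply Rle_trans. apply H. rewrite Cmod_mult, Cmod_tpi.
  pose proof PI_RGT_0. pose proof (Cmod_ge_0 h).
  assert (exp (2 * PI * Cmod h) <= exp (2 * PI)).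
  { destruct Hh as [Hh|Hh]. left. apply exp_increasing. nra. rewrite Hh, Rmult_1_r. lra. }
  pose proof (exp_pos (2 * PI)).
  assert (0 <= (2 * PI * Cmod h) * (2 * PI * Cmod h)) by nra.
  replace (4 * (2 * PI) ^ 2 * exp (2 * PI) * Cmod h ^ 2) with
    (4 * ((2 * PI * Cmod h) * (2 * PI * Cmod h)) * exp (2 * PI)) by ring.
  apply Rmult_le_compat_l; lra.
Qed.

Lemma e2pi_sub1_le : exists K, 0 < K /\ forall h, Cmod h <= 1 -> Cmod (e2pi h - 1)%C <= K * Cmod h.
Proof.
  exists (2 * PI + 4 * (2 * PI) ^ 2 * exp (2 * PI)). pose proof PI_RGT_0. pose proof (exp_pos (2 * PI)).
  split. nra. intros h Hh. pose proof (e2pi_est h Hh).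
  replace (e2pi h - 1)%C with ((e2pi h - 1 - tpi * h) + tpi * h)%C by ring.
  eapply Rle_trans. apply Cmod_triangle. rewrite Cmod_mult, Cmod_tpi.
  pose proof (Cmod_ge_0 h).
  assert (Cmod h ^ 2 <= Cmod h) by nra.
  assert (4 * (2 * PI) ^ 2 * exp (2 * PI) * Cmod h ^ 2 <= 4 * (2 * PI) ^ 2 * exp (2 * PI) * Cmod h).
  { apply Rmult_le_compat_l; nra. }
  nra.
Qed.

Lemma sin_lower_increasing : forall x, 0 <= x <= 3 * PI / 4 -> x / 8 <= sin x.
Proof.
  intros x Hx. pose proof PI_4. pose proof PI2_1.
  destruct (Rle_dec x 2).
  - pose proof (sin_lower x). nra.
  - assert (sin (3 * PI / 4) <= sin x).
    { apply sin_decr_1; lra. }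
    replace (3 * PI / 4) with (PI - PI / 4) in H1 by field.
    assert (sin (PI - PI/4) = sin (PI/4)) by (rewrite sin_minus, sin_PI, cos_PI; ring).
    rewrite H2 in H1.
    pose proof (sin_lower (PI/4)). 
    assert (1/2 <= PI / 4 <= 1) by lra.
    assert (PI/4 - PI / 4 * (PI/4) * (PI/4) / 6 >= 5/12).
    { set (q := PI/4) in *. nra. }
    lra.
Qed.

Lemma sin_pi_lower : forall a, Rabs a <= 3/4 -> PI * Rabs a / 8 <= Rabs (sin (PI * a)).
Proof.
  intros a Ha. pose proof PI_RGT_0. unfold Rabs in Ha at 1.
  destruct (Rcase_abs a).
  - rewrite (Rabs_left a) by lra. 
    replace (sin (PI * a)) with (- sin (PI * - a)) by (rewrite <- sin_neg; f_equal; ring).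
    rewrite Rabs_Ropp. eapply Rle_trans; [|apply Rle_abs]. 
    pose proof (sin_lower_increasing (PI * - a)). nra.
  - rewrite (Rabs_pos_eq a) by lra. eapply Rle_trans; [|apply Rle_abs].
    pose proof (sin_lower_increasing (PI * a)). nra.
Qed.

(** The double angle formula separates the contributions of the real and the
    imaginary part, each of which can then be bounded from below. *)
Lemma Cmod_one_sub_e2pi : forall u, Cmod (1 - e2pi u)%C ^ 2 =
  (1 - exp (- (2 * PI * Im u))) ^ 2 + 4 * exp (- (2 * PI * Im u)) * sin (PI * Re u) ^ 2.
Proof.
  intros [a b]. rewrite Cmod2_alt. unfold e2pi, Cexp. simpl Re. simpl Im.
  replace ((2 * PI * 0 - 0 * 1) * a - (2 * PI * 1 + 0 * 0) * b) with (- (2 * PI * b)) by ring.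
  replace ((2 * PI * 0 - 0 * 1) * b + (2 * PI * 1 + 0 * 0) * a) with (2 * (PI * a)) by ring.
  set (r := exp (- (2 * PI * b))). rewrite cos_2a_sin, sin_2a.
  pose proof (sin2_cos2 (PI * a)) as E. unfold Rsqr in E. 
  set (s := sin (PI * a)) in *. set (c := cos (PI * a)) in *.
  assert (c * c = 1 - s * s) by lra. 
  replace ((1 + - (r * (1 - 2 * s * s))) ^ 2 + (0 + - (r * (2 * s * c))) ^ 2)
    with ((1 + - (r * (1 - 2 * s * s))) ^ 2 + 4 * r * r * s * s * (c * c)) by ring.
  rewrite H. ring.
Qed.

(** In a strip around the imaginary axis that contains no other integer, [1 -
    e(u)] has a simple zero at [0] and no other zero; the bound 3/4 leaves
    room for the numbers [(z + j) / (2M + 1)] with [|j| <= M] and [M] large. *)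
Lemma one_sub_e2pi_low : forall Y, 0 <= Y -> exists K, 0 < K /\
  forall u, Rabs (Re u) <= 3/4 -> Rabs (Im u) <= Y -> K * Cmod u <= Cmod (1 - e2pi u)%C.
Proof.
  intros Y HY. pose proof PI_RGT_0 as Hpi. pose proof PI2_1.
  set (q := exp (- (2 * PI * Y))).
  assert (0 < q) by apply exp_pos.
  assert (q <= 1).
  { unfold q. rewrite <- exp_0 at 1. destruct (Rle_lt_or_eq_dec 0 Y HY).
    left; apply exp_increasing; nra. subst. rewrite Rmult_0_r, Ropp_0. rewrite exp_0; lra. }
  exists (q / 8). split. lra. intros u Hr Hi.
  apply Rsqr_incr_0_var; [|apply Cmod_ge_0].
  replace (Rsqr (Cmod (1 - e2pi u))) with (Cmod (1 - e2pi u) ^ 2) by (unfold Rsqr; ring).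
  rewrite Cmod_one_sub_e2pi. unfold Rsqr.
  replace (q / 8 * Cmod u * (q / 8 * Cmod u)) with (q * q / 64 * Cmod u ^ 2) by (field; lra).
  rewrite Cmod2_alt. set (a := Re u) in *. set (b := Im u) in *.
  pose proof (sin_pi_lower a Hr) as Hs. set (s := sin (PI * a)) in *.
  assert (a * a / 64 <= s * s) as Hss.
  { replace (s * s) with (Rabs s * Rabs s) by (rewrite <- Rabs_mult; apply Rabs_pos_eq; nra).
    replace (a * a) with (Rabs a * Rabs a) by (rewrite <- Rabs_mult; apply Rabs_pos_eq; nra).
    pose proof (Rabs_pos a). assert (Rabs a / 8 <= Rabs s) by nra. nra. }
  set (r := exp (- (2 * PI * b))).
  assert (q <= r).
  { unfold q, r. apply Rabs_le_between in Hi. assert (- (2 * PI * Y) <= - (2 * PI * b)) by nra.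
    destruct H2. left; now apply exp_increasing. rewrite H2; lra. }
  assert (q * q * (b * b) <= (1 - r) ^ 2).
  { pose proof (exp_ineq1_le (2 * PI * b)). pose proof (exp_ineq1_le (- (2 * PI * b))).
    fold r in H4.
    assert (r * exp (2 * PI * b) = 1). { unfold r. rewrite <- exp_plus, Rplus_opp_l, exp_0; auto. }
    assert (1 - r <= 2 * PI * b) by lra.
    pose proof (exp_pos (2 * PI * b)).
    assert (0 < r) by apply exp_pos.
    assert (r * (2 * PI * b) <= 1 - r) by nra.
    destruct (Rle_dec 0 b).
    - assert (q * b <= 1 - r). { apply Rle_trans with (r * (2 * PI * b)); auto. 
        apply Rle_trans with (r * b). nra. assert (b <= 2 * PI * b) by nra. nra. }
      assert (0 <= q * b) by nra. nra.
    - assert (2 * PI * b <= b) by nra. assert (1 - r <= b) by lra.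
      assert (0 <= - b <= r - 1) by lra. assert (q * q <= 1) by nra. nra. }
  assert (q * q * (a * a / 64) <= r * (s * s)).
  { apply Rmult_le_compat; nra. }
  assert (0 <= r * (s * s)) by (apply Rmult_le_pos; nra).
  assert (0 <= q * q * (b * b)) by (apply Rmult_le_pos; nra).
  nra.
Qed.

Lemma one_sub_e2pi_neq0 : forall u, Rabs (Re u) <= 3/4 -> u <> RtoC 0 -> (1 - e2pi u)%C <> RtoC 0.
Proof.
  intros u Hr Hu. destruct (one_sub_e2pi_low (Rabs (Im u)) (Rabs_pos _)) as [K [HK H]].
  specialize (H u Hr (Rle_refl _)). apply Cmod_pos_neq.
  assert (0 < Cmod u) by now apply Cmod_gt_0. nra.
Qed.

(** * The function [i cot(pi z)] and its partial fractions *)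

(** [i cot(pi z)]. Dividing by [i] is avoided so that the expansion in [e(z)]
    is [1 + 2 e(z) + 2 e(z)^2 + ...], with integral coefficients. *)
Definition icot (z : C) : C := ((1 + e2pi z) / (1 - e2pi z))%C.

Definition nonint (z : C) : Prop := forall n : Z, z <> ZtoC n.

Lemma nearest_int : forall r : R, exists n : Z, Rabs (r - IZR n) <= 1/2.
Proof.
  intros r. exists (up (r - 1/2)). destruct (archimed (r - 1/2)). apply Rabs_le. lra.
Qed.

Lemma nonint_e2pi : forall z, nonint z -> (1 - e2pi z)%C <> RtoC 0.
Proof.
  intros z Hz. destruct (nearest_int (Re z)) as [n Hn].
  rewrite <- (e2pi_addZ z (-n)). apply one_sub_e2pi_neq0.
  - rewrite ZtoC_opp. simpl in *. replace (fst z + - IZR n) with (Re z - IZR n) by reflexivity. lra.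
  - intros E. apply (Hz n). transitivity ((z + ZtoC (-n)) + ZtoC n)%C.
    rewrite ZtoC_opp; ring. rewrite E. ring.
Qed.

Lemma nonint_im : forall z, Im z <> 0 -> nonint z.
Proof. intros z H n E. apply H. rewrite E. reflexivity. Qed.

Lemma nonint_dist : forall z, nonint z -> exists d, 0 < d /\ forall j : Z, d <= Cmod (z + ZtoC j)%C.
Proof.
  intros z Hz. destruct (Req_dec (Im z) 0) as [E|E].
  - set (n := Int_part (Re z)). destruct (base_Int_part (Re z)) as [H1 H2]. fold n in H1, H2.
    assert (IZR n <> Re z).
    { intros E'. apply (Hz n). destruct z as [x y]. unfold ZtoC, RtoC. simpl in *. now rewrite E, E'. }
    exists (Rmin (Re z - IZR n) (1 - (Re z - IZR n))). split.
    + apply Rmin_pos; lra.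
    + intros j. eapply Rle_trans; [|apply re_le_Cmod].
      replace (Re (z + ZtoC j)%C) with ((Re z - IZR n) + IZR (n + j)) by (rewrite plus_IZR; simpl; unfold Re; ring).
      destruct (Z_le_gt_dec 0 (n + j)) as [h|h].
      * apply IZR_le in h. eapply Rle_trans; [apply Rmin_l|]. eapply Rle_trans; [|apply Rle_abs]. simpl in h. lra.
      * assert (n + j <= -1)%Z as h' by lia. apply IZR_le in h'.
        eapply Rle_trans; [apply Rmin_r|]. rewrite Rabs_left; lra.
  - exists (Rabs (Im z)). split. now apply Rabs_pos_lt.
    intros j. replace (Im z) with (snd (z + ZtoC j)%C) by (simpl; unfold Im; ring).
    eapply Rle_trans; [|apply Rmax_Cmod]. apply Rmax_r.
Qed.

Lemma nonint_growth : forall z, nonint z -> exists d, 0 < d /\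
  forall j : Z, d * (1 + Rabs (IZR j)) <= Cmod (z + ZtoC j)%C.
Proof.
  intros z Hz. destruct (nonint_dist z Hz) as [d [Hd H]].
  pose proof (Cmod_ge_0 z).
  set (q := (1 + Cmod z) / d + 1).
  assert (0 < q). { unfold q. assert (0 < (1 + Cmod z) / d) by (apply Rdiv_lt_0_compat; lra). lra. }
  exists (/ q). split. now apply Rinv_0_lt_compat. intros j.
  specialize (H j). set (m := Cmod (z + ZtoC j)) in *.
  assert (Rabs (IZR j) <= m + Cmod z).
  { rewrite <- (Cmod_R (IZR j)). fold (ZtoC j).
    replace (ZtoC j) with ((z + ZtoC j) + - z)%C by ring. eapply Rle_trans. apply Cmod_triangle.
    rewrite Cmod_opp. unfold m. lra. }
  apply Rmult_le_reg_l with q; auto. rewrite <- Rmult_assoc, Rinv_r, Rmult_1_l by lra.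
  unfold q. assert (1 + Cmod z <= (1 + Cmod z) / d * m); [|lra].
  apply Rle_trans with ((1 + Cmod z) / d * d). right; field; lra.
  apply Rmult_le_compat_l; auto. left. apply Rdiv_lt_0_compat; lra.
Qed.

Lemma icot_addZ : forall z n, icot (z + ZtoC n)%C = icot z.
Proof. intros. unfold icot. now rewrite e2pi_addZ. Qed.

Lemma icot_opp : forall z, nonint z -> icot (- z)%C = (- icot z)%C.
Proof.
  intros z Hz. unfold icot. rewrite e2pi_opp. pose proof (e2pi_neq0 z). pose proof (nonint_e2pi z Hz).
  field. repeat split; auto. intros E. apply H0. rewrite <- E at 1.
  replace (1 - e2pi z)%C with (- (e2pi z - 1))%C by ring. rewrite E. ring.
Qed.

Lemma icot_alt : forall z, nonint z -> icot z = (2 / (1 - e2pi z) - 1)%C.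
Proof. intros z Hz. unfold icot. pose proof (nonint_e2pi z Hz). field. auto. Qed.

Lemma csum_geom : forall (x : C) n, (csum (fun i => x ^ i) n * (1 - x) = 1 - x ^ n)%C.
Proof. induction n; simpl. ring. rewrite Cmult_plus_distr_r, IHn. ring. Qed.

Lemma unit_sum : forall K i, (0 < i < K)%nat ->
  csum (fun j => e2pi (RtoC (INR i) / RtoC (INR K)) ^ j)%C K = RtoC 0.
Proof.
  intros K i Hi. set (x := e2pi (RtoC (INR i) / RtoC (INR K))%C).
  assert (INR K <> 0) by (apply not_0_INR; lia).
  assert (RtoC (INR K) <> RtoC 0) by (intros E; apply RtoC_inj in E; auto).
  assert ((1 - x)%C <> RtoC 0).
  { apply nonint_e2pi. intros n E.
    assert (RtoC (INR i) = RtoC (IZR n * INR K)).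
    { rewrite RtoC_mult. fold (ZtoC n). rewrite <- E. field. auto. }
    apply RtoC_inj in H1. rewrite !INR_IZR_INZ, <- mult_IZR in H1. apply eq_IZR in H1. 
    assert (0 < n)%Z by nia. nia. }
  assert (x ^ K = 1)%C.
  { unfold x. rewrite <- e2pi_pow.
    replace (INR K * (INR i / INR K))%C with (RtoC (INR i)) by (field; auto). apply e2pi_nat. }
  pose proof (csum_geom x K) as E. rewrite H2 in E.
  replace (1 - 1)%C with (RtoC 0) in E by ring.
  transitivity (csum (fun i0 => x ^ i0)%C K * (1 - x) * / (1 - x))%C; [field; auto|].
  rewrite E. ring.
Qed.

(** The distribution relation: writing [2 / (1 - x)] over the common
    denominator [1 - x^K], the sum over the [K]-th roots of unity kills all
    powers of [x] but the zeroth. *)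
Lemma icot_mult_formula : forall K z, (0 < K)%nat -> nonint z ->
  icot z = (/ RtoC (INR K) * csum (fun j => icot ((z + RtoC (INR j)) / RtoC (INR K))) K)%C.
Proof.
  intros K z HK Hz.
  assert (INR K <> 0) as HK0 by (apply not_0_INR; lia).
  assert (RtoC (INR K) <> RtoC 0) as HKC by (intros E; apply RtoC_inj in E; auto).
  set (k := RtoC (INR K)) in *. set (y := e2pi (z / k)%C).
  assert (forall j, e2pi ((z + RtoC (INR j)) / k)%C = y * e2pi (RtoC (INR j) / k))%C as Ej.
  { intros j. unfold y. rewrite <- e2pi_add. f_equal. field. auto. }
  assert (y ^ K = e2pi z)%C as EK.
  { unfold y. rewrite <- e2pi_pow. f_equal. fold k. field. auto. }
  assert (forall j, nonint ((z + RtoC (INR j)) / k)%C) as Hni.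
  { intros j n E. apply (Hz (n * Z.of_nat K - Z.of_nat j)%Z). rewrite ZtoC_sub, ZtoC_mul, !ZtoC_nat.
    fold k. rewrite <- E. field. auto. }
  assert (forall j, 2 / (1 - e2pi ((z + RtoC (INR j)) / k)) =
    2 / (1 - e2pi z) * csum (fun i => (y * e2pi (RtoC (INR j) / k)) ^ i) K)%C as E1.
  { intros j. pose proof (nonint_e2pi _ (Hni j)) as Hn. rewrite Ej in *.
    set (x := (y * e2pi (RtoC (INR j) / k))%C) in *.
    pose proof (csum_geom x K) as G.
    assert (x ^ K = e2pi z)%C as Ex.
    { unfold x. rewrite Cpow_mult_l, EK, <- e2pi_pow. fold k.
      replace (k * (RtoC (INR j) / k))%C with (RtoC (INR j)) by (field; auto).
      rewrite e2pi_nat. ring. }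
    rewrite Ex in G. pose proof (nonint_e2pi z Hz).
    transitivity (2 / (1 - e2pi z) * (1 - e2pi z) / (1 - x))%C. { field; split; auto. }
    rewrite <- G at 2. field; split; auto. }
  rewrite (csum_ext _ (fun j => 2 / (1 - e2pi z) * csum (fun i => (y * e2pi (RtoC (INR j) / k)) ^ i) K + -(1))%C).
  2:{ intros j _. rewrite icot_alt by auto. rewrite E1. ring. }
  rewrite csum_plus, csum_scal, csum_const, csum_swap. fold k.
  rewrite (csum_single _ K 0%nat); [|lia|].
  - rewrite (csum_ext _ (fun _ => RtoC 1)) by (intros; simpl; ring).
    rewrite csum_const. fold k. rewrite icot_alt by auto. pose proof (nonint_e2pi z Hz). field. auto.
  - intros i Hi Hi0.
    rewrite (csum_ext _ (fun j => y ^ i * e2pi (RtoC (INR i) / k) ^ j)%C).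
    + rewrite csum_scal. 
      transitivity (y ^ i * 0)%C; [f_equal; exact (unit_sum K i ltac:(lia)) | ring].
    + intros j _. rewrite Cpow_mult_l. f_equal. rewrite <- !e2pi_pow. f_equal. field. auto.
Qed.

(** Sums over Z are taken symmetrically, the terms at [n] and [-n] together.
    The cotangent sums converge only in this sense. *)
Definition zfold (F : Z -> C) (n : nat) : C :=
  match n with O => F 0%Z | S _ => (F (Z.of_nat n) + F (- Z.of_nat n)%Z)%C end.

Definition zfoldR (F : Z -> R) (n : nat) : R :=
  match n with O => F 0%Z | S _ => F (Z.of_nat n) + F (- Z.of_nat n)%Z end.

Lemma zfold_sum : forall F M,
  csum (zfold F) (S M) = csum (fun i => F (Z.of_nat i - Z.of_nat M)%Z) (2 * M + 1).
Proof.
  induction M.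
  - simpl. ring.
  - replace (2 * S M + 1)%nat with (S (S (2 * M + 1))) by lia.
    change (csum (zfold F) (S (S M))) with (csum (zfold F) (S M) + zfold F (S M))%C.
    rewrite IHM, (csum_S_l _ (S (2 * M + 1))).
    change (csum (fun i : nat => F (Z.of_nat (S i) - Z.of_nat (S M))%Z) (S (2 * M + 1)))
     with (csum (fun i : nat => F (Z.of_nat (S i) - Z.of_nat (S M))%Z) (2 * M + 1) + F (Z.of_nat (S (2 * M + 1)) - Z.of_nat (S M))%Z)%C.
    rewrite (csum_ext (fun i : nat => F (Z.of_nat (S i) - Z.of_nat (S M))%Z) (fun i => F (Z.of_nat i - Z.of_nat M)%Z)).
    2:{ intros; f_equal; lia. }
    replace (Z.of_nat (S (2 * M + 1)) - Z.of_nat (S M))%Z with (Z.of_nat (S M)) by lia.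
    replace (Z.of_nat 0 - Z.of_nat (S M))%Z with (- Z.of_nat (S M))%Z by lia.
    unfold zfold. ring.
Qed.

Lemma csum_period_shift1 : forall (F : Z -> C) K, (forall j, F (j + Z.of_nat K)%Z = F j) ->
  forall s, csum (fun i => F (s + 1 + Z.of_nat i)%Z) K = csum (fun i => F (s + Z.of_nat i)%Z) K.
Proof.
  intros F K HF s.
  assert (F s + csum (fun i => F (s + 1 + Z.of_nat i)%Z) K = csum (fun i => F (s + Z.of_nat i)%Z) K + F s)%C.
  { rewrite <- (HF s) at 2. change (csum (fun i => F (s + Z.of_nat i)%Z) K + F (s + Z.of_nat K)%Z)%C
      with (csum (fun i => F (s + Z.of_nat i)%Z) (S K)).
    rewrite csum_S_l. f_equal. f_equal; lia. apply csum_ext. intros; f_equal; lia. }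
  replace (csum (fun i => F (s + 1 + Z.of_nat i)%Z) K) with (- F s + (F s + csum (fun i => F (s + 1 + Z.of_nat i)%Z) K))%C by ring.
  rewrite H. ring.
Qed.

Lemma csum_period_shift : forall (F : Z -> C) K, (forall j, F (j + Z.of_nat K)%Z = F j) ->
  forall s, csum (fun i => F (s + Z.of_nat i)%Z) K = csum (fun i => F (Z.of_nat i)) K.
Proof.
  intros F K HF.
  assert (forall s : nat, csum (fun i => F (Z.of_nat s + Z.of_nat i)%Z) K = csum (fun i => F (Z.of_nat i)) K) as Hp.
  { induction s. reflexivity. rewrite <- IHs.
    rewrite <- (csum_period_shift1 F K HF (Z.of_nat s)). apply csum_ext; intros; f_equal; lia. }
  assert (forall s : nat, csum (fun i => F (- Z.of_nat s + Z.of_nat i)%Z) K = csum (fun i => F (Z.of_nat i)) K) as Hn.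
  { induction s. reflexivity. rewrite <- IHs.
    rewrite <- (csum_period_shift1 F K HF (- Z.of_nat (S s))%Z). apply csum_ext; intros; f_equal; lia. }
  intros s. destruct (Z.le_ge_cases 0 s).
  - rewrite <- Hp with (s := Z.to_nat s). apply csum_ext; intros; f_equal; lia.
  - rewrite <- Hn with (s := Z.to_nat (-s)). apply csum_ext; intros; f_equal; lia.
Qed.

Lemma zfold_ext : forall F G n, (forall j, F j = G j) -> zfold F n = zfold G n.
Proof. intros F G [|n] H; unfold zfold; now rewrite !H. Qed.

Lemma zfold_plus : forall F G n, zfold (fun j => F j + G j)%C n = (zfold F n + zfold G n)%C.
Proof. intros F G [|n]; unfold zfold; ring. Qed.

Lemma zfold_scal : forall c F n, zfold (fun j => c * F j)%C n = (c * zfold F n)%C.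
Proof. intros c F [|n]; unfold zfold; ring. Qed.

Lemma Cmod_zfold_le : forall F G n, (forall j, Cmod (F j) <= G j) -> Cmod (zfold F n) <= zfoldR G n.
Proof.
  intros F G [|n] H; unfold zfold, zfoldR. apply H.
  eapply Rle_trans. apply Cmod_triangle. apply Rplus_le_compat; apply H.
Qed.

Lemma clim_zfold : forall (F : nat -> Z -> C) G n, (forall j, clim (fun M => F M j) (G j)) ->
  clim (fun M => zfold (F M) n) (zfold G n).
Proof. intros F G [|n] H; unfold zfold; auto. apply clim_plus; auto. Qed.

Lemma summable_inv_sq : summable (fun n => / ((1 + INR n) * (1 + INR n))).
Proof.
  split. intros n. pose proof (pos_INR n). left. apply Rinv_0_lt_compat. nra.
  exists 2. assert (forall n, rsum (fun n => / ((1 + INR n) * (1 + INR n))) (S n) <= 2 - / (1 + INR n)).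
  { induction n. simpl. lra.
    change (rsum (fun n => / ((1 + INR n) * (1 + INR n))) (S n) + / ((1 + INR (S n)) * (1 + INR (S n))) <= 2 - / (1 + INR (S n))).
    eapply Rle_trans. apply Rplus_le_compat_r. apply IHn.
    rewrite S_INR. pose proof (pos_INR n). set (x := INR n) in *.
    assert (/ ((1 + (x + 1)) * (1 + (x + 1))) <= / ((1 + x) * (1 + (x + 1)))).
    { apply Rinv_le_contravar; nra. }
    assert (/ ((1 + x) * (1 + (x + 1))) = / (1 + x) - / (1 + (x + 1))) by (field; lra).
    lra. }
  intros [|n]. simpl; lra. eapply Rle_trans. apply H.
  pose proof (pos_INR n). assert (0 < / (1 + INR n)) by (apply Rinv_0_lt_compat; lra). lra.
Qed.

Lemma summable_inv_32 : summable (fun n => / ((1 + INR n) * sqrt (1 + INR n))).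
Proof.
  assert (forall n, 0 < sqrt (1 + INR n)) as Hs.
  { intros n. apply sqrt_lt_R0. pose proof (pos_INR n). lra. }
  split. intros n. pose proof (pos_INR n). left. apply Rinv_0_lt_compat. specialize (Hs n). nra.
  exists 3. assert (forall n, rsum (fun n => / ((1 + INR n) * sqrt (1 + INR n))) (S n) <= 3 - 2 * / sqrt (1 + INR n)).
  { induction n. simpl. rewrite Rplus_0_r, sqrt_1. lra.
    change (rsum (fun n => / ((1 + INR n) * sqrt (1 + INR n))) (S n) + / ((1 + INR (S n)) * sqrt (1 + INR (S n))) <= 3 - 2 * / sqrt (1 + INR (S n))).
    eapply Rle_trans. apply Rplus_le_compat_r. apply IHn.
    pose proof (Hs n) as Ha. pose proof (Hs (S n)) as Hb.
    assert (sqrt (1 + INR n) * sqrt (1 + INR n) = 1 + INR n) as Ea by (apply sqrt_sqrt; pose proof (pos_INR n); lra).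
    assert (sqrt (1 + INR (S n)) * sqrt (1 + INR (S n)) = 1 + INR n + 1) as Eb.
    { rewrite sqrt_sqrt. rewrite S_INR; ring. pose proof (pos_INR (S n)); lra. }
    replace (1 + INR (S n)) with (sqrt (1 + INR (S n)) * sqrt (1 + INR (S n))) at 1.
    2:{ rewrite Eb, S_INR; ring. }
    set (a := sqrt (1 + INR n)) in *. set (b := sqrt (1 + INR (S n))) in *.
    assert (b * b = a * a + 1) as E by lra. clearbody a b.
    assert (a < b) by nra.
    assert (/ (b * b * b) <= 2 * (/ a - / b)); [|lra].
    replace (2 * (/ a - / b)) with (2 * (b - a) / (a * b)) by (field; lra).
    apply Rmult_le_reg_r with (a * b * b * b). repeat apply Rmult_lt_0_compat; auto.
    replace (/ (b * b * b) * (a * b * b * b)) with a by (field; lra).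
    replace (2 * (b - a) / (a * b) * (a * b * b * b)) with (2 * (b - a) * b * b) by (field; lra).
    assert ((b - a) * (b + a) = 1) by (ring_simplify; lra).
    assert (0 <= (b - a) * (b - a)) by nra.
    assert (1 <= (b - a) * (2 * b)) by lra.
    assert (b * 1 <= b * ((b - a) * (2 * b))) by (apply Rmult_le_compat_l; lra). lra. }
  intros [|n]. simpl; lra. eapply Rle_trans. apply H.
  specialize (Hs n). assert (0 < / sqrt (1 + INR n)) by now apply Rinv_0_lt_compat. lra.
Qed.

Lemma summable_zfoldR : forall (G : Z -> R) b, (forall j, 0 <= G j <= b (Z.to_nat (Z.abs j))) -> summable b ->
  summable (zfoldR G).
Proof.
  intros G b H Hb. apply summable_le with (fun n => 2 * b n).
  2: apply summable_scal; auto; lra.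
  intros [|n]; unfold zfoldR.
  - specialize (H 0%Z). simpl in H. lra.
  - pose proof (H (Z.of_nat (S n))) as H1. pose proof (H (- Z.of_nat (S n))%Z) as H2.
    rewrite Z.abs_opp in H2. rewrite Z.abs_eq, Nat2Z.id in * by lia. lra.
Qed.

(** The constant [-pi i], which makes the principal part of [neg_pi_i * icot
    z] at [0] equal to [1/z]. *)
Definition neg_pi_i : C := (- (tpi / 2))%C.

Lemma icot_near_0 : exists K, 0 < K /\ forall u, u <> RtoC 0 -> Cmod u <= 3/4 ->
  Cmod (neg_pi_i * u * icot u - 1)%C <= K * Cmod u.
Proof.
  destruct (one_sub_e2pi_low 1) as [k [Hk Hlow]]; [lra|].
  set (K0 := 4 * (2 * PI) ^ 2 * exp (2 * PI)).
  pose proof PI_RGT_0.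
  assert (0 < K0) by (unfold K0; apply Rmult_lt_0_compat; [apply Rmult_lt_0_compat; [lra|apply pow_lt; lra]|apply exp_pos]).
  exists ((2 * PI * PI + PI * K0 + K0) / k). split.
  { apply Rdiv_lt_0_compat; auto. nra. }
  intros u Hu Hu1.
  assert (Rabs (Re u) <= 3/4) by (eapply Rle_trans; [apply re_le_Cmod|auto]).
  assert (Rabs (Im u) <= 1).
  { apply Rle_trans with (Cmod u); [|lra]. eapply Rle_trans; [|apply Rmax_Cmod]. apply Rmax_r. }
  pose proof (one_sub_e2pi_neq0 u H1 Hu) as Hn. specialize (Hlow u H1 H2).
  pose proof (e2pi_est u ltac:(lra)) as He. fold K0 in He.
  set (r := (e2pi u - 1 - tpi * u)%C) in *.
  assert (e2pi u = 1 + tpi * u + r)%C as Eu by (unfold r; ring).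
  assert (neg_pi_i * u * icot u - 1 = (- (tpi * tpi / 2) * (u * u) + (- (tpi / 2)) * (u * r) + r) / (1 - e2pi u))%C as E.
  { unfold icot, neg_pi_i. 
    transitivity ((- (tpi / 2) * u * (1 + e2pi u) - (1 - e2pi u)) / (1 - e2pi u))%C. field; auto.
    f_equal. rewrite Eu. field. }
  rewrite E, Cmod_div by auto.
  assert (0 < Cmod u) as Hup by (now apply Cmod_gt_0).
  assert (0 < Cmod (1 - e2pi u)) by (now apply Cmod_gt_0).
  apply Rmult_le_reg_r with (Cmod (1 - e2pi u)); auto.
  unfold Rdiv at 1. rewrite Rmult_assoc, Rinv_l, Rmult_1_r by lra.
  apply Rle_trans with ((2 * PI * PI + PI * K0 + K0) / k * Cmod u * (k * Cmod u)).
  2:{ apply Rmult_le_compat_l; auto. apply Rmult_le_pos; [|lra]. left. apply Rdiv_lt_0_compat; auto. nra. }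
  replace ((2 * PI * PI + PI * K0 + K0) / k * Cmod u * (k * Cmod u)) with ((2 * PI * PI + PI * K0 + K0) * Cmod u ^ 2) by (field; lra).
  eapply Rle_trans. apply Cmod_triangle. eapply Rle_trans. apply Rplus_le_compat_r. apply Cmod_triangle.
  rewrite !Cmod_mult, !Cmod_opp, !Cmod_div by (intros E'; apply RtoC_inj in E'; lra).
  rewrite Cmod_mult, Cmod_tpi, Cmod_R, (Rabs_pos_eq 2) by lra.
  set (m := Cmod u) in *.
  assert (m * Cmod r <= K0 * m ^ 2).
  { pose proof (Cmod_ge_0 r). apply Rle_trans with (1 * Cmod r). apply Rmult_le_compat_r; lra. lra. }
  replace (2 * PI * (2 * PI) / 2 * (m * m)) with (2 * PI * PI * m ^ 2) by field.
  replace (2 * PI / 2) with PI by field.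
  assert (PI * (m * Cmod r) <= PI * (K0 * m ^ 2)) by (apply Rmult_le_compat_l; lra).
  lra.
Qed.

(** At the scaled points [(z + j)/K] and [(w + j)/K] this is a bound of order
    [K / (1 + |j|)^2], while a single value of [icot] is only bounded by [K /
    (1 + |j|)]; this is why partial fractions are considered for differences. *)
Lemma icot_diff_bound : forall Y, 0 <= Y -> exists K, 0 < K /\ forall u v,
  u <> RtoC 0 -> v <> RtoC 0 -> Cmod (u - v)%C <= 1 ->
  Rabs (Re u) <= 3/4 -> Rabs (Re v) <= 3/4 -> Rabs (Im u) <= Y -> Rabs (Im v) <= Y ->
  Cmod (icot u - icot v)%C <= K * Cmod (u - v)%C / (Cmod u * Cmod v).
Proof.
  intros Y HY. destruct (one_sub_e2pi_low Y HY) as [k [Hk Hlow]].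
  destruct e2pi_sub1_le as [K1 [HK1 H1]]. pose proof PI_RGT_0.
  exists (2 * exp (2 * PI * Y) * K1 / (k * k)). split.
  { apply Rdiv_lt_0_compat. pose proof (exp_pos (2 * PI * Y)). nra. nra. }
  intros u v Hu Hv Huv Ru Rv Iu Iv.
  pose proof (one_sub_e2pi_neq0 u Ru Hu) as Hnu. pose proof (one_sub_e2pi_neq0 v Rv Hv) as Hnv.
  pose proof (Hlow u Ru Iu) as Lu. pose proof (Hlow v Rv Iv) as Lv.
  assert (icot u - icot v = 2 * (e2pi v * (e2pi (u - v) - 1)) / ((1 - e2pi u) * (1 - e2pi v)))%C as E.
  { replace (e2pi v * (e2pi (u - v) - 1))%C with (e2pi u - e2pi v)%C.
    unfold icot. field. auto.
    replace u with (v + (u - v))%C at 1 by ring. rewrite e2pi_add. ring. }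
  rewrite E, Cmod_div, !Cmod_mult, Cmod_R, (Rabs_pos_eq 2) by (try lra; now apply Cmult_neq_0).
  specialize (H1 _ Huv).
  assert (Cmod (e2pi v) <= exp (2 * PI * Y)).
  { rewrite Cmod_e2pi. apply Rabs_le_between in Iv. assert (- (2 * PI * Im v) <= 2 * PI * Y) by nra.
    destruct H0. left; now apply exp_increasing. rewrite H0; lra. }
  assert (0 < Cmod u) by (now apply Cmod_gt_0). assert (0 < Cmod v) by (now apply Cmod_gt_0).
  assert (0 < Cmod (1 - e2pi u)) by (now apply Cmod_gt_0). assert (0 < Cmod (1 - e2pi v)) by (now apply Cmod_gt_0).
  replace (2 * exp (2 * PI * Y) * K1 / (k * k) * Cmod (u - v) / (Cmod u * Cmod v))
    with ((2 * (exp (2 * PI * Y) * (K1 * Cmod (u - v)))) * / ((k * Cmod u) * (k * Cmod v))) by (field; lra).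
  pose proof (Cmod_ge_0 (e2pi v)). pose proof (Cmod_ge_0 (e2pi (u - v) - 1)).
  apply Rmult_le_compat.
  - apply Rmult_le_pos; [lra|]. apply Rmult_le_pos; auto.
  - left. apply Rinv_0_lt_compat. now apply Rmult_lt_0_compat.
  - apply Rmult_le_compat_l; [lra|]. apply Rmult_le_compat; auto.
  - apply Rinv_le_contravar. repeat apply Rmult_lt_0_compat; auto.
    apply Rmult_le_compat; auto; apply Rmult_le_pos; try lra; apply Cmod_ge_0.
Qed.

(** The distribution relation with [K = 2M + 1], written over the symmetric
    range from [-M] to [M]: its terms tend to partial fractions as [M] grows. *)
Lemma icot_fold_formula : forall M z, nonint z ->
  icot z = csum (zfold (fun j => / RtoC (INR (2 * M + 1)) * icot ((z + ZtoC j) / RtoC (INR (2 * M + 1))))%C) (S M).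
Proof.
  intros M z Hz. rewrite zfold_sum. set (K := (2 * M + 1)%nat).
  assert (INR K <> 0) as HK0 by (apply not_0_INR; lia).
  assert (RtoC (INR K) <> RtoC 0) as HKC by (intros E; apply RtoC_inj in E; auto).
  rewrite (icot_mult_formula K z) by (auto; lia). rewrite <- csum_scal.
  set (F := fun j : Z => (/ RtoC (INR K) * icot ((z + ZtoC j) / RtoC (INR K)))%C).
  transitivity (csum (fun i => F (Z.of_nat i)) K).
  { apply csum_ext. intros. unfold F. now rewrite ZtoC_nat. }
  rewrite <- (csum_period_shift F K) with (s := (- Z.of_nat M)%Z).
  - apply csum_ext. intros. unfold F.
    replace (- Z.of_nat M + Z.of_nat i)%Z with (Z.of_nat i - Z.of_nat M)%Z by lia. reflexivity.
  - intros j. unfold F. f_equal. rewrite <- (icot_addZ ((z + ZtoC j) / RtoC (INR K)) 1). f_equal.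
    rewrite ZtoC_add, ZtoC_nat, ZtoC_1. field. auto.
Qed.

Lemma cser_finite : forall a m, (forall n, (m <= n)%nat -> a n = RtoC 0) -> cser a (csum a m).
Proof.
  intros a m H. replace (csum a m) with (csum a m + 0)%C by ring. apply cser_head.
  apply (cser_ext (fun _ => RtoC 0)). intros; symmetry; apply H; lia. apply cser_zero.
Qed.

Lemma big_nat : forall x : R, exists n : nat, x <= INR n.
Proof.
  intros x. destruct (Rle_dec x 0). exists 0%nat; simpl; lra.
  exists (Z.to_nat (up x)). destruct (archimed x). rewrite INR_IZR_INZ, Z2Nat.id. lra.
  apply le_IZR. lra.
Qed.

Lemma nonint_addZ_neq0 : forall z j, nonint z -> (z + ZtoC j)%C <> RtoC 0.
Proof.
  intros z j H E. apply (H (- j)%Z). rewrite ZtoC_opp.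
  replace z with ((z + ZtoC j) - ZtoC j)%C by ring. rewrite E. ring.
Qed.

Lemma icot_scaled_limit : forall M0 z j, nonint z ->
  clim (fun M => neg_pi_i * (/ RtoC (INR (2 * (M + M0) + 1)) * icot ((z + ZtoC j) / RtoC (INR (2 * (M + M0) + 1)))))%C
       (1 / (z + ZtoC j))%C.
Proof.
  intros M0 z j Hz. destruct icot_near_0 as [K [HK H]].
  pose proof (nonint_addZ_neq0 z j Hz) as Hn. set (x := (z + ZtoC j)%C) in *.
  assert (0 < Cmod x) as Hx by now apply Cmod_gt_0.
  intros e He.
  destruct (big_nat (2 * Cmod x)) as [A HA]. destruct (big_nat (K / e + 1)) as [B HB].
  exists (A + B)%nat. intros n Hn'.
  set (k := (2 * (n + M0) + 1)%nat).
  assert (INR A <= INR k) by (apply le_INR; unfold k; lia).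
  assert (INR B <= INR k) by (apply le_INR; unfold k; lia).
  assert (1 <= INR k) by (change 1 with (INR 1); apply le_INR; unfold k; lia).
  assert (RtoC (INR k) <> RtoC 0) as HkC by (intros E; apply RtoC_inj in E; lra).
  assert (Cmod (x / RtoC (INR k)) = Cmod x / INR k) as Em.
  { rewrite Cmod_div by auto. now rewrite Cmod_R, Rabs_pos_eq by lra. }
  assert (x / RtoC (INR k) <> RtoC 0)%C as Hq.
  { apply Cmod_pos_neq. rewrite Em. apply Rdiv_lt_0_compat; lra. }
  specialize (H _ Hq). rewrite Em in H.
  assert (Cmod x / INR k <= 3/4).
  { apply Rmult_le_reg_r with (INR k). lra. unfold Rdiv at 1. rewrite Rmult_assoc, Rinv_l; lra. }
  specialize (H H3). clear Hq.
  replace (neg_pi_i * (/ RtoC (INR k) * icot (x / RtoC (INR k))) - 1 / x)%C with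
    ((neg_pi_i * (x / RtoC (INR k)) * icot (x / RtoC (INR k)) - 1) / x)%C by (field; auto).
  rewrite Cmod_div by auto. apply Rmult_lt_reg_r with (Cmod x); auto.
  unfold Rdiv at 1. rewrite Rmult_assoc, Rinv_l, Rmult_1_r by lra.
  eapply Rle_lt_trans. apply H.
  replace (K * (Cmod x / INR k)) with (K / INR k * Cmod x) by (field; lra).
  apply Rmult_lt_compat_r; auto.
  apply Rmult_lt_reg_r with (INR k). lra. unfold Rdiv. rewrite Rmult_assoc, Rinv_l, Rmult_1_r by lra.
  assert (K / e < INR k) by lra. apply Rmult_lt_compat_r with (r := e) in H4; auto.
  unfold Rdiv in H4. rewrite Rmult_assoc, Rinv_l in H4; lra.
Qed.

Lemma Rabs_Im_Cmod : forall z : C, Rabs (Im z) <= Cmod z.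
Proof. intros. eapply Rle_trans; [|apply Rmax_Cmod]. apply Rmax_r. Qed.

(** Eisenstein's method: the finite identity [icot_fold_formula] for [z] minus
    the one for [w] has terms dominated by an inverse square, uniformly in
    [M], and each term tends to a difference of reciprocals; dominated
    convergence gives the series. *)
Lemma partial_fractions : forall z w, nonint z -> nonint w ->
  cser (zfold (fun j => 1 / (z + ZtoC j) - 1 / (w + ZtoC j))%C) (neg_pi_i * (icot z - icot w))%C.
Proof.
  intros z w Hz Hw.
  destruct (nonint_growth z Hz) as [d1 [Hd1 G1]].
  destruct (nonint_growth w Hw) as [d2 [Hd2 G2]].
  pose proof (Cmod_ge_0 z) as Pz. pose proof (Cmod_ge_0 w) as Qw.
  destruct (icot_diff_bound (Cmod z + Cmod w)) as [K1 [HK1 HB]]; [lra|].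
  (* The shift [M0] makes [(z + j) / (2M + 1)] lie in the strip of
     [icot_diff_bound] for all [j] between [-M] and [M]. *)
  destruct (big_nat (2 * (Cmod z + Cmod w))) as [M0 HM0].
  set (kk := fun M => INR (2 * (M + M0) + 1)).
  set (F := fun M j => (neg_pi_i * (/ RtoC (kk M) * icot ((z + ZtoC j) / RtoC (kk M)))
               - neg_pi_i * (/ RtoC (kk M) * icot ((w + ZtoC j) / RtoC (kk M))))%C).
  set (T := fun M n => if Nat.leb n (M + M0) then zfold (F M) n else RtoC 0).
  set (Q := Cmod neg_pi_i * K1 * Cmod (z - w)%C / (d1 * d2)).
  assert (0 <= Q) as HQ.
  { unfold Q. apply Rmult_le_pos. apply Rmult_le_pos. apply Rmult_le_pos. apply Cmod_ge_0. lra. apply Cmod_ge_0.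
    left. apply Rinv_0_lt_compat. nra. }
  set (G := fun j : Z => Q * / ((1 + Rabs (IZR j)) * (1 + Rabs (IZR j)))).
  assert (summable (zfoldR G)) as HG.
  { apply (summable_zfoldR _ (fun n => Q * / ((1 + INR n) * (1 + INR n)))).
    - intros j. unfold G. rewrite INR_IZR_INZ, Z2Nat.id, abs_IZR by lia. split; [|lra].
      apply Rmult_le_pos; auto. left. apply Rinv_0_lt_compat. pose proof (Rabs_pos (IZR j)). nra.
    - apply summable_scal; auto. apply summable_inv_sq. }
  assert (forall M j, (Z.abs j <= Z.of_nat (M + M0))%Z -> Cmod (F M j) <= G j) as HF.
  { intros M j Hj. unfold F.
    assert (kk M = 2 * INR (M + M0) + 1) as Ek.
    { unfold kk. rewrite plus_INR, mult_INR. simpl. ring. }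
    assert (INR M0 <= INR (M + M0)) as HMM by (apply le_INR; lia).
    set (m := INR (M + M0)) in *. pose proof (pos_INR M0).
    assert (0 < kk M) as Hk by lra. set (k := kk M) in *.
    assert (RtoC k <> RtoC 0) as HkC by (intros E; apply RtoC_inj in E; lra).
    assert (Rabs (IZR j) <= m) as Hjm.
    { rewrite <- abs_IZR. unfold m. rewrite INR_IZR_INZ. now apply IZR_le. }
    assert (forall x, Cmod x <= Cmod z + Cmod w -> nonint x ->
       ((x + ZtoC j) / RtoC k <> RtoC 0)%C /\ Rabs (Re ((x + ZtoC j) / RtoC k)%C) <= 3/4 /\
        Rabs (Im ((x + ZtoC j) / RtoC k)%C) <= Cmod z + Cmod w) as Hx.
    { intros x Hx Hxn. pose proof (nonint_addZ_neq0 x j Hxn) as Hx0.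
      assert (forall y : C, (y / RtoC k)%C = ((/ k * fst y)%R, (/ k * snd y)%R)) as Ediv.
      { intros [y1 y2]. replace ((y1, y2) / RtoC k)%C with (RtoC (/ k) * (y1, y2))%C.
        unfold Cmult, RtoC; simpl; f_equal; ring. rewrite RtoC_inv by lra. field. auto. }
      split; [|split].
      - intros E. apply Hx0. replace (x + ZtoC j)%C with ((x + ZtoC j) / RtoC k * RtoC k)%C by (field; auto).
        rewrite E. ring.
      - rewrite Ediv. simpl Re. rewrite Rabs_mult, (Rabs_pos_eq (/ k)) by (left; now apply Rinv_0_lt_compat).
        apply Rmult_le_reg_l with k; auto. rewrite <- Rmult_assoc, Rinv_r, Rmult_1_l by lra.
        eapply Rle_trans. apply Rabs_triang. simpl.
        pose proof (re_le_Cmod x). unfold Re in H0. lra.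
      - rewrite Ediv. simpl Im. rewrite Rabs_mult, (Rabs_pos_eq (/ k)) by (left; now apply Rinv_0_lt_compat).
        apply Rmult_le_reg_l with k; auto. rewrite <- Rmult_assoc, Rinv_r, Rmult_1_l by lra.
        rewrite Rplus_0_r. pose proof (Rabs_Im_Cmod x). unfold Im in H0. nra. }
    destruct (Hx z ltac:(lra) Hz) as [A1 [A2 A3]]. destruct (Hx w ltac:(lra) Hw) as [B1 [B2 B3]].
    assert (((z + ZtoC j) / RtoC k - (w + ZtoC j) / RtoC k = (z - w) / RtoC k)%C) as Ed by (field; auto).
    assert (Cmod ((z - w) / RtoC k)%C = Cmod (z - w)%C / k) as Ed2.
    { rewrite Cmod_div by auto. now rewrite Cmod_R, Rabs_pos_eq by lra. }
    assert (Cmod (z - w)%C <= Cmod z + Cmod w) as Hzw.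
    { unfold Cminus. eapply Rle_trans. apply Cmod_triangle. rewrite Cmod_opp. lra. }
    assert (Cmod (z - w)%C / k <= 1) as Hle1.
    { apply Rmult_le_reg_r with k; auto. unfold Rdiv. rewrite Rmult_assoc, Rinv_l by lra. lra. }
    specialize (HB _ _ A1 B1 ltac:(rewrite Ed, Ed2; auto) A2 B2 A3 B3).
    rewrite Ed, Ed2 in HB.
    rewrite !Cmod_div, Cmod_R, (Rabs_pos_eq k) in HB by (auto; lra).
    replace (neg_pi_i * (/ RtoC k * icot ((z + ZtoC j) / RtoC k)) - neg_pi_i * (/ RtoC k * icot ((w + ZtoC j) / RtoC k)))%C
      with (neg_pi_i * (/ RtoC k * (icot ((z + ZtoC j) / RtoC k) - icot ((w + ZtoC j) / RtoC k))))%C by ring.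
    rewrite !Cmod_mult, Cmod_inv, Cmod_R, (Rabs_pos_eq k) by (auto; lra).
    specialize (G1 j). specialize (G2 j).
    pose proof (Rabs_pos (IZR j)) as Pj. set (a := 1 + Rabs (IZR j)) in *.
    assert (0 < Cmod (z + ZtoC j)%C) by (apply Cmod_gt_0, nonint_addZ_neq0; auto).
    assert (0 < Cmod (w + ZtoC j)%C) by (apply Cmod_gt_0, nonint_addZ_neq0; auto).
    assert (1 <= a) by (unfold a; lra).
    unfold G, Q. fold a.
    replace (Cmod neg_pi_i * K1 * Cmod (z - w) / (d1 * d2) * / (a * a)) with
      (Cmod neg_pi_i * (K1 * Cmod (z - w) * / ((d1 * a) * (d2 * a)))) by (field; repeat split; lra).
    apply Rmult_le_compat_l. apply Cmod_ge_0.
    apply Rle_trans with (/ k * (K1 * (Cmod (z - w) / k) / (Cmod (z + ZtoC j) / k * (Cmod (w + ZtoC j) / k)))).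
    { apply Rmult_le_compat_l; auto. left; now apply Rinv_0_lt_compat. }
    replace (/ k * (K1 * (Cmod (z - w) / k) / (Cmod (z + ZtoC j) / k * (Cmod (w + ZtoC j) / k))))
     with (K1 * Cmod (z - w) * / (Cmod (z + ZtoC j) * Cmod (w + ZtoC j))) by (field; repeat split; lra).
    apply Rmult_le_compat_l. apply Rmult_le_pos. lra. apply Cmod_ge_0.
    apply Rinv_le_contravar. apply Rmult_lt_0_compat; apply Rmult_lt_0_compat; lra.
    apply Rmult_le_compat; auto; apply Rmult_le_pos; lra. }
  assert (forall M n, Cmod (T M n) <= zfoldR G n) as HT.
  { intros M n. unfold T. destruct (Nat.leb n (M + M0)) eqn:E.
    - apply Nat.leb_le in E. destruct n as [|n]; unfold zfold, zfoldR.
      + apply HF. lia.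
      + eapply Rle_trans. apply Cmod_triangle. apply Rplus_le_compat; apply HF; lia.
    - rewrite Cmod_0. apply HG. }
  set (t := zfold (fun j => 1 / (z + ZtoC j) - 1 / (w + ZtoC j))%C).
  assert (forall n, clim (fun M => T M n) (t n)) as Hlim.
  { intros n. apply (clim_ext (fun M => zfold (F M) n)).
    - exists n. intros M HM. unfold T. replace (Nat.leb n (M + M0)) with true; auto.
      symmetry. apply Nat.leb_le. lia.
    - apply clim_zfold. intros j. unfold F, kk.
      replace (1 / (z + ZtoC j) - 1 / (w + ZtoC j))%C with (1 / (z + ZtoC j) + (-(1)) * (1 / (w + ZtoC j)))%C by ring.
      apply (clim_ext (fun M =>
         (neg_pi_i * (/ RtoC (INR (2 * (M + M0) + 1)) * icot ((z + ZtoC j) / RtoC (INR (2 * (M + M0) + 1))))) +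
         (-(1)) * (neg_pi_i * (/ RtoC (INR (2 * (M + M0) + 1)) * icot ((w + ZtoC j) / RtoC (INR (2 * (M + M0) + 1))))))%C).
      + exists 0%nat. intros; ring.
      + apply clim_plus; [|apply clim_scal]; now apply icot_scaled_limit. }
  destruct (abs_cv t (zfoldR G)) as [s Hs]; auto.
  { intros n. apply (clim_le (fun M => T M n)). apply Hlim. intros M; apply HT. }
  assert (clim (fun _ : nat => (neg_pi_i * (icot z - icot w))%C) s) as Hfin.
  { apply (tannery T t (zfoldR G)); auto.
    intros M. 
    replace (neg_pi_i * (icot z - icot w))%C with (csum (T M) (S (M + M0))).
    - apply cser_finite. intros n Hn. unfold T. replace (Nat.leb n (M + M0)) with false; auto.
      symmetry. apply Nat.leb_gt. lia.
    - rewrite (csum_ext _ (zfold (F M))).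
      2:{ intros n Hn. unfold T. replace (Nat.leb n (M + M0)) with true; auto. symmetry. apply Nat.leb_le. lia. }
      rewrite (icot_fold_formula (M + M0) z), (icot_fold_formula (M + M0) w) by auto.
      set (f := zfold (fun j : Z => (/ INR (2 * (M + M0) + 1) * icot ((z + ZtoC j) / INR (2 * (M + M0) + 1)))%C)).
      set (g := zfold (fun j : Z => (/ INR (2 * (M + M0) + 1) * icot ((w + ZtoC j) / INR (2 * (M + M0) + 1)))%C)).
      rewrite (csum_ext _ (fun n => neg_pi_i * f n + (- neg_pi_i) * g n)%C).
      rewrite csum_plus, !csum_scal. ring.
      intros i _. unfold f, g. rewrite <- !zfold_scal, <- zfold_plus. apply zfold_ext.
      intros j. unfold F, kk. ring. }
  rewrite (clim_unique _ _ _ (clim_const (neg_pi_i * (icot z - icot w))%C) Hfin). exact Hs.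
Qed.

(** * The cotangent sum of a lattice and its inversion formula *)

(** The sum as a total function, so that limits can be named without carrying
    convergence proofs; the value is meaningless for a divergent series. *)
Definition csersum (a : nat -> C) : C :=
  (Series (fun n => fst (a n)), Series (fun n => snd (a n))).

Lemma csersum_eq : forall a l, cser a l -> csersum a = l.
Proof.
  intros a l H. apply cser_re_im in H. destruct H as [H1 H2]. unfold csersum.
  rewrite (is_series_unique _ _ H1), (is_series_unique _ _ H2). now destruct l.
Qed.

Lemma csersum_cv : forall a, (exists l, cser a l) -> cser a (csersum a).
Proof. intros a [l H]. rewrite (csersum_eq a l H). exact H. Qed.

Definition offlat (z tau : C) : Prop := forall m n : Z, z <> (ZtoC m * tau + ZtoC n)%C.

(** An Eisenstein sum of weight one. The terms tend to [1] and [-1] at the two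
    ends, so that it converges only after pairing [m] with [-m]. *)
Definition cot_sum (z tau : C) : C := csersum (zfold (fun m => icot (z + ZtoC m * tau)%C)).

Lemma offlat_nonint : forall z tau m, offlat z tau -> nonint (z + ZtoC m * tau)%C.
Proof.
  intros z tau m H n E. apply (H (- m)%Z n). rewrite <- E, ZtoC_opp. ring.
Qed.

Lemma offlat_add : forall z tau m n, offlat z tau -> offlat (z + (ZtoC m * tau + ZtoC n))%C tau.
Proof.
  intros z tau m n H m' n' E. apply (H (m' - m)%Z (n' - n)%Z).
  replace z with ((z + (ZtoC m * tau + ZtoC n)) - (ZtoC m * tau + ZtoC n))%C by ring.
  rewrite E, !ZtoC_sub. ring.
Qed.

Lemma offlat_addZ : forall z tau n, offlat z tau -> offlat (z + ZtoC n)%C tau.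
Proof.
  intros. replace (z + ZtoC n)%C with (z + (ZtoC 0 * tau + ZtoC n))%C by (rewrite ZtoC_0; ring).
  now apply offlat_add.
Qed.

Lemma offlat_opp : forall z tau, offlat z tau -> offlat (- z)%C tau.
Proof.
  intros z tau H m n E. apply (H (- m)%Z (- n)%Z).
  replace z with (- - z)%C by ring. rewrite E, !ZtoC_opp. ring.
Qed.

Lemma in_H_neq0 : forall tau, in_H tau -> tau <> RtoC 0.
Proof. intros tau H E. unfold in_H in H. rewrite E in H. simpl in H. lra. Qed.

Lemma exp_pow : forall x n, exp (INR n * x) = exp x ^ n.
Proof.
  induction n. simpl. rewrite Rmult_0_l. apply exp_0.
  rewrite S_INR. replace ((INR n + 1) * x) with (x + INR n * x) by ring.
  rewrite exp_plus, IHn. reflexivity.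
Qed.

Lemma nome_lt1 : forall y, 0 < y -> 0 < exp (- (2 * PI * y)) < 1.
Proof.
  intros y Hy. split. apply exp_pos. rewrite <- exp_0. apply exp_increasing.
  pose proof PI_RGT_0. nra.
Qed.

Lemma summable_geom : forall r, 0 <= r < 1 -> summable (fun n => r ^ n).
Proof.
  intros r Hr. split. intros; now apply pow_le. exists (/ (1 - r)). intros n.
  assert (rsum (fun n => r ^ n) n * (1 - r) = 1 - r ^ n) as E.
  { induction n; simpl. ring. rewrite Rmult_plus_distr_r, IHn. ring. }
  apply Rmult_le_reg_r with (1 - r). lra. rewrite E, Rinv_l by lra.
  assert (0 <= r ^ n) by now apply pow_le. lra.
Qed.

(** [e(z + m tau)] decays geometrically as [m] grows, and [icot] depends on it
    like [(1 + x) / (1 - x)]. *)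
Lemma icot_to_1 : forall z tau, in_H tau -> exists K m0, 0 <= K /\ forall m : nat, (m0 <= m)%nat ->
  Cmod (icot (z + ZtoC (Z.of_nat m) * tau) - 1)%C <= K * exp (- (2 * PI * Im tau)) ^ m.
Proof.
  intros z tau Ht. unfold in_H in Ht. pose proof (nome_lt1 _ Ht) as Hr.
  set (r := exp (- (2 * PI * Im tau))) in *.
  set (a := exp (- (2 * PI * Im z))). assert (0 < a) by apply exp_pos.
  destruct (pow_lt_1_zero r ltac:(rewrite Rabs_pos_eq; lra) (1 / (2 * a))) as [m0 Hm0].
  { apply Rdiv_lt_0_compat; lra. }
  exists (4 * a), m0. split. lra. intros m Hm. specialize (Hm0 m ltac:(lia)).
  assert (0 < r ^ m) by (apply pow_lt; lra). rewrite Rabs_pos_eq in Hm0 by lra.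
  set (x := e2pi (z + ZtoC (Z.of_nat m) * tau)%C).
  assert (Cmod x = a * r ^ m) as Ex.
  { unfold x. rewrite Cmod_e2pi. unfold a, r. rewrite <- exp_pow, <- exp_plus. f_equal.
    rewrite ZtoC_nat. simpl. unfold Im. ring. }
  assert (Cmod x <= 1/2).
  { rewrite Ex. apply Rmult_lt_compat_l with (r := a) in Hm0; auto.
    replace (a * (1 / (2 * a))) with (1/2) in Hm0 by (field; lra). lra. }
  assert (1/2 <= Cmod (1 - x)%C).
  { assert (Cmod 1 <= Cmod (1 - x)%C + Cmod x).
    { replace (RtoC 1) with ((1 - x) + x)%C at 1 by ring. apply Cmod_triangle. }
    rewrite Cmod_1 in H2. lra. }
  assert (1 - x <> 0)%C by (apply Cmod_pos_neq; lra).
  assert (icot (z + ZtoC (Z.of_nat m) * tau) - 1 = 2 * x / (1 - x))%C as E.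
  { unfold icot. fold x. field. auto. }
  rewrite E, Cmod_div, Cmod_mult, Cmod_R, (Rabs_pos_eq 2), Ex by (auto; lra).
  apply Rmult_le_reg_r with (Cmod (1 - x)). lra.
  unfold Rdiv. rewrite Rmult_assoc, Rinv_l by lra.
  assert (0 < a * r ^ m) by now apply Rmult_lt_0_compat. nra.
Qed.

Lemma abs_cv_from : forall a b m0, summable b -> (forall n, (m0 <= n)%nat -> Cmod (a n) <= b n) -> exists l, cser a l.
Proof.
  intros a b m0 Hb H. destruct (abs_cv (fun n => a (m0 + n)%nat) (fun n => b (m0 + n)%nat)) as [l Hl].
  now apply summable_shift. intros; apply H; lia.
  exists (csum a m0 + l)%C. now apply cser_head.
Qed.

Lemma zfold_opp_arg : forall F n, zfold (fun j => F (- j)%Z) n = zfold F n.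
Proof. intros F [|n]; unfold zfold. reflexivity. rewrite Z.opp_involutive. ring. Qed.

Lemma cot_sum_cv : forall z tau, in_H tau -> offlat z tau ->
  cser (zfold (fun m => icot (z + ZtoC m * tau)%C)) (cot_sum z tau).
Proof.
  intros z tau Ht Hz. apply csersum_cv.
  destruct (icot_to_1 z tau Ht) as [K1 [m1 [HK1 H1]]].
  destruct (icot_to_1 (- z)%C tau Ht) as [K2 [m2 [HK2 H2]]].
  pose proof (nome_lt1 _ Ht) as Hr. set (r := exp (- (2 * PI * Im tau))) in *.
  apply (abs_cv_from _ (fun n => (K1 + K2) * r ^ n) (S (m1 + m2))).
  - apply summable_scal. lra. apply summable_geom. lra.
  - intros [|n] Hn; [lia|]. unfold zfold.
    set (m := S n) in *.
    replace (z + ZtoC (- Z.of_nat m) * tau)%C with (- (- z + ZtoC (Z.of_nat m) * tau))%C by (rewrite ZtoC_opp; ring).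
    rewrite icot_opp. 2:{ apply offlat_nonint. now apply offlat_opp. }
    replace (icot (z + ZtoC (Z.of_nat m) * tau) + - icot (- z + ZtoC (Z.of_nat m) * tau))%C with
      ((icot (z + ZtoC (Z.of_nat m) * tau) - 1) + - (icot (- z + ZtoC (Z.of_nat m) * tau) - 1))%C by ring.
    eapply Rle_trans. apply Cmod_triangle. rewrite Cmod_opp.
    specialize (H1 m ltac:(lia)). specialize (H2 m ltac:(lia)). simpl in *. lra.
Qed.

Lemma cot_sum_addZ : forall z tau n, cot_sum (z + ZtoC n)%C tau = cot_sum z tau.
Proof.
  intros. unfold cot_sum, csersum.
  assert (forall k, zfold (fun m => icot (z + ZtoC n + ZtoC m * tau)%C) k = zfold (fun m => icot (z + ZtoC m * tau)%C) k).
  { intros k. apply zfold_ext. intros j. rewrite <- (icot_addZ (z + ZtoC j * tau)%C n). f_equal. ring. }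
  f_equal; apply Series_ext; intros k; now rewrite H.
Qed.

Lemma cot_sum_tau_addZ : forall z tau n, cot_sum z (tau + ZtoC n)%C = cot_sum z tau.
Proof.
  intros. unfold cot_sum, csersum.
  assert (forall k, zfold (fun m => icot (z + ZtoC m * (tau + ZtoC n))%C) k = zfold (fun m => icot (z + ZtoC m * tau)%C) k).
  { intros k. apply zfold_ext. intros j. rewrite <- (icot_addZ (z + ZtoC j * tau)%C (j * n)). f_equal.
    rewrite ZtoC_mul. ring. }
  f_equal; apply Series_ext; intros k; now rewrite H.
Qed.

Lemma cot_sum_opp : forall z tau, in_H tau -> offlat z tau -> cot_sum (- z)%C tau = (- cot_sum z tau)%C.
Proof.
  intros z tau Ht Hz. apply csersum_eq.
  replace (- cot_sum z tau)%C with ((-(1)) * cot_sum z tau)%C by ring.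
  apply (cser_ext (fun n => (-(1)) * zfold (fun m => icot (z + ZtoC m * tau)%C) n)%C).
  - intros n. rewrite <- zfold_scal, <- (zfold_opp_arg (fun m => icot (- z + ZtoC m * tau)%C)).
    apply zfold_ext. intros j.
    replace (- z + ZtoC (- j) * tau)%C with (- (z + ZtoC j * tau))%C by (rewrite ZtoC_opp; ring).
    rewrite icot_opp by now apply offlat_nonint. ring.
  - apply cser_scal. now apply cot_sum_cv.
Qed.

Lemma pow_to_0 : forall K r, 0 <= r < 1 -> forall e, 0 < e -> exists m0, forall m, (m0 <= m)%nat -> K * r ^ m < e.
Proof.
  intros K r Hr e He. destruct (Rle_dec K 0).
  - exists 0%nat. intros. assert (0 <= r ^ m) by (now apply pow_le). nra.
  - destruct (pow_lt_1_zero r ltac:(rewrite Rabs_pos_eq; lra) (e / K)) as [m0 Hm0].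
    apply Rdiv_lt_0_compat; lra. exists m0. intros m Hm. specialize (Hm0 m ltac:(lia)).
    rewrite Rabs_pos_eq in Hm0 by (now apply pow_le).
    apply Rmult_lt_compat_l with (r := K) in Hm0; [|lra].
    replace (K * (e / K)) with e in Hm0 by (field; lra). exact Hm0.
Qed.

Lemma icot_lim_1 : forall z tau, in_H tau -> clim (fun M => icot (z + ZtoC (Z.of_nat M) * tau)%C) 1.
Proof.
  intros z tau Ht e He. destruct (icot_to_1 z tau Ht) as [K [m0 [HK H]]].
  pose proof (nome_lt1 _ Ht) as Hr. set (r := exp (- (2 * PI * Im tau))) in *.
  destruct (pow_to_0 K r ltac:(lra) e He) as [m1 Hm1].
  exists (m0 + m1)%nat. intros m Hm. eapply Rle_lt_trans. apply H; lia. apply Hm1; lia.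
Qed.

(** The shift replaces one summand near [1] by one near [-1] at the ends of
    the symmetric range: the limits of [icot] at the two ends differ by [2]. *)
Lemma cot_sum_sub_tau : forall z tau, in_H tau -> offlat z tau -> cot_sum (z - tau)%C tau = (cot_sum z tau - 2)%C.
Proof.
  intros z tau Ht Hz.
  set (F := fun m => icot (z + ZtoC m * tau)%C).
  assert (offlat (z - tau)%C tau) as Hz'.
  { replace (z - tau)%C with (z + (ZtoC (-1) * tau + ZtoC 0))%C. now apply offlat_add.
    rewrite ZtoC_0. change (-1)%Z with (- (1))%Z. rewrite (ZtoC_opp 1), ZtoC_1. ring. }
  pose proof (cot_sum_cv _ _ Ht Hz') as H'. pose proof (cot_sum_cv _ _ Ht Hz) as H.
  apply (clim_unique (fun M => csum (zfold (fun m => icot (z - tau + ZtoC m * tau)%C)) (M + 1))).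
  - apply (clim_shift (csum (zfold (fun m => icot (z - tau + ZtoC m * tau)%C)))). exact H'.
  (* The shifted sum over a symmetric range loses the last term and gains a
     new first one; both enter as values of [icot] near [1]. *)
  - apply (clim_ext (fun M => csum (zfold F) (M + 1) + ((-(1)) * icot (- z + tau + ZtoC (Z.of_nat M) * tau) + (-(1)) * icot (z + ZtoC (Z.of_nat M) * tau)))%C).
    + exists 0%nat. intros M _. replace (M + 1)%nat with (S M) by lia. rewrite !zfold_sum.
      set (K := (2 * M + 1)%nat).
      rewrite (csum_ext (fun i => icot (z - tau + ZtoC (Z.of_nat i - Z.of_nat M) * tau)%C)
                        (fun i => F (- Z.of_nat M - 1 + Z.of_nat i)%Z)).
      2:{ intros i _. unfold F. f_equal. rewrite !ZtoC_add, !ZtoC_sub, !ZtoC_opp, ZtoC_1. ring. }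
      rewrite (csum_ext (fun i => F (Z.of_nat i - Z.of_nat M)%Z) (fun i => F (- Z.of_nat M - 1 + Z.of_nat (S i))%Z)).
      2:{ intros i _. f_equal. lia. }
      pose proof (csum_S_l (fun i => F (- Z.of_nat M - 1 + Z.of_nat i)%Z) K) as E.
      change (csum (fun i => F (- Z.of_nat M - 1 + Z.of_nat i)%Z) (S K)) with
        (csum (fun i => F (- Z.of_nat M - 1 + Z.of_nat i)%Z) K + F (- Z.of_nat M - 1 + Z.of_nat K)%Z)%C in E.
      replace (- Z.of_nat M - 1 + Z.of_nat K)%Z with (Z.of_nat M) in E by lia.
      replace (-(1) * icot (- z + tau + ZtoC (Z.of_nat M) * tau))%C with (F (- Z.of_nat M - 1 + Z.of_nat 0)%Z).
      2:{ unfold F. replace (z + ZtoC (- Z.of_nat M - 1 + Z.of_nat 0) * tau)%C with (- (- z + tau + ZtoC (Z.of_nat M) * tau))%C.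
          rewrite icot_opp. ring.
          replace (- z + tau + ZtoC (Z.of_nat M) * tau)%C with (- (z - tau) + ZtoC (Z.of_nat M) * tau)%C by ring.
          apply offlat_nonint. now apply offlat_opp.
          change (Z.of_nat 0) with 0%Z. rewrite ZtoC_add, ZtoC_sub, ZtoC_opp, ZtoC_0, ZtoC_1. ring. }
      change (icot (z + ZtoC (Z.of_nat M) * tau)%C) with (F (Z.of_nat M)).
      assert (csum (fun i => F (- Z.of_nat M - 1 + Z.of_nat i)%Z) K =
        (F (- Z.of_nat M - 1 + Z.of_nat 0)%Z + csum (fun i => F (- Z.of_nat M - 1 + Z.of_nat (S i))%Z) K) - F (Z.of_nat M))%C as E2.
      { rewrite <- E. ring. }
      rewrite E2. ring.
    + replace (cot_sum z tau - 2)%C with (cot_sum z tau + ((-(1)) * 1 + (-(1)) * 1))%C by ring.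
      apply clim_plus. apply (clim_shift (csum (zfold F))). exact H.
      apply clim_plus; apply clim_scal; now apply icot_lim_1.
Qed.

Lemma lattice_coords : forall z tau, in_H tau -> exists a b : R, z = (RtoC a * tau + RtoC b)%C.
Proof.
  intros [x y] [t u] Ht. unfold in_H in Ht. simpl in Ht. exists (y / u), (x - y / u * t).
  unfold Cplus, Cmult, RtoC. simpl. f_equal; field; lra.
Qed.

Lemma lattice_im : forall tau a b, in_H tau -> Rabs a * Im tau <= Cmod (RtoC a * tau + RtoC b)%C.
Proof.
  intros tau a b Ht. unfold in_H in Ht. eapply Rle_trans; [|apply Rabs_Im_Cmod].
  replace (Im (RtoC a * tau + RtoC b)%C) with (a * Im tau) by (simpl; unfold Im; ring).
  rewrite Rabs_mult, (Rabs_pos_eq (Im tau)); lra.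
Qed.

Lemma lattice_re : forall tau a b, in_H tau ->
  Rabs b <= (1 + Cmod tau / Im tau) * Cmod (RtoC a * tau + RtoC b)%C.
Proof.
  intros tau a b Ht. pose proof (lattice_im tau a b Ht) as H. unfold in_H in Ht.
  set (w := Cmod (RtoC a * tau + RtoC b)%C) in *.
  assert (Rabs b <= w + Rabs a * Cmod tau).
  { rewrite <- (Cmod_R b). replace (RtoC b) with ((RtoC a * tau + RtoC b) + - (RtoC a * tau))%C by ring.
    eapply Rle_trans. apply Cmod_triangle. rewrite Cmod_opp, Cmod_mult, Cmod_R. unfold w. lra. }
  assert (Rabs a <= w / Im tau).
  { apply Rmult_le_reg_r with (Im tau); auto. unfold Rdiv. rewrite Rmult_assoc, Rinv_l; lra. }
  pose proof (Cmod_ge_0 tau).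
  assert (Rabs a * Cmod tau <= w / Im tau * Cmod tau) by (apply Rmult_le_compat_r; auto).
  replace ((1 + Cmod tau / Im tau) * w) with (w + w / Im tau * Cmod tau) by (field; lra). lra.
Qed.

(** If the coordinate along [tau] is not an integer, heights separate [z] from
    the lattice; otherwise the other coordinate is not an integer and the
    points at the same height are separated horizontally. *)
Lemma offlat_dist : forall z tau, in_H tau -> offlat z tau -> exists d, 0 < d /\
  forall i j : Z, d <= Cmod (z + (ZtoC i * tau + ZtoC j))%C.
Proof.
  intros z tau Ht Hz. destruct (lattice_coords z tau Ht) as [a [b E]].
  assert (forall i j, z + (ZtoC i * tau + ZtoC j) = RtoC (a + IZR i) * tau + RtoC (b + IZR j))%C as Eij.
  { intros. rewrite E. unfold ZtoC. rewrite !RtoC_plus. ring. }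
  pose proof Ht as Ht'. unfold in_H in Ht'.
  destruct (classic (nonint (RtoC a))) as [Ha|Ha].
  - destruct (nonint_dist _ Ha) as [d [Hd H]]. exists (d * Im tau). split. nra.
    intros i j. rewrite Eij. eapply Rle_trans; [|now apply lattice_im].
    apply Rmult_le_compat_r. lra. specialize (H i). unfold ZtoC in H. rewrite <- RtoC_plus, Cmod_R in H. auto.
  - assert (exists n, a = IZR n) as [n Hn].
    { apply NNPP. intros h. apply Ha. intros n En. apply h. exists n. now apply RtoC_inj in En. }
    assert (nonint (RtoC b)) as Hb.
    { intros m Em. apply (Hz n m). rewrite E, Hn, Em. reflexivity. }
    destruct (nonint_dist _ Hb) as [d [Hd H]]. exists (Rmin d (Im tau)). split. now apply Rmin_pos.
    intros i j. rewrite Eij. destruct (Z.eq_dec (n + i) 0) as [E0|E0].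
    + eapply Rle_trans; [apply Rmin_l|]. rewrite Hn, <- plus_IZR, E0.
      replace (RtoC 0 * tau + RtoC (b + IZR j))%C with (RtoC b + ZtoC j)%C.
      apply H. unfold ZtoC. rewrite RtoC_plus. ring.
    + eapply Rle_trans; [apply Rmin_r|]. eapply Rle_trans; [|now apply lattice_im].
      rewrite Hn, <- plus_IZR, <- abs_IZR.
      assert (1 <= IZR (Z.abs (n + i))) by (apply IZR_le; lia). nra.
Qed.

(** A lower bound of product form for the distance, obtained from [1 + |i|]
    and [1 + |j|] both being [O(|w|)] by taking the geometric mean. It loses
    half of the growth but is what the interchange of summation requires. *)
Lemma offlat_growth : forall z tau, in_H tau -> offlat z tau -> exists d, 0 < d /\
  forall i j : Z, d * (sqrt (1 + Rabs (IZR i)) * sqrt (1 + Rabs (IZR j))) <= Cmod (z + (ZtoC i * tau + ZtoC j))%C.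
Proof.
  intros z tau Ht Hz. destruct (offlat_dist z tau Ht Hz) as [d [Hd H]].
  destruct (lattice_coords z tau Ht) as [a [b E]].
  assert (forall i j, z + (ZtoC i * tau + ZtoC j) = RtoC (a + IZR i) * tau + RtoC (b + IZR j))%C as Eij.
  { intros. rewrite E. unfold ZtoC. rewrite !RtoC_plus. ring. }
  pose proof Ht as Ht'. unfold in_H in Ht'.
  set (q := 1 + Cmod tau / Im tau).
  assert (1 <= q). { unfold q. assert (0 <= Cmod tau / Im tau). apply Rmult_le_pos. apply Cmod_ge_0. left. now apply Rinv_0_lt_compat. lra. }
  set (c1 := / Im tau + (1 + Rabs a) / d). set (c2 := q + (1 + Rabs b) / d).
  pose proof (Rabs_pos a). pose proof (Rabs_pos b).
  assert (0 < / Im tau) by now apply Rinv_0_lt_compat.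
  assert (0 < (1 + Rabs a) / d) by (apply Rdiv_lt_0_compat; lra).
  assert (0 < (1 + Rabs b) / d) by (apply Rdiv_lt_0_compat; lra).
  assert (0 < c1) by (unfold c1; lra). assert (0 < c2) by (unfold c2; lra).
  set (s := sqrt (c1 * c2)). assert (0 < s) by (apply sqrt_lt_R0; nra).
  exists (/ s). split. now apply Rinv_0_lt_compat. intros i j.
  specialize (H i j). rewrite Eij in *.
  pose proof (lattice_im tau (a + IZR i) (b + IZR j) Ht) as Hi.
  pose proof (lattice_re tau (a + IZR i) (b + IZR j) Ht) as Hj. fold q in Hj.
  set (w := Cmod (RtoC (a + IZR i) * tau + RtoC (b + IZR j))%C) in *.
  assert (1 + Rabs (IZR i) <= c1 * w).
  { assert (Rabs (IZR i) <= Rabs (a + IZR i) + Rabs a).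
    { replace (IZR i) with ((a + IZR i) + - a) at 1 by ring. eapply Rle_trans. apply Rabs_triang. rewrite Rabs_Ropp. lra. }
    assert (Rabs (a + IZR i) <= / Im tau * w).
    { apply Rmult_le_reg_r with (Im tau); auto. replace (/ Im tau * w * Im tau) with w by (field; lra). auto. }
    assert (1 + Rabs a <= (1 + Rabs a) / d * w).
    { apply Rle_trans with ((1 + Rabs a) / d * d). right; field; lra. apply Rmult_le_compat_l; lra. }
    unfold c1. lra. }
  assert (1 + Rabs (IZR j) <= c2 * w).
  { assert (Rabs (IZR j) <= Rabs (b + IZR j) + Rabs b).
    { replace (IZR j) with ((b + IZR j) + - b) at 1 by ring. eapply Rle_trans. apply Rabs_triang. rewrite Rabs_Ropp. lra. }
    assert (1 + Rabs b <= (1 + Rabs b) / d * w).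
    { apply Rle_trans with ((1 + Rabs b) / d * d). right; field; lra. apply Rmult_le_compat_l; lra. }
    unfold c2. lra. }
  pose proof (Rabs_pos (IZR i)). pose proof (Rabs_pos (IZR j)).
  rewrite <- sqrt_mult by lra.
  apply Rmult_le_reg_l with s; auto. rewrite <- Rmult_assoc, Rinv_r, Rmult_1_l by lra.
  assert (0 < w) by lra.
  unfold s. rewrite <- (sqrt_square w) by lra. rewrite <- sqrt_mult by nra.
  apply sqrt_le_1.
  - apply Rmult_le_pos; lra.
  - repeat apply Rmult_le_pos; lra.
  - replace (c1 * c2 * (w * w)) with ((c1 * w) * (c2 * w)) by ring.
    apply Rmult_le_compat; lra.
Qed.

Lemma cser_zfold : forall (a : Z -> nat -> C) (l : Z -> C) n, (forall j, cser (a j) (l j)) ->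
  cser (fun m => zfold (fun j => a j m) n) (zfold l n).
Proof. intros a l [|n] H; unfold zfold; auto. apply cser_plus; auto. Qed.

Lemma zfold_swap : forall (t : Z -> Z -> C) m n,
  zfold (fun i => zfold (t i) n) m = zfold (fun j => zfold (fun i => t i j) m) n.
Proof. intros t [|m] [|n]; unfold zfold; ring. Qed.

Lemma zfoldR_scal : forall c F n, zfoldR (fun j => c * F j) n = c * zfoldR F n.
Proof. intros c F [|n]; unfold zfoldR; ring. Qed.

Lemma zfoldR_mult : forall F G m n, zfoldR (fun i => zfoldR (fun j => F i * G j) n) m = zfoldR F m * zfoldR G n.
Proof. intros F G [|m] [|n]; unfold zfoldR; ring. Qed.

Lemma Cmod_zfold2_le : forall (t : Z -> Z -> C) (G : Z -> Z -> R) m n, (forall i j, Cmod (t i j) <= G i j) ->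
  Cmod (zfold (fun i => zfold (t i) n) m) <= zfoldR (fun i => zfoldR (G i) n) m.
Proof.
  intros t G m n H. apply Cmod_zfold_le. intros i. apply Cmod_zfold_le. auto.
Qed.

(** [(1 + |j|)^(-3/2)], summable over Z. A term of size [|w|^(-3)] is
    dominated by the product of two of these. *)
Definition g32 (j : Z) : R := / ((1 + Rabs (IZR j)) * sqrt (1 + Rabs (IZR j))).

Lemma g32_pos : forall j, 0 <= g32 j.
Proof.
  intros j. unfold g32. left. apply Rinv_0_lt_compat. pose proof (Rabs_pos (IZR j)).
  apply Rmult_lt_0_compat. lra. apply sqrt_lt_R0; lra.
Qed.

Lemma summable_g32 : summable (zfoldR g32).
Proof.
  apply (summable_zfoldR _ (fun n => / ((1 + INR n) * sqrt (1 + INR n)))).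
  - intros j. split. apply g32_pos. unfold g32. rewrite INR_IZR_INZ, Z2Nat.id, abs_IZR by lia. lra.
  - apply summable_inv_32.
Qed.

Lemma offlat_inv : forall z tau, in_H tau -> offlat z tau -> offlat (z / tau)%C (- / tau)%C.
Proof.
  intros z tau Ht Hz m n E. pose proof (in_H_neq0 _ Ht). apply (Hz n (- m)%Z).
  replace z with (z / tau * tau)%C by (field; auto). rewrite E, ZtoC_opp. field. auto.
Qed.

Lemma in_H_inv : forall tau, in_H tau -> in_H (- / tau)%C.
Proof.
  intros [x y] H. unfold in_H in *. simpl in *.
  replace (- (- y / (x * (x * 1) + y * (y * 1)))) with (y / (x * x + y * y)) by (field; nra).
  apply Rdiv_lt_0_compat; nra.
Qed.

(** Up to a constant, the double sum over the lattice of [1/(z + i tau + j)]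
    with the inner sum over [i]; in [cot_sum] the inner sum is over [j]. The
    two orders give different values, since convergence is only conditional. *)
Definition cot_sum_swapped (z tau : C) : C := (/ tau * cot_sum (z / tau) (- / tau))%C.

Lemma cot_sum_swapped_cv : forall z tau, in_H tau -> offlat z tau ->
  cser (zfold (fun n => / tau * icot ((z + ZtoC n) / tau))%C) (cot_sum_swapped z tau).
Proof.
  intros z tau Ht Hz. pose proof (in_H_neq0 _ Ht) as Ht0.
  pose proof (cot_sum_cv _ _ (in_H_inv _ Ht) (offlat_inv _ _ Ht Hz)) as H.
  unfold cot_sum_swapped. apply (cser_ext (fun n => / tau * zfold (fun m => icot (z / tau + ZtoC m * - / tau)) n)%C).
  - intros n. rewrite <- zfold_scal, <- (zfold_opp_arg (fun n => / tau * icot ((z + ZtoC n) / tau))%C).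
    apply zfold_ext. intros j. rewrite ZtoC_opp. do 2 f_equal. field. auto.
  - now apply cser_scal.
Qed.

(** The combination of three translates of [1/w] that decays like [w^(-3)], so
    that the double sum over the lattice converges absolutely. *)
Lemma second_difference : forall a l : C, a <> RtoC 0 -> (a + 1)%C <> RtoC 0 -> (a + l)%C <> RtoC 0 ->
  (1 / (a + l) - l * (1 / (a + 1)) + (l - 1) * (1 / a) = l * (l - 1) / (a * (a + 1) * (a + l)))%C.
Proof. intros. field. auto. Qed.

Lemma offlat_neq0 : forall z tau m n, offlat z tau -> (z + (ZtoC m * tau + ZtoC n))%C <> RtoC 0.
Proof.
  intros z tau m n H E. apply (H (- m)%Z (- n)%Z). rewrite !ZtoC_opp.
  replace z with ((z + (ZtoC m * tau + ZtoC n)) - (ZtoC m * tau + ZtoC n))%C by ring. rewrite E. ring.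
Qed.

(** For the combination of [second_difference] the double sum over the lattice
    converges absolutely and can be taken in either order; the row and column
    sums are given by [partial_fractions]. *)
Lemma cot_sum_second_difference : forall z l tau, in_H tau -> offlat z tau -> offlat (z + l)%C tau ->
  (cot_sum (z + l) tau - l * cot_sum (z + 1) tau + (l - 1) * cot_sum z tau =
   cot_sum_swapped (z + l) tau - l * cot_sum_swapped (z + 1) tau + (l - 1) * cot_sum_swapped z tau)%C.
Proof.
  intros z l tau Ht Hz Hl. pose proof (in_H_neq0 _ Ht) as Ht0.
  assert (offlat (z + 1)%C tau) as H1 by (apply (offlat_addZ z tau 1); auto).
  set (t := fun i j : Z => (1 / (z + l + (ZtoC i * tau + ZtoC j)) - l * (1 / (z + 1 + (ZtoC i * tau + ZtoC j)))
     + (l - 1) * (1 / (z + (ZtoC i * tau + ZtoC j))))%C).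
  set (CA := fun i => (neg_pi_i * (icot (z + l + ZtoC i * tau) - l * icot (z + 1 + ZtoC i * tau) + (l - 1) * icot (z + ZtoC i * tau)))%C).
  set (CB := fun j => (neg_pi_i * (/ tau * icot ((z + l + ZtoC j) / tau) - l * (/ tau * icot ((z + 1 + ZtoC j) / tau))
      + (l - 1) * (/ tau * icot ((z + ZtoC j) / tau))))%C).
  assert (forall i, cser (zfold (t i)) (CA i)) as HrA.
  { intros i.
    pose proof (partial_fractions _ _ (offlat_nonint _ _ i Hl) (offlat_nonint _ _ i Hz)) as P1'.
    pose proof (partial_fractions _ _ (offlat_nonint _ _ i H1) (offlat_nonint _ _ i Hz)) as P2'.
    apply (cser_scal (- l)%C) in P2'. pose proof (cser_plus _ _ _ _ P1' P2') as P.
    replace (CA i) with (neg_pi_i * (icot (z + l + ZtoC i * tau) - icot (z + ZtoC i * tau)) +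
      - l * (neg_pi_i * (icot (z + 1 + ZtoC i * tau) - icot (z + ZtoC i * tau))))%C by (unfold CA; ring).
    eapply cser_ext; [|exact P]. intros n. simpl. rewrite <- zfold_scal, <- zfold_plus. apply zfold_ext.
    intros j. unfold t. rewrite !Cplus_assoc. ring. }
  assert (forall j, cser (zfold (fun i => t i j)) (CB j)) as HrB.
  { assert (forall y j, offlat y tau -> nonint ((y + ZtoC j) / tau)%C) as Hn.
    { intros y j Hy n E. apply (Hy n (- j)%Z). rewrite ZtoC_opp, <- E. field. auto. }
    intros j.
    pose proof (partial_fractions _ _ (Hn _ j Hl) (Hn _ j Hz)) as P1'.
    pose proof (partial_fractions _ _ (Hn _ j H1) (Hn _ j Hz)) as P2'.
    apply (cser_scal (/ tau)%C) in P1'.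
    apply (cser_scal (- l * / tau)%C) in P2'. pose proof (cser_plus _ _ _ _ P1' P2') as P.
    replace (CB j) with (/ tau * (neg_pi_i * (icot ((z + l + ZtoC j) / tau) - icot ((z + ZtoC j) / tau))) +
      - l * / tau * (neg_pi_i * (icot ((z + 1 + ZtoC j) / tau) - icot ((z + ZtoC j) / tau))))%C by (unfold CB; ring).
    eapply cser_ext; [|exact P]. intros n. simpl. rewrite <- !zfold_scal, <- zfold_plus. apply zfold_ext.
    intros i. unfold t.
    assert (forall y, offlat y tau -> / tau * (1 / ((y + ZtoC j) / tau + ZtoC i)) = 1 / (y + (ZtoC i * tau + ZtoC j)))%C as Hy.
    { intros y Hy. pose proof (offlat_neq0 y tau i j Hy) as h.
      assert (y + ZtoC j + ZtoC i * tau <> 0)%C.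
      { replace (y + ZtoC j + ZtoC i * tau)%C with (y + (ZtoC i * tau + ZtoC j))%C by ring. exact h. }
      field. repeat split; auto; try (replace (y + ZtoC j + ZtoC i * tau)%C with (y + ZtoC j + tau * ZtoC i)%C by ring; auto). }
    rewrite <- (Hy (z + l)%C), <- (Hy (z + 1)%C), <- (Hy z) by auto. ring. }
  destruct (offlat_growth _ _ Ht Hz) as [d0 [Hd0 G0]].
  destruct (offlat_growth _ _ Ht H1) as [d1 [Hd1 G1]].
  destruct (offlat_growth _ _ Ht Hl) as [d2 [Hd2 G2]].
  set (Q := Cmod (l * (l - 1))%C / (d0 * d1 * d2)).
  assert (0 <= Q). { unfold Q. apply Rmult_le_pos. apply Cmod_ge_0. left. apply Rinv_0_lt_compat. repeat apply Rmult_lt_0_compat; auto. }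
  assert (forall i j, Cmod (t i j) <= (Q * g32 i) * g32 j) as Hb.
  { intros i j. unfold t. specialize (G0 i j). specialize (G1 i j). specialize (G2 i j).
    pose proof (offlat_neq0 z tau i j Hz) as N0. pose proof (offlat_neq0 _ tau i j H1) as N1.
    pose proof (offlat_neq0 _ tau i j Hl) as N2.
    set (w := (z + (ZtoC i * tau + ZtoC j))%C) in *.
    replace (z + 1 + (ZtoC i * tau + ZtoC j))%C with (w + 1)%C in * by (unfold w; ring).
    replace (z + l + (ZtoC i * tau + ZtoC j))%C with (w + l)%C in * by (unfold w; ring).
    rewrite second_difference by auto. rewrite Cmod_div by (repeat apply Cmult_neq_0; auto).
    unfold g32. pose proof (Rabs_pos (IZR i)). pose proof (Rabs_pos (IZR j)).
    set (a := 1 + Rabs (IZR i)) in *. set (b := 1 + Rabs (IZR j)) in *.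
    assert (0 < sqrt a) by (apply sqrt_lt_R0; unfold a; lra).
    assert (0 < sqrt b) by (apply sqrt_lt_R0; unfold b; lra).
    assert (sqrt a * sqrt a = a) as Ea by (apply sqrt_sqrt; unfold a; lra).
    assert (sqrt b * sqrt b = b) as Eb by (apply sqrt_sqrt; unfold b; lra).
    replace (a * sqrt a) with (sqrt a * sqrt a * sqrt a) by (rewrite Ea; ring).
    replace (b * sqrt b) with (sqrt b * sqrt b * sqrt b) by (rewrite Eb; ring).
    set (x := sqrt a) in *. set (y := sqrt b) in *. clearbody x y.
    unfold Q.
    replace (Cmod (l * (l - 1)) / (d0 * d1 * d2) * / (x * x * x) * / (y * y * y)) with
      (Cmod (l * (l - 1)) * / ((d0 * (x * y)) * (d1 * (x * y)) * (d2 * (x * y)))) by (field; repeat split; lra).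
    rewrite !Cmod_mult. apply Rmult_le_compat_l. apply Rmult_le_pos; apply Cmod_ge_0.
    assert (0 < x * y) by now apply Rmult_lt_0_compat.
    apply Rinv_le_contravar. repeat apply Rmult_lt_0_compat; auto.
    apply Rmult_le_compat; auto. apply Rmult_le_pos; apply Rmult_le_pos; lra. apply Rmult_le_pos; lra.
    apply Rmult_le_compat; auto; apply Rmult_le_pos; lra. }
  set (LA := (neg_pi_i * (cot_sum (z + l) tau - l * cot_sum (z + 1) tau + (l - 1) * cot_sum z tau))%C).
  set (LB := (neg_pi_i * (cot_sum_swapped (z + l) tau - l * cot_sum_swapped (z + 1) tau + (l - 1) * cot_sum_swapped z tau))%C).
  assert (cser (zfold CA) LA) as HLA.
  { unfold LA. replace (neg_pi_i * (cot_sum (z + l) tau - l * cot_sum (z + 1) tau + (l - 1) * cot_sum z tau))%C with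
      (neg_pi_i * cot_sum (z + l) tau + (- neg_pi_i * l * cot_sum (z + 1) tau + neg_pi_i * (l - 1) * cot_sum z tau))%C by ring.
    eapply cser_ext; [|apply cser_plus; [apply cser_scal, (cot_sum_cv _ _ Ht Hl)|apply cser_plus; apply cser_scal; [apply (cot_sum_cv _ _ Ht H1)|apply (cot_sum_cv _ _ Ht Hz)]]].
    intros n. simpl. rewrite <- !zfold_scal, <- !zfold_plus. apply zfold_ext. intros i. unfold CA. ring. }
  assert (cser (zfold CB) LB) as HLB.
  { unfold LB. replace (neg_pi_i * (cot_sum_swapped (z + l) tau - l * cot_sum_swapped (z + 1) tau + (l - 1) * cot_sum_swapped z tau))%C with
      (neg_pi_i * cot_sum_swapped (z + l) tau + (- neg_pi_i * l * cot_sum_swapped (z + 1) tau + neg_pi_i * (l - 1) * cot_sum_swapped z tau))%C by ring.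
    eapply cser_ext; [|apply cser_plus; [apply cser_scal, (cot_sum_swapped_cv _ _ Ht Hl)|apply cser_plus; apply cser_scal; [apply (cot_sum_swapped_cv _ _ Ht H1)|apply (cot_sum_swapped_cv _ _ Ht Hz)]]].
    intros n. simpl. rewrite <- !zfold_scal, <- !zfold_plus. apply zfold_ext. intros i. unfold CB. ring. }
  assert (LA = LB) as E.
  { apply (cser_unique (zfold CB)); auto.
    apply (fubini (fun m n => zfold (fun i => zfold (t i) n) m) (zfold CA) (zfold CB)
      (fun m => Q * zfoldR g32 m) (zfoldR g32)); auto.
    - apply summable_scal; auto. apply summable_g32.
    - apply summable_g32.
    - intros m n. eapply Rle_trans. apply (Cmod_zfold2_le _ (fun i j => (Q * g32 i) * g32 j)). auto.
      rewrite zfoldR_mult, zfoldR_scal. lra.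
    - intros m. apply (cser_zfold (fun i n => zfold (t i) n)). auto.
    - intros n. apply (cser_ext (fun m => zfold (fun j => zfold (fun i => t i j) m) n)).
      intros m. now rewrite zfold_swap.
      apply (cser_zfold (fun j m => zfold (fun i => t i j) m)). auto. }
  unfold LA, LB in E.
  assert (neg_pi_i <> RtoC 0) as Hc0.
  { unfold neg_pi_i. intros E'. apply tpi_neq0. replace tpi with (- (2) * - (tpi / 2))%C by field. rewrite E'. ring. }
  transitivity (/ neg_pi_i * (neg_pi_i * (cot_sum (z + l) tau - l * cot_sum (z + 1) tau + (l - 1) * cot_sum z tau)))%C. field; auto.
  rewrite E. field; auto.
Qed.

(** Take [l = -2z] in [cot_sum_second_difference]. Both sides are odd in [z]
    and have known behaviour under [z -> z + 1]: [cot_sum] is periodic, while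
    [cot_sum_swapped] changes by [-2 / tau] according to [cot_sum_sub_tau].
    What is left is a linear equation for the two values. *)
Lemma cot_sum_inversion : forall z tau, in_H tau -> offlat z tau ->
  cot_sum (z / tau) (- / tau) = (tau * cot_sum z tau - 2 * z)%C.
Proof.
  intros z tau Ht Hz. pose proof (in_H_neq0 _ Ht) as Ht0.
  assert (offlat (z + - (2) * z)%C tau) as Hl.
  { replace (z + - (2) * z)%C with (- z)%C by ring. now apply offlat_opp. }
  pose proof (cot_sum_second_difference z (- (2) * z)%C tau Ht Hz Hl) as E.
  replace (z + - (2) * z)%C with (- z)%C in E by ring.
  rewrite (cot_sum_opp z tau Ht Hz) in E.
  replace (z + 1)%C with (z + ZtoC 1)%C in E by (rewrite ZtoC_1; ring).
  rewrite cot_sum_addZ in E.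
  unfold cot_sum_swapped in E.
  pose proof (offlat_inv _ _ Ht Hz) as Hz'. pose proof (in_H_inv _ Ht) as Ht'.
  replace (- z / tau)%C with (- (z / tau))%C in E by (field; auto).
  rewrite (cot_sum_opp _ _ Ht' Hz') in E.
  replace ((z + ZtoC 1) / tau)%C with (z / tau - - / tau)%C in E by (rewrite ZtoC_1; field; auto).
  rewrite (cot_sum_sub_tau _ _ Ht' Hz') in E.
  set (a := cot_sum z tau) in *. set (b := cot_sum (z / tau) (- / tau)) in *.
  assert (a * (-(2)) = / tau * b * (-(2)) + / tau * (-(4)) * z)%C as E'.
  { transitivity (- a - - (2) * z * a + (- (2) * z - 1) * a)%C. ring. rewrite E. ring. }
  transitivity (tau * (/ tau * b * - (2) + / tau * - (4) * z) * (- (1/2)) - 2 * z)%C. field; auto.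
  rewrite <- E'. field.
Qed.

(** * Eisenstein series of weight one at the [N]-division points *)

(** The correction [- 2i/N] makes the value periodic in [i] modulo [N] and
    absorbs the term [- 2z] of the inversion formula. *)
Definition eis (N i j : Z) (tau : C) : C :=
  (cot_sum ((ZtoC i * tau + ZtoC j) / ZtoC N) tau - 2 * ZtoC i / ZtoC N)%C.

(** The division point is not a lattice point, so that the sum avoids the pole
    of [icot]. *)
Definition nzvec (N i j : Z) : Prop := ~ ((N | i)%Z /\ (N | j)%Z).

Lemma real_im_0 : forall tau a b, in_H tau -> (ZtoC a * tau + ZtoC b = RtoC 0)%C -> a = 0%Z /\ b = 0%Z.
Proof.
  intros [x y] a b H E. unfold in_H in H. simpl in H.
  injection E as E1 E2.
  assert (IZR a = 0) by nra. rewrite H0 in E1. split; apply eq_IZR; lra.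
Qed.

Lemma eis_offlat : forall N i j tau, N <> 0%Z -> in_H tau -> nzvec N i j ->
  offlat ((ZtoC i * tau + ZtoC j) / ZtoC N)%C tau.
Proof.
  intros N i j tau HN Ht Hv m n E. apply Hv.
  pose proof (ZtoC_neq0 N HN) as HN'.
  assert (ZtoC (i - m * N) * tau + ZtoC (j - n * N) = 0)%C as E2.
  { rewrite !ZtoC_sub, !ZtoC_mul.
    replace ((ZtoC i - ZtoC m * ZtoC N) * tau + (ZtoC j - ZtoC n * ZtoC N))%C
      with ((ZtoC i * tau + ZtoC j) / ZtoC N * ZtoC N - (ZtoC m * tau + ZtoC n) * ZtoC N)%C by (field; auto).
    rewrite E. ring. }
  destruct (real_im_0 _ _ _ Ht E2). split; [exists m|exists n]; lia.
Qed.

Lemma nzvec_add : forall N i j a b, nzvec N i j -> nzvec N (i + a * N) (j + b * N).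
Proof.
  intros N i j a b H [[u Hu] [v Hv]]. apply H. split; [exists (u - a)%Z|exists (v - b)%Z]; lia.
Qed.

Lemma eis_addN_r : forall N i j tau, N <> 0%Z -> eis N i (j + N) tau = eis N i j tau.
Proof.
  intros N i j tau HN. unfold eis. f_equal. rewrite <- (cot_sum_addZ ((ZtoC i * tau + ZtoC j) / ZtoC N)%C tau 1).
  f_equal. rewrite ZtoC_add, ZtoC_1. pose proof (ZtoC_neq0 N HN). field. auto.
Qed.

Lemma eis_addN_l : forall N i j tau, N <> 0%Z -> in_H tau -> nzvec N i j -> eis N (i + N) j tau = eis N i j tau.
Proof.
  intros N i j tau HN Ht Hv. pose proof (ZtoC_neq0 N HN) as HN'. unfold eis.
  assert (nzvec N (i + N) j) as Hv'.
  { replace (i + N)%Z with (i + 1 * N)%Z by lia. replace j with (j + 0 * N)%Z by lia. now apply nzvec_add. }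
  pose proof (cot_sum_sub_tau _ _ Ht (eis_offlat N _ _ _ HN Ht Hv')) as E.
  replace ((ZtoC (i + N) * tau + ZtoC j) / ZtoC N - tau)%C with ((ZtoC i * tau + ZtoC j) / ZtoC N)%C in E.
  2:{ rewrite ZtoC_add. field. auto. }
  rewrite E, ZtoC_add. field. auto.
Qed.

Lemma eis_opp : forall N i j tau, N <> 0%Z -> in_H tau -> nzvec N i j -> eis N (- i) (- j) tau = (- eis N i j tau)%C.
Proof.
  intros N i j tau HN Ht Hv. pose proof (ZtoC_neq0 N HN) as HN'. unfold eis. rewrite !ZtoC_opp.
  replace ((- ZtoC i * tau + - ZtoC j) / ZtoC N)%C with (- ((ZtoC i * tau + ZtoC j) / ZtoC N))%C by (field; auto).
  rewrite cot_sum_opp by (auto using eis_offlat). field. auto.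
Qed.

Lemma eis_T : forall N i j b tau, eis N i j (tau + ZtoC b)%C = eis N i (j + b * i) tau.
Proof.
  intros. unfold eis. rewrite cot_sum_tau_addZ. f_equal. f_equal.
  rewrite ZtoC_add, ZtoC_mul. unfold Cdiv. ring.
Qed.

Lemma eis_S : forall N i j tau, N <> 0%Z -> in_H tau -> nzvec N i j ->
  eis N i j (- / tau)%C = (tau * eis N j (- i) tau)%C.
Proof.
  intros N i j tau HN Ht Hv. pose proof (ZtoC_neq0 N HN) as HN'. pose proof (in_H_neq0 _ Ht).
  assert (nzvec N j (- i)) as Hv'.
  { intros [[u Hu] [v Hw]]. apply Hv. split; [exists (- v)%Z|exists u]; lia. }
  unfold eis.
  replace ((ZtoC i * - / tau + ZtoC j) / ZtoC N)%C with ((ZtoC j * tau + ZtoC (- i)) / ZtoC N / tau)%C.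
  2:{ rewrite ZtoC_opp. field. auto. }
  rewrite cot_sum_inversion by (auto using eis_offlat). rewrite ZtoC_opp. field. auto.
Qed.

Lemma automorphy_neq0 : forall a b c d tau, (a * d - b * c = 1)%Z -> in_H tau -> automorphy c d tau <> RtoC 0.
Proof.
  intros a b c d tau H Ht E. unfold automorphy in E. destruct (real_im_0 _ _ _ Ht E). subst. lia.
Qed.

Lemma Im_moebius : forall a b c d tau, (a * d - b * c = 1)%Z -> in_H tau ->
  Im (moebius a b c d tau) = Im tau / Cmod (automorphy c d tau) ^ 2.
Proof.
  intros a b c d tau H Ht. pose proof (automorphy_neq0 a b c d tau H Ht) as Hn.
  assert (0 < Cmod (automorphy c d tau)) as Hp by now apply Cmod_gt_0.
  assert (moebius a b c d tau = RtoC (/ Cmod (automorphy c d tau) ^ 2) * ((ZtoC a * tau + ZtoC b) * Cconj (automorphy c d tau)))%C as E.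
  { unfold moebius. rewrite RtoC_inv by (apply pow_nonzero; lra). rewrite Cmod2_conj.
    assert (Cconj (automorphy c d tau) <> RtoC 0).
    { apply Cmod_pos_neq. now rewrite Cmod_conj. }
    field. auto. }
  rewrite E. unfold Rdiv. set (m := / Cmod (automorphy c d tau) ^ 2). clearbody m. clear E Hp Hn Ht.
  destruct tau as [x y]. simpl. unfold Im, Re, automorphy. simpl.
  assert (IZR a * IZR d - IZR b * IZR c = 1) as Hd.
  { rewrite <- !mult_IZR, <- minus_IZR. f_equal. lia. }
  transitivity (m * y * (IZR a * IZR d - IZR b * IZR c)). ring. rewrite Hd. ring.
Qed.

Lemma moebius_in_H : forall a b c d tau, (a * d - b * c = 1)%Z -> in_H tau -> in_H (moebius a b c d tau).
Proof.
  intros a b c d tau H Ht. unfold in_H. rewrite (Im_moebius a b c d tau H Ht).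
  apply Rdiv_lt_0_compat. exact Ht. apply pow_lt. apply Cmod_gt_0. now apply (automorphy_neq0 a b).
Qed.

Lemma in_H_addZ : forall tau n, in_H tau -> in_H (tau + ZtoC n)%C.
Proof. intros [x y] n H. unfold in_H in *. simpl in *. lra. Qed.

(** Euclid's algorithm on the bottom row: [d = q c + r] writes the matrix as
    one with smaller lower left entry, times the inversion, times a
    translation. The integer [m] bounds the number of steps. *)
Lemma eis_SL2 : forall N, N <> 0%Z -> forall m a b c d i j tau, (Z.abs c < m)%Z -> (a * d - b * c = 1)%Z ->
  in_H tau -> nzvec N i j ->
  eis N i j (moebius a b c d tau) = (automorphy c d tau * eis N (i * a + j * c) (i * b + j * d) tau)%C.
Proof.
  intros N HN.
  assert (forall m : nat, forall a b c d i j tau, (Z.abs c < Z.of_nat m)%Z -> (a * d - b * c = 1)%Z ->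
  in_H tau -> nzvec N i j ->
  eis N i j (moebius a b c d tau) = (automorphy c d tau * eis N (i * a + j * c) (i * b + j * d) tau)%C) as Hmain.
  2:{ intros m a b c d i j tau Hc. apply (Hmain (Z.to_nat m)). lia. }
  induction m; intros a b c d i j tau Hc Hdet Ht Hv. lia.
  destruct (Z.eq_dec c 0) as [->|Hc0].
  - assert (a * d = 1)%Z as Had by lia. destruct (Z.mul_eq_1 a d Had) as [-> | ->].
    + assert (d = 1)%Z as -> by lia. 
      replace (moebius 1 b 0 1 tau) with (tau + ZtoC b)%C.
      2:{ unfold moebius, automorphy. rewrite ZtoC_0, ZtoC_1. field. }
      rewrite eis_T. unfold automorphy. rewrite ZtoC_0, ZtoC_1.
      replace (i * 1 + j * 0)%Z with i by lia. replace (i * b + j * 1)%Z with (j + b * i)%Z by lia. ring.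
    + assert (d = -1)%Z as -> by lia. change (- (1))%Z with (-1)%Z.
      assert (ZtoC (-1) = -(1))%C as Em by (change (-1)%Z with (- (1))%Z; rewrite (ZtoC_opp 1), ZtoC_1; ring).
      replace (moebius (-1) b 0 (-1) tau) with (tau + ZtoC (- b))%C.
      2:{ unfold moebius, automorphy. rewrite ZtoC_0, Em, ZtoC_opp. field. }
      rewrite eis_T. unfold automorphy. rewrite ZtoC_0, Em.
      replace (i * -1 + j * 0)%Z with (- i)%Z by lia.
      replace (i * b + j * -1)%Z with (- (j + - b * i))%Z by lia.
      rewrite eis_opp; auto. ring.
      replace i with (i + 0 * N)%Z at 1 by lia. intros [[u Hu] [v Hw]]. apply Hv. split. exists u; lia.
      exists (v + b * u)%Z. assert (i = u * N)%Z by lia. subst. lia.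
  - set (q := (d / c)%Z). set (r := (d mod c)%Z).
    assert (d = q * c + r)%Z as Ed by (unfold q, r; rewrite Z.mul_comm; apply Z_div_mod_eq_full).
    assert (Z.abs r < Z.abs c)%Z as Hr by (unfold r; now apply Z.mod_bound_abs || (pose proof (Z.mod_bound_or d c Hc0); lia)).
    set (w := (tau + ZtoC q)%C). assert (in_H w) as Hw by now apply in_H_addZ.
    pose proof (in_H_neq0 _ Hw) as Hw0. pose proof (in_H_inv _ Hw) as Hw'.
    assert (((b - a * q) * - c - - a * r = 1)%Z) as Hdet' by (rewrite <- Hdet, Ed; ring).
    pose proof (automorphy_neq0 _ _ _ _ _ Hdet Ht) as Hn.
    pose proof (automorphy_neq0 _ _ _ _ _ Hdet' Hw') as Hn'.
    replace (moebius a b c d tau) with (moebius (b - a * q) (- a) r (- c) (- / w)).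
    2:{ unfold moebius, automorphy in *. rewrite Ed in *. 
        assert (ZtoC r * - / w + ZtoC (- c) = - (ZtoC c * tau + ZtoC (q * c + r)) / w)%C as E1.
        { rewrite !ZtoC_add, !ZtoC_mul, !ZtoC_opp. unfold w. field. exact Hw0. }
        assert (ZtoC (b - a * q) * - / w + ZtoC (- a) = - (ZtoC a * tau + ZtoC b) / w)%C as E2.
        { rewrite !ZtoC_sub, !ZtoC_mul, !ZtoC_opp. unfold w. field. exact Hw0. }
        rewrite E1, E2. field. auto. }
    rewrite (IHm (b - a * q)%Z (- a)%Z r (- c)%Z i j (- / w)%C); auto; [|lia].
    assert (nzvec N (i * (b - a * q) + j * r) (i * - a + j * - c)) as Hv2.
    { intros [[u Hu] [v Hv']]. apply Hv. split.
      - exists (- c * u - r * v)%Z. transitivity (i * ((b - a * q) * - c - - a * r))%Z. rewrite Hdet'; ring.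
        replace ((- c * u - r * v) * N)%Z with (- c * (u * N) - r * (v * N))%Z by ring. rewrite <- Hu, <- Hv'. ring.
      - exists ((b - a * q) * v + a * u)%Z. transitivity (j * ((b - a * q) * - c - - a * r))%Z. rewrite Hdet'; ring.
        replace (((b - a * q) * v + a * u) * N)%Z with ((b - a * q) * (v * N) + a * (u * N))%Z by ring. rewrite <- Hu, <- Hv'. ring. }
    rewrite eis_S by auto.
    replace (i * - a + j * - c)%Z with (- (i * a + j * c))%Z by ring.
    assert (nzvec N (i * a + j * c) (i * (b - a * q) + j * r)) as Hv3.
    { intros [[u Hu] [v Hv']]. apply Hv2. split. exists v; lia. exists (- u)%Z. lia. }
    rewrite eis_opp by auto. unfold w at 3. rewrite eis_T.
    replace (i * (b - a * q) + j * r + q * (i * a + j * c))%Z with (i * b + j * d)%Z by (rewrite Ed; ring).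
    unfold automorphy. rewrite Ed, !ZtoC_opp, !ZtoC_add, !ZtoC_mul. unfold w. field. exact Hw0.
Qed.

(** * Power series in [exp(2 pi i tau / h)] *)

(** Polynomially bounded coefficients are stable under products and make the
    series and its derivatives converge in the half plane, so no radius of
    convergence has to be tracked. *)
Definition pbound (a : nat -> C) : Prop :=
  exists K D, 0 <= K /\ forall n, Cmod (a n) <= K * (1 + INR n) ^ D.

Definition cauchy_prod (a b : nat -> C) (n : nat) : C := csum (fun i => a i * b (n - i)%nat)%C (S n).

Lemma linear_geom_bound : forall s, 0 <= s < 1 -> exists K, 0 <= K /\ forall n, (1 + INR n) * s ^ n <= K.
Proof.
  intros s Hs. destruct (Req_dec s 0) as [->|Hs0].
  - exists 1. split. lra. intros [|n]. simpl. lra. rewrite pow_ne_zero by lia. lra.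
  - set (h := / s - 1). assert (1 < / s) by (rewrite <- Rinv_1 at 1; apply Rinv_lt_contravar; lra).
    assert (0 < h) by (unfold h; lra).
    assert (0 < / h) by (now apply Rinv_0_lt_compat).
    exists (1 + / h). split. lra. intros n.
    assert (1 + INR n * h <= (/ s) ^ n).
    { replace (/ s) with (1 + h) by (unfold h; ring).
      induction n. simpl; lra. rewrite S_INR. simpl pow.
      pose proof (pos_INR n). apply Rle_trans with ((1 + h) * (1 + INR n * h)).
      assert (0 <= INR n * h * h) by (repeat apply Rmult_le_pos; lra). lra.
      apply Rmult_le_compat_l; lra. }
    assert (0 < s ^ n) by (apply pow_lt; lra).
    assert (s ^ n * (/ s) ^ n = 1).
    { rewrite <- Rpow_mult_distr, Rinv_r by lra. apply pow1. }
    pose proof (pos_INR n).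
    assert (1 + INR n <= (1 + / h) * (1 + INR n * h)).
    { replace ((1 + / h) * (1 + INR n * h)) with (1 + INR n + / h + INR n * h) by (field; lra).
      assert (0 <= INR n * h) by (apply Rmult_le_pos; lra). lra. }
    apply Rle_trans with ((1 + / h) * (1 + INR n * h) * s ^ n).
    apply Rmult_le_compat_r; lra.
    apply Rle_trans with ((1 + / h) * ((/ s) ^ n * s ^ n)).
    rewrite Rmult_assoc. apply Rmult_le_compat_l. lra. apply Rmult_le_compat_r; lra.
    rewrite (Rmult_comm ((/ s) ^ n)), H4. lra.
Qed.

Lemma sqrt_nome : forall r, 0 <= r < 1 -> 0 <= sqrt r < 1 /\ sqrt r * sqrt r = r.
Proof.
  intros r Hr. pose proof (sqrt_pos r). pose proof (sqrt_sqrt r ltac:(lra)).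
  split; auto. split; auto. apply Rnot_le_lt. intros h. nra.
Qed.

Lemma summable_poly_geom : forall D r, 0 <= r < 1 -> summable (fun n => (1 + INR n) ^ D * r ^ n).
Proof.
  induction D; intros r Hr.
  - apply summable_le with (fun n => r ^ n). intros n. simpl. assert (0 <= r ^ n) by now apply pow_le. lra.
    now apply summable_geom.
  - destruct (sqrt_nome r Hr) as [Hs Hs2]. set (s := sqrt r) in *.
    destruct (linear_geom_bound s Hs) as [K [HK H]].
    apply summable_le with (fun n => K * ((1 + INR n) ^ D * s ^ n)).
    + intros n. pose proof (pos_INR n). assert (0 <= s ^ n) by (apply pow_le; lra).
      assert (0 <= (1 + INR n) ^ D) by (apply pow_le; lra).
      rewrite <- Hs2, Rpow_mult_distr. simpl pow. split.
      repeat apply Rmult_le_pos; lra.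
      replace ((1 + INR n) * (1 + INR n) ^ D * (s ^ n * s ^ n)) with
        (((1 + INR n) * s ^ n) * ((1 + INR n) ^ D * s ^ n)) by ring.
      apply Rmult_le_compat_r; auto. now apply Rmult_le_pos.
    + apply summable_scal; auto.
Qed.

Lemma one_le_1n : forall n, 1 <= 1 + INR n.
Proof. intros n. pose proof (pos_INR n). lra. Qed.

Lemma pbound_plus : forall a b, pbound a -> pbound b -> pbound (fun n => a n + b n)%C.
Proof.
  intros a b [K [D [HK H]]] [K' [D' [HK' H']]]. exists (K + K'), (D + D')%nat. split. lra.
  intros n. eapply Rle_trans. apply Cmod_triangle.
  pose proof (one_le_1n n). rewrite Rmult_plus_distr_r.
  apply Rplus_le_compat; (eapply Rle_trans; [apply H||apply H'|]); apply Rmult_le_compat_l; auto;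
    apply Rle_pow; auto; lia.
Qed.

Lemma pbound_scal : forall c a, pbound a -> pbound (fun n => c * a n)%C.
Proof.
  intros c a [K [D [HK H]]]. exists (Cmod c * K), D. pose proof (Cmod_ge_0 c). split. nra.
  intros n. rewrite Cmod_mult, Rmult_assoc. apply Rmult_le_compat_l; auto.
Qed.

Lemma pbound_zero : pbound (fun _ => RtoC 0).
Proof. exists 0, 0%nat. split. lra. intros. rewrite Cmod_0. simpl; lra. Qed.

Lemma pbound_prod : forall a b, pbound a -> pbound b -> pbound (cauchy_prod a b).
Proof.
  intros a b [K [D [HK H]]] [K' [D' [HK' H']]]. exists (K * K'), (D + D' + 1)%nat. split. nra.
  intros n. pose proof (one_le_1n n). unfold cauchy_prod.
  apply Rle_trans with (rsum (fun _ => K * (1 + INR n) ^ D * (K' * (1 + INR n) ^ D')) (S n)).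
  - apply Cmod_csum_le. intros i Hi. rewrite Cmod_mult.
    apply Rmult_le_compat; try apply Cmod_ge_0.
    + eapply Rle_trans. apply H. apply Rmult_le_compat_l; auto. apply pow_incr.
      pose proof (pos_INR i). assert (INR i <= INR n) by (apply le_INR; lia). lra.
    + eapply Rle_trans. apply H'. apply Rmult_le_compat_l; auto. apply pow_incr.
      pose proof (pos_INR (n - i)). assert (INR (n - i) <= INR n) by (apply le_INR; lia). lra.
  - rewrite rsum_const, S_INR. right. rewrite !pow_add. simpl. ring.
Qed.

(** Splitting [|q|] into two square roots bounds the terms of the Cauchy
    product by a product of a function of [m] and a function of [n], as
    [fubini] requires. *)
Lemma power_series_mult : forall a b q la lb, pbound a -> pbound b -> Cmod q < 1 ->
  cser (fun n => a n * q ^ n)%C la -> cser (fun n => b n * q ^ n)%C lb ->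
  cser (fun n => cauchy_prod a b n * q ^ n)%C (la * lb)%C.
Proof.
  intros a b q la lb Ha Hb Hq Hla Hlb.
  set (r := Cmod q) in *. assert (0 <= r < 1) as Hr by (split; auto; apply Cmod_ge_0).
  destruct (sqrt_nome r Hr) as [Hs Hs2]. set (s := sqrt r) in *.
  destruct Ha as [K [D [HK HA]]]. destruct Hb as [K' [D' [HK' HB]]].
  set (A := fun m n => if Nat.leb m n then (a m * b (n - m)%nat * q ^ n)%C else RtoC 0).
  apply (fubini A (fun m => lb * (a m * q ^ m))%C _ (fun m => K * ((1 + INR m) ^ D * s ^ m)) (fun n => K' * ((1 + INR n) ^ D' * s ^ n))).
  - apply summable_scal; auto. now apply summable_poly_geom.
  - apply summable_scal; auto. now apply summable_poly_geom.
  - intros m n. unfold A. destruct (Nat.leb m n) eqn:E.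
    + apply Nat.leb_le in E. rewrite !Cmod_mult, Cmod_pow. fold r.
      assert (r ^ n <= s ^ m * s ^ n).
      { rewrite <- Hs2, Rpow_mult_distr. apply Rmult_le_compat_r. apply pow_le; lra.
        replace n with (m + (n - m))%nat by lia. rewrite pow_add.
        assert (0 <= s ^ m) by (apply pow_le; lra).
        assert (s ^ (n - m) <= 1). { rewrite <- (pow1 (n - m)). apply pow_incr; lra. }
        rewrite <- (Rmult_1_r (s ^ m)) at 2. apply Rmult_le_compat_l; auto. }
      assert (Cmod (b (n - m)%nat) <= K' * (1 + INR n) ^ D').
      { eapply Rle_trans. apply HB. apply Rmult_le_compat_l; auto. apply pow_incr.
        pose proof (pos_INR (n - m)). assert (INR (n - m) <= INR n) by (apply le_INR; lia). lra. }
      replace (K * ((1 + INR m) ^ D * s ^ m) * (K' * ((1 + INR n) ^ D' * s ^ n))) with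
        ((K * (1 + INR m) ^ D) * (K' * (1 + INR n) ^ D') * (s ^ m * s ^ n)) by ring.
      apply Rmult_le_compat; auto. apply Rmult_le_pos; apply Cmod_ge_0. apply pow_le; lra.
      apply Rmult_le_compat; auto; apply Cmod_ge_0.
    + rewrite Cmod_0. pose proof (one_le_1n m). pose proof (one_le_1n n).
      repeat apply Rmult_le_pos; auto; apply pow_le; lra.
  - intros m.
    replace (lb * (a m * q ^ m))%C with (csum (A m) m + (a m * q ^ m) * lb)%C.
    2:{ rewrite csum_eq0. ring. intros i Hi. unfold A. replace (Nat.leb m i) with false; auto.
        symmetry; apply Nat.leb_gt; auto. }
    apply cser_head. apply (cser_ext (fun n => (a m * q ^ m) * (b n * q ^ n))%C).
    intros n. unfold A. replace (Nat.leb m (m + n)) with true by (symmetry; apply Nat.leb_le; lia).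
    replace (m + n - m)%nat with n by lia. rewrite Cpow_add_r. ring.
    now apply cser_scal.
  - intros n. replace (cauchy_prod a b n * q ^ n)%C with (csum (fun m => A m n) (S n)).
    + apply cser_finite. intros m Hm. unfold A. replace (Nat.leb m n) with false; auto.
      symmetry; apply Nat.leb_gt; lia.
    + unfold cauchy_prod. rewrite (csum_ext _ (fun m => q ^ n * (a m * b (n - m)%nat))%C).
      rewrite csum_scal. ring.
      intros i Hi. unfold A. replace (Nat.leb i n) with true by (symmetry; apply Nat.leb_le; lia). ring.
  - rewrite Cmult_comm. now apply cser_scal.
Qed.

(** The value at infinity is part of the expansion and there is no polar part;
    [h] is the width of the cusp. *)
Definition expn (h : Z) (a : nat -> C) (F : C -> C) : Prop :=
  pbound a /\ forall tau, in_H tau -> cser (fun n => a n * e2pi (tau / ZtoC h) ^ n)%C (F tau).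

Lemma Cmod_q : forall h tau, (0 < h)%Z -> Cmod (e2pi (tau / ZtoC h)%C) = exp (- (2 * PI * (Im tau / IZR h))).
Proof.
  intros h tau Hh. rewrite Cmod_e2pi. do 3 f_equal. apply IZR_lt in Hh.
  unfold Cdiv, ZtoC. rewrite <- RtoC_inv by lra. destruct tau as [x y]; simpl. unfold Im, Rdiv; simpl. ring.
Qed.

Lemma Cmod_q_lt1 : forall h tau, (0 < h)%Z -> in_H tau -> 0 < Cmod (e2pi (tau / ZtoC h)%C) < 1.
Proof.
  intros h tau Hh Ht. rewrite Cmod_q by auto. apply nome_lt1. apply Rdiv_lt_0_compat; auto. now apply IZR_lt in Hh.
Qed.

Lemma expn_plus : forall h a b F G, expn h a F -> expn h b G ->
  expn h (fun n => a n + b n)%C (fun t => F t + G t)%C.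
Proof.
  intros h a b F G [Ha HF] [Hb HG]. split. now apply pbound_plus. intros tau Ht.
  eapply cser_ext; [|apply cser_plus; [apply HF|apply HG]; auto]. intros n; simpl. ring.
Qed.

Lemma expn_scal : forall h c a F, expn h a F -> expn h (fun n => c * a n)%C (fun t => c * F t)%C.
Proof.
  intros h c a F [Ha HF]. split. now apply pbound_scal. intros tau Ht.
  eapply cser_ext; [|apply cser_scal; apply HF; auto]. intros n; simpl. ring.
Qed.

Lemma expn_zero : forall h, expn h (fun _ => RtoC 0) (fun _ => RtoC 0).
Proof.
  intros h. split. apply pbound_zero. intros. apply (cser_ext (fun _ => RtoC 0)). intros; ring. apply cser_zero.
Qed.

Lemma expn_csum : forall h (a : nat -> nat -> C) (F : nat -> C -> C) m, (forall i, (i < m)%nat -> expn h (a i) (F i)) ->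
  expn h (fun n => csum (fun i => a i n) m) (fun t => csum (fun i => F i t) m).
Proof.
  induction m; intros H; simpl. apply expn_zero.
  apply (expn_plus h (fun n => csum (fun i => a i n) m) (a m) (fun t => csum (fun i => F i t) m) (F m)); auto.
Qed.

Lemma expn_mult : forall h a b F G, (0 < h)%Z -> expn h a F -> expn h b G ->
  expn h (cauchy_prod a b) (fun t => F t * G t)%C.
Proof.
  intros h a b F G Hh [Ha HF] [Hb HG]. split. now apply pbound_prod. intros tau Ht.
  apply power_series_mult; auto. now apply Cmod_q_lt1.
Qed.

Definition one_coef (n : nat) : C := match n with O => RtoC 1 | _ => RtoC 0 end.

Fixpoint series_pow (a : nat -> C) (k : nat) : nat -> C :=
  match k with O => one_coef | S m => cauchy_prod a (series_pow a m) end.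

Lemma expn_one : forall h, expn h one_coef (fun _ => RtoC 1).
Proof.
  intros h. split.
  - exists 1, 0%nat. split. lra. intros [|n]; simpl. rewrite Cmod_1; lra. rewrite Cmod_0; lra.
  - intros tau Ht. replace (RtoC 1) with (csum (fun n => one_coef n * e2pi (tau / ZtoC h) ^ n)%C 1) by (simpl; ring).
    apply cser_finite. intros [|n] Hn. lia. simpl. ring.
Qed.

Lemma expn_pow : forall h a F k, (0 < h)%Z -> expn h a F -> expn h (series_pow a k) (fun t => F t ^ k)%C.
Proof.
  intros h a F k Hh H. induction k; simpl. apply expn_one.
  apply (expn_mult h a (series_pow a k) F (fun t => F t ^ k)%C); auto.
Qed.

Lemma expn_ext : forall h a b F G, (forall n, a n = b n) -> (forall t, in_H t -> F t = G t) -> expn h a F -> expn h b G.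
Proof.
  intros h a b F G Hab HFG [[K [D [HK HD]]] H]. split.
  - exists K, D. split; auto. intros. now rewrite <- Hab.
  - intros tau Ht. rewrite <- HFG by auto. apply (cser_ext (fun n => a n * e2pi (tau / ZtoC h) ^ n)%C); auto.
    intros n. now rewrite Hab.
Qed.

(** The coefficients of [y x^mu + y^2 x^(2 mu) + ...], for [mu > 0]. For [mu =
    0] all are zero, which is convenient for the row [i = 0] below. *)
Definition geom_coef (mu : nat) (y : C) (n : nat) : C :=
  if Nat.eqb n 0 then RtoC 0 else if Nat.eqb (n mod mu) 0 then (y ^ (n / mu))%C else RtoC 0.

Lemma geom_coef_zero : forall mu y n, (n < mu)%nat -> geom_coef mu y n = RtoC 0.
Proof.
  intros mu y n H. unfold geom_coef. destruct (Nat.eqb n 0) eqn:E; auto. apply Nat.eqb_neq in E.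
  rewrite Nat.mod_small by auto. destruct (Nat.eqb n 0) eqn:E2; auto. apply Nat.eqb_eq in E2. lia.
Qed.

Lemma geom_coef_mu0 : forall y n, geom_coef 0 y n = RtoC 0.
Proof.
  intros y n. unfold geom_coef. destruct (Nat.eqb n 0) eqn:E; auto. simpl. now rewrite E.
Qed.

Lemma geom_coef_bound : forall mu y n, Cmod y = 1 -> Cmod (geom_coef mu y n) <= 1.
Proof.
  intros mu y n H. unfold geom_coef. destruct (Nat.eqb n 0). rewrite Cmod_0; lra.
  destruct (Nat.eqb (n mod mu) 0). rewrite Cmod_pow, H, pow1. lra. rewrite Cmod_0; lra.
Qed.

Lemma geom_coef_shift : forall mu y n, (0 < mu)%nat -> geom_coef mu y (mu + n) = if Nat.eqb n 0 then y else (y * geom_coef mu y n)%C.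
Proof.
  intros mu y n H. unfold geom_coef at 1. replace (Nat.eqb (mu + n) 0) with false by (symmetry; apply Nat.eqb_neq; lia).
  replace (mu + n)%nat with (n + 1 * mu)%nat by lia.
  rewrite Nat.Div0.mod_add, Nat.div_add by lia.
  destruct (Nat.eqb n 0) eqn:E.
  - apply Nat.eqb_eq in E. subst. rewrite Nat.Div0.mod_0_l, Nat.Div0.div_0_l by lia. simpl. ring.
  - unfold geom_coef. rewrite E. destruct (Nat.eqb (n mod mu) 0).
    rewrite Nat.add_1_r. simpl. ring. ring.
Qed.

Lemma geom_coef_series : forall mu y q, (0 < mu)%nat -> Cmod y = 1 -> Cmod q < 1 ->
  cser (fun n => geom_coef mu y n * q ^ n)%C (y * q ^ mu / (1 - y * q ^ mu))%C.
Proof.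
  intros mu y q Hmu Hy Hq. pose proof (Cmod_ge_0 q).
  assert (forall a, (forall n, Cmod (a n) <= 1) -> exists l, cser (fun n => a n * q ^ n)%C l) as Hex.
  { intros a Ha. apply (abs_cv _ (fun n => Cmod q ^ n)). apply summable_geom; auto.
    intros n. rewrite Cmod_mult, Cmod_pow. rewrite <- (Rmult_1_l (Cmod q ^ n)) at 2.
    apply Rmult_le_compat_r; auto. now apply pow_le. }
  destruct (Hex (geom_coef mu y)) as [s Hs]. intros; now apply geom_coef_bound.
  assert (s = y * q ^ mu * (1 + s))%C as E.
  { apply (cser_unique (fun n => geom_coef mu y n * q ^ n)%C); auto.
    replace (y * q ^ mu * (1 + s))%C with (csum (fun n => geom_coef mu y n * q ^ n) mu + (y * q ^ mu * (1 + s)))%C.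
    2:{ rewrite csum_eq0. ring. intros i Hi. rewrite geom_coef_zero by auto. ring. }
    apply cser_head.
    apply (cser_ext (fun n => y * q ^ mu * (one_coef n + geom_coef mu y n * q ^ n))%C).
    - intros n. rewrite geom_coef_shift by auto. rewrite Cpow_add_r. destruct n as [|n].
      + unfold geom_coef. simpl. ring.
      + simpl Nat.eqb. cbv iota. simpl one_coef. ring.
    - apply cser_scal. apply cser_plus; auto.
      replace (RtoC 1) with (csum one_coef 1) by (simpl; ring). apply cser_finite. intros [|n] Hn. lia. reflexivity. }
  assert (Cmod (y * q ^ mu)%C < 1).
  { rewrite Cmod_mult, Hy, Cmod_pow, Rmult_1_l. destruct mu as [|m]; [lia|]. simpl.
    assert (Cmod q ^ m <= 1). { rewrite <- (pow1 m). apply pow_incr. lra. }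
    assert (0 <= Cmod q ^ m) by now apply pow_le. nra. }
  assert (1 - y * q ^ mu <> 0)%C as Hn.
  { intros E0. assert (y * q ^ mu = 1)%C as E1. { replace (y * q ^ mu)%C with (1 - (1 - y * q ^ mu))%C by ring. rewrite E0. ring. }
    rewrite E1, Cmod_1 in H0. lra. }
  replace (y * q ^ mu / (1 - y * q ^ mu))%C with s; auto.
  transitivity (s * (1 - y * q ^ mu) / (1 - y * q ^ mu))%C. field; auto.
  f_equal. transitivity (s - s * (y * q ^ mu))%C. ring. rewrite E at 1. ring.
Qed.

(** The contribution of the summands [m] and [-m] of [cot_sum]: since [icot]
    is odd, the summand at [-m] is a series in [e(-z + m tau)], whence the
    exponents [mN - i], the inverse root of unity and the minus sign. *)
Definition lambert_term (N i : nat) (x xi : C) (n m : nat) : C :=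
  match m with
  | O => geom_coef i x n
  | _ => (geom_coef (m * N + i) x n - geom_coef (m * N - i) xi n)%C
  end.

(** Only the [m <= n] contribute to the coefficient at [n]. *)
Definition lambert_coef (N i : nat) (x xi : C) (n : nat) : C := csum (lambert_term N i x xi n) (S n).

(** Apart from the constant term the coefficients are twice integral
    polynomials in the root of unity [e(j/N)]; the divisibility of the final
    form rests on this. *)
Definition eis_coef (N i : nat) (j : Z) (n : nat) : C :=
  match n with
  | O => ((if Nat.eqb i 0 then icot (ZtoC j / RtoC (INR N)) else RtoC 1) - 2 * RtoC (INR i) / RtoC (INR N))%C
  | _ => (2 * lambert_coef N i (e2pi (ZtoC j / RtoC (INR N))) (e2pi (- (ZtoC j / RtoC (INR N)))) n)%C
  end.

Lemma lambert_term_zero : forall N i x xi n m, (i < N)%nat -> (n < m)%nat -> lambert_term N i x xi n m = RtoC 0.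
Proof.
  intros N i x xi n m Hi Hm. unfold lambert_term. destruct m as [|m]; [lia|].
  rewrite !geom_coef_zero by nia. ring.
Qed.

Lemma lambert_term_bound : forall N i x xi n m, Cmod x = 1 -> Cmod xi = 1 -> Cmod (lambert_term N i x xi n m) <= 2.
Proof.
  intros N i x xi n m Hx Hxi. unfold lambert_term. destruct m as [|m].
  pose proof (geom_coef_bound i x n Hx). lra.
  unfold Cminus. eapply Rle_trans. apply Cmod_triangle. rewrite Cmod_opp.
  pose proof (geom_coef_bound (S m * N + i) x n Hx). pose proof (geom_coef_bound (S m * N - i) xi n Hxi). lra.
Qed.

Lemma eis_coef_pbound : forall N i j, (0 < N)%nat -> pbound (eis_coef N i j).
Proof.
  intros N i j HN.
  exists (Cmod (eis_coef N i j 0) + 4), 1%nat. pose proof (Cmod_ge_0 (eis_coef N i j 0)). split. lra.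
  intros n. pose proof (one_le_1n n). rewrite pow_1. destruct n as [|n].
  - simpl (INR 0). rewrite Rplus_0_r, Rmult_1_r. lra.
  - unfold eis_coef at 1. rewrite Cmod_mult, Cmod_R, Rabs_pos_eq by lra.
    assert (Cmod (lambert_coef N i (e2pi (ZtoC j / RtoC (INR N))) (e2pi (- (ZtoC j / RtoC (INR N)))) (S n)) <= INR (S (S n)) * 2).
    { unfold lambert_coef. rewrite <- rsum_const. apply Cmod_csum_le. intros m _.
      assert (forall y : R, Cmod (e2pi (RtoC y)) = 1) as Hy.
      { intros y. rewrite Cmod_e2pi. simpl. rewrite Rmult_0_r, Ropp_0. apply exp_0. }
      assert (INR N <> 0) as E by (apply not_0_INR; lia).
      apply lambert_term_bound; unfold ZtoC; rewrite <- RtoC_div by auto; try rewrite <- RtoC_opp; apply Hy. }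
    rewrite S_INR in H1. nra.
Qed.

Lemma icot_expand : forall z, 0 < Im z -> icot z = (1 + 2 * (e2pi z / (1 - e2pi z)))%C.
Proof.
  intros z Hz. assert (1 - e2pi z <> 0)%C. { apply nonint_e2pi, nonint_im. lra. }
  unfold icot. field. auto.
Qed.

(** Expand each [icot] as a geometric series and interchange the two
    summations; the majorant is again made of square roots of [|q|]. *)
Lemma eis_expn : forall N i j, (i < N)%nat -> nzvec (Z.of_nat N) (Z.of_nat i) j ->
  expn (Z.of_nat N) (eis_coef N i j) (eis (Z.of_nat N) (Z.of_nat i) j).
Proof.
  intros N i j Hi Hv. split. apply eis_coef_pbound; lia. intros tau Ht.
  assert (0 < Z.of_nat N)%Z as HN by lia.
  assert (Z.of_nat N <> 0%Z) as HN0 by lia.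
  pose proof (ZtoC_neq0 _ HN0) as HNC.
  pose proof (Cmod_q_lt1 _ tau HN Ht) as Hq.
  set (q := e2pi (tau / ZtoC (Z.of_nat N))%C) in *.
  set (x := e2pi (ZtoC j / RtoC (INR N))%C). set (xi := e2pi (- (ZtoC j / RtoC (INR N)))%C).
  rewrite ZtoC_nat in *.
  set (k := RtoC (INR N)) in *.
  assert (INR N <> 0) as HNR by (apply not_0_INR; lia).
  assert (Cmod x = 1 /\ Cmod xi = 1) as [Hx Hxi].
  { unfold x, xi, k, ZtoC. rewrite <- RtoC_div, <- RtoC_opp by auto. rewrite !Cmod_e2pi. simpl.
    rewrite Rmult_0_r, Ropp_0, exp_0. auto. }
  set (z := ((ZtoC (Z.of_nat i) * tau + ZtoC j) / k)%C).
  assert (offlat z tau) as Hz.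
  { unfold z, k. rewrite <- ZtoC_nat. apply eis_offlat; auto. }
  pose proof (cot_sum_cv z tau Ht Hz) as HA.
  set (kap := if Nat.eqb i 0 then icot (ZtoC j / k)%C else RtoC 1).
  set (L := (cot_sum z tau - kap)%C).
  assert (forall m, cser (fun n => 2 * (lambert_term N i x xi n m * q ^ n))%C
     (match m with O => zfold (fun m => icot (z + ZtoC m * tau)%C) 0 - kap | _ => zfold (fun m => icot (z + ZtoC m * tau)%C) m end)%C) as Hrow.
  { assert (forall mu, (0 < mu)%nat -> 0 < Im ((RtoC (INR mu) * tau + ZtoC j) / k)%C /\ e2pi ((RtoC (INR mu) * tau + ZtoC j) / k)%C = x * q ^ mu
           /\ 0 < Im ((RtoC (INR mu) * tau - ZtoC j) / k)%C /\ e2pi ((RtoC (INR mu) * tau - ZtoC j) / k)%C = xi * q ^ mu)%C as Hmu.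
    { intros mu Hmu. unfold in_H in Ht.
      assert (forall w : C, Im (w / k)%C = Im w / INR N) as Ediv.
      { intros w. unfold k, Cdiv. rewrite <- RtoC_inv by auto. destruct w as [w1 w2]; simpl. unfold Im, Rdiv; simpl. ring. }
      assert (0 < INR mu) by (apply lt_0_INR; auto). assert (0 < INR N) by (apply lt_0_INR; lia).
      repeat split.
      - rewrite Ediv. apply Rdiv_lt_0_compat; auto. destruct tau; simpl in *. unfold Im; simpl. nra.
      - unfold x, q. rewrite <- e2pi_pow, <- e2pi_add, ZtoC_nat. fold k. f_equal. field. auto.
      - rewrite Ediv. apply Rdiv_lt_0_compat; auto. destruct tau; simpl in *. unfold Im; simpl. nra.
      - unfold xi, q. rewrite <- e2pi_pow, <- e2pi_add, ZtoC_nat. fold k. f_equal. field. auto. }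
    assert (forall mu, (0 < mu)%nat -> cser (fun n => 2 * (geom_coef mu x n * q ^ n))%C (icot ((RtoC (INR mu) * tau + ZtoC j) / k) - 1)%C) as G1.
    { intros mu H. destruct (Hmu mu H) as [A1 [A2 _]]. rewrite icot_expand, A2 by auto.
      replace (1 + 2 * (x * q ^ mu / (1 - x * q ^ mu)) - 1)%C with (2 * (x * q ^ mu / (1 - x * q ^ mu)))%C by ring.
      apply cser_scal. apply geom_coef_series; auto; lra. }
    assert (forall mu, (0 < mu)%nat -> cser (fun n => 2 * (geom_coef mu xi n * q ^ n))%C (icot ((RtoC (INR mu) * tau - ZtoC j) / k) - 1)%C) as G2.
    { intros mu H. destruct (Hmu mu H) as [_ [_ [A1 A2]]]. rewrite icot_expand, A2 by auto.
      replace (1 + 2 * (xi * q ^ mu / (1 - xi * q ^ mu)) - 1)%C with (2 * (xi * q ^ mu / (1 - xi * q ^ mu)))%C by ring.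
      apply cser_scal. apply geom_coef_series; auto; lra. }
    intros [|m].
    - unfold zfold, lambert_term, kap. destruct (Nat.eqb i 0) eqn:E.
      + apply Nat.eqb_eq in E. subst i. replace (z + ZtoC 0 * tau)%C with (ZtoC j / k)%C.
        2:{ unfold z. rewrite !ZtoC_0. simpl Z.of_nat. rewrite ZtoC_0. field. auto. }
        replace (icot (ZtoC j / k) - icot (ZtoC j / k))%C with (RtoC 0) by ring.
        apply (cser_ext (fun _ => RtoC 0)). intros n. rewrite geom_coef_mu0. ring. apply cser_zero.
      + apply Nat.eqb_neq in E. replace (z + ZtoC 0 * tau)%C with ((RtoC (INR i) * tau + ZtoC j) / k)%C.
        apply G1; lia. unfold z. rewrite ZtoC_0, ZtoC_nat. field. auto.
    - unfold zfold, lambert_term. set (M := S m).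
      replace (z + ZtoC (- Z.of_nat M) * tau)%C with (- ((RtoC (INR (M * N - i)) * tau - ZtoC j) / k))%C.
      2:{ unfold z. rewrite ZtoC_opp, !ZtoC_nat. rewrite minus_INR by (unfold M; nia).
          rewrite mult_INR, RtoC_minus, RtoC_mult. fold k. field. auto. }
      rewrite icot_opp.
      2:{ apply nonint_im. destruct (Hmu (M * N - i)%nat) as [_ [_ [h _]]]. unfold M; nia. lra. }
      replace (z + ZtoC (Z.of_nat M) * tau)%C with ((RtoC (INR (M * N + i)) * tau + ZtoC j) / k)%C.
      2:{ unfold z. rewrite !ZtoC_nat. rewrite plus_INR, mult_INR, RtoC_plus, RtoC_mult. fold k. field. auto. }
      pose proof (G1 (M * N + i)%nat ltac:(unfold M; nia)) as B1.
      pose proof (cser_scal (-(1))%C _ _ (G2 (M * N - i)%nat ltac:(unfold M; nia))) as B2.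
      pose proof (cser_plus _ _ _ _ B1 B2) as B.
      replace (icot ((RtoC (INR (M * N + i)) * tau + ZtoC j) / k) + - icot ((RtoC (INR (M * N - i)) * tau - ZtoC j) / k))%C
        with (icot ((RtoC (INR (M * N + i)) * tau + ZtoC j) / k) - 1 + -(1) * (icot ((RtoC (INR (M * N - i)) * tau - ZtoC j) / k) - 1))%C by ring.
      eapply cser_ext; [|exact B]. intros n. simpl. ring. }
  assert (cser (fun n => csum (fun m => 2 * (lambert_term N i x xi n m * q ^ n)) (S n))%C L) as HL.
  { destruct (sqrt_nome (Cmod q) ltac:(lra)) as [Hs Hs2]. set (s := sqrt (Cmod q)) in *.
    refine (fubini (fun m n => 2 * (lambert_term N i x xi n m * q ^ n))%C _ _ (fun m => 4 * s ^ m) (fun n => s ^ n) _ _ _ _ Hrow _ _).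
    - apply summable_scal. lra. now apply summable_geom.
    - now apply summable_geom.
    - intros m n. assert (0 <= s ^ m) by (apply pow_le; lra). assert (0 <= s ^ n) by (apply pow_le; lra).
      destruct (Nat.le_gt_cases m n).
      + rewrite !Cmod_mult, Cmod_R, Rabs_pos_eq, Cmod_pow by lra.
        pose proof (lambert_term_bound N i x xi n m Hx Hxi).
        assert (Cmod q ^ n <= s ^ m * s ^ n).
        { rewrite <- Hs2, Rpow_mult_distr. apply Rmult_le_compat_r; auto.
          replace n with (m + (n - m))%nat by lia. rewrite pow_add.
          assert (s ^ (n - m) <= 1). { rewrite <- (pow1 (n - m)). apply pow_incr; lra. }
          rewrite <- (Rmult_1_r (s ^ m)) at 2. apply Rmult_le_compat_l; auto. }
        assert (0 <= Cmod q ^ n) by (apply pow_le; lra).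
        pose proof (Cmod_ge_0 (lambert_term N i x xi n m)). nra.
      + rewrite lambert_term_zero by auto. replace (2 * (0 * q ^ n))%C with (RtoC 0) by ring. rewrite Cmod_0. nra.
    - intros n. apply cser_finite. intros m Hm. rewrite lambert_term_zero by lia. ring.
    - unfold L. pose proof (cser_plus _ _ _ _ HA (cser_scal (- kap)%C _ _ (cser_finite one_coef 1 ltac:(intros [|n] Hn; [lia|reflexivity])))) as B.
      replace (cot_sum z tau - kap)%C with (cot_sum z tau + - kap * csum one_coef 1)%C by (simpl; ring).
      eapply cser_ext; [|exact B]. intros [|m]; simpl; ring. }
  replace (eis (Z.of_nat N) (Z.of_nat i) j tau) with (L + eis_coef N i j 0)%C.
  2:{ unfold eis, L, eis_coef. rewrite !ZtoC_nat. fold k. fold kap. unfold z. rewrite ZtoC_nat. ring. }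
  pose proof (cser_plus _ _ _ _ HL (cser_finite (fun n => match n with O => eis_coef N i j 0 | _ => RtoC 0 end) 1 ltac:(intros [|n] Hn; [lia|reflexivity]))) as B.
  replace (L + eis_coef N i j 0)%C with (L + csum (fun n => match n with O => eis_coef N i j 0 | _ => RtoC 0 end) 1)%C by (simpl; ring).
  eapply cser_ext; [|exact B].
  intros [|n].
  - simpl csum. unfold lambert_term, geom_coef. simpl. ring.
  - rewrite (csum_ext _ (fun m => (2 * q ^ S n) * lambert_term N i x xi (S n) m)%C) by (intros; ring).
    rewrite csum_scal. unfold eis_coef, lambert_coef. fold k x xi. ring.
Qed.

(** * Real Dirichlet characters *)

Definition real_character (N : Z) (chi : Z -> C) : Prop :=
  dirichlet_character N chi /\ forall a, Z.gcd a N = 1%Z -> (chi a * chi a)%C = RtoC 1.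

Lemma periodic_mul : forall (F : Z -> C) N, (forall j, F (j + N)%Z = F j) -> forall m j, F (j + m * N)%Z = F j.
Proof.
  intros F N H.
  assert (forall n : nat, forall a, F (a + Z.of_nat n * N)%Z = F a) as Hn.
  { induction n; intros b. f_equal; ring.
    replace (b + Z.of_nat (S n) * N)%Z with ((b + Z.of_nat n * N) + N)%Z by (rewrite Nat2Z.inj_succ; ring).
    rewrite H. apply IHn. }
  intros m j. destruct (Z.le_ge_cases 0 m).
  - rewrite <- (Z2Nat.id m) by lia. apply Hn.
  - rewrite <- (Hn (Z.to_nat (- m)) (j + m * N)%Z). f_equal. rewrite Z2Nat.id by lia. ring.
Qed.

Lemma chi_period_mul : forall N chi a m, dirichlet_character N chi -> chi (a + m * N)%Z = chi a.
Proof. intros N chi a m [_ [H _]]. now apply periodic_mul. Qed.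

Lemma chi_1 : forall N chi, (0 < N)%Z -> dirichlet_character N chi -> chi 1%Z = RtoC 1.
Proof.
  intros N chi HN [Hm [_ Hu]].
  assert (chi 1%Z <> RtoC 0) as H1 by (apply Hu; apply Z.gcd_1_l).
  pose proof (Hm 1 1)%Z as E. simpl in E.
  transitivity (chi 1%Z * chi 1%Z / chi 1%Z)%C. field; auto. rewrite <- E. field; auto.
Qed.

Lemma chi_nonunit : forall N chi a, dirichlet_character N chi -> Z.gcd a N <> 1%Z -> chi a = RtoC 0.
Proof.
  intros N chi a [_ [_ Hu]] H. apply NNPP. intros h. apply H. now apply Hu.
Qed.

Lemma chi_unit_sq : forall N chi a, real_character N chi -> chi a <> RtoC 0 -> (chi a * chi a)%C = RtoC 1.
Proof. intros N chi a [[_ [_ Hu]] H] h. apply H. now apply Hu. Qed.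

Lemma chi_vals : forall N chi a, real_character N chi -> chi a = RtoC 0 \/ chi a = RtoC 1 \/ chi a = (-(1))%C.
Proof.
  intros N chi a H. destruct (classic (chi a = RtoC 0)) as [h|h]; auto. right.
  pose proof (chi_unit_sq N chi a H h) as E.
  destruct (classic (chi a - 1 = RtoC 0)%C) as [h1|h1].
  - left. replace (chi a) with (chi a - 1 + 1)%C by ring. rewrite h1. ring.
  - right. assert ((chi a - 1) * (chi a + 1) = 0)%C as E2.
    { transitivity (chi a * chi a - 1)%C. ring. rewrite E. ring. }
    transitivity ((chi a - 1) * (chi a + 1) / (chi a - 1) - 1)%C. field; auto. rewrite E2. field. auto.
Qed.

Lemma csum_reindex : forall (F : nat -> C) (sg : nat -> nat) N,
  (forall i, (i < N)%nat -> (sg i < N)%nat) ->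
  (forall r, (r < N)%nat -> exists i, (i < N)%nat /\ sg i = r /\ forall j, (j < N)%nat -> sg j = r -> j = i) ->
  csum (fun i => F (sg i)) N = csum F N.
Proof.
  intros F sg N H1 H2.
  rewrite (csum_ext _ (fun i => csum (fun r => if Nat.eqb (sg i) r then F r else RtoC 0) N)).
  2:{ intros i Hi. rewrite (csum_single _ N (sg i)); auto. now rewrite Nat.eqb_refl.
      intros j _ Hj. destruct (Nat.eqb (sg i) j) eqn:E; auto. apply Nat.eqb_eq in E. congruence. }
  rewrite csum_swap. apply csum_ext. intros r Hr.
  destruct (H2 r Hr) as [i [Hi [E HU]]].
  rewrite (csum_single _ N i); auto. now rewrite E, Nat.eqb_refl.
  intros j Hj Hne. destruct (Nat.eqb (sg j) r) eqn:E'; auto. apply Nat.eqb_eq in E'. exfalso. auto.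
Qed.

Lemma periodic_mod : forall (F : Z -> C) N, (forall j, F (j + N)%Z = F j) -> N <> 0%Z -> forall j, F (j mod N)%Z = F j.
Proof.
  intros F N H HN j. rewrite <- (periodic_mul F N H (j / N) (j mod N)). f_equal.
  pose proof (Z_div_mod_eq_full j N). lia.
Qed.

(** Multiplication by a unit followed by a translation permutes the residues. *)
Lemma csum_affine : forall (F : Z -> C) N a b, (0 < N)%nat -> (forall j, F (j + Z.of_nat N)%Z = F j) ->
  Z.gcd a (Z.of_nat N) = 1%Z ->
  csum (fun i => F (a * Z.of_nat i + b)%Z) N = csum (fun i => F (Z.of_nat i)) N.
Proof.
  intros F N a b HN HF Hg. set (n := Z.of_nat N) in *. assert (0 < n)%Z as Hn by (unfold n; lia).
  set (sg := fun i => Z.to_nat ((a * Z.of_nat i + b) mod n)).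
  rewrite <- (csum_reindex (fun i => F (Z.of_nat i)) sg).
  - apply csum_ext. intros i Hi. unfold sg. rewrite Z2Nat.id by (apply Z.mod_pos_bound; auto).
    now rewrite (periodic_mod F n) by (auto; lia).
  - intros i Hi. unfold sg. pose proof (Z.mod_pos_bound (a * Z.of_nat i + b) n Hn). unfold n in *. lia.
  - intros r Hr.
    destruct (Zis_gcd_bezout a n 1) as [u v Huv]. { rewrite <- Hg. apply Zgcd_is_gcd. }
    assert (forall i, (i < N)%nat -> sg i = r -> Z.of_nat i = (u * (Z.of_nat r - b)) mod n)%Z as Huniq.
    { intros i Hi E. unfold sg in E.
      assert ((a * Z.of_nat i + b) mod n = Z.of_nat r)%Z as E1.
      { rewrite <- E, Z2Nat.id; auto. apply Z.mod_pos_bound; auto. }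
      pose proof (Z_div_mod_eq_full (a * Z.of_nat i + b) n) as E2. rewrite E1 in E2.
      set (t := ((a * Z.of_nat i + b) / n)%Z) in *.
      replace (u * (Z.of_nat r - b))%Z with (Z.of_nat i + (- u * t - v * Z.of_nat i) * n)%Z.
      rewrite Z.mod_add by lia. symmetry; apply Z.mod_small. unfold n; lia.
      replace (Z.of_nat r - b)%Z with (a * Z.of_nat i - n * t)%Z by lia.
      transitivity (Z.of_nat i * (u * a + v * n) + (- u * t - v * Z.of_nat i) * n)%Z. rewrite Huv; ring. ring. }
    exists (Z.to_nat ((u * (Z.of_nat r - b)) mod n)).
    pose proof (Z.mod_pos_bound (u * (Z.of_nat r - b)) n Hn) as Hb.
    repeat split.
    + unfold n in *; lia.
    + unfold sg. rewrite Z2Nat.id by lia.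
      pose proof (Z_div_mod_eq_full (u * (Z.of_nat r - b)) n) as E2.
      set (w := ((u * (Z.of_nat r - b)) mod n)%Z) in *. set (t := ((u * (Z.of_nat r - b)) / n)%Z) in *.
      replace (a * w + b)%Z with (Z.of_nat r + (- v * (Z.of_nat r - b) - a * t) * n)%Z.
      rewrite Z.mod_add by lia. rewrite Z.mod_small by (unfold n; lia). apply Nat2Z.id.
      replace w with (u * (Z.of_nat r - b) - n * t)%Z by lia.
      transitivity (Z.of_nat r - b - (1 - u * a) * (Z.of_nat r - b) - a * n * t + b)%Z; [|ring].
      rewrite <- Huv. ring.
    + intros j Hj E. rewrite <- (Huniq j Hj E), Nat2Z.id. reflexivity.
Qed.

(** * Power sums of the Eisenstein series twisted by a character *)

(** The sum over all rows [(u, v)] multiplied by a matrix on the right;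
    carrying the matrix along expresses the behaviour of the sum under all of
    SL_2(Z). The rows with [chi v = 0] drop out, in particular [(0, 0)]. *)
Definition eis_plane_sum (N : nat) (chi : Z -> C) (k : nat) (a b c d : Z) (tau : C) : C :=
  csum (fun v => csum (fun u => chi (Z.of_nat v) *
    eis (Z.of_nat N) (Z.of_nat u * a + Z.of_nat v * c) (Z.of_nat u * b + Z.of_nat v * d) tau ^ k)%C N) N.

(** The part of the orbit that comes from the rows [(u, 0)]. *)
Definition eis_axis_sum (N : nat) (chi : Z -> C) (k : nat) (a b : Z) (tau : C) : C :=
  csum (fun u => chi (Z.of_nat u) * eis (Z.of_nat N) (Z.of_nat u * a) (Z.of_nat u * b) tau ^ k)%C N.

(** The scalar [lm] will be [eps] times a Gauss sum, which makes the
    coefficients obey the sign condition. *)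
Definition eis_power_form (N : nat) (chi : Z -> C) (k : nat) (lm : C) (a b c d : Z) (tau : C) : C :=
  (eis_plane_sum N chi k a b c d tau + lm * eis_axis_sum N chi k a b tau)%C.

Lemma unit_not_dvd : forall N a, (1 < N)%Z -> Z.gcd a N = 1%Z -> ~ (N | a)%Z.
Proof.
  intros N a HN Hg H. assert (N | Z.gcd a N)%Z by (apply Z.gcd_greatest; auto; apply Z.divide_refl).
  rewrite Hg in H0. apply Z.divide_1_r_nonneg in H0; lia.
Qed.

Lemma nzvec_SL2 : forall N a b c d u v, (a * d - b * c = 1)%Z -> nzvec N u v -> nzvec N (u * a + v * c) (u * b + v * d).
Proof.
  intros N a b c d u v Hd H [H1 H2]. apply H. split.
  - replace u with (d * (u * a + v * c) - c * (u * b + v * d))%Z.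
    apply Z.divide_sub_r; now apply Z.divide_mul_r.
    transitivity (u * (a * d - b * c))%Z. ring. rewrite Hd. ring.
  - replace v with (a * (u * b + v * d) - b * (u * a + v * c))%Z.
    apply Z.divide_sub_r; now apply Z.divide_mul_r.
    transitivity (v * (a * d - b * c))%Z. ring. rewrite Hd. ring.
Qed.

Lemma chi_nzvec : forall N chi v, (1 < N)%Z -> dirichlet_character N chi -> chi v <> RtoC 0 -> ~ (N | v)%Z.
Proof.
  intros N chi v HN H h. apply unit_not_dvd; auto. now apply H.
Qed.

Lemma eis_power_form_moebius : forall N chi k lm a b c d tau, (1 < N)%nat -> dirichlet_character (Z.of_nat N) chi ->
  (a * d - b * c = 1)%Z -> in_H tau ->
  eis_power_form N chi k lm 1 0 0 1 (moebius a b c d tau) = (automorphy c d tau ^ k * eis_power_form N chi k lm a b c d tau)%C.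
Proof.
  intros N chi k lm a b c d tau HN Hchi Hdet Ht.
  assert (Z.of_nat N <> 0%Z) as HN0 by lia.
  assert (forall u v, nzvec (Z.of_nat N) u v ->
    eis (Z.of_nat N) u v (moebius a b c d tau) = (automorphy c d tau * eis (Z.of_nat N) (u * a + v * c) (u * b + v * d) tau)%C) as Hev.
  { intros u v Huv. apply (eis_SL2 (Z.of_nat N) HN0 (Z.abs c + 1)); auto. lia. }
  unfold eis_power_form, eis_plane_sum, eis_axis_sum. rewrite Cmult_plus_distr_l. f_equal.
  - rewrite <- csum_scal. apply csum_ext. intros v _. rewrite <- csum_scal. apply csum_ext. intros u _.
    destruct (classic (chi (Z.of_nat v) = RtoC 0)) as [h|h]. rewrite h; ring.
    replace (Z.of_nat u * 1 + Z.of_nat v * 0)%Z with (Z.of_nat u) by ring.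
    replace (Z.of_nat u * 0 + Z.of_nat v * 1)%Z with (Z.of_nat v) by ring.
    rewrite Hev, Cpow_mult_l. ring.
    intros [_ H2]. revert H2. apply (chi_nzvec _ chi); auto; lia.
  - rewrite Cmult_assoc, (Cmult_comm _ lm), <- Cmult_assoc. f_equal. rewrite <- csum_scal. apply csum_ext. intros u _.
    destruct (classic (chi (Z.of_nat u) = RtoC 0)) as [h|h]. rewrite h; ring.
    replace (Z.of_nat u * 1)%Z with (Z.of_nat u) by ring.
    replace (Z.of_nat u * 0)%Z with 0%Z by ring.
    rewrite Hev, Cpow_mult_l.
    replace (Z.of_nat u * a + 0 * c)%Z with (Z.of_nat u * a)%Z by ring.
    replace (Z.of_nat u * b + 0 * d)%Z with (Z.of_nat u * b)%Z by ring. ring.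
    intros [H2 _]. revert H2. apply (chi_nzvec _ chi); auto; lia.
Qed.

Lemma eis_addmul_r : forall N i j m tau, N <> 0%Z -> eis N i (j + m * N) tau = eis N i j tau.
Proof. intros N i j m tau HN. apply (periodic_mul (fun j => eis N i j tau)). intros; now apply eis_addN_r. Qed.

Lemma gcd_of_det : forall N a b c d, (a * d - b * c = 1)%Z -> (N | b)%Z -> Z.gcd a N = 1%Z /\ Z.gcd d N = 1%Z.
Proof.
  intros N a b c d H [m ->]. split; apply Zgcd_1_rel_prime; apply bezout_rel_prime.
  - apply Bezout_intro with d (- m * c)%Z. lia.
  - apply Bezout_intro with a (- m * c)%Z. lia.
Qed.

(** Modulo [N] the matrix is lower triangular with [a d = 1], so it maps the
    rows with second entry [v] bijectively to those with second entry [d v],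
    and [chi a = chi d] because [chi] is real. *)
Lemma eis_power_form_invariant : forall N chi k lm a b c d tau, (1 < N)%nat -> real_character (Z.of_nat N) chi ->
  (a * d - b * c = 1)%Z -> (Z.of_nat N | b)%Z -> in_H tau ->
  eis_power_form N chi k lm a b c d tau = (chi d * eis_power_form N chi k lm 1 0 0 1 tau)%C.
Proof.
  intros N chi k lm a b c d tau HN Hr Hdet [b' Hb] Ht. pose proof (proj1 Hr) as Hchi.
  assert (Z.of_nat N <> 0%Z) as HN0 by lia. set (n := Z.of_nat N) in *.
  destruct (gcd_of_det n a b c d Hdet) as [Ha Hd]. now exists b'.
  assert (forall i v, ~ (n | v)%Z -> nzvec n i v) as Hnz2 by (intros i v h [_ h']; auto).
  assert (forall i v, ~ (n | i)%Z -> nzvec n i v) as Hnz1 by (intros i v h [h' _]; auto).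
  assert (chi a = chi d) as Had.
  { pose proof (proj2 Hr d Hd) as Ed. destruct Hchi as [Hm' [Hp Hu]].
    transitivity (chi a * (chi d * chi d))%C. rewrite Ed; ring.
    rewrite Cmult_assoc, <- Hm'. replace (a * d)%Z with (1 + b' * c * n)%Z by lia.
    rewrite chi_period_mul by (repeat split; auto; apply Hu). rewrite (chi_1 n chi) by (try lia; repeat split; auto; apply Hu). ring. }
  unfold eis_power_form, eis_plane_sum, eis_axis_sum. fold n. rewrite Cmult_plus_distr_l. f_equal.
  - set (K := fun v => csum (fun u => chi v * eis n (Z.of_nat u) v tau ^ k)%C N).
    transitivity (csum (fun v => chi d * K (d * Z.of_nat v + 0)%Z)%C N).
    + apply csum_ext. intros v _. unfold K. rewrite <- csum_scal.
      destruct (classic (chi (Z.of_nat v) = RtoC 0)) as [h|h].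
      { rewrite !csum_eq0; auto; intros i _.
        rewrite Z.add_0_r, (proj1 Hchi), h. ring. rewrite h. ring. }
      assert (~ (n | Z.of_nat v)%Z) as Hv by (apply (chi_nzvec _ chi); auto; lia).
      assert (chi (d * Z.of_nat v)%Z <> RtoC 0) as hd.
      { rewrite (proj1 Hchi). apply Cmult_neq_0; auto. now apply Hchi. }
      assert (~ (n | d * Z.of_nat v)%Z) as Hdv by (apply (chi_nzvec _ chi); auto; lia).
      rewrite Z.add_0_r.
      rewrite <- (csum_affine (fun u => chi d * (chi (d * Z.of_nat v)%Z * eis n u (d * Z.of_nat v) tau ^ k))%C N a (Z.of_nat v * c)); auto; try lia.
      * apply csum_ext. intros u _.
        replace (Z.of_nat u * b + Z.of_nat v * d)%Z with (d * Z.of_nat v + Z.of_nat u * b' * n)%Z by (rewrite Hb; ring).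
        rewrite eis_addmul_r by auto. replace (Z.of_nat u * a + Z.of_nat v * c)%Z with (a * Z.of_nat u + Z.of_nat v * c)%Z by ring.
        rewrite (proj1 Hchi d). rewrite Cmult_assoc, Cmult_assoc, (proj2 Hr d Hd). ring.
      * intros j. fold n. now rewrite eis_addN_l by auto.
    + rewrite csum_scal. f_equal. rewrite (csum_affine K N d 0); auto; try lia.
      * apply csum_ext. intros v _. unfold K. apply csum_ext. intros u _. do 3 f_equal; ring.
      * intros j. unfold K. apply csum_ext. intros u _. fold n. rewrite eis_addN_r by auto. f_equal.
        apply Hchi.
  - rewrite Cmult_assoc, (Cmult_comm (chi d)), <- Cmult_assoc. f_equal. rewrite <- csum_scal.
    transitivity (csum (fun u => (fun i => chi d * (chi i * eis n i 0 tau ^ k))%C (a * Z.of_nat u + 0)%Z) N).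
    + apply csum_ext. intros u _. rewrite Z.add_0_r, (proj1 Hchi a), Had.
      replace (Z.of_nat u * b)%Z with (0 + Z.of_nat u * b' * n)%Z by (rewrite Hb; ring). rewrite eis_addmul_r by auto.
      replace (Z.of_nat u * a)%Z with (a * Z.of_nat u)%Z by ring.
      rewrite !Cmult_assoc, (proj2 Hr d Hd). ring.
    + rewrite (csum_affine (fun i => chi d * (chi i * eis n i 0 tau ^ k))%C N a 0); auto; try lia.
      * apply csum_ext. intros u _. now rewrite Z.mul_1_r, Z.mul_0_r.
      * intros j. fold n. destruct (classic (chi j = RtoC 0)) as [h|h].
        { rewrite (proj1 (proj2 Hchi)), h. ring. }
        rewrite (proj1 (proj2 Hchi)). rewrite eis_addN_l; auto. apply Hnz1. apply (chi_nzvec _ chi); auto; lia.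
Qed.

(** * Holomorphy and expansions at the cusps *)

(** A quadratic remainder is how [expn_holomorphic] meets the definition of
    the complex derivative by filters. *)
Lemma C_derive_of_quadratic : forall (f : C -> C) (x l : C) (K d : R), 0 < d -> 0 <= K ->
  (forall h, Cmod h <= d -> Cmod (f (x + h) - f x - h * l)%C <= K * Cmod h ^ 2) ->
  is_derive (K := C_AbsRing) (V := C_NormedModule) f x l.
Proof.
  intros f x l K d Hd HK H. split. apply is_linear_scal_l.
  intros x' Hx'.
  assert (x = x') as <-.
  { apply (is_filter_lim_locally_unique (K := C_AbsRing) (V := AbsRing_NormedModule C_AbsRing)). exact Hx'. }
  intros [e He]. simpl.
  assert (0 < Rmin d (e / (K + 1))) as Hpos.
  { apply Rmin_pos; auto. apply Rdiv_lt_0_compat; lra. }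
  exists (mkposreal _ Hpos). intros y Hy.
  change (Cmod (y - x)%C < Rmin d (e / (K + 1))) in Hy.
  change (Cmod (f y - f x - (y - x) * l)%C <= e * Cmod (y - x)%C).
  set (h := (y - x)%C) in *. replace y with (x + h)%C by (unfold h; ring).
  pose proof (Rmin_l d (e / (K + 1))). pose proof (Rmin_r d (e / (K + 1))).
  eapply Rle_trans. apply H. lra.
  pose proof (Cmod_ge_0 h).
  replace (K * Cmod h ^ 2) with (K * Cmod h * Cmod h) by ring.
  apply Rmult_le_compat_r; auto.
  assert (Cmod h * (K + 1) <= e).
  { apply Rle_trans with (e / (K + 1) * (K + 1)). apply Rmult_le_compat_r; lra. right; field; lra. }
  nra.
Qed.

(** Differentiate term by term: the remainders [e(n h) - 1 - 2 pi i n h] are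
    quadratic in [h] with constants [O(n^2)], which the geometric decay of
    [e(tau)^n] absorbs. *)
Lemma expn_holomorphic : forall a F, expn 1 a F -> holomorphic_on_H F.
Proof.
  intros a F [[K [D [HK HA]]] HF] tau Ht. pose proof Ht as Ht'. unfold in_H in Ht'.
  set (y := Im tau) in *. pose proof PI_RGT_0 as Hpi.
  (* Half of the decay at height [y] pays for moving by at most [y / 2], the
     other half for the polynomial factors. *)
  set (r := exp (- (2 * PI * y))). set (s := exp (- (2 * PI * (y / 2)))).
  assert (0 < s < 1) as Hs by (apply nome_lt1; lra).
  assert (r = s * s) as Ers.
  { unfold r, s. rewrite <- exp_plus. f_equal. field. }
  assert (forall t, e2pi (t / ZtoC 1) = e2pi t)%C as E1.
  { intros t. f_equal. rewrite ZtoC_1. field. }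
  assert (Cmod (e2pi tau) = r) as Er by apply Cmod_e2pi.
  set (b := fun n => K * (2 * PI) * ((1 + INR n) ^ (D + 1) * s ^ n)).
  assert (forall n, 0 <= s ^ n <= 1) as Hsn.
  { intros n. split. apply pow_le; lra. rewrite <- (pow1 n). apply pow_incr; lra. }
  destruct (abs_cv (fun n => a n * (tpi * RtoC (INR n)) * e2pi tau ^ n)%C b) as [l Hl].
  { unfold b. apply summable_scal. nra. apply summable_poly_geom. lra. }
  { intros n. unfold b. rewrite !Cmod_mult, Cmod_pow, Er, Cmod_tpi, Cmod_R, Rabs_pos_eq by apply pos_INR.
    rewrite Ers, Rpow_mult_distr, pow_add, pow_1.
    pose proof (pos_INR n). specialize (HA n). specialize (Hsn n). pose proof (Cmod_ge_0 (a n)).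
    apply Rle_trans with (K * (1 + INR n) ^ D * (2 * PI * (1 + INR n)) * (s ^ n)).
    - apply Rmult_le_compat; try nra.
      apply Rmult_le_pos; auto. nra.
      apply Rmult_le_compat; auto; nra.
    - right; ring. }
  destruct (summable_poly_geom (D + 2) s) as [Hg0 [B HB]]. lra.
  assert (0 <= B) by (specialize (HB 0%nat); simpl in HB; lra).
  exists l. apply (C_derive_of_quadratic F tau l (K * (4 * (2 * PI) ^ 2) * B) (y / 2)). lra.
  { apply Rmult_le_pos; auto. apply Rmult_le_pos; auto. apply Rmult_le_pos. lra. apply pow_le; lra. }
  intros h Hh.
  assert (in_H (tau + h)%C) as Hth.
  { unfold in_H. pose proof (Rabs_Im_Cmod h). assert (Rabs (Im h) <= y / 2) as H1 by lra. apply Rabs_le_between in H1.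
    replace (Im (tau + h)%C) with (y + Im h) by reflexivity. lra. }
  pose proof (HF _ Ht) as S0. pose proof (HF _ Hth) as S1.
  pose proof (cser_plus _ _ _ _ (cser_plus _ _ _ _ S1 (cser_scal (-(1))%C _ _ S0)) (cser_scal (- h)%C _ _ Hl)) as S.
  replace (F (tau + h) - F tau - h * l)%C with (F (tau + h)%C + -(1) * F tau + - h * l)%C by ring.
  apply (cser_le _ (fun n => (K * (4 * (2 * PI) ^ 2) * Cmod h ^ 2) * ((1 + INR n) ^ (D + 2) * s ^ n)) _ _ S).
  - intros n. cbv beta. rewrite !E1.
    assert (e2pi (tau + h) ^ n = e2pi tau ^ n * Cexp (tpi * (RtoC (INR n) * h)))%C as E2.
    { rewrite e2pi_add, Cpow_mult_l. f_equal. rewrite <- e2pi_pow. reflexivity. }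
    rewrite E2. set (w := (tpi * (RtoC (INR n) * h))%C).
    replace (a n * (e2pi tau ^ n * Cexp w) + -(1) * (a n * e2pi tau ^ n) + - h * (a n * (tpi * RtoC (INR n)) * e2pi tau ^ n))%C
      with (a n * e2pi tau ^ n * (Cexp w - 1 - w))%C by (unfold w; ring).
    rewrite !Cmod_mult, Cmod_pow, Er.
    pose proof (Cexp_est w) as He. pose proof (pos_INR n) as Hn. pose proof (Cmod_ge_0 h) as Hh0.
    assert (Cmod w = 2 * PI * (INR n * Cmod h)) as Ew.
    { unfold w. rewrite !Cmod_mult, Cmod_tpi, Cmod_R, Rabs_pos_eq by auto. reflexivity. }
    rewrite Ew in He.
    assert (r ^ n * exp (2 * PI * (INR n * Cmod h)) <= s ^ n) as Hrs.
    { unfold r, s. rewrite <- !exp_pow, <- exp_plus.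
      assert (INR n * - (2 * PI * y) + 2 * PI * (INR n * Cmod h) <= INR n * - (2 * PI * (y / 2))) as Hle.
      { assert (2 * PI * INR n * Cmod h <= 2 * PI * INR n * (y / 2)). apply Rmult_le_compat_l; nra. lra. }
      destruct Hle as [h1|h1]. left; now apply exp_increasing. rewrite h1; lra. }
    specialize (HA n). pose proof (Cmod_ge_0 (a n)). assert (0 <= r ^ n) by (apply pow_le; left; apply exp_pos).
    apply Rle_trans with (Cmod (a n) * r ^ n * (4 * (2 * PI * (INR n * Cmod h) * (2 * PI * (INR n * Cmod h))) * exp (2 * PI * (INR n * Cmod h)))).
    { apply Rmult_le_compat_l; auto. now apply Rmult_le_pos. }
    set (E := exp (2 * PI * (INR n * Cmod h))) in *.
    replace (Cmod (a n) * r ^ n * (4 * (2 * PI * (INR n * Cmod h) * (2 * PI * (INR n * Cmod h))) * E)) with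
      (4 * (2 * PI) ^ 2 * Cmod h ^ 2 * ((Cmod (a n) * INR n ^ 2) * (r ^ n * E))) by ring.
    replace (K * (4 * (2 * PI) ^ 2) * Cmod h ^ 2 * ((1 + INR n) ^ (D + 2) * s ^ n)) with
      (4 * (2 * PI) ^ 2 * Cmod h ^ 2 * ((K * (1 + INR n) ^ D * (1 + INR n) ^ 2) * s ^ n)) by (rewrite pow_add; ring).
    apply Rmult_le_compat_l. apply Rmult_le_pos. apply Rmult_le_pos. lra. apply pow_le; lra. apply pow_le; auto.
    apply Rmult_le_compat; auto.
    apply Rmult_le_pos; auto. apply pow_le; auto. apply Rmult_le_pos; auto. left; apply exp_pos.
    apply Rmult_le_compat; auto. apply pow_le; auto. apply pow_incr; lra.
  - intros n. rewrite rsum_scal.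
    replace (K * (4 * (2 * PI) ^ 2) * B * Cmod h ^ 2) with ((K * (4 * (2 * PI) ^ 2) * Cmod h ^ 2) * B) by ring.
    apply Rmult_le_compat_l; auto.
    apply Rmult_le_pos; [|apply pow_le, Cmod_ge_0]. apply Rmult_le_pos; auto. apply Rmult_le_pos. lra. apply pow_le; lra.
Qed.

Definition zero_extension (a : nat -> C) (n : Z) : C := if (n <? 0)%Z then RtoC 0 else a (Z.to_nat n).

Lemma expn_laurent : forall h a F, (0 < h)%Z -> expn h a F -> laurent_expansion h F (zero_extension a).
Proof.
  intros h a F Hh [_ H]. exists 0%Z. split.
  - intros n Hn. unfold zero_extension. apply Z.ltb_lt in Hn. now rewrite Hn.
  - intros tau Ht. apply is_series_cser. eapply cser_ext; [|apply (H tau Ht)].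
    intros n. cbv zeta. unfold zero_extension.
    replace (0 + Z.of_nat n <? 0)%Z with false by (symmetry; apply Z.ltb_ge; lia).
    replace (Z.to_nat (0 + Z.of_nat n)) with n by lia. f_equal.
    rewrite <- e2pi_pow. f_equal. replace (0 + Z.of_nat n)%Z with (Z.of_nat n) by lia. rewrite ZtoC_nat.
    unfold Cdiv. ring.
Qed.

Lemma eis_expn_ex : forall N i j, (0 < N)%nat -> nzvec (Z.of_nat N) i j ->
  exists a, expn (Z.of_nat N) a (eis (Z.of_nat N) i j).
Proof.
  intros N i j HN Hv. set (n := Z.of_nat N) in *. assert (0 < n)%Z as Hn by (unfold n; lia).
  pose proof (Z.mod_pos_bound i n Hn) as Hb. pose proof (Z_div_mod_eq_full i n) as E.
  set (i0 := (i mod n)%Z) in *. set (t := (i / n)%Z) in *.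
  assert (nzvec n i0 j) as Hv0.
  { replace i0 with (i + (- t) * n)%Z by lia. replace j with (j + 0 * n)%Z by lia. now apply nzvec_add. }
  assert (forall m tau, in_H tau -> eis n (i0 + m * n) j tau = eis n i0 j tau) as Hper.
  { intros m tau Ht.
    assert (forall k : nat, forall i, nzvec n i j -> eis n (i + Z.of_nat k * n) j tau = eis n i j tau) as Hk.
    { induction k; intros i' Hi'. f_equal. ring.
      replace (i' + Z.of_nat (S k) * n)%Z with ((i' + Z.of_nat k * n) + n)%Z by (rewrite Nat2Z.inj_succ; ring).
      rewrite eis_addN_l; auto. lia. replace j with (j + 0 * n)%Z by lia. now apply nzvec_add. }
    destruct (Z.le_ge_cases 0 m).
    - rewrite <- (Z2Nat.id m) by lia. apply Hk; auto.
    - rewrite <- (Hk (Z.to_nat (- m)) (i0 + m * n)%Z). f_equal. rewrite Z2Nat.id by lia. ring.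
      replace j with (j + 0 * n)%Z by lia. now apply nzvec_add. }
  exists (eis_coef N (Z.to_nat i0) j).
  apply (expn_ext n (eis_coef N (Z.to_nat i0) j) _ (eis n (Z.of_nat (Z.to_nat i0)) j)); auto.
  - intros tau Ht. rewrite Z2Nat.id by lia. replace i with (i0 + t * n)%Z by lia. now rewrite Hper.
  - apply eis_expn. unfold n in *; lia. rewrite Z2Nat.id by lia. exact Hv0.
Qed.

Lemma expn_ex_csum : forall h (F : nat -> C -> C) m, (forall i, (i < m)%nat -> exists a, expn h a (F i)) ->
  exists a, expn h a (fun t => csum (fun i => F i t) m).
Proof.
  induction m; intros H; simpl. eexists; apply expn_zero.
  destruct (H m) as [b Hb]; auto. destruct IHm as [a Ha]; auto.
  eexists. apply (expn_plus h a b _ _ Ha Hb).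
Qed.

Lemma eis_power_form_expn : forall N chi k lm a b c d, (1 < N)%nat -> dirichlet_character (Z.of_nat N) chi ->
  (a * d - b * c = 1)%Z -> exists e, expn (Z.of_nat N) e (eis_power_form N chi k lm a b c d).
Proof.
  intros N chi k lm a b c d HN Hchi Hdet.
  assert (forall x u v, (x <> RtoC 0 -> nzvec (Z.of_nat N) u v) ->
     exists e, expn (Z.of_nat N) e (fun t => x * eis (Z.of_nat N) (u * a + v * c) (u * b + v * d) t ^ k)%C) as Hx.
  { intros x u v H. destruct (classic (x = RtoC 0)) as [->|h].
    - exists (fun _ => RtoC 0). apply (expn_ext _ (fun _ => RtoC 0) _ (fun _ => RtoC 0)); auto. intros; ring. apply expn_zero.
    - destruct (eis_expn_ex N (u * a + v * c) (u * b + v * d)) as [e He]. lia. now apply nzvec_SL2; auto.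
      eexists. apply expn_scal. apply expn_pow. lia. exact He. }
  assert (exists e, expn (Z.of_nat N) e (eis_plane_sum N chi k a b c d)) as [e1 H1].
  { unfold eis_plane_sum. apply expn_ex_csum. intros v _. apply (expn_ex_csum _ (fun u t => _)). intros u _. apply Hx.
    intros h [_ h2]. revert h2. apply (chi_nzvec _ chi); auto; lia. }
  assert (exists e, expn (Z.of_nat N) e (eis_axis_sum N chi k a b)) as [e2 H2].
  { unfold eis_axis_sum. apply expn_ex_csum. intros u _. 
    destruct (Hx (chi (Z.of_nat u)) (Z.of_nat u) 0%Z) as [e He].
    intros h [h2 _]. revert h2. apply (chi_nzvec _ chi); auto; lia.
    exists e. replace (Z.of_nat u * a)%Z with (Z.of_nat u * a + 0 * c)%Z by ring.
    replace (Z.of_nat u * b)%Z with (Z.of_nat u * b + 0 * d)%Z by ring. exact He. }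
  eexists. unfold eis_power_form. apply (expn_plus _ _ _ _ _ H1 (expn_scal _ lm _ _ H2)).
Qed.

Lemma csum_sparse : forall s (b : nat -> C) m, (0 < s)%nat ->
  csum (fun m => if Nat.eqb (m mod s) 0 then b (m / s)%nat else RtoC 0) m = csum b ((m + s - 1) / s).
Proof.
  intros s b m Hs. induction m.
  - rewrite Nat.div_small by lia. reflexivity.
  - assert ((S m + s - 1) / s = m / s + 1)%nat as E0.
    { replace (S m + s - 1)%nat with (m + 1 * s)%nat by lia. apply Nat.div_add. lia. }
    rewrite E0. cbn [csum]. rewrite IHm.
    pose proof (Nat.div_mod m s ltac:(lia)) as E. pose proof (Nat.mod_upper_bound m s ltac:(lia)) as Hb.
    set (t := (m / s)%nat) in *. set (r := (m mod s)%nat) in *.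
    destruct (Nat.eqb r 0) eqn:Er.
    + apply Nat.eqb_eq in Er. replace ((m + s - 1) / s)%nat with t.
      rewrite Nat.add_1_r. reflexivity.
      apply Nat.div_unique with (s - 1)%nat; lia.
    + apply Nat.eqb_neq in Er. replace ((m + s - 1) / s)%nat with (t + 1)%nat. ring.
      apply Nat.div_unique with (r - 1)%nat; lia.
Qed.

(** Substituting [x^s] for [x] in a power series. *)
Lemma cser_sparse : forall s (b : nat -> C) l, (0 < s)%nat ->
  cser b l <-> cser (fun m => if Nat.eqb (m mod s) 0 then b (m / s)%nat else RtoC 0) l.
Proof.
  intros s b l Hs. split; intros H e He; destruct (H e He) as [K HK].
  - exists (s * K)%nat. intros n Hn. rewrite csum_sparse by auto. apply HK.
    apply Nat.div_le_lower_bound; lia.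
  - exists K. intros n Hn. specialize (HK (s * n)%nat ltac:(nia)). rewrite csum_sparse in HK by auto.
    replace ((s * n + s - 1) / s)%nat with n in HK; auto. apply Nat.div_unique with (s - 1)%nat; lia.
Qed.

(** The argument [N tau] turns invariance under lower left entries divisible
    by [N] into invariance of [eis_power_form] under upper right entries
    divisible by [N]. *)
Definition eis_form (N : nat) (chi : Z -> C) (k : nat) (lm kap : C) (tau : C) : C :=
  (kap * eis_power_form N chi k lm 1 0 0 1 (ZtoC (Z.of_nat N) * tau))%C.

Lemma Cpow_Z_nat : forall z k, Cpow_Z z (Z.of_nat k) = (z ^ k)%C.
Proof.
  intros z [|k]. reflexivity. simpl Z.of_nat. unfold Cpow_Z. rewrite SuccNat2Pos.id_succ. reflexivity.
Qed.

Lemma Cpow_Z_neg : forall z k, Cpow_Z z (- Z.of_nat k) = (/ (z ^ k))%C.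
Proof.
  intros z [|k]. simpl. field. simpl Z.of_nat. unfold Cpow_Z. simpl Z.opp. cbv iota.
  rewrite SuccNat2Pos.id_succ. reflexivity.
Qed.

Lemma in_H_scale : forall tau A B D, (0 < A)%Z -> (0 < D)%Z -> in_H tau -> in_H ((ZtoC A * tau + ZtoC B) / ZtoC D)%C.
Proof.
  intros [x y] A B D HA HD H. unfold in_H in *. apply IZR_lt in HA. apply IZR_lt in HD.
  unfold Cdiv, ZtoC. rewrite <- RtoC_inv by lra. simpl in *.
  assert (0 < / IZR D) by now apply Rinv_0_lt_compat.
  replace ((IZR A * x - 0 * y + IZR B) * 0 + (IZR A * y + 0 * x + 0) * / IZR D) with (IZR A * y * / IZR D) by ring.
  repeat apply Rmult_lt_0_compat; auto.
Qed.

(** Conjugation by diag(N, 1) moves the condition from the lower left entry to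
    the upper right one. *)
Lemma eis_form_transform : forall N chi k lm kap a b c d tau, (1 < N)%nat -> real_character (Z.of_nat N) chi ->
  (a * d - b * c = 1)%Z -> (Z.of_nat N | c)%Z -> in_H tau ->
  eis_form N chi k lm kap (moebius a b c d tau) = (chi d * automorphy c d tau ^ k * eis_form N chi k lm kap tau)%C.
Proof.
  intros N chi k lm kap a b c d tau HN Hr Hdet [c' Hc] Ht. unfold eis_form.
  set (n := Z.of_nat N) in *. assert (0 < n)%Z as Hn by (unfold n; lia).
  pose proof (ZtoC_neq0 n ltac:(lia)) as HnC.
  assert (a * d - b * n * c' = 1)%Z as Hdet' by (rewrite <- Hdet, Hc; ring).
  assert (in_H (ZtoC n * tau)%C) as Hnt.
  { replace (ZtoC n * tau)%C with ((ZtoC n * tau + ZtoC 0) / ZtoC 1)%C by (rewrite ZtoC_0, ZtoC_1; field).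
    apply in_H_scale; auto; lia. }
  assert (automorphy c' d (ZtoC n * tau) = automorphy c d tau) as Ea.
  { unfold automorphy. rewrite Hc, ZtoC_mul. ring. }
  pose proof (automorphy_neq0 _ _ _ _ _ Hdet Ht) as Hne.
  replace (ZtoC n * moebius a b c d tau)%C with (moebius a (b * n) c' d (ZtoC n * tau)).
  2:{ unfold moebius. rewrite Ea, ZtoC_mul. field. auto. }
  rewrite (eis_power_form_moebius N chi k lm a (b * n) c' d) by (auto; apply Hr).
  rewrite (eis_power_form_invariant N chi k lm a (b * n) c' d) by (auto; now exists b).
  rewrite Ea. ring.
Qed.

(** Row reduction of [diag(n, 1) * (a b; c d)]: it is an element of SL_2(Z)
    times an upper triangular integral matrix of determinant [n]. The entry
    [A] is the gcd of the first column. *)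
Lemma hecke_decomposition : forall n a b c d, (0 < n)%Z -> (a * d - b * c = 1)%Z ->
  exists p q r x A B D, (p * x - q * r = 1)%Z /\ (0 < A)%Z /\ (A * D = n)%Z /\
   (p * A = n * a)%Z /\ (p * B + q * D = n * b)%Z /\ (r * A = c)%Z /\ (r * B + x * D = d)%Z.
Proof.
  intros n a b c d Hn Hdet.
  set (A := Z.gcd (n * a) c).
  assert (0 < A)%Z as HA.
  { assert (0 <= A)%Z by apply Z.gcd_nonneg. assert (A <> 0)%Z; [|lia].
    intros E. apply Z.gcd_eq_0 in E. destruct E as [E1 E2]. subst c. 
    assert (a = 0)%Z by nia. subst. lia. }
  destruct (Z.gcd_divide_l (n * a) c) as [p Hp]. destruct (Z.gcd_divide_r (n * a) c) as [r Hr]. fold A in Hp, Hr.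
  destruct (Zis_gcd_bezout (n * a) c A) as [x y Hxy]. apply Zgcd_is_gcd.
  assert (p * x + r * y = 1)%Z as H1. { apply (Z.mul_reg_r _ _ A); [lia|]. transitivity (x * (p * A) + y * (r * A))%Z. ring. rewrite <- Hp, <- Hr, Hxy. ring. }
  exists p, (- y)%Z, r, x, A, (x * n * b + y * d)%Z, (p * d - r * n * b)%Z.
  repeat split; auto; try lia.
  - transitivity (p * A * d - r * A * n * b)%Z. ring. rewrite <- Hp, <- Hr. transitivity (n * (a * d - b * c))%Z. ring. rewrite Hdet. ring.
  - transitivity ((p * x + r * y) * n * b)%Z. ring. rewrite H1. ring.
  - transitivity ((p * x + r * y) * d)%Z. ring. rewrite H1. ring.
Qed.

Lemma unit_sum_mod : forall N m, (0 < N)%nat ->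
  csum (fun i => e2pi (RtoC (INR i) / RtoC (INR N)) ^ m)%C N = if Nat.eqb (m mod N) 0 then RtoC (INR N) else RtoC 0.
Proof.
  intros N m HN. assert (INR N <> 0) as H0 by (apply not_0_INR; lia).
  assert (RtoC (INR N) <> RtoC 0) as H0C by (intros E; apply RtoC_inj in E; auto).
  pose proof (Nat.div_mod m N ltac:(lia)) as E. pose proof (Nat.mod_upper_bound m N ltac:(lia)) as Hb.
  set (r := (m mod N)%nat) in *. set (t := (m / N)%nat) in *.
  assert (forall i, e2pi (RtoC (INR i) / RtoC (INR N)) ^ m = e2pi (RtoC (INR r) / RtoC (INR N)) ^ i)%C as Ei.
  { intros i. rewrite <- !e2pi_pow. rewrite E, plus_INR, mult_INR, RtoC_plus, RtoC_mult.
    replace ((RtoC (INR N) * RtoC (INR t) + RtoC (INR r)) * (RtoC (INR i) / RtoC (INR N)))%C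
      with (RtoC (INR i) * (RtoC (INR r) / RtoC (INR N)) + ZtoC (Z.of_nat (t * i)))%C.
    apply e2pi_addZ. rewrite ZtoC_nat, mult_INR, RtoC_mult. field. auto. }
  rewrite (csum_ext _ (fun i => e2pi (RtoC (INR r) / RtoC (INR N)) ^ i)%C) by auto.
  destruct (Nat.eqb r 0) eqn:Er.
  - apply Nat.eqb_eq in Er. rewrite Er. rewrite (csum_ext _ (fun _ => RtoC 1)).
    rewrite csum_const. ring. intros i _. replace (RtoC (INR 0) / RtoC (INR N))%C with (RtoC 0) by (simpl; field; auto).
    rewrite e2pi_0. apply Cpow_1_l.
  - apply Nat.eqb_neq in Er. apply unit_sum. lia.
Qed.

(** At a cusp the form is [eis_power_form] at [(A tau + B)/D], a series in
    [e(tau / N^2)]. Invariance under [tau -> tau + N] leaves only the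
    exponents divisible by [N]. *)
Lemma eis_form_cusp : forall N chi k lm kap a b c d, (1 < N)%nat -> real_character (Z.of_nat N) chi ->
  (a * d - b * c = 1)%Z ->
  exists bn, laurent_expansion (Z.of_nat N) (slash (Z.of_nat k) a b c d (eis_form N chi k lm kap)) bn.
Proof.
  intros N chi k lm kap a b c d HN Hr Hdet. set (n := Z.of_nat N) in *.
  assert (0 < n)%Z as Hn by (unfold n; lia).
  pose proof (ZtoC_neq0 n ltac:(lia)) as HnC.
  set (F := slash (Z.of_nat k) a b c d (eis_form N chi k lm kap)).
  destruct (hecke_decomposition n a b c d Hn Hdet) as [p [q [r [x [A [B [D [H1 [HA [HAD [E1 [E2 [E3 E4]]]]]]]]]]]]].
  assert (0 < D)%Z as HD by nia.
  pose proof (ZtoC_neq0 A ltac:(lia)) as HAC. pose proof (ZtoC_neq0 D ltac:(lia)) as HDC.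
  destruct (eis_power_form_expn N chi k lm p q r x HN (proj1 Hr) H1) as [e [_ He]]. fold n in He.
  set (C0 := (kap / ZtoC D ^ k)%C).
  assert (forall tau, in_H tau -> F tau = C0 * eis_power_form N chi k lm p q r x ((ZtoC A * tau + ZtoC B) / ZtoC D))%C as EF.
  { intros tau Ht. unfold F, slash, eis_form. fold n. rewrite Cpow_Z_neg.
    pose proof (automorphy_neq0 _ _ _ _ _ Hdet Ht) as Hne.
    set (z := ((ZtoC A * tau + ZtoC B) / ZtoC D)%C).
    assert (in_H z) as Hz by (apply in_H_scale; auto).
    assert (automorphy r x z = automorphy c d tau / ZtoC D)%C as Ea.
    { unfold automorphy, z. rewrite <- E3, <- E4, !ZtoC_add, !ZtoC_mul. field. auto. }
    replace (ZtoC n * moebius a b c d tau)%C with (moebius p q r x z).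
    2:{ unfold moebius. rewrite Ea. 
        assert (ZtoC n * (ZtoC a * tau + ZtoC b) = (ZtoC p * z + ZtoC q) * ZtoC D)%C as E5.
        { transitivity (ZtoC (n * a) * tau + ZtoC (n * b))%C. rewrite !ZtoC_mul; ring.
          rewrite <- E1, <- E2, !ZtoC_add, !ZtoC_mul. unfold z. field. auto. }
        transitivity (((ZtoC p * z + ZtoC q) * ZtoC D) / automorphy c d tau)%C. field; auto.
        rewrite <- E5. field; auto. }
    rewrite (eis_power_form_moebius N chi k lm p q r x) by (auto; apply Hr). rewrite Ea. unfold C0.
    replace (automorphy c d tau / ZtoC D)%C with (automorphy c d tau * / ZtoC D)%C by reflexivity.
    rewrite Cpow_mult_l, Cpow_inv by auto.
    pose proof (Cpow_nz _ k Hne). pose proof (Cpow_nz _ k HDC). field. auto. }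
  (* The conjugate of the translation by [N] lies in Gamma(N), where the
     character is trivial. *)
  assert (forall tau, in_H tau -> F (tau + ZtoC n)%C = F tau) as Hper.
  { intros tau Ht. unfold F, slash. rewrite !Cpow_Z_neg.
    pose proof (in_H_addZ tau n Ht) as Ht'.
    pose proof (automorphy_neq0 _ _ _ _ _ Hdet Ht) as Hne.
    pose proof (automorphy_neq0 _ _ _ _ _ Hdet Ht') as Hne'.
    assert ((1 - n * a * c) * (1 + n * a * c) - (n * a * a) * (- n * c * c) = 1)%Z as Hg by ring.
    assert (automorphy (- n * c * c) (1 + n * a * c) (moebius a b c d tau) = automorphy c d (tau + ZtoC n) / automorphy c d tau)%C as Ea.
    { assert (ZtoC a * ZtoC d - ZtoC b * ZtoC c = 1)%C as EdC by (rewrite <- !ZtoC_mul, <- ZtoC_sub, Hdet; apply ZtoC_1).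
      unfold automorphy at 1. unfold moebius. rewrite ZtoC_add, !ZtoC_mul, ZtoC_opp, ZtoC_1.
      transitivity ((automorphy c d tau + ZtoC n * ZtoC c * (ZtoC a * automorphy c d tau - ZtoC c * (ZtoC a * tau + ZtoC b))) / automorphy c d tau)%C.
      field; auto. f_equal. unfold automorphy.
      transitivity (ZtoC c * tau + ZtoC d + ZtoC n * ZtoC c * (ZtoC a * ZtoC d - ZtoC b * ZtoC c))%C. ring.
      rewrite EdC. ring. }
    assert (moebius a b c d (tau + ZtoC n) = moebius (1 - n * a * c) (n * a * a) (- n * c * c) (1 + n * a * c) (moebius a b c d tau)) as Em.
    { assert (ZtoC a * ZtoC d - ZtoC b * ZtoC c = 1)%C as EdC by (rewrite <- !ZtoC_mul, <- ZtoC_sub, Hdet; apply ZtoC_1).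
      unfold moebius at 2. rewrite Ea. unfold moebius.
      transitivity ((ZtoC a * (tau + ZtoC n) + ZtoC b) / automorphy c d (tau + ZtoC n))%C. reflexivity.
      assert (ZtoC (1 - n * a * c) * ((ZtoC a * tau + ZtoC b) / automorphy c d tau) + ZtoC (n * a * a) =
        (ZtoC a * (tau + ZtoC n) + ZtoC b) / automorphy c d tau)%C as E5.
      { rewrite ZtoC_sub, !ZtoC_mul, ZtoC_1.
        transitivity ((ZtoC a * tau + ZtoC b + ZtoC n * ZtoC a * (ZtoC a * automorphy c d tau - ZtoC c * (ZtoC a * tau + ZtoC b))) / automorphy c d tau)%C.
        field; auto. f_equal. unfold automorphy.
        transitivity (ZtoC a * tau + ZtoC b + ZtoC n * ZtoC a * (ZtoC a * ZtoC d - ZtoC b * ZtoC c))%C. ring.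
        rewrite EdC. ring. }
      rewrite E5. field. auto. }
    rewrite Em, (eis_form_transform N chi k lm kap _ _ _ _ _ HN Hr Hg).
    2:{ exists (- c * c)%Z. fold n. ring. }
    2:{ now apply moebius_in_H. }
    rewrite Ea. replace (1 + n * a * c)%Z with (1 + (a * c) * n)%Z by ring.
    rewrite (chi_period_mul n) by apply Hr. rewrite (chi_1 n) by (try lia; apply Hr).
    replace (automorphy c d (tau + ZtoC n) / automorphy c d tau)%C with (automorphy c d (tau + ZtoC n) * / automorphy c d tau)%C by reflexivity.
    rewrite Cpow_mult_l, Cpow_inv by auto.
    pose proof (Cpow_nz _ k Hne). pose proof (Cpow_nz _ k Hne'). field. auto. }
  set (w := e2pi (ZtoC B / (ZtoC D * ZtoC n))%C).
  set (sA := Z.to_nat (A * A)). assert (0 < sA)%nat as HsA by (unfold sA; nia).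
  set (cc := fun m : nat => if Nat.eqb (m mod sA) 0 then (C0 * e (m / sA)%nat * w ^ (m / sA))%C else RtoC 0).
  set (Q := fun tau => e2pi (tau / (ZtoC n * ZtoC n))%C).
  assert (forall tau, in_H tau -> cser (fun m => cc m * Q tau ^ m)%C (F tau)) as HF1.
  { intros tau Ht. rewrite EF by auto.
    pose proof (He _ (in_H_scale tau A B D HA HD Ht)) as S.
    apply (cser_scal C0) in S. apply (cser_sparse sA) in S; auto.
    eapply cser_ext; [|exact S]. intros m. cbv beta. unfold cc.
    destruct (Nat.eqb (m mod sA) 0) eqn:E; [|ring]. apply Nat.eqb_eq in E.
    assert (e2pi ((ZtoC A * tau + ZtoC B) / ZtoC D / ZtoC n) = w * Q tau ^ sA)%C as E5.
    { unfold w, Q. rewrite <- e2pi_pow, <- e2pi_add. f_equal.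
      assert (RtoC (INR sA) = ZtoC A * ZtoC A)%C as ->.
      { unfold sA. rewrite <- ZtoC_nat, Z2Nat.id, ZtoC_mul by nia. reflexivity. }
      assert (ZtoC n = ZtoC A * ZtoC D)%C as -> by (rewrite <- ZtoC_mul, HAD; reflexivity). field. auto. }
    rewrite E5, Cpow_mult_l, <- Cpow_mult_r.
    replace (sA * (m / sA))%nat with m. ring.
    pose proof (Nat.div_mod m sA ltac:(lia)). lia. }
  assert (forall i tau, in_H tau -> in_H (tau + ZtoC (Z.of_nat i * n))%C /\ F (tau + ZtoC (Z.of_nat i * n))%C = F tau) as Hperi.
  { induction i; intros tau Ht.
    - simpl Z.of_nat. rewrite Z.mul_0_l, ZtoC_0. replace (tau + 0)%C with tau by ring. auto.
    - destruct (IHi tau Ht) as [I1 I2].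
      replace (tau + ZtoC (Z.of_nat (S i) * n))%C with ((tau + ZtoC (Z.of_nat i * n)) + ZtoC n)%C.
      2:{ rewrite Nat2Z.inj_succ. replace (Z.succ (Z.of_nat i) * n)%Z with (Z.of_nat i * n + n)%Z by ring. rewrite ZtoC_add. ring. }
      split. now apply in_H_addZ. rewrite Hper; auto. }
  assert (INR N <> 0) as HN0 by (apply not_0_INR; lia).
  assert (RtoC (INR N) <> RtoC 0) as HNC by (intros E; apply RtoC_inj in E; auto).
  assert (ZtoC n = RtoC (INR N)) as EnN by (unfold n; apply ZtoC_nat).
  exists (zero_extension (fun j => cc (N * j)%nat)). exists 0%Z. split.
  { intros m Hm. unfold zero_extension. apply Z.ltb_lt in Hm. now rewrite Hm. }
  intros tau Ht. apply is_series_cser.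
  assert (cser (fun m => if Nat.eqb (m mod N) 0 then (fun j => cc (N * j)%nat * Q tau ^ (N * j))%C (m / N)%nat else RtoC 0) (F tau)) as S.
  (* Averaging over the translates by multiples of [N] projects to the
     exponents divisible by [N]. *)
  { replace (F tau) with (/ RtoC (INR N) * csum (fun i => F (tau + ZtoC (Z.of_nat i * n))%C) N)%C.
    2:{ rewrite (csum_ext _ (fun _ => F tau)). rewrite csum_const. field. auto. intros i _. now apply Hperi. }
    eapply cser_ext; [|apply cser_scal; apply (cser_csum (fun i m => cc m * Q (tau + ZtoC (Z.of_nat i * n))%C ^ m)%C)].
    2:{ intros i _. apply HF1. now apply Hperi. }
    intros m. cbv beta.
    rewrite (csum_ext _ (fun i => (cc m * Q tau ^ m) * e2pi (RtoC (INR i) / RtoC (INR N)) ^ m)%C).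
    2:{ intros i _. unfold Q. replace ((tau + ZtoC (Z.of_nat i * n)) / (ZtoC n * ZtoC n))%C with
          (tau / (ZtoC n * ZtoC n) + RtoC (INR i) / RtoC (INR N))%C.
        rewrite e2pi_add, Cpow_mult_l. ring. rewrite ZtoC_mul, ZtoC_nat, EnN. field. auto. }
    rewrite csum_scal, unit_sum_mod by lia.
    destruct (Nat.eqb (m mod N) 0) eqn:E.
    - apply Nat.eqb_eq in E. replace (N * (m / N))%nat with m. field; auto.
      pose proof (Nat.div_mod m N ltac:(lia)). lia.
    - ring. }
  apply (cser_sparse N (fun j => cc (N * j)%nat * Q tau ^ (N * j))%C) in S; [|lia].
  eapply cser_ext; [|exact S]. intros j. cbv zeta. unfold zero_extension.
  replace (0 + Z.of_nat j <? 0)%Z with false by (symmetry; apply Z.ltb_ge; lia).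
  replace (Z.to_nat (0 + Z.of_nat j)) with j by lia. f_equal.
  unfold Q. rewrite <- e2pi_pow. f_equal. replace (0 + Z.of_nat j)%Z with (Z.of_nat j) by lia.
  rewrite ZtoC_nat, EnN, mult_INR, RtoC_mult. field. auto.
Qed.

Lemma eis_form_expn : forall N chi k lm kap e, (1 < N)%nat ->
  expn (Z.of_nat N) e (eis_power_form N chi k lm 1 0 0 1) -> expn 1 (fun n => kap * e n)%C (eis_form N chi k lm kap).
Proof.
  intros N chi k lm kap e HN [Hb He].
  assert (expn 1 e (fun tau => eis_power_form N chi k lm 1 0 0 1 (ZtoC (Z.of_nat N) * tau)%C)) as H.
  { split; auto. intros tau Ht.
    assert (in_H (ZtoC (Z.of_nat N) * tau)%C) as Hnt.
    { replace (ZtoC (Z.of_nat N) * tau)%C with ((ZtoC (Z.of_nat N) * tau + ZtoC 0) / ZtoC 1)%C by (rewrite ZtoC_0, ZtoC_1; field).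
      apply in_H_scale; auto; lia. }
    eapply cser_ext; [|apply (He _ Hnt)]. intros n. cbv beta. do 2 f_equal.
    pose proof (ZtoC_neq0 (Z.of_nat N) ltac:(lia)). f_equal. rewrite ZtoC_1. field. auto. }
  apply (expn_scal 1 kap) in H. exact H.
Qed.

Lemma eis_form_weakly_holomorphic : forall N chi k lm kap, (1 < N)%nat -> real_character (Z.of_nat N) chi ->
  weakly_holomorphic_form (Z.of_nat N) (Z.of_nat k) chi (eis_form N chi k lm kap).
Proof.
  intros N chi k lm kap HN Hr. repeat split.
  - destruct (eis_power_form_expn N chi k lm 1 0 0 1 HN (proj1 Hr) ltac:(lia)) as [e He].
    apply (expn_holomorphic (fun n => kap * e n)%C). now apply eis_form_expn.
  - intros a b c d Hdet. now apply eis_form_cusp.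
  - intros a b c d Hdet Hc tau Ht. rewrite Cpow_Z_nat. now apply eis_form_transform.
Qed.

(** * A form that vanishes to high order at infinity is zero *)

Definition nome (t : R) : R := exp (- (2 * PI * t)).

Lemma nome_pos : forall t, 0 < nome t. Proof. intros; apply exp_pos. Qed.

Lemma nome_add : forall s t, nome (s + t) = nome s * nome t.
Proof. intros. unfold nome. rewrite <- exp_plus. f_equal. ring. Qed.

Lemma nome_bound : forall t, 0 < t -> 0 < nome t < 1.
Proof. intros. now apply nome_lt1. Qed.

Lemma nome_decr : forall s t, s <= t -> nome t <= nome s.
Proof.
  intros s t [H|H]. left. unfold nome. apply exp_increasing. pose proof PI_RGT_0. nra. rewrite H. lra.
Qed.

Definition qseries (b : nat -> C) (f : C -> C) : Prop :=
  forall tau, in_H tau -> cser (fun n => b n * e2pi tau ^ n)%C (f tau).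

(** A bound for the absolute series at height [t]. All estimates are in terms
    of such bounds, which depend on the coefficients only, so that they can be
    used at other cusps. *)
Definition majorant (b : nat -> C) (t B : R) : Prop :=
  forall n, rsum (fun n => Cmod (b n) * nome t ^ n) n <= B.

Lemma cser_terms_bounded : forall a l, cser a l -> exists M, forall n, Cmod (a n) <= M.
Proof.
  intros a l H. destruct (H 1 ltac:(lra)) as [K HK].
  exists (2 + rsum (fun n => Cmod (a n)) K). intros n.
  destruct (Nat.lt_ge_cases n K).
  - pose proof (rsum_term (fun n => Cmod (a n)) K n ltac:(intros; apply Cmod_ge_0) H0). simpl in *. lra.
  - pose proof (HK n H0). pose proof (HK (S n) ltac:(lia)). 
    assert (0 <= rsum (fun n => Cmod (a n)) K) by (apply rsum_ge0; intros; apply Cmod_ge_0).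
    replace (a n) with ((csum a (S n) - l) + - (csum a n - l))%C by (simpl; ring).
    eapply Rle_trans. apply Cmod_triangle. rewrite Cmod_opp. lra.
Qed.

Lemma in_H_i : forall x t, 0 < t -> in_H (x, t). Proof. intros; exact H. Qed.

Lemma qseries_summable : forall b f t, qseries b f -> 0 < t -> summable (fun n => Cmod (b n) * nome t ^ n).
Proof.
  intros b f t Hq Ht.
  assert (in_H (0, t/2)) as Hh by (apply in_H_i; lra).
  destruct (cser_terms_bounded _ _ (Hq _ Hh)) as [M HM].
  assert (Cmod (e2pi (0, t/2)) = nome (t/2)) as E by (rewrite Cmod_e2pi; reflexivity).
  assert (nome t = nome (t/2) * nome (t/2)) as E2 by (rewrite <- nome_add; f_equal; field).
  pose proof (nome_bound (t/2) ltac:(lra)).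
  assert (0 <= M). { eapply Rle_trans. apply Cmod_ge_0. apply (HM 0%nat). }
  apply summable_le with (fun n => M * nome (t/2) ^ n).
  - intros n. specialize (HM n). rewrite Cmod_mult, Cmod_pow, E in HM.
    assert (0 <= nome (t/2) ^ n) by (apply pow_le; lra). pose proof (Cmod_ge_0 (b n)).
    rewrite E2, Rpow_mult_distr. split. repeat apply Rmult_le_pos; auto.
    rewrite <- Rmult_assoc. apply Rmult_le_compat_r; auto.
  - apply summable_scal; auto. apply summable_geom. lra.
Qed.

Lemma majorant_exists : forall b f t, qseries b f -> 0 < t -> exists B, majorant b t B.
Proof. intros b f t Hq Ht. destruct (qseries_summable b f t Hq Ht) as [_ [B HB]]. exists B. exact HB. Qed.

Lemma majorant_nonneg : forall b t B, majorant b t B -> 0 <= B.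
Proof. intros b t B H. specialize (H 0%nat). exact H. Qed.

Lemma majorant_incr : forall b s t B, s <= t -> majorant b s B -> majorant b t B.
Proof.
  intros b s t B Hst H n. eapply Rle_trans; [|apply (H n)]. apply rsum_le. intros i _.
  apply Rmult_le_compat_l. apply Cmod_ge_0. apply pow_incr. split. left; apply nome_pos. now apply nome_decr.
Qed.

Lemma majorant_bound : forall b f tau B, qseries b f -> in_H tau -> majorant b (Im tau) B -> Cmod (f tau) <= B.
Proof.
  intros b f tau B Hq Ht HB. apply (cser_le _ (fun n => Cmod (b n) * nome (Im tau) ^ n) _ _ (Hq tau Ht)); auto.
  intros n. rewrite Cmod_mult, Cmod_pow, Cmod_e2pi. unfold nome. lra.
Qed.

(** Averaging [f] against a character over the points [j/K + i t] isolates the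
    [m]-th term of the series, up to terms of index at least [K]. *)
Lemma cauchy_estimate : forall b f t A, qseries b f -> 0 < t ->
  (forall x, Cmod (f (x, t)) <= A) -> forall m, Cmod (b m) * nome t ^ m <= A.
Proof.
  intros b f t A Hq Ht HA m. apply Rnot_lt_le. intros Hlt.
  pose proof (qseries_summable b f t Hq Ht) as Hs.
  set (e := Cmod (b m) * nome t ^ m - A). assert (0 < e) by (unfold e; lra).
  destruct (summable_tail _ Hs (e/2) ltac:(lra)) as [K0 HK0].
  set (K := (S (K0 + m))%nat). assert (m < K)%nat by (unfold K; lia).
  assert (INR K <> 0) as HK by (apply not_0_INR; unfold K; lia).
  assert (RtoC (INR K) <> RtoC 0) as HKC by (intros E; apply RtoC_inj in E; auto).
  set (tt := fun j : nat => (INR j / INR K, t) : C).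
  assert (forall j, tt j = RtoC (INR j) / RtoC (INR K) + (0, t))%C as Ett.
  { intros j. unfold tt. rewrite <- RtoC_div by auto. unfold RtoC, Cplus. simpl. f_equal; ring. }
  (* The weight is the [-m]-th power, written with a natural exponent. *)
  set (wt := fun j => (e2pi (RtoC (INR j) / RtoC (INR K)) ^ (K - m))%C).
  assert (forall y : R, Cmod (e2pi (RtoC y)) = 1) as Hun.
  { intros y. rewrite Cmod_e2pi. simpl. rewrite Rmult_0_r, Ropp_0. apply exp_0. }
  set (avg := (/ RtoC (INR K) * csum (fun j => wt j * f (tt j)) K)%C).
  assert (Cmod avg <= A) as Havg.
  { unfold avg. rewrite Cmod_mult, Cmod_inv, Cmod_R, Rabs_pos_eq by (auto; apply pos_INR).
    assert (0 < INR K) by (apply lt_0_INR; unfold K; lia).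
    apply Rmult_le_reg_l with (INR K); auto. rewrite <- Rmult_assoc, Rinv_r, Rmult_1_l by auto.
    rewrite <- rsum_const. apply Cmod_csum_le. intros j _. unfold wt.
    rewrite Cmod_mult, Cmod_pow, <- RtoC_div, Hun, pow1, Rmult_1_l by auto. apply HA. }
  set (a := fun n => if Nat.eqb ((n + (K - m)) mod K) 0 then (b n * e2pi (0, t) ^ n)%C else RtoC 0).
  assert (cser a avg) as Hcs.
  { unfold avg. eapply cser_ext; [|apply cser_scal; apply (cser_csum (fun j n => wt j * (b n * e2pi (tt j) ^ n))%C)].
    2:{ intros j _. apply cser_scal. apply Hq. now apply in_H_i. }
    intros n. cbv beta.
    rewrite (csum_ext _ (fun j => (b n * e2pi (0, t) ^ n) * e2pi (RtoC (INR j) / RtoC (INR K)) ^ (n + (K - m)))%C).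
    2:{ intros j _. rewrite Ett, e2pi_add, Cpow_mult_l, Cpow_add_r. unfold wt. ring. }
    rewrite csum_scal, unit_sum_mod by (unfold K; lia). unfold a.
    destruct (Nat.eqb ((n + (K - m)) mod K) 0). field; auto. ring. }
  assert (forall n, (n < K)%nat -> n <> m -> (n + (K - m)) mod K <> 0)%nat as Hmod.
  { intros n Hn Hne. destruct (Nat.lt_ge_cases n m).
    - rewrite Nat.mod_small; lia.
    - replace (n + (K - m))%nat with ((n - m) + 1 * K)%nat by lia. rewrite Nat.Div0.mod_add, Nat.mod_small; lia. }
  assert (csum a K = b m * e2pi (0, t) ^ m)%C as Ecs.
  { rewrite (csum_single _ K m); auto.
    - unfold a. replace ((m + (K - m)) mod K)%nat with 0%nat. reflexivity.
      replace (m + (K - m))%nat with K by lia. now rewrite Nat.Div0.mod_same.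
    - intros j Hj Hne. unfold a. replace (Nat.eqb ((j + (K - m)) mod K) 0) with false; auto.
      symmetry. apply Nat.eqb_neq. auto. }
  assert (Cmod (avg - csum a K) <= e / 2) as Htail.
  { apply (cser_tail_le a (fun n => Cmod (b n) * nome t ^ n)); auto.
    - intros n. unfold a. destruct (Nat.eqb _ 0).
      + rewrite Cmod_mult, Cmod_pow, Cmod_e2pi. unfold nome. simpl. lra.
      + rewrite Cmod_0. apply Hs.
    - intros n Hn. left. apply HK0. unfold K in *. lia. }
  rewrite Ecs in Htail.
  assert (Cmod (b m * e2pi (0, t) ^ m)%C = Cmod (b m) * nome t ^ m) as Em.
  { rewrite Cmod_mult, Cmod_pow, Cmod_e2pi. reflexivity. }
  assert (Cmod (b m * e2pi (0, t) ^ m)%C <= Cmod (avg - b m * e2pi (0, t) ^ m)%C + Cmod avg).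
  { replace (b m * e2pi (0, t) ^ m)%C with (- (avg - b m * e2pi (0, t) ^ m) + avg)%C at 1 by ring.
    eapply Rle_trans. apply Cmod_triangle. rewrite Cmod_opp. lra. }
  rewrite Em in H1. unfold e in *. lra.
Qed.

Lemma Im_inv : forall t, in_H t -> Im (- / t)%C = Im t / Cmod t ^ 2.
Proof.
  intros [x y] H. rewrite Cmod2_alt. unfold in_H in H. simpl in *. unfold Im, Re in *. simpl in *.
  field. intros E. assert (0 < y * y) by nra. assert (0 <= x * x) by nra. lra.
Qed.

(** Translate into [|Re| <= 1/2]; if the height is below 1/2, then [|tau|^2 <=
    1/2] and inversion at least doubles it. The number [n] counts the
    doublings that are still needed. *)
Lemma reduce_height : forall n tau, in_H tau -> 1/2 <= 2 ^ n * Im tau ->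
  exists a b c d z, (a * d - b * c = 1)%Z /\ in_H z /\ 1/2 <= Im z /\ tau = moebius a b c d z.
Proof.
  assert (forall tau, in_H tau -> 1/2 <= Im tau ->
    exists a b c d z, (a * d - b * c = 1)%Z /\ in_H z /\ 1/2 <= Im z /\ tau = moebius a b c d z) as H0.
  { intros tau Ht H. exists 1%Z, 0%Z, 0%Z, 1%Z, tau. repeat split; auto.
    unfold moebius, automorphy. rewrite ZtoC_0, ZtoC_1. field. }
  induction n; intros tau Ht H. apply H0; auto. simpl in H. lra.
  destruct (Rle_dec (1/2) (Im tau)) as [h|h]. now apply H0.
  destruct (nearest_int (Re tau)) as [m Hm].
  set (t1 := (tau + ZtoC (- m))%C). assert (in_H t1) as Ht1 by now apply in_H_addZ.
  assert (Im (- / t1)%C = Im tau / Cmod t1 ^ 2) as EI.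
  { rewrite Im_inv by auto. f_equal. unfold t1. simpl. unfold Im. ring. }
  assert (Cmod t1 ^ 2 <= 1/2) as Hc.
  { rewrite Cmod2_alt. replace (Re t1) with (Re tau - IZR m) by (unfold t1; rewrite ZtoC_opp; reflexivity).
    replace (Im t1) with (Im tau) by (unfold t1; simpl; unfold Im; ring).
    unfold in_H in Ht. apply Rabs_le_between in Hm. nra. }
  assert (0 < Cmod t1 ^ 2) as Hp by (apply pow_lt, Cmod_gt_0, in_H_neq0; auto).
  destruct (IHn (- / t1)%C (in_H_inv _ Ht1)) as [a [b [c [d [z [Hdet [Hz [Hz2 E]]]]]]]].
  { rewrite EI. unfold in_H in Ht. assert (2 * Im tau <= Im tau / Cmod t1 ^ 2).
    { apply Rmult_le_reg_r with (Cmod t1 ^ 2); auto. set (cc := Cmod t1 ^ 2) in *.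
      replace (Im tau / cc * cc) with (Im tau) by (field; lra). nra. }
    simpl in H. assert (0 < 2 ^ n) by (apply pow_lt; lra). nra. }
  exists (- c - (- m) * a)%Z, (- d - (- m) * b)%Z, a, b, z. repeat split; auto. lia.
  pose proof (in_H_neq0 _ Ht1) as Hn1.
  pose proof (automorphy_neq0 _ _ _ _ _ Hdet Hz) as Hne.
  assert (automorphy a b z <> RtoC 0) as Hne'.
  { apply (automorphy_neq0 (- c) (- d) a b z); auto. lia. }
  assert (t1 = - (automorphy c d z / automorphy a b z))%C as E1.
  { replace t1 with (- / (- / t1))%C by (field; auto). rewrite E. unfold moebius.
    change (ZtoC a * z + ZtoC b)%C with (automorphy a b z). field. auto. }
  replace tau with (t1 - ZtoC (- m))%C by (unfold t1; ring). rewrite E1. unfold moebius.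
  change (automorphy a b z) with (automorphy a b z).
  assert (ZtoC (- c - - m * a) * z + ZtoC (- d - - m * b) = - automorphy c d z - ZtoC (- m) * automorphy a b z)%C as E2.
  { unfold automorphy. rewrite !ZtoC_sub, !ZtoC_mul, !ZtoC_opp. ring. }
  rewrite E2. field. auto.
Qed.

Lemma equivalent_height_half : forall tau, in_H tau ->
  exists a b c d z, (a * d - b * c = 1)%Z /\ in_H z /\ 1/2 <= Im z /\ tau = moebius a b c d z.
Proof.
  intros tau Ht. pose proof Ht as Ht'. unfold in_H in Ht'.
  destruct (big_nat (/ Im tau)) as [n Hn]. apply (reduce_height n); auto.
  assert (INR n <= 2 ^ n).
  { clear. induction n. simpl; lra. rewrite S_INR. simpl. assert (1 <= 2 ^ n) by (apply pow_R1_Rle; lra). lra. }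
  assert (/ Im tau * Im tau <= 2 ^ n * Im tau) by (apply Rmult_le_compat_r; lra).
  rewrite Rinv_l in H0 by lra. lra.
Qed.

(** The size of [f] near any cusp is bounded through the coefficients at
    infinity, at the price of dividing the height by [N^2]. *)
Definition cusp_controlled (N k : nat) (C0 : R) (b : nat -> C) (f : C -> C) : Prop :=
  forall a b' c d z B, (a * d - b' * c = 1)%Z -> in_H z -> majorant b (Im z / (INR N * INR N)) B ->
  Cmod (f (moebius a b' c d z)) <= C0 * Cmod (automorphy c d z) ^ k * B.

Lemma sqrt_pow_exp_bound : forall k c, 0 < c -> exists K, 0 <= K /\ forall y, 0 <= y -> sqrt y ^ k * exp (- (c * y)) <= K.
Proof.
  intros k c Hc.
  set (h := c / INR (S k)). assert (0 < INR (S k)) by (apply lt_0_INR; lia).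
  assert (0 < h) by (apply Rdiv_lt_0_compat; auto).
  set (M := 1 + / h). assert (0 < / h) by now apply Rinv_0_lt_compat.
  exists (M ^ S k). split. apply pow_le; unfold M; lra.
  intros y Hy.
  assert (1 + y <= M * exp (h * y)).
  { pose proof (exp_ineq1_le (h * y)). apply Rle_trans with (M * (1 + h * y)).
    unfold M. replace ((1 + / h) * (1 + h * y)) with (1 + y + / h + h * y) by (field; lra). nra.
    apply Rmult_le_compat_l; unfold M; lra. }
  assert (sqrt y ^ k <= (1 + y) ^ S k).
  { apply Rle_trans with ((1 + y) ^ k). apply pow_incr. split. apply sqrt_pos.
    assert (sqrt y * sqrt y = y) by (apply sqrt_sqrt; auto). pose proof (sqrt_pos y). nra.
    simpl. assert (0 <= (1 + y) ^ k) by (apply pow_le; lra). nra. }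
  assert ((1 + y) ^ S k <= M ^ S k * exp (c * y)).
  { eapply Rle_trans. apply pow_incr. split; [lra|apply H2]. rewrite Rpow_mult_distr.
    apply Rmult_le_compat_l. apply pow_le; unfold M; lra.
    rewrite <- exp_pow. right. f_equal. unfold h. field. lra. }
  assert (exp (c * y) * exp (- (c * y)) = 1) by (rewrite <- exp_plus, Rplus_opp_r; apply exp_0).
  pose proof (exp_pos (- (c * y))).
  apply Rle_trans with (M ^ S k * exp (c * y) * exp (- (c * y))).
  apply Rmult_le_compat_r; lra. rewrite Rmult_assoc, H5. lra.
Qed.

(** An argument in the style of Hecke and Sturm. The function [|f| Im^(k/2)]
    is bounded, since every point is the image of one of height at least 1/2.
    If it is bounded by [mu], Cauchy's estimate at half the relevant height
    bounds the coefficients in terms of [mu], and the absence of the first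
    [B0] of them multiplies the resulting bound for the function by [rho^B0],
    which is small enough to give [mu / 2]. Repeating this, the function is
    zero. *)
Lemma vanishing : forall N k C0, (0 < N)%nat -> 0 <= C0 -> exists B0 : nat, (1 <= B0)%nat /\
  forall b f, qseries b f -> cusp_controlled N k C0 b f -> (forall n, (n < B0)%nat -> b n = RtoC 0) ->
  forall n, b n = RtoC 0.
Proof.
  intros N k C0 HN HC0. pose proof PI_RGT_0 as Hpi.
  set (n2 := INR N * INR N).
  assert (0 < n2) as Hn2. { assert (0 < INR N) by (apply lt_0_INR; auto). unfold n2; nra. }
  (* A point of height at least 1/2 leads to the height [1/(2 N^2)], and half
     of it is used in Cauchy's estimate. *)
  set (rho := nome (1 / (4 * n2))).
  assert (0 < 1 / (4 * n2)) by (apply Rdiv_lt_0_compat; lra).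
  pose proof (nome_bound _ H) as Hrho. fold rho in Hrho.
  set (W := C0 * sqrt (2 * n2) ^ k / (1 - rho)).
  destruct (pow_to_0 W rho ltac:(lra) (1/2) ltac:(lra)) as [m0 Hm0].
  exists (S m0). split. lia. intros b f Hq Hcc Hb0.
  specialize (Hm0 (S m0) ltac:(lia)). set (B0 := S m0) in *.
  set (Phi := fun tau => Cmod (f tau) * sqrt (Im tau) ^ k).
  assert (forall a b' c d z B, (a * d - b' * c = 1)%Z -> in_H z -> majorant b (Im z / n2) B ->
     Phi (moebius a b' c d z) <= C0 * B * sqrt (Im z) ^ k) as HPhi.
  { intros a b' c d z B Hdet Hz HB. unfold Phi. rewrite (Im_moebius a b' c d z Hdet Hz).
    pose proof (Hcc a b' c d z B Hdet Hz HB) as H1.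
    assert (0 < Cmod (automorphy c d z)) as Hp by (apply Cmod_gt_0, (automorphy_neq0 a b'); auto).
    rewrite sqrt_div by (try (apply pow_lt; auto); unfold in_H in Hz; lra).
    rewrite sqrt_pow2 by lra. set (m := Cmod (automorphy c d z)) in *.
    unfold Rdiv. rewrite Rpow_mult_distr.
    assert (0 <= sqrt (Im z) ^ k) by (apply pow_le, sqrt_pos).
    assert (m ^ k * (/ m) ^ k = 1). { rewrite <- Rpow_mult_distr, Rinv_r by lra. apply pow1. }
    assert (0 <= (/ m) ^ k). { apply pow_le. left; now apply Rinv_0_lt_compat. }
    apply Rle_trans with (C0 * m ^ k * B * (sqrt (Im z) ^ k * (/ m) ^ k)).
    apply Rmult_le_compat_r; auto. now apply Rmult_le_pos.
    right. transitivity (C0 * B * sqrt (Im z) ^ k * (m ^ k * (/ m) ^ k)). ring. rewrite H2. ring. }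
  assert (exists mu, 0 <= mu /\ forall tau, in_H tau -> Phi tau <= mu) as [mu [Hmu HPmu]].
  { destruct (majorant_exists b f (1 / (4 * n2)) Hq H) as [S0 HS0].
    pose proof (majorant_nonneg _ _ _ HS0).
    assert (0 < 2 * PI / (2 * n2)) as Hc by (apply Rdiv_lt_0_compat; lra).
    destruct (sqrt_pow_exp_bound k (2 * PI / (2 * n2)) Hc) as [K [HK HKb]].
    exists (C0 * S0 * K). split. repeat apply Rmult_le_pos; auto.
    intros tau Ht. destruct (equivalent_height_half tau Ht) as [a [b' [c [d [z [Hdet [Hz [Hz2 ->]]]]]]]].
    (* The constant coefficient vanishes, so one factor of exponential decay
       remains to beat the power of [Im z]. *)
    assert (majorant b (Im z / n2) (S0 * nome (Im z / (2 * n2)))) as HM.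
    { intros n. rewrite Rmult_comm.
      apply Rle_trans with (rsum (fun n => nome (Im z / (2 * n2)) * (Cmod (b n) * nome (1 / (4 * n2)) ^ n)) n).
      2:{ rewrite rsum_scal. apply Rmult_le_compat_l. left; apply nome_pos. apply HS0. }
      apply rsum_le. intros [|i] _.
      - rewrite (Hb0 0%nat) by (unfold B0; lia). rewrite Cmod_0. lra.
      - replace (nome (Im z / (2 * n2)) * (Cmod (b (S i)) * nome (1 / (4 * n2)) ^ S i))
          with (Cmod (b (S i)) * (nome (Im z / (2 * n2)) * nome (1 / (4 * n2)) ^ S i)) by ring.
        apply Rmult_le_compat_l. apply Cmod_ge_0.
        assert (nome (Im z / n2) = nome (Im z / (2 * n2)) * nome (Im z / (2 * n2))) as E by (rewrite <- nome_add; f_equal; field; lra).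
        assert (0 < Im z / (2 * n2)) as Hzz by (apply Rdiv_lt_0_compat; lra).
        pose proof (nome_bound _ Hzz) as Hr.
        assert (nome (Im z / (2 * n2)) <= nome (1 / (4 * n2))) as Hle.
        { apply nome_decr. apply Rmult_le_reg_r with (4 * n2). lra.
          replace (1 / (4 * n2) * (4 * n2)) with 1 by (field; lra).
          replace (Im z / (2 * n2) * (4 * n2)) with (2 * Im z) by (field; lra). lra. }
        rewrite E, Rpow_mult_distr.
        set (r := nome (Im z / (2 * n2))) in *.
        assert (r ^ S i <= r). { simpl. assert (r ^ i <= 1). { rewrite <- (pow1 i). apply pow_incr; lra. } nra. }
        apply Rmult_le_compat; auto; try (apply pow_le; lra). apply pow_incr; lra. }
    eapply Rle_trans. apply (HPhi a b' c d z _ Hdet Hz HM).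
    replace (C0 * (S0 * nome (Im z / (2 * n2))) * sqrt (Im z) ^ k) with (C0 * S0 * (sqrt (Im z) ^ k * nome (Im z / (2 * n2)))) by ring.
    apply Rmult_le_compat_l. now apply Rmult_le_pos.
    replace (nome (Im z / (2 * n2))) with (exp (- (2 * PI / (2 * n2) * Im z))) by (unfold nome; f_equal; field; lra).
    apply HKb. lra. }
  assert (forall mu, 0 <= mu -> (forall tau, in_H tau -> Phi tau <= mu) -> forall tau, in_H tau -> Phi tau <= mu / 2) as Hcontr.
  { clear mu Hmu HPmu. intros mu Hmu HPmu tau Ht.
    destruct (equivalent_height_half tau Ht) as [a [b' [c [d [z [Hdet [Hz [Hz2 ->]]]]]]]].
    set (y := Im z) in *. set (T := y / n2). set (t := T / 2).
    assert (0 < t) as Htp by (unfold t, T; apply Rdiv_lt_0_compat; [apply Rdiv_lt_0_compat; lra|lra]).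
    assert (0 < sqrt t) as Hst by now apply sqrt_lt_R0.
    assert (0 < sqrt t ^ k) as Hstk by now apply pow_lt.
    assert (forall n, Cmod (b n) * nome t ^ n <= mu / sqrt t ^ k) as HCE.
    { apply (cauchy_estimate b f t); auto. intros x.
      pose proof (HPmu (x, t) (in_H_i _ _ Htp)) as H1. unfold Phi in H1. simpl in H1.
      apply Rmult_le_reg_r with (sqrt t ^ k); auto.
      unfold Rdiv. rewrite Rmult_assoc, Rinv_l by lra. rewrite Rmult_1_r. exact H1. }
    assert (0 <= mu / sqrt t ^ k) as Hms by (apply Rmult_le_pos; auto; left; now apply Rinv_0_lt_compat).
    assert (majorant b T (mu / sqrt t ^ k * (rho ^ B0 / (1 - rho)))) as HM.
    { intros n. 
      apply Rle_trans with (rsum (fun i => mu / sqrt t ^ k * (if Nat.ltb i B0 then 0 else rho ^ i)) n).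
      - apply rsum_le. intros i _. destruct (Nat.ltb i B0) eqn:E.
        + apply Nat.ltb_lt in E. rewrite Hb0 by auto. rewrite Cmod_0. lra.
        + assert (nome T = nome t * nome t) as E2 by (rewrite <- nome_add; f_equal; unfold t; field).
          rewrite E2, Rpow_mult_distr, <- Rmult_assoc.
          assert (nome t <= rho).
          { unfold rho. apply nome_decr. unfold t, T. apply Rmult_le_reg_r with (4 * n2). lra.
            replace (1 / (4 * n2) * (4 * n2)) with 1 by (field; lra).
            replace (y / n2 / 2 * (4 * n2)) with (2 * y) by (field; lra). lra. }
          pose proof (nome_pos t).
          apply Rmult_le_compat; auto. apply Rmult_le_pos. apply Cmod_ge_0. apply pow_le; lra.
          apply pow_le; lra. apply pow_incr; lra.
      - rewrite rsum_scal. apply Rmult_le_compat_l; auto.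
        assert (forall n, rsum (fun i => if Nat.ltb i B0 then 0 else rho ^ i) n * (1 - rho) <= rho ^ B0 - (if Nat.leb B0 n then rho ^ n else rho ^ B0)) as Hgs.
        { induction n0.
          - simpl. lra.
          - cbn [rsum]. rewrite Rmult_plus_distr_r.
            destruct (Nat.leb B0 (S n0)) eqn:E1; destruct (Nat.leb B0 n0) eqn:E2.
            + replace (Nat.ltb n0 B0) with false. change (rho ^ S n0) with (rho * rho ^ n0). lra.
              symmetry. apply Nat.ltb_ge. now apply Nat.leb_le.
            + apply Nat.leb_le in E1. apply Nat.leb_gt in E2. replace (Nat.ltb n0 B0) with true by (symmetry; apply Nat.ltb_lt; auto).
              replace (S n0) with B0 by lia. lra.
            + apply Nat.leb_gt in E1. apply Nat.leb_le in E2. lia.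
            + apply Nat.leb_gt in E2. replace (Nat.ltb n0 B0) with true by (symmetry; apply Nat.ltb_lt; auto). lra. }
        specialize (Hgs n). assert (0 <= (if Nat.leb B0 n then rho ^ n else rho ^ B0)) by (destruct (Nat.leb B0 n); apply pow_le; lra).
        apply Rmult_le_reg_r with (1 - rho). lra. unfold Rdiv. rewrite Rmult_assoc, Rinv_l by lra. lra. }
    eapply Rle_trans. apply (HPhi a b' c d z _ Hdet Hz HM). fold y.
    assert (sqrt y = sqrt (2 * n2) * sqrt t) as Esq.
    { rewrite <- sqrt_mult by lra. f_equal. unfold t, T. field. lra. }
    rewrite Esq, Rpow_mult_distr.
    replace (C0 * (mu / sqrt t ^ k * (rho ^ B0 / (1 - rho))) * (sqrt (2 * n2) ^ k * sqrt t ^ k)) with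
      (mu * (W * rho ^ B0)) by (unfold W; field; split; lra).
    replace (mu / 2) with (mu * (1/2)) by field. apply Rmult_le_compat_l; lra. }
  assert (forall j tau, in_H tau -> Phi tau <= mu / 2 ^ j) as Hiter.
  { induction j. intros; simpl; replace (mu / 1) with mu by field; auto.
    intros tau Ht. replace (mu / 2 ^ S j) with (mu / 2 ^ j / 2) by (simpl; field; apply pow_nonzero; lra).
    apply Hcontr; auto. apply Rmult_le_pos; auto. left. apply Rinv_0_lt_compat, pow_lt; lra. }
  assert (forall tau, in_H tau -> f tau = RtoC 0) as Hf0.
  { intros tau Ht. assert (0 < sqrt (Im tau) ^ k) by (apply pow_lt, sqrt_lt_R0; auto).
    assert (Phi tau <= 0).
    { apply Rnot_lt_le. intros h. destruct (pow_to_0 mu (1/2) ltac:(lra) _ h) as [j Hj].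
      specialize (Hj j (le_n _)). specialize (Hiter j tau Ht).
      replace (mu * (1/2) ^ j) with (mu / 2 ^ j) in Hj. lra.
      unfold Rdiv. rewrite Rmult_1_l, pow_inv. reflexivity. }
    unfold Phi in H1. pose proof (Cmod_ge_0 (f tau)). apply Cmod_eq_0. nra. }
  intros n. assert (Cmod (b n) * nome 1 ^ n <= 0) as Hfin.
  { apply (cauchy_estimate b f 1); auto. lra. intros x. rewrite Hf0 by (apply in_H_i; lra). rewrite Cmod_0. lra. }
  assert (0 < nome 1 ^ n) by (apply pow_lt, nome_pos). pose proof (Cmod_ge_0 (b n)).
  apply Cmod_eq_0. nra.
Qed.

(** * Bounds at the cusps from the sign condition *)

Definition modular (N k : nat) (chi : Z -> C) (f : C -> C) : Prop :=
  forall a b c d tau, (a * d - b * c = 1)%Z -> (Z.of_nat N | c)%Z -> in_H tau ->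
  f (moebius a b c d tau) = (chi d * automorphy c d tau ^ k * f tau)%C.

(** Separability of the Gauss sums at every [n], also those not prime to [N],
    with a nonzero constant. *)
Definition gauss_sum (N : nat) (chi : Z -> C) (g : C) : Prop :=
  g <> RtoC 0 /\ forall n : nat,
  csum (fun j => chi (Z.of_nat j) * e2pi (RtoC (INR j) / RtoC (INR N)) ^ n)%C N = (g * chi (Z.of_nat n))%C.

(** For [ep = 1] or [-1], as multiplication by [chi n] this says that the
    coefficient vanishes where [chi n = - ep]; no condition is imposed where
    [chi n = 0]. *)
Definition sign_supported (chi : Z -> C) (ep : C) (b : nat -> C) : Prop :=
  forall n, chi (Z.of_nat n) <> RtoC 0 -> (chi (Z.of_nat n) * b n = ep * b n)%C.

(** The translates of [f(tau / N)] by [j / N]. Inversion permutes the ones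
    with [j] a unit. *)
Definition phi (N : nat) (f : C -> C) (j : Z) (tau : C) : C := f ((tau + ZtoC j) / ZtoC (Z.of_nat N))%C.

Lemma in_H_phi : forall N j tau, (0 < N)%nat -> in_H tau -> in_H ((tau + ZtoC j) / ZtoC (Z.of_nat N))%C.
Proof.
  intros N j tau HN Ht. replace (tau + ZtoC j)%C with (ZtoC 1 * tau + ZtoC j)%C by (rewrite ZtoC_1; ring).
  apply in_H_scale; auto; lia.
Qed.

Lemma Im_phi : forall N j tau, (0 < N)%nat -> Im ((tau + ZtoC j) / ZtoC (Z.of_nat N))%C = Im tau / INR N.
Proof.
  intros N j [x y] HN. assert (INR N <> 0) by (apply not_0_INR; lia). rewrite ZtoC_nat. unfold Cdiv.
  rewrite <- RtoC_inv by auto. simpl. unfold Im. simpl. field. auto.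
Qed.

Lemma phi_series : forall N b f j tau, (0 < N)%nat -> qseries b f -> in_H tau ->
  cser (fun n => e2pi (RtoC (INR j) / RtoC (INR N)) ^ n * (b n * e2pi (tau / RtoC (INR N)) ^ n))%C (phi N f (Z.of_nat j) tau).
Proof.
  intros N b f j tau HN Hq Ht. assert (INR N <> 0) by (apply not_0_INR; lia).
  assert (RtoC (INR N) <> RtoC 0) by (intros E; apply RtoC_inj in E; auto).
  eapply cser_ext; [|apply Hq; apply in_H_phi; auto]. intros n. cbv beta.
  rewrite !ZtoC_nat. replace ((tau + RtoC (INR j)) / RtoC (INR N))%C with (tau / RtoC (INR N) + RtoC (INR j) / RtoC (INR N))%C by (field; auto).
  rewrite e2pi_add, Cpow_mult_l. ring.
Qed.

(** A linear relation between the [phi]'s can be checked on coefficients,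
    where it becomes a relation between finite sums of roots of unity. *)
Lemma comb_eq : forall N b f (w w' : nat -> C) tau, (0 < N)%nat -> qseries b f -> in_H tau ->
  (forall n, (csum (fun j => w j * e2pi (RtoC (INR j) / RtoC (INR N)) ^ n) N * b n =
              csum (fun j => w' j * e2pi (RtoC (INR j) / RtoC (INR N)) ^ n) N * b n)%C) ->
  csum (fun j => w j * phi N f (Z.of_nat j) tau)%C N = csum (fun j => w' j * phi N f (Z.of_nat j) tau)%C N.
Proof.
  intros N b f w w' tau HN Hq Ht H.
  assert (forall v : nat -> C, cser (fun n => (csum (fun j => v j * e2pi (RtoC (INR j) / RtoC (INR N)) ^ n) N * b n) * e2pi (tau / RtoC (INR N)) ^ n)%C
     (csum (fun j => v j * phi N f (Z.of_nat j) tau)%C N)) as Hv.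
  { intros v. eapply cser_ext; [|apply (cser_csum (fun j n => v j * (e2pi (RtoC (INR j) / RtoC (INR N)) ^ n * (b n * e2pi (tau / RtoC (INR N)) ^ n))))%C; intros j _; apply cser_scal; apply phi_series; eauto].
    intros n. cbv beta. 
    rewrite (csum_ext _ (fun j => (b n * e2pi (tau / RtoC (INR N)) ^ n) * (v j * e2pi (RtoC (INR j) / RtoC (INR N)) ^ n))%C) by (intros; ring).
    rewrite csum_scal. ring. }
  apply (cser_unique _ _ _ (Hv w)). eapply cser_ext; [|apply Hv]. intros n. cbv beta. now rewrite H.
Qed.

Lemma modular_T : forall N k chi f tau n, real_character (Z.of_nat N) chi -> (0 < N)%nat -> modular N k chi f -> in_H tau ->
  f (tau + ZtoC n)%C = f tau.
Proof.
  intros N k chi f tau n Hr HN Hf Ht.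
  replace (tau + ZtoC n)%C with (moebius 1 n 0 1 tau).
  2:{ unfold moebius, automorphy. rewrite ZtoC_0, ZtoC_1. field. }
  rewrite (Hf 1 n 0 1)%Z; auto. 2: lia. 2: apply Z.divide_0_r.
  rewrite (chi_1 (Z.of_nat N)) by (try lia; apply Hr). unfold automorphy. rewrite ZtoC_0, ZtoC_1.
  replace (0 * tau + 1)%C with (RtoC 1) by ring. rewrite Cpow_1_l. ring.
Qed.

Lemma phi_T : forall N f j n tau, phi N f j (tau + ZtoC n)%C = phi N f (j + n) tau.
Proof. intros. unfold phi. rewrite ZtoC_add. f_equal. f_equal. ring. Qed.

Lemma phi_addN : forall N k chi f j tau, real_character (Z.of_nat N) chi -> (0 < N)%nat -> modular N k chi f -> in_H tau ->
  phi N f (j + Z.of_nat N) tau = phi N f j tau.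
Proof.
  intros N k chi f j tau Hr HN Hf Ht. unfold phi.
  rewrite <- (modular_T N k chi f ((tau + ZtoC j) / ZtoC (Z.of_nat N))%C 1); auto. 2: now apply in_H_phi.
  f_equal. pose proof (ZtoC_neq0 (Z.of_nat N) ltac:(lia)). rewrite ZtoC_add, ZtoC_1. field. auto.
Qed.

(** The matrix that compares the two sides has lower left entry divisible by
    [N] exactly when [j j' = -1] modulo [N]. *)
Lemma phi_S : forall N k chi f j j' tau, real_character (Z.of_nat N) chi -> (0 < N)%nat -> modular N k chi f -> in_H tau ->
  (Z.of_nat N | j * j' + 1)%Z -> phi N f j (- / tau)%C = (chi j * tau ^ k * phi N f j' tau)%C.
Proof.
  intros N k chi f j j' tau Hr HN Hf Ht [m Hm]. pose proof (in_H_neq0 _ Ht) as Ht0.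
  set (n := Z.of_nat N) in *. pose proof (ZtoC_neq0 n ltac:(unfold n; lia)) as Hn.
  assert (j * - j' - - m * n = 1)%Z as Hdet by lia.
  assert (automorphy n (- j') ((tau + ZtoC j') / ZtoC n)%C = tau) as Ea.
  { unfold automorphy. rewrite ZtoC_opp. field. auto. }
  unfold phi at 1. fold n.
  replace ((- / tau + ZtoC j) / ZtoC n)%C with (moebius j (- m) n (- j') ((tau + ZtoC j') / ZtoC n)).
  2:{ unfold moebius. rewrite Ea, ZtoC_opp.
      assert (ZtoC j * ZtoC j' + 1 = ZtoC m * ZtoC n)%C as E by (rewrite <- ZtoC_1, <- !ZtoC_mul, <- ZtoC_add, Hm; reflexivity).
      replace (ZtoC j * ((tau + ZtoC j') / ZtoC n) + - ZtoC m)%C with ((ZtoC j * tau + (ZtoC j * ZtoC j' - ZtoC m * ZtoC n)) / ZtoC n)%C by (field; auto).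
      rewrite <- E. field. auto. }
  rewrite (Hf j (- m)%Z n (- j')%Z); auto. 2: apply Z.divide_refl. 2:{ apply in_H_phi; auto. }
  rewrite Ea. unfold phi. fold n. f_equal. f_equal.
  assert (chi j * chi (- j')%Z = 1)%C as E1.
  { rewrite <- (proj1 (proj1 Hr)). replace (j * - j')%Z with (1 + (- m) * n)%Z by lia.
    rewrite (chi_period_mul n) by apply Hr. apply (chi_1 n); [unfold n; lia|apply Hr]. }
  assert (chi j <> RtoC 0) as E2.
  { intros E. rewrite E in E1. apply (f_equal fst) in E1. simpl in E1. lra. }
  pose proof (chi_unit_sq n chi j Hr E2) as E3.
  transitivity (chi j * (chi j * chi (- j')%Z))%C. rewrite Cmult_assoc, E3. ring. rewrite E1. ring.
Qed.

(** The involution [j -> -1/j] on the units modulo [N], extended by the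
    identity to a permutation of all residues. *)
Definition sigma (N j : nat) : nat :=
  match find (fun j' => Nat.eqb ((j * j' + 1) mod N) 0) (seq 0 N) with Some j' => j' | None => j end.

Lemma sigma_unit : forall N j, (0 < N)%nat -> Z.gcd (Z.of_nat j) (Z.of_nat N) = 1%Z ->
  (sigma N j < N)%nat /\ (Z.of_nat N | Z.of_nat j * Z.of_nat (sigma N j) + 1)%Z.
Proof.
  intros N j HN Hg. unfold sigma.
  destruct (find _ _) eqn:E.
  - apply find_some in E. destruct E as [E1 E2]. apply in_seq in E1. apply Nat.eqb_eq in E2. split. lia.
    exists (Z.of_nat ((j * n + 1) / N)).
    pose proof (Nat.div_mod (j * n + 1) N ltac:(lia)). rewrite E2 in H. nia.
  - exfalso.
    destruct (Zis_gcd_bezout (Z.of_nat j) (Z.of_nat N) 1) as [u v Huv]. { rewrite <- Hg. apply Zgcd_is_gcd. }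
    set (j' := Z.to_nat ((- u) mod (Z.of_nat N))).
    pose proof (Z.mod_pos_bound (- u) (Z.of_nat N) ltac:(lia)) as Hb.
    pose proof (Z_div_mod_eq_full (- u) (Z.of_nat N)) as Ed.
    assert (In j' (seq 0 N)) as Hin by (apply in_seq; unfold j'; lia).
    pose proof (find_none _ _ E j' Hin) as HF. cbv beta in HF. apply Nat.eqb_neq in HF. apply HF.
    apply Nat.Div0.mod_divides.
    assert (Z.of_nat N | Z.of_nat (j * j' + 1))%Z as [q Hq].
    { rewrite Nat2Z.inj_add, Nat2Z.inj_mul. unfold j'. rewrite Z2Nat.id by lia.
      exists (v - Z.of_nat j * ((- u) / Z.of_nat N))%Z.
      replace ((- u) mod Z.of_nat N)%Z with (- u - Z.of_nat N * ((- u) / Z.of_nat N))%Z by lia.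
      change (Z.of_nat 1) with 1%Z. rewrite <- Huv at 1. ring. }
    exists (Z.to_nat q). nia.
Qed.

Lemma sigma_nonunit : forall N j, (0 < N)%nat -> Z.gcd (Z.of_nat j) (Z.of_nat N) <> 1%Z -> sigma N j = j.
Proof.
  intros N j HN Hg. unfold sigma. destruct (find _ _) eqn:E; auto. exfalso. apply Hg.
  apply find_some in E. destruct E as [E1 E2]. apply Nat.eqb_eq in E2.
  pose proof (Nat.div_mod (j * n + 1) N ltac:(lia)) as H. rewrite E2 in H.
  apply Zgcd_1_rel_prime, bezout_rel_prime. apply Bezout_intro with (- Z.of_nat n)%Z (Z.of_nat ((j * n + 1) / N)). nia.
Qed.

Lemma sigma_lt : forall N j, (j < N)%nat -> (sigma N j < N)%nat.
Proof.
  intros N j H. destruct (Z.eq_dec (Z.gcd (Z.of_nat j) (Z.of_nat N)) 1) as [h|h].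
  apply sigma_unit; auto; lia. rewrite sigma_nonunit; auto; lia.
Qed.

Lemma sigma_invol : forall N j, (j < N)%nat -> sigma N (sigma N j) = j.
Proof.
  intros N j H. destruct (Z.eq_dec (Z.gcd (Z.of_nat j) (Z.of_nat N)) 1) as [h|h].
  2:{ rewrite !sigma_nonunit; auto; try lia. rewrite sigma_nonunit; auto; lia. }
  destruct (sigma_unit N j ltac:(lia) h) as [H1 H2]. set (s := sigma N j) in *.
  assert (Z.gcd (Z.of_nat s) (Z.of_nat N) = 1%Z) as hs.
  { destruct H2 as [q Hq]. apply Zgcd_1_rel_prime, bezout_rel_prime. apply Bezout_intro with (- Z.of_nat j)%Z q. lia. }
  destruct (sigma_unit N s ltac:(lia) hs) as [H3 H4]. set (t := sigma N s) in *.
  assert (Z.of_nat N | Z.of_nat t - Z.of_nat j)%Z as [q Hq].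
  { replace (Z.of_nat t - Z.of_nat j)%Z with (Z.of_nat t * (Z.of_nat j * Z.of_nat s + 1) - Z.of_nat j * (Z.of_nat s * Z.of_nat t + 1))%Z by ring.
    apply Z.divide_sub_r; apply Z.divide_mul_r; auto. }
  assert (q = 0)%Z by nia. lia.
Qed.

Lemma csum_sigma : forall N F, csum (fun j => F (sigma N j)) N = csum F N.
Proof.
  intros N F. apply (csum_reindex F (sigma N)).
  - intros; now apply sigma_lt.
  - intros r Hr. exists (sigma N r). repeat split. now apply sigma_lt. now apply sigma_invol.
    intros j Hj <-. symmetry. now apply sigma_invol.
Qed.

(** The twist of [f] by [chi], up to a Gauss sum. *)
Definition Theta (N : nat) (chi : Z -> C) (f : C -> C) (tau : C) : C :=
  csum (fun j => chi (Z.of_nat j) * phi N f (Z.of_nat j) tau)%C N.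

(** The square of [chi] selects the units, so that this is the sum of the
    [phi]'s with [j] prime to [N]. *)
Definition Psi (N : nat) (chi : Z -> C) (f : C -> C) (tau : C) : C :=
  csum (fun j => chi (Z.of_nat j) * chi (Z.of_nat j) * phi N f (Z.of_nat j) tau)%C N.

(** Reindex by [sigma]; as [chi] is real, [chi(-1/j)] and the factor from
    [phi_S] cancel. *)
Lemma Theta_S : forall N k chi f tau, real_character (Z.of_nat N) chi -> (0 < N)%nat -> modular N k chi f -> in_H tau ->
  Theta N chi f (- / tau)%C = (tau ^ k * Psi N chi f tau)%C.
Proof.
  intros N k chi f tau Hr HN Hf Ht. unfold Theta, Psi.
  rewrite <- csum_sigma, <- csum_scal. apply csum_ext. intros j Hj.
  destruct (Z.eq_dec (Z.gcd (Z.of_nat j) (Z.of_nat N)) 1) as [h|h].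
  2:{ rewrite sigma_nonunit by (auto; lia). rewrite (chi_nonunit (Z.of_nat N)) by (auto; apply Hr). ring. }
  destruct (sigma_unit N j HN h) as [H1 H2]. set (s := sigma N j) in *.
  assert (Z.gcd (Z.of_nat s) (Z.of_nat N) = 1%Z) as hs.
  { destruct H2 as [q Hq]. apply Zgcd_1_rel_prime, bezout_rel_prime. apply Bezout_intro with (- Z.of_nat j)%Z q. lia. }
  rewrite (phi_S N k chi f (Z.of_nat s) (Z.of_nat j)); auto.
  - replace (chi (Z.of_nat s) * (chi (Z.of_nat s) * tau ^ k * phi N f (Z.of_nat j) tau))%C with
      (chi (Z.of_nat s) * chi (Z.of_nat s) * (tau ^ k * phi N f (Z.of_nat j) tau))%C by ring.
    rewrite (proj2 Hr _ hs), (proj2 Hr _ h). ring.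
  - rewrite Z.mul_comm. auto.
Qed.

Lemma Psi_S : forall N k chi f tau, real_character (Z.of_nat N) chi -> (0 < N)%nat -> modular N k chi f -> in_H tau ->
  Psi N chi f (- / tau)%C = ((- tau) ^ k * Theta N chi f tau)%C.
Proof.
  intros N k chi f tau Hr HN Hf Ht. pose proof (in_H_inv _ Ht) as Ht'. pose proof (in_H_neq0 _ Ht) as H0.
  pose proof (Theta_S N k chi f _ Hr HN Hf Ht') as E.
  replace (- / (- / tau))%C with tau in E by (field; auto). rewrite E, Cmult_assoc, <- Cpow_mult_l.
  replace (- tau * - / tau)%C with (RtoC 1) by (field; auto). rewrite Cpow_1_l. ring.
Qed.

Lemma Cmod_chi_le : forall N chi a, real_character N chi -> Cmod (chi a) <= 1.
Proof.
  intros N chi a Hr. destruct (chi_vals N chi a Hr) as [E|[E|E]]; rewrite E.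
  rewrite Cmod_0; lra. rewrite Cmod_1; lra. rewrite Cmod_m1; lra.
Qed.

Lemma phi_bound : forall N b f j tau B, (0 < N)%nat -> qseries b f -> in_H tau -> majorant b (Im tau / INR N) B ->
  Cmod (phi N f j tau) <= B.
Proof.
  intros N b f j tau B HN Hq Ht HB. unfold phi. apply (majorant_bound b f); auto. now apply in_H_phi. now rewrite Im_phi.
Qed.

Lemma Theta_bound : forall N chi b f tau B, real_character (Z.of_nat N) chi -> (0 < N)%nat -> qseries b f -> in_H tau ->
  majorant b (Im tau / INR N) B -> Cmod (Theta N chi f tau) <= INR N * B /\ Cmod (Psi N chi f tau) <= INR N * B.
Proof.
  intros N chi b f tau B Hr HN Hq Ht HB.
  assert (forall j, Cmod (chi j) <= 1) as Hc by (intros; eapply Cmod_chi_le; eauto).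
  pose proof (phi_bound N b f) as Hp.
  split; rewrite <- rsum_const; apply Cmod_csum_le; intros j _; rewrite !Cmod_mult;
    specialize (Hp (Z.of_nat j) tau B HN Hq Ht HB); specialize (Hc (Z.of_nat j));
    pose proof (Cmod_ge_0 (chi (Z.of_nat j))); pose proof (Cmod_ge_0 (phi N f (Z.of_nat j) tau)).
  - nra.
  - assert (Cmod (chi (Z.of_nat j)) * Cmod (chi (Z.of_nat j)) <= 1) by nra.
    assert (0 <= Cmod (chi (Z.of_nat j)) * Cmod (chi (Z.of_nat j))) by nra. nra.
Qed.

Definition phi_controlled (N k : nat) (C0 : R) (j : Z) (b : nat -> C) (f : C -> C) : Prop :=
  forall tau B, in_H tau -> majorant b (Im tau / INR N) B -> Cmod (phi N f j (- / tau)%C) <= C0 * Cmod tau ^ k * B.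

(** The sum [phi 0 + Psi] is [p] times the part of [phi 0] with exponents
    divisible by [p], and by the sign condition [c * Theta] is [p] times the
    rest. Hence [(p - 1) phi 0] is [Psi + c * Theta], and the images of both
    under inversion are known. *)
Lemma phi_controlled_prime : forall (p k : nat) chi g ep, prime (Z.of_nat p) -> (2 < p)%nat ->
  real_character (Z.of_nat p) chi -> gauss_sum p chi g -> (ep * ep = 1)%C ->
  exists C0, 1 <= C0 /\ forall b f, qseries b f -> modular p k chi f -> sign_supported chi ep b ->
    phi_controlled p k C0 0 b f.
Proof.
  intros p k chi g ep Hp Hp2 Hr [Hg HG] Hep.
  assert (INR p <> 0) as HpR by (apply not_0_INR; lia).
  assert (RtoC (INR p) <> RtoC 0) as HpC by (intros E; apply RtoC_inj in E; auto).
  assert (2 < INR p) as Hp2R by (change 2 with (INR 2); apply lt_INR; auto).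
  assert (RtoC (INR p) - 1 <> 0)%C as Hp1.
  { intros E. rewrite <- RtoC_minus in E. apply RtoC_inj in E. lra. }
  (* Chosen so that the coefficients of [c * Theta] are [p b_n] for [n] prime
     to [p]. *)
  set (c := (RtoC (INR p) * ep / g)%C).
  set (C0 := (1 + (Cmod c + 1) * INR p)).
  pose proof (Cmod_ge_0 c) as Hc0.
  exists C0. split. unfold C0. nra.
  intros b f Hq Hf Hs tau B Ht HB.
  assert (forall t, in_H t -> (RtoC (INR p) - 1) * phi p f 0 t = Psi p chi f t + c * Theta p chi f t)%C as Hid.
  { intros t Ht'.
    transitivity (csum (fun j => (if Nat.eqb j 0 then RtoC (INR p) - 1 else 0) * phi p f (Z.of_nat j) t)%C p).
    { rewrite (csum_single _ p 0%nat); [reflexivity|lia|]. intros j _ Hj. apply Nat.eqb_neq in Hj. rewrite Hj. ring. }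
    unfold Psi, Theta. rewrite <- csum_scal, <- csum_plus.
    rewrite (csum_ext (fun i => (chi (Z.of_nat i) * chi (Z.of_nat i) * phi p f (Z.of_nat i) t + c * (chi (Z.of_nat i) * phi p f (Z.of_nat i) t))%C)
       (fun j => (chi (Z.of_nat j) * chi (Z.of_nat j) + c * chi (Z.of_nat j)) * phi p f (Z.of_nat j) t)%C) by (intros; ring).
    apply (comb_eq p b f _ _ t); auto; try lia.
    intros n.
    rewrite (csum_single (fun j => (if Nat.eqb j 0 then RtoC (INR p) - 1 else 0) * e2pi (RtoC (INR j) / RtoC (INR p)) ^ n)%C p 0%nat); [|lia|].
    2:{ intros j _ Hj. apply Nat.eqb_neq in Hj. rewrite Hj. ring. }
    change (Nat.eqb 0 0) with true. cbv iota.
    replace (RtoC (INR 0) / RtoC (INR p))%C with (RtoC 0) by (simpl; field; auto). rewrite e2pi_0, Cpow_1_l.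
    rewrite (csum_ext (fun j => ((chi (Z.of_nat j) * chi (Z.of_nat j) + c * chi (Z.of_nat j)) * e2pi (RtoC (INR j) / RtoC (INR p)) ^ n)%C)
      (fun j => (e2pi (RtoC (INR j) / RtoC (INR p)) ^ n + (if Nat.eqb j 0 then -(1) else 0)) + c * (chi (Z.of_nat j) * e2pi (RtoC (INR j) / RtoC (INR p)) ^ n))%C).
    2:{ intros j Hj. destruct (Nat.eqb j 0) eqn:Ej.
        - apply Nat.eqb_eq in Ej. subst j. simpl Z.of_nat.
          rewrite (chi_nonunit (Z.of_nat p) chi 0); [|apply Hr|].
          replace (RtoC (INR 0) / RtoC (INR p))%C with (RtoC 0) by (simpl; field; auto). rewrite e2pi_0, Cpow_1_l. ring.
          rewrite Z.gcd_0_l. lia.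
        - apply Nat.eqb_neq in Ej.
          assert (Z.gcd (Z.of_nat j) (Z.of_nat p) = 1%Z) as hj.
          { apply Zgcd_1_rel_prime. apply rel_prime_le_prime; auto; lia. }
          rewrite (proj2 Hr _ hj). ring. }
    rewrite !csum_plus, csum_scal, HG.
    rewrite (csum_single (fun j => if Nat.eqb j 0 then (-(1))%C else RtoC 0) p 0%nat); [|lia|].
    2:{ intros j _ Hj. apply Nat.eqb_neq in Hj. now rewrite Hj. }
    change (Nat.eqb 0 0) with true. cbv iota.
    rewrite unit_sum_mod by lia.
    destruct (Nat.eqb (n mod p) 0) eqn:En.
    - apply Nat.eqb_eq in En. rewrite (chi_nonunit (Z.of_nat p) chi (Z.of_nat n)); [ring|apply Hr|].
      pose proof (Nat.div_mod n p ltac:(lia)) as Ed. rewrite En in Ed.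
      intros E. apply (unit_not_dvd (Z.of_nat p) (Z.of_nat n)); auto. lia. exists (Z.of_nat (n / p)). nia.
    - apply Nat.eqb_neq in En.
      assert (chi (Z.of_nat n) <> RtoC 0) as hn.
      { apply Hr. apply Zgcd_1_rel_prime, rel_prime_sym. apply prime_rel_prime; auto.
        intros [q Hq']. apply En. apply Nat.Div0.mod_divides. exists (Z.to_nat q). nia. }
      specialize (Hs n hn). unfold c.
      transitivity (- b n + RtoC (INR p) * ep * (chi (Z.of_nat n) * b n))%C. 2: field; auto.
      rewrite Hs. replace (RtoC (INR p) * ep * (ep * b n))%C with (RtoC (INR p) * (ep * ep) * b n)%C by ring. rewrite Hep. ring. }
  pose proof (Hid _ (in_H_inv _ Ht)) as E.
  rewrite (Psi_S p k chi f), (Theta_S p k chi f) in E by (auto; lia).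
  destruct (Theta_bound p chi b f tau B Hr ltac:(lia) Hq Ht HB) as [HT HP].
  assert (Cmod (RtoC (INR p) - 1)%C = INR p - 1) as Em.
  { rewrite <- RtoC_minus, Cmod_R, Rabs_pos_eq; lra. }
  assert ((INR p - 1) * Cmod (phi p f 0 (- / tau)%C) <= Cmod tau ^ k * (INR p * B) + Cmod c * (Cmod tau ^ k * (INR p * B))) as HE.
  { rewrite <- Em, <- Cmod_mult, E. eapply Rle_trans. apply Cmod_triangle.
    rewrite !Cmod_mult, !Cmod_pow, Cmod_opp.
    assert (0 <= Cmod tau ^ k) by (apply pow_le, Cmod_ge_0).
    apply Rplus_le_compat. apply Rmult_le_compat_l; auto.
    apply Rmult_le_compat_l; auto. apply Rmult_le_compat_l; auto. }
  pose proof (Cmod_ge_0 (phi p f 0 (- / tau)%C)).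
  pose proof (majorant_nonneg _ _ _ HB).
  assert (0 <= Cmod tau ^ k * B) by (apply Rmult_le_pos; auto; apply pow_le, Cmod_ge_0).
  apply Rle_trans with ((INR p - 1) * Cmod (phi p f 0 (- / tau)%C)). nra.
  eapply Rle_trans. apply HE. unfold C0.
  replace ((1 + (Cmod c + 1) * INR p) * Cmod tau ^ k * B) with ((1 + (Cmod c + 1) * INR p) * (Cmod tau ^ k * B)) by ring.
  nra.
Qed.

Lemma chi4_vals : forall chi, dirichlet_character 4 chi -> chi 0%Z = RtoC 0 /\ chi 1%Z = RtoC 1 /\ chi 2%Z = RtoC 0.
Proof.
  intros chi H. repeat split.
  - apply (chi_nonunit 4); auto. vm_compute. discriminate.
  - apply (chi_1 4); auto; lia.
  - apply (chi_nonunit 4); auto. vm_compute. discriminate.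
Qed.

Definition iota4 : C := e2pi (RtoC (INR 1) / RtoC (INR 4)).

Lemma iota4_alt : iota4 = e2pi (RtoC 1 / RtoC 4)%C.
Proof. unfold iota4. rewrite !INR_IZR_INZ. reflexivity. Qed.

Lemma iota4_sq : (iota4 * iota4 = -(1))%C.
Proof.
  pose proof (unit_sum 4 2 ltac:(lia)) as E. rewrite !INR_IZR_INZ in E. simpl Z.of_nat in E.
  assert (e2pi (RtoC 2 / RtoC 4) = iota4 * iota4)%C as E2.
  { rewrite iota4_alt, <- e2pi_add. f_equal. field. }
  assert (iota4 * iota4 * (iota4 * iota4) = 1)%C as E4.
  { rewrite iota4_alt, <- !e2pi_add.
    replace (1 / 4 + 1 / 4 + (1 / 4 + 1 / 4))%C with (RtoC 1) by field. apply e2pi_1. }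
  rewrite E2 in E. simpl csum in E.
  set (x := (iota4 * iota4)%C) in *.
  assert (2 * (1 + x) = 0)%C as E5.
  { transitivity (1 + x + x * x + x * (x * x))%C. rewrite E4. ring. rewrite <- E. ring. }
  replace x with ((2 * (1 + x)) / 2 - 1)%C by field. rewrite E5. field.
Qed.

(** The difference of [phi 2] and [phi 0] is a multiple of [Theta] by the sign
    condition. For their sum [P], translation by [1] exchanges [P] and [Psi]
    and multiplies [Theta] by a constant; together with inversion, which
    exchanges [Theta] and [Psi], this determines the image of [P] under
    inversion. *)
Lemma phi_controlled_4 : forall k chi ep, real_character 4 chi -> chi 3%Z = (-(1))%C -> (ep * ep = 1)%C ->
  exists C0, 1 <= C0 /\ forall b f, qseries b f -> modular 4 k chi f -> sign_supported chi ep b ->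
    phi_controlled 4 k C0 0 b f /\ phi_controlled 4 k C0 2 b f.
Proof.
  intros k chi ep Hr H3 Hep. destruct (chi4_vals chi (proj1 Hr)) as [H0 [H1 H2]].
  pose proof iota4_sq as Hi.
  assert (Cmod ep = 1) as Hepm.
  { pose proof (Cmod_ge_0 ep). assert (Cmod ep * Cmod ep = 1) by (rewrite <- Cmod_mult, Hep; apply Cmod_1). nra. }
  assert (Cmod iota4 = 1) as Him.
  { pose proof (Cmod_ge_0 iota4). assert (Cmod iota4 * Cmod iota4 = 1) by (rewrite <- Cmod_mult, Hi; apply Cmod_m1). nra. }
  exists 3. split. lra. intros b f Hq Hf Hs.
  assert (forall t, Theta 4 chi f t = phi 4 f 1 t - phi 4 f 3 t)%C as ET.
  { intros t. unfold Theta. simpl csum. simpl Z.of_nat. rewrite H0, H1, H2, H3. ring. }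
  assert (forall t, Psi 4 chi f t = phi 4 f 1 t + phi 4 f 3 t)%C as EP.
  { intros t. unfold Psi. simpl csum. simpl Z.of_nat. rewrite H0, H1, H2, H3. ring. }
  set (P := fun t => (phi 4 f 0 t + phi 4 f 2 t)%C).
  (* By the sign condition the odd exponents lie in one residue class modulo
     4. *)
  assert (forall t, in_H t -> phi 4 f 2 t - phi 4 f 0 t = ep * iota4 * Theta 4 chi f t)%C as Hodd.
  { intros t Ht.
    set (w := fun j : nat => match j return C with O => (-(1))%C | S (S O) => RtoC 1 | _ => RtoC 0 end).
    set (w' := fun j : nat => match j return C with S O => (ep * iota4)%C | S (S (S O)) => (- (ep * iota4))%C | _ => RtoC 0 end).
    pose proof (comb_eq 4 b f w w' t ltac:(lia) Hq Ht) as E.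
    assert (csum (fun j => w j * phi 4 f (Z.of_nat j) t)%C 4 = phi 4 f 2 t - phi 4 f 0 t)%C as E1.
    { simpl csum. simpl Z.of_nat. unfold w. ring. }
    assert (csum (fun j => w' j * phi 4 f (Z.of_nat j) t)%C 4 = ep * iota4 * Theta 4 chi f t)%C as E2.
    { rewrite ET. simpl csum. simpl Z.of_nat. unfold w'. ring. }
    rewrite <- E1, <- E2. apply E. clear E E1 E2. intros n.
    assert (forall j, e2pi (RtoC (INR j) / RtoC (INR 4)) ^ n = (iota4 ^ n) ^ j)%C as Ej.
    { intros j. rewrite <- Cpow_mult_r, Nat.mul_comm, Cpow_mult_r. f_equal. rewrite iota4_alt, <- e2pi_pow. f_equal.
      rewrite (INR_IZR_INZ 4). simpl Z.of_nat. field. }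
    rewrite (csum_ext (fun j => w j * e2pi (RtoC (INR j) / RtoC (INR 4)) ^ n)%C (fun j => w j * (iota4 ^ n) ^ j)%C) by (intros; now rewrite Ej).
    rewrite (csum_ext (fun j => w' j * e2pi (RtoC (INR j) / RtoC (INR 4)) ^ n)%C (fun j => w' j * (iota4 ^ n) ^ j)%C) by (intros; now rewrite Ej).
    simpl csum. unfold w, w'. set (x := (iota4 ^ n)%C).
    assert (n = 4 * (n / 4) + n mod 4)%nat as Ed by (apply Nat.div_mod; lia).
    pose proof (Nat.mod_upper_bound n 4 ltac:(lia)) as Hb.
    assert (x = iota4 ^ (n mod 4))%C as Ex.
    { unfold x. rewrite Ed at 1. rewrite Cpow_add_r, Cpow_mult_r.
      replace (iota4 ^ 4)%C with ((iota4 * iota4) * (iota4 * iota4))%C by (simpl; ring). rewrite Hi.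
      replace (-(1) * -(1))%C with (RtoC 1) by ring. rewrite Cpow_1_l. ring. }
    assert (chi (Z.of_nat n) = chi (Z.of_nat (n mod 4))) as Emod.
    { rewrite Ed at 1. replace (Z.of_nat (4 * (n / 4) + n mod 4)) with (Z.of_nat (n mod 4) + Z.of_nat (n / 4) * 4)%Z by lia.
      apply chi_period_mul. apply Hr. }
    pose proof (Hs n) as Hsn. rewrite Emod in Hsn.
    assert (iota4 ^ 2 = -(1))%C as I2 by (simpl; rewrite <- Hi; ring).
    assert (iota4 ^ 3 = - iota4)%C as I3 by (replace (iota4 ^ 3)%C with (iota4 * iota4 * iota4)%C by (simpl; ring); rewrite Hi; ring).
    clearbody x. clear Emod Ed.
    destruct (n mod 4)%nat as [|[|[|[|m]]]]; try lia.
    - simpl in Ex. rewrite Ex. ring.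
    - simpl in Ex. replace (iota4 * 1)%C with iota4 in Ex by ring. rewrite Ex.
      simpl Z.of_nat in Hsn. rewrite H1 in Hsn. assert (b n = ep * b n)%C as Hb1.
      { transitivity (1 * b n)%C. ring. apply Hsn. intros E'. apply RtoC_inj in E'. lra. }
      replace ((0 + -(1) * 1 + 0 * (iota4 * 1) + 1 * (iota4 * (iota4 * 1)) + 0 * (iota4 * (iota4 * (iota4 * 1)))) * b n)%C
        with ((-(1) + iota4 * iota4) * b n)%C by ring.
      replace ((0 + 0 * 1 + ep * iota4 * (iota4 * 1) + 0 * (iota4 * (iota4 * 1)) + - (ep * iota4) * (iota4 * (iota4 * (iota4 * 1)))) * b n)%C
        with ((iota4 * iota4 - (iota4 * iota4) * (iota4 * iota4)) * (ep * b n))%C by ring.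
      rewrite <- Hb1, Hi. ring.
    - rewrite Ex, I2. ring.
    - rewrite Ex, I3.
      simpl Z.of_nat in Hsn. rewrite H3 in Hsn. assert (-(1) * b n = ep * b n)%C as Hb1.
      { apply Hsn. intros E'. apply (f_equal fst) in E'. simpl in E'. lra. }
      replace ((0 + -(1) * 1 + 0 * (- iota4 * 1) + 1 * (- iota4 * (- iota4 * 1)) + 0 * (- iota4 * (- iota4 * (- iota4 * 1)))) * b n)%C
        with ((-(1) + iota4 * iota4) * b n)%C by ring.
      replace ((0 + 0 * 1 + ep * iota4 * (- iota4 * 1) + 0 * (- iota4 * (- iota4 * 1)) + - (ep * iota4) * (- iota4 * (- iota4 * (- iota4 * 1)))) * b n)%C
        with ((- (iota4 * iota4) + (iota4 * iota4) * (iota4 * iota4)) * (ep * b n))%C by ring.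
      rewrite <- Hb1, Hi. ring. }
  assert (forall j t, in_H t -> phi 4 f (j + 4) t = phi 4 f j t) as Hper by (intros; apply (phi_addN 4 k chi f); auto; lia).
  assert (forall t, P (t + 1)%C = Psi 4 chi f t) as HP1.
  { intros t. unfold P. rewrite EP. change (RtoC 1) with (ZtoC 1). now rewrite !phi_T. }
  assert (forall t, in_H t -> Psi 4 chi f (t + 1)%C = P t) as HP2.
  { intros t Ht. unfold P. rewrite EP. change (RtoC 1) with (ZtoC 1). rewrite !phi_T. simpl (1 + 1)%Z. simpl (3 + 1)%Z.
    replace (phi 4 f 4 t) with (phi 4 f 0 t). ring. symmetry. apply (Hper 0%Z); auto. }
  assert (forall t, in_H t -> Theta 4 chi f (t + 1)%C = ep * iota4 * Theta 4 chi f t)%C as HT1.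
  { intros t Ht. rewrite <- Hodd by auto. rewrite ET. change (RtoC 1) with (ZtoC 1). rewrite !phi_T. simpl (1 + 1)%Z. simpl (3 + 1)%Z.
    replace (phi 4 f 4 t) with (phi 4 f 0 t). ring. symmetry. apply (Hper 0%Z); auto. }
  (* With [T] the translation by [1] and [S] the inversion, [S] and [T S T S
     T] act in the same way; each factor takes one of [P], [Psi], [Theta] to
     another. *)
  assert (forall t, in_H t -> P (- / t)%C = (- t) ^ k * (ep * iota4) * P t)%C as HPS.
  { intros t Ht. pose proof (in_H_neq0 _ Ht) as Ht0.
    assert (in_H (t + 1)%C) as Ht1 by (apply (in_H_addZ t 1); auto). pose proof (in_H_neq0 _ Ht1) as Ht10.
    set (w := (- / (t + 1) + 1)%C).
    assert (in_H w) as Hw by (apply (in_H_addZ _ 1), in_H_inv; auto).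
    assert (w = t / (t + 1))%C as Ew by (unfold w; field; auto).
    replace (- / t)%C with ((- / w) + 1)%C by (rewrite Ew; field; auto).
    rewrite HP1, (Psi_S 4 k chi f) by (auto; lia).
    unfold w at 2. rewrite HT1 by (apply in_H_inv; auto).
    rewrite (Theta_S 4 k chi f) by (auto; lia). rewrite HP2 by auto.
    replace ((- w) ^ k * (ep * iota4 * ((t + 1) ^ k * P t)))%C with (((- w) ^ k * (t + 1) ^ k) * (ep * iota4) * P t)%C by ring.
    rewrite <- Cpow_mult_l. replace (- w * (t + 1))%C with (- t)%C by (rewrite Ew; field; auto). reflexivity. }
  assert (forall t B, in_H t -> majorant b (Im t / INR 4) B ->
     Cmod (P (- / t)%C) <= 2 * B * Cmod t ^ k /\ Cmod (ep * iota4 * Theta 4 chi f (- / t))%C <= 4 * B * Cmod t ^ k) as Hbd.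
  { intros t B Ht HB. assert (0 <= Cmod t ^ k) by (apply pow_le, Cmod_ge_0). split.
    - rewrite HPS, !Cmod_mult, Cmod_pow, Cmod_opp, Hepm, Him by auto.
      assert (Cmod (P t) <= 2 * B).
      { unfold P. eapply Rle_trans. apply Cmod_triangle.
        pose proof (phi_bound 4 b f 0 t B ltac:(lia) Hq Ht HB). pose proof (phi_bound 4 b f 2 t B ltac:(lia) Hq Ht HB). lra. }
      nra.
    - rewrite (Theta_S 4 k chi f), !Cmod_mult, Cmod_pow, Hepm, Him by (auto; lia).
      destruct (Theta_bound 4 chi b f t B Hr ltac:(lia) Hq Ht HB) as [_ h]. simpl (INR 4) in h. nra. }
  split; intros t B Ht HB; destruct (Hbd t B Ht HB) as [B1 B2]; pose proof (Hodd _ (in_H_inv _ Ht)) as Ho.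
  - replace (phi 4 f 0 (- / t)%C) with (/ 2 * (P (- / t) + - (ep * iota4 * Theta 4 chi f (- / t))))%C by (rewrite <- Ho; unfold P; field).
    rewrite Cmod_mult, Cmod_inv, Cmod_R, Rabs_pos_eq by (try lra; intros E; apply RtoC_inj in E; lra).
    pose proof (Cmod_triangle (P (- / t)%C) (- (ep * iota4 * Theta 4 chi f (- / t)))%C) as Htr. rewrite Cmod_opp in Htr. lra.
  - replace (phi 4 f 2 (- / t)%C) with (/ 2 * (P (- / t) + (ep * iota4 * Theta 4 chi f (- / t))))%C by (rewrite <- Ho; unfold P; field).
    rewrite Cmod_mult, Cmod_inv, Cmod_R, Rabs_pos_eq by (try lra; intros E; apply RtoC_inj in E; lra).
    pose proof (Cmod_triangle (P (- / t)%C) (ep * iota4 * Theta 4 chi f (- / t))%C) as Htr. lra.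
Qed.

Lemma cusp_at_infinity : forall N k chi C0 b f a b' c d z B, (0 < N)%nat -> real_character (Z.of_nat N) chi -> modular N k chi f ->
  qseries b f -> 1 <= C0 -> (a * d - b' * c = 1)%Z -> (Z.of_nat N | c)%Z -> in_H z -> majorant b (Im z / (INR N * INR N)) B ->
  Cmod (f (moebius a b' c d z)) <= C0 * Cmod (automorphy c d z) ^ k * B.
Proof.
  intros N k chi C0 b f a b' c d z B HN Hr Hf Hq HC Hdet Hc Hz HB. rewrite (Hf a b' c d) by auto.
  rewrite !Cmod_mult, Cmod_pow. pose proof (Cmod_chi_le _ chi d Hr).
  assert (1 <= INR N) as HN1 by (change 1 with (INR 1); apply le_INR; lia).
  assert (Cmod (f z) <= B).
  { apply (majorant_bound b f z B); auto. apply (majorant_incr b (Im z / (INR N * INR N))); auto.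
    unfold in_H in Hz. assert (1 <= INR N * INR N) by nra. set (NN := INR N * INR N) in *.
    apply Rmult_le_reg_r with NN. lra. replace (Im z / NN * NN) with (Im z) by (field; lra). nra. }
  pose proof (Cmod_ge_0 (f z)). pose proof (Cmod_ge_0 (chi d)).
  assert (0 <= Cmod (automorphy c d z) ^ k) by (apply pow_le, Cmod_ge_0). set (m := Cmod (automorphy c d z) ^ k) in *.
  assert (0 <= m * B) by (apply Rmult_le_pos; auto; eapply majorant_nonneg; eauto).
  apply Rle_trans with (1 * m * B); [|nra].
  apply Rmult_le_compat; auto. now apply Rmult_le_pos. apply Rmult_le_compat_r; auto.
Qed.

(** When [c] is prime to [N], the matrix is an element of Gamma_0(N) times the
    inversion times a translation, and [f] after inversion is [phi 0]. *)
Lemma cusp_at_zero : forall N k chi C0 b f a b' c d z B, (0 < N)%nat -> real_character (Z.of_nat N) chi -> modular N k chi f ->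
  1 <= C0 -> phi_controlled N k C0 0 b f -> (a * d - b' * c = 1)%Z -> Z.gcd c (Z.of_nat N) = 1%Z -> in_H z ->
  majorant b (Im z / (INR N * INR N)) B ->
  Cmod (f (moebius a b' c d z)) <= C0 * Cmod (automorphy c d z) ^ k * B.
Proof.
  intros N k chi C0 b f a b' c d z B HN Hr Hf HC Hphi Hdet Hc Hz HB.
  destruct (Zis_gcd_bezout c (Z.of_nat N) 1) as [u v Huv]. { rewrite <- Hc. apply Zgcd_is_gcd. }
  set (l := (u * d)%Z).
  set (y := (z + ZtoC l)%C). assert (in_H y) as Hy by now apply in_H_addZ.
  pose proof (in_H_neq0 _ Hy) as Hy0. pose proof (in_H_inv _ Hy) as Hy'.
  assert (- (b' - a * l) * c - a * - (d - c * l) = 1)%Z as Hdet' by (rewrite <- Hdet; ring).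
  pose proof (automorphy_neq0 _ _ _ _ _ Hdet Hz) as Hne.
  assert (automorphy (- (d - c * l)) c (- / y)%C = automorphy c d z / y)%C as Ea.
  { unfold automorphy. rewrite ZtoC_opp, ZtoC_sub, ZtoC_mul. unfold y. field. exact Hy0. }
  replace (moebius a b' c d z) with (moebius (- (b' - a * l)) a (- (d - c * l)) c (- / y)).
  2:{ unfold moebius. rewrite Ea.
      assert (ZtoC (- (b' - a * l)) * - / y + ZtoC a = (ZtoC a * z + ZtoC b') / y)%C as E.
      { rewrite ZtoC_opp, ZtoC_sub, ZtoC_mul. unfold y. field. exact Hy0. }
      rewrite E. field. auto. }
  rewrite (Hf (- (b' - a * l))%Z a (- (d - c * l))%Z c); auto.
  2:{ exists (- v * d)%Z. unfold l. transitivity (- (d * (u * c + v * Z.of_nat N) - c * (u * d)))%Z. rewrite Huv; ring. ring. }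
  rewrite !Cmod_mult, Cmod_pow, Ea, Cmod_div by auto.
  pose proof (ZtoC_neq0 (Z.of_nat N) ltac:(lia)) as HnC.
  set (w := (y / ZtoC (Z.of_nat N))%C).
  assert (INR N <> 0) as HNR by (apply not_0_INR; lia).
  assert (0 < INR N) as HNp by (apply lt_0_INR; auto).
  assert (in_H w) as Hw.
  { unfold w. replace y with (z + ZtoC l)%C by reflexivity. now apply in_H_phi. }
  pose proof (in_H_neq0 _ Hw) as Hw0.
  assert (phi N f 0 (- / w)%C = f (- / y)%C) as Ef.
  { unfold phi. f_equal. rewrite ZtoC_0. unfold w. field. auto. }
  rewrite <- Ef.
  assert (Im w / INR N = Im z / (INR N * INR N)) as EI.
  { unfold w, y. rewrite Im_phi by auto. field. auto. }
  pose proof (Hphi w B Hw ltac:(rewrite EI; auto)) as H1.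
  assert (Cmod w = Cmod y / INR N) as Ew.
  { unfold w. rewrite Cmod_div, ZtoC_nat, Cmod_R, Rabs_pos_eq by (auto; lra). reflexivity. }
  rewrite Ew in H1.
  assert (0 < Cmod y) as Hym by now apply Cmod_gt_0.
  pose proof (majorant_nonneg _ _ _ HB) as HB0.
  pose proof (Cmod_chi_le _ chi c Hr) as Hch. pose proof (Cmod_ge_0 (chi c)).
  pose proof (Cmod_ge_0 (automorphy c d z)) as Ham.
  assert (1 <= INR N) as HN1 by (change 1 with (INR 1); apply le_INR; lia).
  set (m := Cmod (automorphy c d z)) in *. set (t := Cmod y) in *.
  assert (0 <= (m / t) ^ k) by (apply pow_le, Rmult_le_pos; auto; left; now apply Rinv_0_lt_compat).
  apply Rle_trans with (1 * (m / t) ^ k * (C0 * (t / INR N) ^ k * B)).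
  { apply Rmult_le_compat; auto. now apply Rmult_le_pos. apply Cmod_ge_0. now apply Rmult_le_compat_r. }
  assert ((m / t) ^ k * (t / INR N) ^ k <= m ^ k) as Hk.
  { rewrite <- Rpow_mult_distr. apply pow_incr. replace (m / t * (t / INR N)) with (m / INR N) by (field; lra).
    split. apply Rmult_le_pos; auto. left; now apply Rinv_0_lt_compat.
    apply Rmult_le_reg_r with (INR N); auto. unfold Rdiv. rewrite Rmult_assoc, Rinv_l by auto. nra. }
  replace (1 * (m / t) ^ k * (C0 * (t / INR N) ^ k * B)) with (C0 * ((m / t) ^ k * (t / INR N) ^ k) * B) by ring.
  apply Rmult_le_compat_r; auto. apply Rmult_le_compat_l; lra.
Qed.

Lemma cusp_controlled_prime : forall (p k : nat) chi g ep, prime (Z.of_nat p) -> (2 < p)%nat ->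
  real_character (Z.of_nat p) chi -> gauss_sum p chi g -> (ep * ep = 1)%C ->
  exists C0, 0 <= C0 /\ forall b f, qseries b f -> modular p k chi f -> sign_supported chi ep b ->
    cusp_controlled p k C0 b f.
Proof.
  intros p k chi g ep Hp Hp2 Hr HG Hep.
  destruct (phi_controlled_prime p k chi g ep Hp Hp2 Hr HG Hep) as [C0 [HC H]].
  exists C0. split. lra. intros b f Hq Hf Hs a b' c d z B Hdet Hz HB.
  destruct (Zdivide_dec (Z.of_nat p) c) as [h|h].
  - apply (cusp_at_infinity p k chi C0 b f); auto. lia.
  - apply (cusp_at_zero p k chi C0 b f); auto. lia.
    apply Zgcd_1_rel_prime, rel_prime_sym. now apply prime_rel_prime.
Qed.

(** Besides the cusps at infinity and zero there is one with [c] twice an odd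
    number; it is reached through [phi 2]. *)
Lemma cusp_controlled_4 : forall k chi ep, real_character 4 chi -> chi 3%Z = (-(1))%C -> (ep * ep = 1)%C ->
  exists C0, 0 <= C0 /\ forall b f, qseries b f -> modular 4 k chi f -> sign_supported chi ep b ->
    cusp_controlled 4 k C0 b f.
Proof.
  intros k chi ep Hr H3 Hep.
  destruct (phi_controlled_4 k chi ep Hr H3 Hep) as [C0 [HC H]].
  exists C0. split. lra. intros b f Hq Hf Hs a b' c d z B Hdet Hz HB.
  destruct (H b f Hq Hf Hs) as [P0 P2]. 
  pose proof (Z.mod_pos_bound c 4 ltac:(lia)) as Hb. pose proof (Z_div_mod_eq_full c 4) as Emod.
  assert (c mod 4 = 0 \/ c mod 4 = 2 \/ (c mod 4 = 1 \/ c mod 4 = 3))%Z as [h|[h|h]] by lia.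
  - apply (cusp_at_infinity 4 k chi C0 b f); auto; try lia. exists (c / 4)%Z. simpl Z.of_nat. lia.
  - set (y := (2 * z + 1)%C).
    assert (Im (z + 1/2)%C = Im z) as EIm.
    { replace (1/2)%C with (RtoC (1/2)) by (rewrite RtoC_div by lra; reflexivity).
      destruct z as [x t]. unfold Im. simpl. ring. }
    assert (in_H (z + 1/2)%C) as Hw by (unfold in_H in *; rewrite EIm; auto).
    pose proof (in_H_neq0 _ Hw) as Hw0.
    assert (y <> RtoC 0) as Hy0.
    { intros E. apply Hw0. replace (z + 1/2)%C with (/ 2 * (2 * z + 1))%C by field. fold y. rewrite E. ring. }
    set (zz := (z / y)%C).
    assert ((a - 2 * b') * d - b' * (c - 2 * d) = 1)%Z as Hdet' by (rewrite <- Hdet; ring).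
    pose proof (automorphy_neq0 _ _ _ _ _ Hdet Hz) as Hne.
    assert (automorphy (c - 2 * d) d zz = automorphy c d z / y)%C as Ea.
    { unfold automorphy, zz. rewrite ZtoC_sub, ZtoC_mul. change (ZtoC 2) with (RtoC 2). unfold y. field. exact Hy0. }
    assert (phi 4 f 2 (- / (z + 1/2)) = f zz) as Ef.
    { unfold phi. f_equal. unfold zz, y. simpl Z.of_nat. change (ZtoC 4) with (RtoC 4). change (ZtoC 2) with (RtoC 2). 
      assert (2 * z + 1 <> 0)%C by exact Hy0. field. auto. }
    replace (moebius a b' c d z) with (moebius (a - 2 * b') b' (c - 2 * d) d zz).
    2:{ unfold moebius. rewrite Ea.
        assert (ZtoC (a - 2 * b') * zz + ZtoC b' = (ZtoC a * z + ZtoC b') / y)%C as E.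
        { rewrite ZtoC_sub, ZtoC_mul. change (ZtoC 2) with (RtoC 2). unfold zz, y. field. exact Hy0. }
        rewrite E. field. auto. }
    assert (in_H zz) as Hzz.
    { replace zz with (moebius 1 0 2 1 z). apply moebius_in_H; auto. 
      unfold moebius, automorphy, zz, y. rewrite ZtoC_0, ZtoC_1. change (ZtoC 2) with (RtoC 2). f_equal. ring. }
    rewrite (Hf (a - 2 * b')%Z b' (c - 2 * d)%Z d); auto.
    2:{ simpl Z.of_nat. assert (Z.odd (a * d - b' * c) = true) as Ho by (rewrite Hdet; reflexivity).
        assert (exists e, d = 2 * e + 1)%Z as [e He].
        { exists (d / 2)%Z. pose proof (Z_div_mod_eq_full d 2). pose proof (Z.mod_pos_bound d 2 ltac:(lia)).
          assert (d mod 2 <> 0)%Z; [|lia]. intros E0.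
          assert (c = 2 * (2 * (c / 4) + 1))%Z as E2 by lia.
          assert (d = 2 * (d / 2))%Z as E3 by lia. rewrite E2, E3 in Hdet.
          assert (2 * (a * (d / 2) - b' * (2 * (c / 4) + 1)) = 1)%Z by lia. lia. }
        exists (c / 4 - e)%Z. lia. }
    rewrite <- Ef, !Cmod_mult, Cmod_pow, Ea, Cmod_div by auto.
    assert (majorant b (Im (z + 1/2)%C / INR 4) B) as HB'.
    { apply (majorant_incr b (Im z / (INR 4 * INR 4))); auto.
      rewrite EIm. unfold in_H in Hz. simpl (INR 4). lra. }
    pose proof (P2 _ _ Hw HB') as H1.
    assert (Cmod (z + 1/2)%C = Cmod y / 2) as Ew.
    { replace (z + 1/2)%C with (y / 2)%C by (unfold y; field). rewrite Cmod_div, Cmod_R, Rabs_pos_eq by (try lra; intros E; apply RtoC_inj in E; lra). reflexivity. }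
    rewrite Ew in H1.
    assert (0 < Cmod y) as Hym by now apply Cmod_gt_0.
    pose proof (majorant_nonneg _ _ _ HB) as HB0.
    pose proof (Cmod_chi_le _ chi d Hr) as Hch. pose proof (Cmod_ge_0 (chi d)).
    pose proof (Cmod_ge_0 (automorphy c d z)) as Ham.
    set (m := Cmod (automorphy c d z)) in *. set (t := Cmod y) in *.
    assert (0 <= (m / t) ^ k) by (apply pow_le, Rmult_le_pos; auto; left; now apply Rinv_0_lt_compat).
    apply Rle_trans with (1 * (m / t) ^ k * (C0 * (t / 2) ^ k * B)).
    { apply Rmult_le_compat; auto. now apply Rmult_le_pos. apply Cmod_ge_0. now apply Rmult_le_compat_r. }
    assert ((m / t) ^ k * (t / 2) ^ k <= m ^ k) as Hk.
    { rewrite <- Rpow_mult_distr. apply pow_incr. replace (m / t * (t / 2)) with (m / 2) by (field; lra). lra. }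
    replace (1 * (m / t) ^ k * (C0 * (t / 2) ^ k * B)) with (C0 * ((m / t) ^ k * (t / 2) ^ k) * B) by ring.
    apply Rmult_le_compat_r; auto. apply Rmult_le_compat_l; lra.
  - apply (cusp_at_zero 4 k chi C0 b f); auto; try lia.
    simpl Z.of_nat. apply Zgcd_1_rel_prime, bezout_rel_prime. destruct h as [h|h].
    + apply Bezout_intro with 1%Z (- (c / 4))%Z. lia.
    + apply Bezout_intro with (-1)%Z (c / 4 + 1)%Z. lia.
Qed.

(** * Linear algebra of reduced forms *)

(** The orders of the elements of [V]. A reduced form vanishes at those beyond
    its own order. *)
Definition leading (V : (Z -> C) -> Prop) (n : Z) : Prop :=
  exists b, V b /\ (forall j, (j < n)%Z -> b j = RtoC 0) /\ b n = RtoC 1.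

(** Abstracted from modular forms: the elimination concerns a space [V] of
    coefficient sequences. *)
Definition reduced (V : (Z -> C) -> Prop) (sN : Z -> Z) (m : Z) (a : Z -> C) : Prop :=
  V a /\ (forall n, (n < m)%Z -> a n = RtoC 0) /\ a m = (1 / ZtoC (sN m))%C /\
  forall n, (m < n)%Z -> a n <> RtoC 0 -> ~ leading V n.

Definition in_multiples (d : Z) (x : C) : Prop := exists z, x = (ZtoC d * ZtoC z)%C.

Section Reduced.

Variable V : (Z -> C) -> Prop.
Hypothesis V_lin : forall a b c, V a -> V b -> V (fun n => a n + c * b n)%C.
Hypothesis V_low : forall a, V a -> exists n0, forall n, (n < n0)%Z -> a n = RtoC 0.
Variable B0 : Z.
Hypothesis V_van : forall a, V a -> (forall n, (n < B0)%Z -> a n = RtoC 0) -> forall n, a n = RtoC 0.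
Variable sN : Z -> Z.
Hypothesis sN_pos : forall m, sN m <> 0%Z.

Lemma leading_lt : forall n, leading V n -> (n < B0)%Z.
Proof.
  intros n [b [H1 [H2 H3]]]. destruct (Z_lt_ge_dec n B0) as [h|h]; auto. exfalso.
  assert (b n = RtoC 0) as E. { apply (V_van b); auto. intros j Hj. apply H2. lia. }
  rewrite H3 in E. apply RtoC_inj in E. lra.
Qed.

Lemma leading_of_nonzero : forall a m, V a -> (forall n, (n < m)%Z -> a n = RtoC 0) -> a m <> RtoC 0 -> leading V m.
Proof.
  intros a m Ha Hlow Hm. exists (fun n => a n + (/ a m - 1) * a n)%C. split; [|split].
  - now apply V_lin.
  - intros j Hj. rewrite (Hlow j Hj). ring.
  - field. auto.
Qed.

(** Gaussian elimination at the leading exponents from [M] up to [B0]. *)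
Lemma eliminate : forall j : nat, forall M x, M = (B0 - Z.of_nat j)%Z -> V x ->
  exists y, V y /\ (forall n, (n < M)%Z -> y n = x n) /\ forall n, (M <= n)%Z -> leading V n -> y n = RtoC 0.
Proof.
  induction j; intros M x HM Hx.
  - exists x. repeat split; auto. intros n Hn Hl. apply leading_lt in Hl. lia.
  - destruct (classic (leading V M)) as [[g [G1 [G2 G3]]]|Hn].
    + destruct (IHj (M + 1)%Z (fun n => x n + (- x M) * g n)%C) as [y [Y1 [Y2 Y3]]]. lia. now apply V_lin.
      exists y. split; [auto|split].
      * intros n Hn. rewrite Y2 by lia. rewrite G2 by lia. ring.
      * intros n Hn Hl. destruct (Z.eq_dec n M) as [->|]. rewrite Y2 by lia. rewrite G3. ring.
        apply Y3; auto; lia.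
    + destruct (IHj (M + 1)%Z x) as [y [Y1 [Y2 Y3]]]; auto. lia.
      exists y. split; [auto|split]. intros n Hn'; apply Y2; lia.
      intros n Hn' Hl. destruct (Z.eq_dec n M) as [->|]. contradiction. apply Y3; auto; lia.
Qed.

(** Integrality is assumed for the reduced forms that exist, so their
    existence at every leading exponent has to be proved. *)
Lemma reduced_exists : forall m, leading V m -> exists a, reduced V sN m a.
Proof.
  intros m Hm. pose proof (leading_lt m Hm) as Hlt. destruct Hm as [g [G1 [G2 G3]]].
  destruct (eliminate (Z.to_nat (B0 - (m + 1))) (m + 1)%Z g) as [y [Y1 [Y2 Y3]]]; auto. lia.
  pose proof (ZtoC_neq0 _ (sN_pos m)) as Hs.
  exists (fun n => y n + (/ ZtoC (sN m) - 1) * y n)%C. split; [|split; [|split]].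
  - now apply V_lin.
  - intros n Hn. rewrite Y2, G2 by lia. ring.
  - rewrite Y2, G3 by lia. field. auto.
  - intros n Hn Hne Hl. apply Hne. rewrite Y3 by (auto; lia). ring.
Qed.

Hypothesis integrality : forall m a, reduced V sN m a -> forall n, exists z, (ZtoC (sN m) * a n)%C = ZtoC z.

(** Subtract the multiple [x(m) s(m)] of the reduced form of order [m], where
    [m] is the order of [x]. This does not change the coefficients at the
    other leading exponents, so the hypothesis persists while the order
    increases to [B0]. *)
Lemma multiples_of_leading : forall d (j : nat) x, V x -> (forall n, (n < B0 - Z.of_nat j)%Z -> x n = RtoC 0) ->
  (forall n, leading V n -> in_multiples d (x n)) -> forall n, in_multiples d (x n).
Proof.
  intros d. induction j; intros x Hx Hlow HL n.
  - rewrite (V_van x Hx) by (intros; apply Hlow; lia). exists 0%Z. rewrite ZtoC_0. ring.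
  - set (m := (B0 - Z.of_nat (S j))%Z) in *.
    destruct (classic (x m = RtoC 0)) as [E|E].
    + apply IHj; auto. intros i Hi. destruct (Z.eq_dec i m) as [->|]; auto. apply Hlow. lia.
    + assert (leading V m) as Hm by (apply (leading_of_nonzero x); auto).
      destruct (reduced_exists m Hm) as [a Ha]. pose proof (integrality m a Ha) as Hint.
      destruct Ha as [A1 [A2 [A3 A4]]]. pose proof (ZtoC_neq0 _ (sN_pos m)) as Hs.
      destruct (HL m Hm) as [w Hw].
      set (x' := fun i => (x i + (- (x m * ZtoC (sN m))) * a i)%C).
      assert (in_multiples d (x' n)) as [v Hv].
      { apply IHj.
        - unfold x'. now apply V_lin.
        - intros i Hi. unfold x'. destruct (Z.eq_dec i m) as [->|].
          rewrite A3. field. auto. rewrite Hlow, A2 by lia. ring.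
        - intros i Hi. unfold x'. destruct (Z.lt_trichotomy i m) as [h|[h|h]].
          + rewrite A2 by auto. replace (x i + - (x m * ZtoC (sN m)) * 0)%C with (x i) by ring. auto.
          + subst i. exists 0%Z. rewrite A3, ZtoC_0. field. auto.
          + replace (a i) with (RtoC 0). replace (x i + - (x m * ZtoC (sN m)) * 0)%C with (x i) by ring. auto.
            symmetry. apply NNPP. intros h'. apply (A4 i h h'). auto. }
      destruct (Hint n) as [u Hu]. exists (v + w * u)%Z.
      assert (x n = x' n + x m * (ZtoC (sN m) * a n))%C as En by (unfold x'; ring).
      rewrite En, Hv, Hu, Hw, ZtoC_add, ZtoC_mul. ring.
Qed.

(** Apply [multiples_of_leading] to [E - E_0 s(0) f_0]. The factor [D1] allows
    [E] to be an integral multiple of a form with constant term prime to [D]. *)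
Lemma reduced_divisibility : forall a0 E D1 D T, reduced V sN 0 a0 -> V E -> D1 <> 0%Z ->
  (forall n, n <> 0%Z -> in_multiples (D1 * D) (E n)) -> E 0%Z = (ZtoC D1 * ZtoC T)%C -> Z.gcd D T = 1%Z ->
  forall n, (0 < n)%Z -> int_divides D (ZtoC (sN 0) * a0 n)%C.
Proof.
  intros a0 E D1 D T Ha HE HD1 HEn HE0 Hg n Hn.
  pose proof (integrality 0 a0 Ha) as Hint. destruct Ha as [A1 [A2 [A3 A4]]].
  pose proof (ZtoC_neq0 _ (sN_pos 0)) as Hs.
  set (x := fun i => (E i + (- (E 0%Z * ZtoC (sN 0))) * a0 i)%C).
  assert (V x) as Hx by (unfold x; now apply V_lin).
  destruct (V_low x Hx) as [n0 Hn0].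
  assert (forall i, leading V i -> in_multiples (D1 * D) (x i)) as HL.
  { intros i Hi. unfold x. destruct (Z.lt_trichotomy i 0) as [h|[h|h]].
    - rewrite A2 by auto. replace (E i + - (E 0%Z * ZtoC (sN 0)) * 0)%C with (E i) by ring. apply HEn. lia.
    - subst i. exists 0%Z. rewrite A3, ZtoC_0. field. auto.
    - replace (a0 i) with (RtoC 0). replace (E i + - (E 0%Z * ZtoC (sN 0)) * 0)%C with (E i) by ring. apply HEn; lia.
      symmetry. apply NNPP. intros h'. apply (A4 i h h'). auto. }
  destruct (multiples_of_leading (D1 * D) (Z.to_nat (B0 - Z.min n0 B0)) x Hx ltac:(intros; apply Hn0; lia) HL n) as [v Hv].
  destruct (HEn n ltac:(lia)) as [w Hw]. destruct (Hint n) as [z Hz].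
  exists z. split; auto.
  unfold x in Hv. rewrite Hw, HE0 in Hv.
  assert (ZtoC (D1 * (T * z)) = ZtoC (D1 * (D * (w - v))))%C as E1.
  { rewrite !ZtoC_mul, !ZtoC_sub. rewrite !ZtoC_mul in Hv. rewrite <- Hz.
    transitivity (ZtoC D1 * ZtoC D * ZtoC w - (ZtoC D1 * ZtoC D * ZtoC w + - (ZtoC D1 * ZtoC T * ZtoC (sN 0)) * a0 n))%C. ring.
    rewrite Hv. ring. }
  apply ZtoC_inj in E1. apply Z.mul_reg_l in E1; auto.
  apply (Z.gauss D T z); auto. exists (w - v)%Z. lia.
Qed.

End Reduced.

Definition lcomb (c : C) (f g : C -> C) (t : C) : C := (f t + c * g t)%C.

(** Expansions may be started at any sufficiently small exponent, which makes
    two of them comparable. *)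
Lemma laurent_from : forall h F a, laurent_expansion h F a -> exists n0, forall n1, (n1 <= n0)%Z ->
  (forall n, (n < n1)%Z -> a n = RtoC 0) /\
  forall tau, in_H tau -> cser (fun j => a (n1 + Z.of_nat j)%Z * e2pi (ZtoC (n1 + Z.of_nat j) * tau / ZtoC h))%C (F tau).
Proof.
  intros h F a [n0 [H0 H1]]. exists n0. intros n1 Hn. split. intros; apply H0; lia.
  intros tau Ht. specialize (H1 tau Ht). apply is_series_cser in H1. cbv zeta in H1.
  set (m := Z.to_nat (n0 - n1)).
  replace (F tau) with (csum (fun j => a (n1 + Z.of_nat j)%Z * e2pi (ZtoC (n1 + Z.of_nat j) * tau / ZtoC h))%C m + F tau)%C.
  - apply cser_head. eapply cser_ext; [|exact H1]. intros j. cbv beta.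
    replace (n1 + Z.of_nat (m + j))%Z with (n0 + Z.of_nat j)%Z by (unfold m; lia). reflexivity.
  - rewrite csum_eq0. ring. intros i Hi. rewrite H0 by (unfold m in Hi; lia). ring.
Qed.

Lemma laurent_lcomb : forall h F G a b c, laurent_expansion h F a -> laurent_expansion h G b ->
  laurent_expansion h (lcomb c F G) (fun n => a n + c * b n)%C.
Proof.
  intros h F G a b c Ha Hb. destruct (laurent_from h F a Ha) as [n1 H1]. destruct (laurent_from h G b Hb) as [n2 H2].
  destruct (H1 (Z.min n1 n2) ltac:(lia)) as [A1 A2]. destruct (H2 (Z.min n1 n2) ltac:(lia)) as [B1 B2].
  exists (Z.min n1 n2). split. intros n Hn. rewrite A1, B1 by auto. ring.
  intros tau Ht. apply is_series_cser. eapply cser_ext; [|apply cser_plus; [apply A2; auto|apply cser_scal, B2; auto]].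
  intros n. cbv beta zeta. ring.
Qed.

Lemma laurent_ext : forall h F G a, (forall t, in_H t -> F t = G t) -> laurent_expansion h F a -> laurent_expansion h G a.
Proof.
  intros h F G a HFG [n0 [H0 H1]]. exists n0. split; auto. intros tau Ht. rewrite <- HFG by auto. now apply H1.
Qed.

Lemma holomorphic_lcomb : forall c f g, holomorphic_on_H f -> holomorphic_on_H g -> holomorphic_on_H (lcomb c f g).
Proof.
  intros c f g Hf Hg tau Ht. destruct (Hf tau Ht) as [l Hl]. destruct (Hg tau Ht) as [m Hm].
  assert (is_derive (K := C_AbsRing) (V := C_NormedModule) (fun t => scal (K := C_AbsRing) (V := C_NormedModule) c (g t)) tau
     (scal (K := C_AbsRing) (V := C_NormedModule) c m)) as Hs.
  { unfold is_derive in *.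
    pose proof (filterdiff_scal_r_fct (K := C_AbsRing) (U := AbsRing_NormedModule C_AbsRing) (V := C_NormedModule)
      (F := locally (T := AbsRing_UniformSpace C_AbsRing) tau) c g _ Cmult_comm Hm) as H.
    refine (filterdiff_ext_lin _ _ _ H _). intros y.
    change ((c * (y * m))%C = (y * (c * m))%C). ring. }
  exists (plus (G := C_NormedModule) l (scal (K := C_AbsRing) (V := C_NormedModule) c m)).
  exact (is_derive_plus (K := C_AbsRing) (V := C_NormedModule) f _ tau l _ Hl Hs).
Qed.

Lemma slash_lcomb : forall k a b c d x f g t, slash k a b c d (lcomb x f g) t = lcomb x (slash k a b c d f) (slash k a b c d g) t.
Proof. intros. unfold slash, lcomb. ring. Qed.

Lemma in_A_eps_lcomb : forall N k chi chip eps f g a b c,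
  in_A_eps N k chi chip eps f a -> in_A_eps N k chi chip eps g b ->
  in_A_eps N k chi chip eps (lcomb c f g) (fun n => a n + c * b n)%C.
Proof.
  intros N k chi chip eps f g a b c [[F1 [F2 F3]] [F4 F5]] [[G1 [G2 G3]] [G4 G5]].
  split; [split; [|split]|split].
  - now apply holomorphic_lcomb.
  - intros a' b' c' d' Hdet. destruct (F2 _ _ _ _ Hdet) as [u Hu]. destruct (G2 _ _ _ _ Hdet) as [v Hv].
    exists (fun n => u n + c * v n)%C.
    apply (laurent_ext N (lcomb c (slash k a' b' c' d' f) (slash k a' b' c' d' g))).
    intros; now rewrite slash_lcomb. now apply laurent_lcomb.
  - intros a' b' c' d' Hdet Hc tau Ht. unfold lcomb. rewrite F3, G3 by auto. ring.
  - now apply laurent_lcomb.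
  - intros n p Hp Hd Hn. rewrite (F5 n p), (G5 n p) by auto. ring.
Qed.

(** * Coefficients of the Eisenstein form *)

(** The exponent [p^t m] is reached by [t] successive [p]-th powers and one
    [m]-th power. The divisibility of the coefficients by [p] is gained one
    [p]-th power at a time. *)
Fixpoint iterated_pow (p t : nat) (a : nat -> C) : nat -> C :=
  match t with O => a | S t' => iterated_pow p t' (series_pow a p) end.

Definition split_pow (p t m : nat) (a : nat -> C) : nat -> C := series_pow (iterated_pow p t a) m.

Lemma expn_iterated_pow : forall h p t a F, (0 < h)%Z -> expn h a F -> expn h (iterated_pow p t a) (fun z => F z ^ (p ^ t))%C.
Proof.
  intros h p t. induction t; intros a F Hh H; cbn [iterated_pow].
  - apply (expn_ext h a a F); auto. intros; simpl; ring.
  - apply (expn_ext h (iterated_pow p t (series_pow a p)) _ (fun z => (F z ^ p) ^ (p ^ t))%C); auto.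
    + intros z _. now rewrite <- Cpow_mult_r.
    + apply IHt; auto. now apply expn_pow.
Qed.

Lemma expn_split_pow : forall h p t m a F, (0 < h)%Z -> expn h a F -> expn h (split_pow p t m a) (fun z => F z ^ (p ^ t * m))%C.
Proof.
  intros h p t m a F Hh H. unfold split_pow.
  apply (expn_ext h (series_pow (iterated_pow p t a) m) _ (fun z => (F z ^ (p ^ t)) ^ m)%C); auto.
  - intros z _. now rewrite <- Cpow_mult_r.
  - apply expn_pow; auto. now apply expn_iterated_pow.
Qed.

Lemma expn_shift : forall N a F j, (0 < N)%nat -> expn (Z.of_nat N) a F ->
  expn (Z.of_nat N) (fun n => a n * e2pi (RtoC (INR j) / RtoC (INR N)) ^ n)%C (fun t => F (t + ZtoC (Z.of_nat j))%C).
Proof.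
  intros N a F j HN [[K [D [HK HA]]] HF].
  assert (INR N <> 0) as H0 by (apply not_0_INR; lia).
  assert (RtoC (INR N) <> RtoC 0) as H0C by (intros E; apply RtoC_inj in E; auto).
  split.
  - exists K, D. split; auto. intros n. rewrite Cmod_mult, Cmod_pow, <- RtoC_div, Cmod_e2pi by auto. simpl.
    rewrite Rmult_0_r, Ropp_0, exp_0, pow1, Rmult_1_r. apply HA.
  - intros tau Ht. eapply cser_ext; [|apply HF; apply in_H_addZ; auto]. intros n. cbv beta.
    rewrite !ZtoC_nat. replace ((tau + RtoC (INR j)) / RtoC (INR N))%C with (tau / RtoC (INR N) + RtoC (INR j) / RtoC (INR N))%C by (field; auto).
    rewrite e2pi_add, Cpow_mult_l. ring.
Qed.

Section Coefficients.

Variables (N : nat) (chi : Z -> C) (g ep s : C) (p t m : nat).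
Hypothesis HN : (1 < N)%nat.
Hypothesis Hr : real_character (Z.of_nat N) chi.
Hypothesis HG : gauss_sum N chi g.
Hypothesis Hep : (ep * ep = 1)%C.

Let k := (p ^ t * m)%nat.
Let n0 := Z.of_nat N.

(** The scalar [s] clears the denominator of the constant term [1 - 2u/N]. *)
Definition scaled_eis_coef (u : nat) (v : Z) (n : nat) : C := (s * eis_coef N u v n)%C.

(** The factor [1 + ep chi(n)] makes these rows satisfy the sign condition
    term by term. *)
Definition unit_row_coef (u n : nat) : C :=
  (chi (Z.of_nat u) * (1 + ep * chi (Z.of_nat n)) * split_pow p t m (scaled_eis_coef u 0) n)%C.

Definition nonunit_row_coef (u n : nat) : C :=
  (ep / g * csum (fun v => chi (Z.of_nat v) * split_pow p t m (scaled_eis_coef u (Z.of_nat v)) n) N)%C.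

(** Grouped by the rows [u]. For a unit [u] the sum over [v] has been carried
    out; for the others it is kept and evaluated as a Gauss sum later. *)
Definition form_coef (n : nat) : C :=
  csum (fun u => if Z.eqb (Z.gcd (Z.of_nat u) (Z.of_nat N)) 1 then unit_row_coef u n else nonunit_row_coef u n) N.

Lemma scaled_eis_coef_expn : forall u v, (u < N)%nat -> nzvec n0 (Z.of_nat u) v ->
  expn n0 (scaled_eis_coef u v) (fun z => s * eis n0 (Z.of_nat u) v z)%C.
Proof. intros u v Hu Hv. unfold scaled_eis_coef, n0. apply expn_scal. now apply eis_expn. Qed.

Lemma unit_nz : forall u, Z.gcd u n0 = 1%Z -> ~ (n0 | u)%Z.
Proof. intros u. apply unit_not_dvd. unfold n0; lia. Qed.

(** For a unit [u], translation by [j] produces [eis_(u,uj)] from [eis_(u,0)],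
    so the sum over [v] multiplies the coefficient at [n] by a Gauss sum,
    which is [g chi(n)]. *)
Lemma unit_row_expn : forall u, (u < N)%nat -> Z.gcd (Z.of_nat u) n0 = 1%Z ->
  expn n0 (unit_row_coef u) (fun z => s ^ k / (ep * g) *
    (csum (fun v => chi (Z.of_nat v) * eis n0 (Z.of_nat u) (Z.of_nat v) z ^ k) N
     + ep * g * (chi (Z.of_nat u) * eis n0 (Z.of_nat u) 0 z ^ k)))%C.
Proof.
  intros u Hu Hg. destruct HG as [Hg0 HGs].
  assert (ep <> RtoC 0) as Hep0. { intros E. rewrite E in Hep. apply (f_equal fst) in Hep. simpl in Hep. lra. }
  assert (n0 <> 0%Z) as Hn0 by (unfold n0; lia).
  assert (forall v, nzvec n0 (Z.of_nat u) v) as Hnz by (intros v [h _]; revert h; now apply unit_nz).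
  pose proof (expn_split_pow n0 p t m _ _ ltac:(unfold n0; lia) (scaled_eis_coef_expn u 0 Hu (Hnz 0%Z))) as HY. fold k in HY.
  set (Y := split_pow p t m (scaled_eis_coef u 0)) in *.
  assert (expn n0 (fun n => csum (fun j => (chi (Z.of_nat u) * chi (Z.of_nat j)) * (Y n * e2pi (RtoC (INR j) / RtoC (INR N)) ^ n)) N)%C
    (fun z => csum (fun j => (chi (Z.of_nat u) * chi (Z.of_nat j)) * (s * eis n0 (Z.of_nat u) 0 (z + ZtoC (Z.of_nat j))) ^ k) N)%C) as H1.
  { apply (expn_csum n0 (fun j n => (chi (Z.of_nat u) * chi (Z.of_nat j)) * (Y n * e2pi (RtoC (INR j) / RtoC (INR N)) ^ n))%C
      (fun j z => (chi (Z.of_nat u) * chi (Z.of_nat j)) * (s * eis n0 (Z.of_nat u) 0 (z + ZtoC (Z.of_nat j))) ^ k)%C).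
    intros j _. apply (expn_scal n0 _ _ (fun z => (s * eis n0 (Z.of_nat u) 0 (z + ZtoC (Z.of_nat j))) ^ k)%C).
    apply (expn_shift N Y (fun z => (s * eis n0 (Z.of_nat u) 0 z) ^ k)%C); auto. lia. }
  pose proof (expn_plus _ _ _ _ _ (expn_scal n0 (/ (ep * g))%C _ _ H1) (expn_scal n0 (chi (Z.of_nat u)) _ _ HY)) as H2.
  refine (expn_ext _ _ _ _ _ _ _ H2).
  - intros n. unfold unit_row_coef. fold Y.
    rewrite (csum_ext _ (fun j => (chi (Z.of_nat u) * Y n) * (chi (Z.of_nat j) * e2pi (RtoC (INR j) / RtoC (INR N)) ^ n))%C) by (intros; ring).
    rewrite csum_scal, HGs.
    transitivity (chi (Z.of_nat u) * (1 + (/ ep) * chi (Z.of_nat n)) * Y n)%C. field; auto.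
    replace (/ ep)%C with ep. ring. transitivity (ep * ep * / ep)%C. field; auto. rewrite Hep. ring.
  - intros z Hz.
    set (F := fun v => (chi v * eis n0 (Z.of_nat u) v z ^ k)%C).
    assert (csum (fun v => F (Z.of_nat v)) N = csum (fun j => F (Z.of_nat u * Z.of_nat j + 0)%Z) N) as E1.
    { symmetry. apply csum_affine; auto. lia. intros j. unfold F. fold n0. rewrite eis_addN_r by auto. f_equal. apply Hr. }
    change (csum (fun v => chi (Z.of_nat v) * eis n0 (Z.of_nat u) (Z.of_nat v) z ^ k)%C N) with (csum (fun v => F (Z.of_nat v)) N).
    rewrite E1.
    rewrite (csum_ext (fun j => (chi (Z.of_nat u) * chi (Z.of_nat j) * (s * eis n0 (Z.of_nat u) 0 (z + ZtoC (Z.of_nat j))) ^ k)%C)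
       (fun j => s ^ k * F (Z.of_nat u * Z.of_nat j + 0)%Z)%C).
    2:{ intros j _. unfold F. rewrite Z.add_0_r, (proj1 (proj1 Hr)), eis_T, Cpow_mult_l.
        replace (0 + Z.of_nat j * Z.of_nat u)%Z with (Z.of_nat u * Z.of_nat j)%Z by ring. ring. }
    rewrite csum_scal, Cpow_mult_l. field. auto.
Qed.

Lemma nonunit_row_expn : forall u, (u < N)%nat -> Z.gcd (Z.of_nat u) n0 <> 1%Z ->
  expn n0 (nonunit_row_coef u) (fun z => s ^ k / (ep * g) *
    (csum (fun v => chi (Z.of_nat v) * eis n0 (Z.of_nat u) (Z.of_nat v) z ^ k) N
     + ep * g * (chi (Z.of_nat u) * eis n0 (Z.of_nat u) 0 z ^ k)))%C.
Proof.
  intros u Hu Hg. destruct HG as [Hg0 HGs].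
  assert (ep <> RtoC 0) as Hep0. { intros E. rewrite E in Hep. apply (f_equal fst) in Hep. simpl in Hep. lra. }
  assert (forall v, (v < N)%nat -> expn n0 (fun n => chi (Z.of_nat v) * split_pow p t m (scaled_eis_coef u (Z.of_nat v)) n)%C
    (fun z => chi (Z.of_nat v) * (s * eis n0 (Z.of_nat u) (Z.of_nat v) z) ^ k)%C) as Hv.
  { intros v _. destruct (classic (chi (Z.of_nat v) = RtoC 0)) as [h|h].
    - rewrite h. apply (expn_ext n0 (fun _ => RtoC 0) _ (fun _ => RtoC 0)); try (intros; ring). apply expn_zero.
    - apply (expn_scal n0 _ _ (fun z => (s * eis n0 (Z.of_nat u) (Z.of_nat v) z) ^ k)%C).
      apply expn_split_pow. unfold n0; lia. apply scaled_eis_coef_expn; auto. intros [_ h2]. revert h2.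
      apply (chi_nzvec _ chi); auto. unfold n0; lia. apply Hr. }
  pose proof (expn_csum n0 _ _ N Hv) as H1.
  refine (expn_ext _ _ _ _ _ _ _ (expn_scal n0 (ep / g)%C _ _ H1)).
  - intros n. reflexivity.
  - intros z Hz. rewrite (chi_nonunit n0 chi (Z.of_nat u)) by (auto; apply Hr).
    rewrite (csum_ext _ (fun v => s ^ k * (chi (Z.of_nat v) * eis n0 (Z.of_nat u) (Z.of_nat v) z ^ k))%C).
    2:{ intros v _. rewrite Cpow_mult_l. ring. }
    rewrite csum_scal. set (S := csum _ N).
    transitivity (/ g * s ^ k * S * ep)%C. field; auto.
    replace (/ g * s ^ k * S * ep)%C with (/ g * s ^ k * S * (ep * ep * / ep))%C by (field; auto). rewrite Hep. field. auto.
Qed.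

Lemma form_coef_expn : expn n0 form_coef (fun z => s ^ k / (ep * g) * eis_power_form N chi k (ep * g) 1 0 0 1 z)%C.
Proof.
  assert (expn n0 form_coef (fun z => csum (fun u => s ^ k / (ep * g) *
    (csum (fun v => chi (Z.of_nat v) * eis n0 (Z.of_nat u) (Z.of_nat v) z ^ k) N
     + ep * g * (chi (Z.of_nat u) * eis n0 (Z.of_nat u) 0 z ^ k))) N)%C) as H.
  { unfold form_coef.
    apply (expn_csum n0 (fun u n => if Z.eqb (Z.gcd (Z.of_nat u) (Z.of_nat N)) 1 then unit_row_coef u n else nonunit_row_coef u n)
      (fun u z => s ^ k / (ep * g) *
    (csum (fun v => chi (Z.of_nat v) * eis n0 (Z.of_nat u) (Z.of_nat v) z ^ k) N
     + ep * g * (chi (Z.of_nat u) * eis n0 (Z.of_nat u) 0 z ^ k)))%C).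
    intros u Hu. destruct (Z.eqb (Z.gcd (Z.of_nat u) (Z.of_nat N)) 1) eqn:E.
    - apply Z.eqb_eq in E. now apply unit_row_expn.
    - apply Z.eqb_neq in E. now apply nonunit_row_expn. }
  refine (expn_ext _ _ _ _ _ _ _ H). reflexivity.
  intros z Hz. rewrite csum_scal. f_equal. rewrite csum_plus, csum_scal. unfold eis_power_form, eis_plane_sum, eis_axis_sum. fold n0. f_equal.
  - rewrite csum_swap. apply csum_ext. intros v _. apply csum_ext. intros u _.
    replace (Z.of_nat u * 1 + Z.of_nat v * 0)%Z with (Z.of_nat u) by ring.
    replace (Z.of_nat u * 0 + Z.of_nat v * 1)%Z with (Z.of_nat v) by ring. reflexivity.
  - f_equal. apply csum_ext. intros u _. rewrite Z.mul_1_r, Z.mul_0_r. reflexivity.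
Qed.

End Coefficients.

(** * Congruences for powers of power series *)

(** Rings of functions of a residue [v]. The coefficients in question depend
    on a root of unity [e(v/N)] through one polynomial for all [v], and
    divisibility must hold uniformly in [v] to survive the sum against [chi]. *)
Definition fsubring (O : (Z -> C) -> Prop) : Prop :=
  (forall z, O (fun _ => ZtoC z)) /\ (forall F G, O F -> O G -> O (fun v => F v + G v)%C) /\
  (forall F G, O F -> O G -> O (fun v => F v * G v)%C) /\
  (forall F G : Z -> C, (forall v, F v = G v) -> O F -> O G).

(** The principal ideal generated by the integer [d] in the ring [O]. *)
Definition ideal_mult (O : (Z -> C) -> Prop) (d : Z) (F : Z -> C) : Prop :=
  exists G, O G /\ forall v, F v = (ZtoC d * G v)%C.

Section Integral.

Variable O : (Z -> C) -> Prop.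
Hypothesis HO : fsubring O.

Lemma O_int : forall z, O (fun _ => ZtoC z). Proof. apply HO. Qed.
Lemma O_plus : forall F G, O F -> O G -> O (fun v => F v + G v)%C. Proof. apply HO. Qed.
Lemma O_mult : forall F G, O F -> O G -> O (fun v => F v * G v)%C. Proof. apply HO. Qed.
Lemma O_ext : forall F G : Z -> C, (forall v, F v = G v) -> O F -> O G. Proof. apply HO. Qed.

Lemma O_pow : forall F j, O F -> O (fun v => F v ^ j)%C.
Proof.
  induction j; intros H; simpl. apply (O_int 1). apply O_mult; auto.
Qed.

Lemma ideal_mult_ext : forall d (F G : Z -> C), (forall v, F v = G v) -> ideal_mult O d F -> ideal_mult O d G.
Proof. intros d F G H [A [H1 H2]]. exists A. split; auto. intros. now rewrite <- H. Qed.

Lemma ideal_mult_O : forall d F, ideal_mult O d F -> O F.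
Proof. intros d F [A [H1 H2]]. apply (O_ext (fun v => ZtoC d * A v)%C). intros; now rewrite H2. apply O_mult; auto. apply O_int. Qed.

Lemma ideal_mult_1 : forall F, O F -> ideal_mult O 1 F.
Proof. intros F H. exists F. split; auto. intros. rewrite ZtoC_1. ring. Qed.

Lemma ideal_mult_plus : forall d F G, ideal_mult O d F -> ideal_mult O d G -> ideal_mult O d (fun v => F v + G v)%C.
Proof.
  intros d F G [A [H1 H2]] [B [H3 H4]]. exists (fun v => A v + B v)%C. split. now apply O_plus.
  intros. rewrite H2, H4. ring.
Qed.

Lemma ideal_mult_mult : forall d e F G, ideal_mult O d F -> ideal_mult O e G -> ideal_mult O (d * e) (fun v => F v * G v)%C.
Proof.
  intros d e F G [A [H1 H2]] [B [H3 H4]]. exists (fun v => A v * B v)%C. split. now apply O_mult.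
  intros. rewrite H2, H4, ZtoC_mul. ring.
Qed.

Lemma ideal_mult_dvd : forall d e F, (d | e)%Z -> ideal_mult O e F -> ideal_mult O d F.
Proof.
  intros d e F [q ->] [A [H1 H2]]. exists (fun v => ZtoC q * A v)%C. split. apply O_mult; auto. apply O_int.
  intros. rewrite H2, ZtoC_mul. ring.
Qed.

Lemma ideal_mult_zero : forall d, ideal_mult O d (fun _ => RtoC 0).
Proof. intros d. exists (fun _ => ZtoC 0). split. apply O_int. intros. rewrite ZtoC_0. ring. Qed.

Lemma ideal_mult_csum : forall d (F : nat -> Z -> C) n, (forall i, (i < n)%nat -> ideal_mult O d (F i)) ->
  ideal_mult O d (fun v => csum (fun i => F i v) n).
Proof.
  induction n; intros H; simpl. apply ideal_mult_zero. apply (ideal_mult_plus d (fun v => csum (fun i => F i v) n) (F n)); auto.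
Qed.

Lemma ideal_mult_mulr : forall d F G, ideal_mult O d F -> O G -> ideal_mult O d (fun v => F v * G v)%C.
Proof.
  intros d F G H1 H2. replace d with (d * 1)%Z by ring. apply ideal_mult_mult; auto. now apply ideal_mult_1.
Qed.

Lemma ideal_mult_mull : forall d F G, ideal_mult O d G -> O F -> ideal_mult O d (fun v => F v * G v)%C.
Proof.
  intros d F G H1 H2. apply (ideal_mult_ext d (fun v => G v * F v)%C). intros; ring. now apply ideal_mult_mulr.
Qed.

Lemma series_pow_all : forall d (A : nat -> Z -> C) k, (forall n, ideal_mult O d (A n)) ->
  forall n, ideal_mult O (d ^ Z.of_nat k) (fun v => series_pow (fun i => A i v) k n).
Proof.
  intros d A k HA. induction k; intros n.
  - simpl. destruct n; simpl. apply (ideal_mult_1 (fun _ => ZtoC 1)). apply O_int. apply ideal_mult_zero.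
  - rewrite Nat2Z.inj_succ, Z.pow_succ_r by lia. cbn [series_pow]. unfold cauchy_prod.
    apply (ideal_mult_csum _ (fun i v => A i v * series_pow (fun i => A i v) k (n - i)%nat)%C). intros i _. now apply ideal_mult_mult.
Qed.

Lemma series_pow_0_coef : forall (a : nat -> C) k, series_pow a k 0 = (a 0%nat ^ k)%C.
Proof. induction k; simpl. reflexivity. unfold cauchy_prod. simpl. rewrite IHk. ring. Qed.

(** Modulo [d^2], the binomial expansion of a power of [y + d X] stops at the
    linear term. *)
Lemma series_pow_linear : forall d (A : nat -> Z -> C), O (A 0%nat) -> (forall n, (1 <= n)%nat -> ideal_mult O d (A n)) ->
  forall j n, (1 <= n)%nat ->
  ideal_mult O (d * d) (fun v => series_pow (fun i => A i v) j n + (- (RtoC (INR j) * A 0%nat v ^ (j - 1) * A n v)))%C.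
Proof.
  intros d A H0 HA. induction j; intros n Hn.
  - apply (ideal_mult_ext _ (fun _ => RtoC 0)). intros v. simpl. destruct n; [lia|]. simpl. ring. apply ideal_mult_zero.
  - assert (forall n, (1 <= n)%nat -> ideal_mult O d (fun v => series_pow (fun i => A i v) j n)) as Hj.
    { intros i Hi. apply (ideal_mult_ext _ (fun v => (series_pow (fun i => A i v) j i + (- (RtoC (INR j) * A 0%nat v ^ (j - 1) * A i v))) + (RtoC (INR j) * A 0%nat v ^ (j - 1)) * A i v)%C).
      intros; ring. apply ideal_mult_plus. apply (ideal_mult_dvd d (d * d)); auto. now exists d.
      apply ideal_mult_mull; auto. apply O_mult. apply (O_ext (fun _ => ZtoC (Z.of_nat j))). intros; apply ZtoC_nat. apply O_int.
      now apply O_pow. }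
    destruct n as [|n]; [lia|].
    apply (ideal_mult_ext _ (fun v => A 0%nat v * (series_pow (fun i => A i v) j (S n) + (- (RtoC (INR j) * A 0%nat v ^ (j - 1) * A (S n) v)))
       + csum (fun i => A (S i) v * series_pow (fun i => A i v) j (n - i)%nat) n)%C).
    + intros v. cbn [series_pow]. unfold cauchy_prod.
      rewrite (csum_S_l _ (S n)). cbn [csum]. rewrite Nat.sub_0_r, Nat.sub_diag, series_pow_0_coef.
      change (csum (fun i => (A (S i) v * series_pow (fun i0 => A i0 v) j (S n - S i))%C) n) with (csum (fun i => A (S i) v * series_pow (fun i0 => A i0 v) j (n - i))%C n).
      rewrite S_INR, RtoC_plus. replace (S j - 1)%nat with j by lia.
      assert (RtoC (INR j) * (A 0%nat v * A 0%nat v ^ (j - 1)) = RtoC (INR j) * A 0%nat v ^ j)%C as E.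
      { destruct j. simpl. ring. replace (S j - 1)%nat with j by lia. simpl. ring. }
      set (S1 := csum _ n).
      transitivity (A 0%nat v * series_pow (fun i => A i v) j (S n) + S1 - RtoC (INR j) * (A 0%nat v * A 0%nat v ^ (j - 1)) * A (S n) v)%C. ring.
      rewrite E. ring.
    + apply ideal_mult_plus. apply ideal_mult_mull; auto.
      apply (ideal_mult_csum _ (fun i v => A (S i) v * series_pow (fun i0 => A i0 v) j (n - i)%nat)%C). intros i Hi.
      apply ideal_mult_mult. apply HA; lia. apply Hj; lia.
Qed.

Lemma series_pow_ideal : forall d (A : nat -> Z -> C) k, O (A 0%nat) -> (forall n, (1 <= n)%nat -> ideal_mult O d (A n)) ->
  forall n, (1 <= n)%nat -> ideal_mult O d (fun v => series_pow (fun i => A i v) k n).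
Proof.
  intros d A k H0 HA n Hn.
  apply (ideal_mult_ext _ (fun v => (series_pow (fun i => A i v) k n + (- (RtoC (INR k) * A 0%nat v ^ (k - 1) * A n v))) + (RtoC (INR k) * A 0%nat v ^ (k - 1)) * A n v)%C).
  intros; ring. apply ideal_mult_plus. apply (ideal_mult_dvd d (d * d)). now exists d. now apply series_pow_linear.
  apply ideal_mult_mull; auto. apply O_mult. apply (O_ext (fun _ => ZtoC (Z.of_nat k))). intros; apply ZtoC_nat. apply O_int.
  now apply O_pow.
Qed.

(** If [X] is in the ideal of [d], then [(y + X)^p - y^p] is [p y^(p-1) X]
    modulo [d^2]; as [p] divides [d], both are in the ideal of [p d]. Each
    step gains a factor [p]. *)
Lemma iterated_pow_ideal : forall (p t : nat) d (A : nat -> Z -> C), (Z.of_nat p | d)%Z -> O (A 0%nat) ->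
  (forall n, (1 <= n)%nat -> ideal_mult O d (A n)) ->
  O (fun v => iterated_pow p t (fun i => A i v) 0%nat) /\
  forall n, (1 <= n)%nat -> ideal_mult O (d * Z.of_nat p ^ Z.of_nat t) (fun v => iterated_pow p t (fun i => A i v) n).
Proof.
  intros p t. induction t; intros d A Hd H0 HA.
  - split; auto. intros n Hn. simpl. rewrite Z.mul_1_r. now apply HA.
  - cbn [iterated_pow]. rewrite Nat2Z.inj_succ, Z.pow_succ_r by lia.
    replace (d * (Z.of_nat p * Z.of_nat p ^ Z.of_nat t))%Z with ((d * Z.of_nat p) * Z.of_nat p ^ Z.of_nat t)%Z by ring.
    apply (IHt (d * Z.of_nat p)%Z (fun n v => series_pow (fun i => A i v) p n)).
    + apply Z.divide_mul_l; auto.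
    + apply (O_ext (fun v => A 0%nat v ^ p)%C). intros; now rewrite series_pow_0_coef. now apply O_pow.
    + intros n Hn.
      apply (ideal_mult_ext _ (fun v => (series_pow (fun i => A i v) p n + (- (RtoC (INR p) * A 0%nat v ^ (p - 1) * A n v))) + (RtoC (INR p) * A n v) * A 0%nat v ^ (p - 1))%C).
      intros; ring. apply ideal_mult_plus.
      * apply (ideal_mult_dvd _ (d * d)). destruct Hd as [q ->]. exists q. ring. now apply series_pow_linear.
      * apply ideal_mult_mulr; [|now apply O_pow]. rewrite Z.mul_comm. apply ideal_mult_mult; auto.
        exists (fun _ => ZtoC 1). split. apply O_int. intros. rewrite ZtoC_nat, ZtoC_1. ring.
Qed.

Lemma iterated_pow_0_coef : forall p t (a : nat -> C), iterated_pow p t a 0%nat = (a 0%nat ^ (p ^ t))%C.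
Proof.
  intros p t. induction t; intros a; cbn [iterated_pow]. simpl; ring.
  rewrite IHt, series_pow_0_coef, <- Cpow_mult_r. reflexivity.
Qed.

Lemma split_pow_0_coef : forall p t m (a : nat -> C), split_pow p t m a 0%nat = (a 0%nat ^ (p ^ t * m))%C.
Proof. intros. unfold split_pow. rewrite series_pow_0_coef, iterated_pow_0_coef, <- Cpow_mult_r. reflexivity. Qed.

Lemma split_pow_ideal : forall (p t m : nat) d (A : nat -> Z -> C), (Z.of_nat p | d)%Z -> O (A 0%nat) ->
  (forall n, (1 <= n)%nat -> ideal_mult O d (A n)) -> forall n, (1 <= n)%nat ->
  ideal_mult O (d * Z.of_nat p ^ Z.of_nat t) (fun v => split_pow p t m (fun i => A i v) n).
Proof.
  intros p t m d A Hd H0 HA n Hn. destruct (iterated_pow_ideal p t d A Hd H0 HA) as [T0 T1].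
  unfold split_pow. apply (series_pow_ideal _ (fun n v => iterated_pow p t (fun i => A i v) n)); auto.
Qed.

End Integral.

(** * Integral polynomials in a root of unity *)

Definition eval_terms (l : list (Z * nat)) (x : C) : C :=
  fold_right (fun t acc => ZtoC (fst t) * x ^ snd t + acc)%C (RtoC 0) l.

Definition mul_terms (l l' : list (Z * nat)) : list (Z * nat) :=
  flat_map (fun t => map (fun t' => ((fst t * fst t')%Z, (snd t + snd t')%nat)) l') l.

Lemma eval_terms_app : forall l l' x, eval_terms (l ++ l') x = (eval_terms l x + eval_terms l' x)%C.
Proof. induction l; intros; simpl. ring. unfold eval_terms in *. simpl. rewrite IHl. ring. Qed.

Lemma eval_terms_mul : forall l l' x, eval_terms (mul_terms l l') x = (eval_terms l x * eval_terms l' x)%C.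
Proof.
  induction l; intros; unfold mul_terms; simpl. ring.
  rewrite eval_terms_app. fold (mul_terms l l'). rewrite IHl.
  assert (eval_terms (map (fun t' => ((fst a * fst t')%Z, (snd a + snd t')%nat)) l') x = ZtoC (fst a) * x ^ snd a * eval_terms l' x)%C as E.
  { induction l'; simpl. ring. rewrite IHl'. rewrite ZtoC_mul, Cpow_add_r. ring. }
  rewrite E. ring.
Qed.

Definition unity_root (N : nat) (v : Z) : C := e2pi (ZtoC v / RtoC (INR N))%C.

(** One integral polynomial for all residues prime to [N]; nothing is required
    at the other residues, where [chi] vanishes. *)
Definition cyclo (N : nat) (F : Z -> C) : Prop :=
  exists l, forall v, Z.gcd v (Z.of_nat N) = 1%Z -> F v = eval_terms l (unity_root N v).

(** The ring for the rows with [v = 0], where no root of unity occurs. *)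
Definition constant_int (F : Z -> C) : Prop := exists z, forall v, F v = ZtoC z.

Lemma cyclo_subring : forall N, fsubring (cyclo N).
Proof.
  intros N. split; [|split; [|split]].
  - intros z. exists ((z, 0%nat) :: nil). intros v _. simpl. ring.
  - intros F G [l H] [l' H']. exists (l ++ l'). intros v Hv. rewrite eval_terms_app, H, H'; auto.
  - intros F G [l H] [l' H']. exists (mul_terms l l'). intros v Hv. rewrite eval_terms_mul, H, H'; auto.
  - intros F G HFG [l H]. exists l. intros v Hv. rewrite <- HFG. auto.
Qed.

Lemma constant_int_subring : fsubring constant_int.
Proof.
  split; [|split; [|split]].
  - intros z. now exists z.
  - intros F G [a H] [b H']. exists (a + b)%Z. intros v. now rewrite H, H', ZtoC_add.
  - intros F G [a H] [b H']. exists (a * b)%Z. intros v. now rewrite H, H', ZtoC_mul.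
  - intros F G HFG [a H]. exists a. intros v. now rewrite <- HFG.
Qed.

Lemma cyclo_unity_root : forall N, cyclo N (unity_root N).
Proof. intros N. exists ((1%Z, 1%nat) :: nil). intros v _. simpl. rewrite ZtoC_1. ring. Qed.

Lemma unity_root_pow_N : forall N v, (0 < N)%nat -> (unity_root N v ^ N = 1)%C.
Proof.
  intros N v HN. assert (RtoC (INR N) <> RtoC 0) by (intros E; apply RtoC_inj in E; apply (not_0_INR N); auto; lia).
  unfold unity_root. rewrite <- e2pi_pow. replace (RtoC (INR N) * (ZtoC v / RtoC (INR N)))%C with (ZtoC v) by (field; auto). apply e2pi_Z.
Qed.

Lemma unity_root_inv : forall N v, (0 < N)%nat -> e2pi (- (ZtoC v / RtoC (INR N)))%C = (unity_root N v ^ (N - 1))%C.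
Proof.
  intros N v HN. rewrite e2pi_opp. fold (unity_root N v). pose proof (unity_root_pow_N N v HN) as E.
  destruct N as [|n]; [lia|]. replace (S n - 1)%nat with n by lia. simpl in E.
  assert (unity_root (S n) v <> RtoC 0) by apply e2pi_neq0.
  transitivity (unity_root (S n) v * unity_root (S n) v ^ n * / unity_root (S n) v)%C. rewrite E; ring. field. auto.
Qed.

Lemma O_csum : forall O, fsubring O -> forall (F : nat -> Z -> C) n, (forall i, (i < n)%nat -> O (F i)) -> O (fun v => csum (fun i => F i v) n).
Proof.
  intros O HO F n H. apply (ideal_mult_O O HO 1). apply (ideal_mult_csum O HO 1 F). intros i Hi. apply (ideal_mult_1 O). auto.
Qed.

Lemma lambert_coef_O : forall O, fsubring O -> forall N u (x xi : Z -> C) n, O x -> O xi -> O (fun v => lambert_coef N u (x v) (xi v) n).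
Proof.
  intros O HO N u x xi n Hx Hxi.
  assert (forall mu y, O y -> O (fun v => geom_coef mu (y v) n)) as Hg.
  { intros mu y Hy. unfold geom_coef. destruct (Nat.eqb n 0). apply (O_int O HO 0).
    destruct (Nat.eqb (n mod mu) 0). now apply (O_pow O HO). apply (O_int O HO 0). }
  unfold lambert_coef. apply (O_csum O HO (fun m v => lambert_term N u (x v) (xi v) n m)). intros m _. unfold lambert_term.
  destruct m as [|m]. now apply Hg.
  apply (O_ext O HO (fun v => geom_coef (S m * N + u) (x v) n + ZtoC (-1) * geom_coef (S m * N - u) (xi v) n)%C).
  - intros v. change (-1)%Z with (- (1))%Z. rewrite ZtoC_opp, ZtoC_1. ring.
  - apply (O_plus O HO); auto. apply (O_mult O HO); auto. apply (O_int O HO).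
Qed.

(** Works in any of the rings, because the coefficients beyond the constant
    one are integral polynomials in [e(v/N)] and its inverse, which is a
    power. *)
Lemma scaled_eis_coef_high : forall O, fsubring O -> forall N (s : Z) u (w : Z -> Z) n, (0 < N)%nat -> (1 <= n)%nat ->
  O (fun v => unity_root N (w v)) -> ideal_mult O (2 * s) (fun v => scaled_eis_coef N (ZtoC s) u (w v) n).
Proof.
  intros O HO N s u w n HN Hn Hrt.
  exists (fun v => lambert_coef N u (unity_root N (w v)) (unity_root N (w v) ^ (N - 1))%C n). split.
  - apply (lambert_coef_O O HO N u (fun v => unity_root N (w v)) (fun v => unity_root N (w v) ^ (N - 1))%C); auto. now apply (O_pow O HO).
  - intros v. unfold scaled_eis_coef, eis_coef. destruct n as [|n]; [lia|]. rewrite unity_root_inv by auto. fold (unity_root N (w v)).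
    rewrite ZtoC_mul. change (ZtoC 2) with (RtoC 2). ring.
Qed.

Definition chi_int (chi : Z -> C) : Prop := forall a, exists z, chi a = ZtoC z.

Lemma real_chi_int : forall N chi, real_character N chi -> chi_int chi.
Proof.
  intros N chi Hr a. destruct (chi_vals N chi a Hr) as [E|[E|E]].
  exists 0%Z; auto. exists 1%Z; auto. exists (-1)%Z. rewrite E. change (-1)%Z with (- (1))%Z. now rewrite ZtoC_opp, ZtoC_1.
Qed.

(** Against [chi], the monomial [x^e] in [x = e(v/N)] sums to [g chi(e)]:
    every integral polynomial gives [g] times an integer. *)
Lemma cyclo_gauss : forall N chi g F d, (1 < N)%nat -> real_character (Z.of_nat N) chi -> gauss_sum N chi g -> ideal_mult (cyclo N) d F ->
  exists z, csum (fun v => chi (Z.of_nat v) * F (Z.of_nat v))%C N = (g * (ZtoC d * ZtoC z))%C.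
Proof.
  intros N chi g F d HN Hr [_ HG] [G [[l Hl] HF]].
  assert (exists z, csum (fun v => chi (Z.of_nat v) * eval_terms l (unity_root N (Z.of_nat v)))%C N = (g * ZtoC z)%C) as [z Hz].
  { clear Hl HF. induction l as [|[c e] l [z Hz]].
    - exists 0%Z. rewrite csum_eq0. rewrite ZtoC_0. ring. intros; simpl; ring.
    - destruct (real_chi_int _ _ Hr (Z.of_nat e)) as [w Hw]. exists (c * w + z)%Z.
      rewrite (csum_ext _ (fun v => ZtoC c * (chi (Z.of_nat v) * e2pi (RtoC (INR v) / RtoC (INR N)) ^ e) + chi (Z.of_nat v) * eval_terms l (unity_root N (Z.of_nat v)))%C).
      rewrite csum_plus, csum_scal, HG, Hz, Hw, ZtoC_add, ZtoC_mul. ring.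
      intros v _. simpl. unfold unity_root at 1. rewrite ZtoC_nat. ring. }
  exists z. rewrite (csum_ext _ (fun v => ZtoC d * (chi (Z.of_nat v) * eval_terms l (unity_root N (Z.of_nat v))))%C).
  rewrite csum_scal, Hz. ring.
  intros v _. destruct (Z.eq_dec (Z.gcd (Z.of_nat v) (Z.of_nat N)) 1) as [h|h].
  rewrite HF, Hl by auto. ring. rewrite (chi_nonunit (Z.of_nat N)) by (auto; apply Hr). ring.
Qed.

Lemma in_multiples_plus : forall d x y, in_multiples d x -> in_multiples d y -> in_multiples d (x + y)%C.
Proof. intros d x y [a ->] [b ->]. exists (a + b)%Z. rewrite ZtoC_add. ring. Qed.

Lemma in_multiples_zero : forall d, in_multiples d (RtoC 0).
Proof. intros d. exists 0%Z. rewrite ZtoC_0. ring. Qed.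

Lemma in_multiples_csum : forall d (f : nat -> C) n, (forall i, (i < n)%nat -> in_multiples d (f i)) -> in_multiples d (csum f n).
Proof. induction n; intros H; simpl. apply in_multiples_zero. apply in_multiples_plus; auto. Qed.

Lemma unit_row_coef_multiple : forall N chi (e : Z) s p t m d u n, real_character (Z.of_nat N) chi ->
  ideal_mult constant_int d (fun _ => split_pow p t m (scaled_eis_coef N s u 0) n) -> in_multiples d (unit_row_coef N chi (ZtoC e) s p t m u n).
Proof.
  intros N chi e s p t m d u n Hr [G [[z Hz] HG]]. unfold unit_row_coef.
  destruct (real_chi_int _ _ Hr (Z.of_nat u)) as [a ->]. destruct (real_chi_int _ _ Hr (Z.of_nat n)) as [b ->].
  rewrite (HG 0%Z), (Hz 0%Z). exists (a * (1 + e * b) * z)%Z. rewrite !ZtoC_mul, ZtoC_add, ZtoC_1, ZtoC_mul. ring.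
Qed.

(** * The constant terms at a nonunit row *)

Lemma unity_root_unit_neq1 : forall N v, (1 < N)%nat -> Z.gcd v (Z.of_nat N) = 1%Z -> (1 - unity_root N v)%C <> RtoC 0.
Proof.
  intros N v HN Hg. apply nonint_e2pi. intros n E.
  assert (RtoC (INR N) <> RtoC 0) as H0 by (intros E'; apply RtoC_inj in E'; apply (not_0_INR N); auto; lia).
  apply (unit_not_dvd (Z.of_nat N) v); auto. lia. exists n. apply ZtoC_inj.
  rewrite ZtoC_mul, ZtoC_nat, <- E. field. auto.
Qed.

Lemma csum_weighted_geom : forall (x : C) n, (csum (fun j => RtoC (INR j) * x ^ j) n * (1 - x) = csum (fun j => x ^ S j) n - RtoC (INR n) * x ^ n)%C.
Proof.
  induction n. simpl. ring. cbn [csum]. rewrite Cmult_plus_distr_r, IHn, S_INR, RtoC_plus. simpl. ring.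
Qed.

(** Makes [p / (1 - x)] an integral polynomial in the [p]-th root of unity
    [x]. *)
Lemma inv_one_sub : forall p x, (0 < p)%nat -> (1 - x)%C <> RtoC 0 -> (x ^ p = 1)%C ->
  (csum (fun j => RtoC (INR j) * x ^ j) p * (1 - x) = - RtoC (INR p))%C.
Proof.
  intros p x Hp Hx E. rewrite csum_weighted_geom, E.
  pose proof (csum_geom x p) as G. rewrite E in G.
  assert (csum (fun i => x ^ i) p = 0)%C as G0.
  { transitivity (csum (fun i => x ^ i)%C p * (1 - x) / (1 - x))%C. field; auto. rewrite G. field. auto. }
  rewrite (csum_ext (fun j => x ^ S j)%C (fun j => x * x ^ j)%C) by (intros; reflexivity).
  rewrite csum_scal. transitivity (x * csum (fun i => x ^ i) p - RtoC (INR p) * 1)%C. reflexivity. rewrite G0. ring.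
Qed.

(** The polynomial equal to [p / (1 - x)^2] at a nontrivial [p]-th root of
    unity [x], for odd [p]. The second summand corrects the first by [p
    (p-1)/2], the sum of the weights. *)
Definition sqpoly (p : nat) (x : C) : C :=
  (csum (fun j => RtoC (INR j) * csum (fun i => x ^ i) j) p + RtoC (INR ((p - 1) / 2)) * csum (fun j => RtoC (INR j) * x ^ j) p)%C.

Lemma sum_INR : forall p, (2 * csum (fun j => RtoC (INR j)) p = RtoC (INR p) * (RtoC (INR p) - 1))%C.
Proof. induction p. simpl. ring. cbn [csum]. rewrite Cmult_plus_distr_l, IHp, S_INR, RtoC_plus. ring. Qed.

Lemma sqpoly_eq : forall p x, (0 < p)%nat -> Nat.Odd p -> (1 - x)%C <> RtoC 0 -> (x ^ p = 1)%C ->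
  (sqpoly p x * (1 - x) = - csum (fun j => RtoC (INR j) * x ^ j) p)%C.
Proof.
  intros p x Hp [h Hh] Hx E. unfold sqpoly. rewrite Cmult_plus_distr_r, <- Cmult_assoc, inv_one_sub by auto.
  rewrite Cmult_comm, <- csum_scal.
  rewrite (csum_ext _ (fun j => RtoC (INR j) + (-(1)) * (RtoC (INR j) * x ^ j))%C).
  2:{ intros j _. pose proof (csum_geom x j) as G.
      transitivity (RtoC (INR j) * (csum (fun i => x ^ i)%C j * (1 - x)))%C. ring. rewrite G. ring. }
  rewrite csum_plus, csum_scal.
  replace ((p - 1) / 2)%nat with h by (rewrite Hh; replace (2 * h + 1 - 1)%nat with (h * 2)%nat by lia; now rewrite Nat.div_mul).
  assert (csum (fun j => RtoC (INR j)) p = RtoC (INR h) * RtoC (INR p))%C as E2.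
  { pose proof (sum_INR p) as S. rewrite Hh in S at 3. rewrite plus_INR, mult_INR, RtoC_plus, RtoC_mult in S. simpl (INR 2) in S. simpl (INR 1) in S.
    replace (RtoC (1 + 1)) with (RtoC 2) in S by (f_equal; ring).
    transitivity (/ 2 * (2 * csum (fun j => RtoC (INR j)) p))%C. field. rewrite S. field. }
  rewrite E2. ring.
Qed.

Lemma icot_const_cyclo : forall p, (1 < p)%nat -> cyclo p (fun v => RtoC (INR p) * icot (ZtoC v / RtoC (INR p)))%C.
Proof.
  intros p Hp. set (P := fun v => csum (fun j => RtoC (INR j) * unity_root p v ^ j)%C p).
  assert (cyclo p (fun v => ZtoC (-1) * ((ZtoC 1 + unity_root p v) * P v)))%C as H.
  { pose proof (cyclo_subring p) as HO.
    apply (O_mult _ HO (fun _ => ZtoC (-1))). apply (O_int _ HO).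
    apply (O_mult _ HO (fun v => ZtoC 1 + unity_root p v)%C). apply (O_plus _ HO (fun _ => ZtoC 1)). apply (O_int _ HO). apply cyclo_unity_root.
    apply (O_csum _ HO (fun j v => RtoC (INR j) * unity_root p v ^ j)%C). intros j _.
    apply (O_mult _ HO (fun _ => RtoC (INR j))). apply (O_ext _ HO (fun _ => ZtoC (Z.of_nat j))). intros; apply ZtoC_nat. apply (O_int _ HO).
    apply (O_pow _ HO). apply cyclo_unity_root. }
  destruct H as [l Hl]. exists l. intros v Hv. rewrite <- Hl by auto.
  pose proof (unity_root_unit_neq1 p v Hp Hv) as Hn. pose proof (unity_root_pow_N p v ltac:(lia)) as E.
  pose proof (inv_one_sub p (unity_root p v) ltac:(lia) Hn E) as I. fold (P v) in I.
  change (icot (ZtoC v / RtoC (INR p))) with ((1 + unity_root p v) / (1 - unity_root p v))%C.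
  transitivity (- ((1 + unity_root p v) * (P v * (1 - unity_root p v)) / (1 - unity_root p v)))%C. rewrite I. field; auto.
  change (-1)%Z with (- (1))%Z. rewrite ZtoC_opp, ZtoC_1. field; auto.
Qed.

(** [icot] at [v/p] is [(1 + x) / (1 - x)], so the square of [p icot] is [p (1
    + x)^2] times the polynomial [sqpoly]. This is the reason why the row [u =
    0] does not disturb the constant term modulo [p] as soon as [k >= 2]. *)
Lemma icot_const_square : forall p, (1 < p)%nat -> Nat.Odd p ->
  ideal_mult (cyclo p) (Z.of_nat p) (fun v => (if Z.eqb (Z.gcd v (Z.of_nat p)) 1 then (RtoC (INR p) * icot (ZtoC v / RtoC (INR p))) ^ 2 else 0))%C.
Proof.
  intros p Hp Hodd. pose proof (cyclo_subring p) as HO.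
  exists (fun v => if Z.eqb (Z.gcd v (Z.of_nat p)) 1 then (ZtoC 1 + unity_root p v) ^ 2 * sqpoly p (unity_root p v) else 0)%C. split.
  - assert (cyclo p (fun v => (ZtoC 1 + unity_root p v) ^ 2 * sqpoly p (unity_root p v)))%C as H.
    { assert (forall j, cyclo p (fun _ => RtoC (INR j))) as Hj.
      { intros j. apply (O_ext _ HO (fun _ => ZtoC (Z.of_nat j))). intros; apply ZtoC_nat. apply (O_int _ HO). }
      apply (O_mult _ HO (fun v => (ZtoC 1 + unity_root p v) ^ 2)%C).
      apply (O_pow _ HO). apply (O_plus _ HO (fun _ => ZtoC 1)). apply (O_int _ HO). apply cyclo_unity_root.
      unfold sqpoly. apply (O_plus _ HO (fun v => csum (fun j => RtoC (INR j) * csum (fun i => unity_root p v ^ i) j) p)%C).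
      - apply (O_csum _ HO (fun j v => RtoC (INR j) * csum (fun i => unity_root p v ^ i) j)%C). intros j _.
        apply (O_mult _ HO (fun _ => RtoC (INR j))). auto.
        apply (O_csum _ HO (fun i v => unity_root p v ^ i)%C). intros i _. apply (O_pow _ HO). apply cyclo_unity_root.
      - apply (O_mult _ HO (fun _ => RtoC (INR ((p - 1) / 2)))). auto.
        apply (O_csum _ HO (fun j v => RtoC (INR j) * unity_root p v ^ j)%C). intros j _.
        apply (O_mult _ HO (fun _ => RtoC (INR j))). auto. apply (O_pow _ HO). apply cyclo_unity_root. }
    destruct H as [l Hl]. exists l. intros v Hv. rewrite Hv. simpl Z.eqb. cbv iota. now apply Hl.
  - intros v. destruct (Z.eqb (Z.gcd v (Z.of_nat p)) 1) eqn:Ev; [|ring]. apply Z.eqb_eq in Ev.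
    pose proof (unity_root_unit_neq1 p v Hp Ev) as Hn. pose proof (unity_root_pow_N p v ltac:(lia)) as E.
    pose proof (inv_one_sub p (unity_root p v) ltac:(lia) Hn E) as I.
    pose proof (sqpoly_eq p (unity_root p v) ltac:(lia) Hodd Hn E) as S.
    change (icot (ZtoC v / RtoC (INR p))) with ((1 + unity_root p v) / (1 - unity_root p v))%C.
    set (P := csum (fun j => RtoC (INR j) * unity_root p v ^ j)%C p) in *.
    assert (sqpoly p (unity_root p v) * (1 - unity_root p v) * (1 - unity_root p v) = RtoC (INR p))%C as S2.
    { rewrite S. transitivity (- (P * (1 - unity_root p v)))%C. ring. rewrite I. ring. }
    rewrite ZtoC_nat. change (ZtoC 1) with (RtoC 1).
    transitivity (RtoC (INR p) * RtoC (INR p) * (1 + unity_root p v) ^ 2 / ((1 - unity_root p v) * (1 - unity_root p v)))%C. simpl. field; auto.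
    rewrite <- S2 at 2. simpl. field; auto.
Qed.

(** Only the residues prime to [N] matter, so the coefficients may be replaced
    by a family [A] that agrees with them there and is easier to handle at the
    other residues. *)
Lemma nonunit_row_coef_multiple : forall N chi g (e : Z) s p t m d u n (A : nat -> Z -> C), (1 < N)%nat ->
  real_character (Z.of_nat N) chi -> gauss_sum N chi g ->
  (forall v i, Z.gcd v (Z.of_nat N) = 1%Z -> scaled_eis_coef N s u v i = A i v) ->
  ideal_mult (cyclo N) d (fun v => split_pow p t m (fun i => A i v) n) -> in_multiples d (nonunit_row_coef N chi g (ZtoC e) s p t m u n).
Proof.
  intros N chi g e s p t m d u n A HN Hr HG HA H. unfold nonunit_row_coef.
  destruct (cyclo_gauss N chi g _ d HN Hr HG H) as [z Hz]. cbv beta in Hz.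
  rewrite (csum_ext _ (fun v => chi (Z.of_nat v) * split_pow p t m (fun i => A i (Z.of_nat v)) n)%C), Hz.
  exists (e * z)%Z. rewrite ZtoC_mul. field. apply HG.
  intros v _. destruct (Z.eq_dec (Z.gcd (Z.of_nat v) (Z.of_nat N)) 1) as [h|h].
  - do 2 f_equal. apply functional_extensionality. intros i. now apply HA.
  - rewrite (chi_nonunit (Z.of_nat N)) by (auto; apply Hr). ring.
Qed.

(** * Divisibility at a prime level *)

Lemma constant_int_unity_root_0 : forall N, (0 < N)%nat -> constant_int (fun _ => unity_root N 0).
Proof. intros N HN. exists 1%Z. intros _. unfold unity_root. rewrite ZtoC_0, ZtoC_1. unfold Cdiv. rewrite Cmult_0_l. apply e2pi_0. Qed.

Lemma scaled_eis_coef_unit_const : forall N (s q : Z) u, (0 < N)%nat -> (0 < u)%nat -> (s * 2 = q * Z.of_nat N)%Z ->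
  scaled_eis_coef N (ZtoC s) u 0 0 = ZtoC (s - q * Z.of_nat u).
Proof.
  intros N s q u HN Hu Hq. unfold scaled_eis_coef, eis_coef. destruct u as [|u]; [lia|]. cbn [Nat.eqb].
  assert (RtoC (INR N) <> RtoC 0) as H0 by (intros E'; apply RtoC_inj in E'; apply (not_0_INR N); auto; lia).
  rewrite ZtoC_sub, ZtoC_mul. rewrite <- !ZtoC_nat in *.
  transitivity (ZtoC s - (ZtoC s * ZtoC 2) * ZtoC (Z.of_nat (S u)) / ZtoC (Z.of_nat N))%C.
  - change (ZtoC 2) with (RtoC 2). field; auto.
  - rewrite <- ZtoC_mul, Hq, ZtoC_mul. field; auto.
Qed.

Lemma pow_sub_dvd : forall d a b (k : nat), (d | a - b)%Z -> (d | a ^ Z.of_nat k - b ^ Z.of_nat k)%Z.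
Proof.
  intros d a b k H. induction k. exists 0%Z; reflexivity.
  rewrite Nat2Z.inj_succ, !Z.pow_succ_r by lia.
  replace (a * a ^ Z.of_nat k - b * b ^ Z.of_nat k)%Z with (a * (a ^ Z.of_nat k - b ^ Z.of_nat k) + (a - b) * b ^ Z.of_nat k)%Z by ring.
  apply Z.divide_add_r. now apply Z.divide_mul_r. now apply Z.divide_mul_l.
Qed.

Lemma ZtoC_pow : forall a k, ZtoC (a ^ Z.of_nat k) = (ZtoC a ^ k)%C.
Proof. intros a k. induction k. reflexivity. rewrite Nat2Z.inj_succ, Z.pow_succ_r, ZtoC_mul, IHk by lia. reflexivity. Qed.

Section PrimeLevel.

Variables (p nu m : nat) (chi : Z -> C) (g : C) (e : Z).
Hypothesis Hp : prime (Z.of_nat p).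
Hypothesis Hp2 : (2 < p)%nat.
Hypothesis Hr : real_character (Z.of_nat p) chi.
Hypothesis HG : gauss_sum p chi g.
Let k := (p ^ nu * m)%nat.
Let P := Z.of_nat p.
Let s := ZtoC P.

Lemma prime_odd : Nat.Odd p.
Proof.
  destruct (Nat.Even_or_Odd p) as [[h Hh]|H]; auto. exfalso.
  assert (2 | Z.of_nat p)%Z as Hd by (exists (Z.of_nat h); lia).
  apply (Znumtheory.prime_divisors _ Hp) in Hd. lia.
Qed.

Lemma prime_row : forall u, (u < p)%nat -> Z.gcd (Z.of_nat u) P <> 1%Z -> u = 0%nat.
Proof.
  intros u Hu H. destruct (Nat.eq_dec u 0); auto. exfalso. apply H.
  apply Zgcd_1_rel_prime. apply rel_prime_le_prime; auto. unfold P. lia.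
Qed.

(** Each row is the [p^nu m]-th power of a series whose nonconstant
    coefficients are divisible by [p]. *)
Lemma form_coef_prime_multiple : forall n, (1 <= n)%nat -> in_multiples (P ^ (Z.of_nat nu + 1)) (form_coef p chi g (ZtoC e) s p nu m n).
Proof.
  intros n Hn. replace (P ^ (Z.of_nat nu + 1))%Z with (P * Z.of_nat p ^ Z.of_nat nu)%Z by (unfold P; rewrite Z.pow_add_r by lia; ring).
  unfold form_coef. apply in_multiples_csum. intros u Hu.
  destruct (Z.eqb (Z.gcd (Z.of_nat u) (Z.of_nat p)) 1) eqn:E.
  - apply unit_row_coef_multiple; auto.
    apply (split_pow_ideal constant_int constant_int_subring p nu m P (fun i _ => scaled_eis_coef p s u 0 i)); auto.
    + apply Z.divide_refl.
    + destruct (Nat.eq_dec u 0) as [->|h]. apply Z.eqb_eq in E. simpl in E. lia.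
      exists (P - 2 * Z.of_nat u)%Z. intros _. apply scaled_eis_coef_unit_const; lia.
    + intros i Hi. apply (ideal_mult_dvd constant_int constant_int_subring P (2 * P)). exists 2%Z; ring.
      apply (scaled_eis_coef_high constant_int constant_int_subring p P u (fun _ => 0%Z)); auto. lia. apply constant_int_unity_root_0. lia.
  - apply Z.eqb_neq in E. apply prime_row in E; auto. subst u.
    apply (nonunit_row_coef_multiple p chi g e s p nu m _ 0 n (fun i v => scaled_eis_coef p s 0 v i)); auto. lia.
    apply (split_pow_ideal (cyclo p) (cyclo_subring p) p nu m P (fun i v => scaled_eis_coef p s 0 v i)); auto.
    + apply Z.divide_refl.
    + apply (O_ext _ (cyclo_subring p) (fun v => RtoC (INR p) * icot (ZtoC v / RtoC (INR p)))%C).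
      * intros v. unfold scaled_eis_coef, eis_coef, s, P. cbn [Nat.eqb]. rewrite <- ZtoC_nat. simpl INR. unfold Cdiv. ring.
      * apply icot_const_cyclo. lia.
    + intros i Hi. apply (ideal_mult_dvd _ (cyclo_subring p) P (2 * P)). exists 2%Z; ring.
      apply (scaled_eis_coef_high _ (cyclo_subring p) p P 0 (fun v => v)); auto. apply cyclo_unity_root.
Qed.

Hypothesis Hk : (2 <= k)%nat.
Hypothesis Heuler : forall u c, Z.gcd u P = 1%Z -> chi u = ZtoC c -> (P | c * u ^ Z.of_nat k - 1)%Z.

Lemma nonunit_row_prime_constant : in_multiples P (nonunit_row_coef p chi g (ZtoC e) s p nu m 0 0).
Proof.
  apply (nonunit_row_coef_multiple p chi g e s p nu m P 0 0
    (fun i v => match i with O => if Z.eqb (Z.gcd v P) 1 then RtoC (INR p) * icot (ZtoC v / RtoC (INR p)) else 0 | _ => scaled_eis_coef p s 0 v i end)%C); auto. lia.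
  - intros v [|i] Hv; auto. unfold P. rewrite Hv. simpl Z.eqb. cbv iota.
    unfold scaled_eis_coef, eis_coef, s, P. cbn [Nat.eqb]. rewrite <- ZtoC_nat. simpl INR. unfold Cdiv. ring.
  - pose proof (cyclo_subring p) as HO.
    apply (ideal_mult_ext _ _ (fun v => (if Z.eqb (Z.gcd v P) 1 then (RtoC (INR p) * icot (ZtoC v / RtoC (INR p))) ^ 2 else 0) *
      (if Z.eqb (Z.gcd v P) 1 then RtoC (INR p) * icot (ZtoC v / RtoC (INR p)) else 0) ^ (k - 2))%C).
    + intros v. rewrite split_pow_0_coef. fold k. destruct (Z.eqb (Z.gcd v P) 1).
      * rewrite <- Cpow_add_r. f_equal. lia.
      * replace k with (S (k - 1)) by lia. simpl. ring.
    + apply (ideal_mult_mulr _ HO). apply icot_const_square. lia. apply prime_odd.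
      apply (O_pow _ HO). destruct (icot_const_cyclo p ltac:(lia)) as [l Hl]. exists l. intros v Hv.
      unfold P. rewrite Hv. simpl Z.eqb. cbv iota. now apply Hl.
Qed.

(** Each unit row contributes [chi(u) (p - 2u)^k], which is [(-2)^k] modulo
    [p] by the congruence for [chi(u) u^k]; there are [p - 1] of them. *)
Lemma form_coef_prime_constant : exists T, form_coef p chi g (ZtoC e) s p nu m 0 = ZtoC T /\ Z.gcd (P ^ (Z.of_nat nu + 1)) T = 1%Z.
Proof.
  assert (forall n, (n < p)%nat -> exists T,
    csum (fun u => if Z.eqb (Z.gcd (Z.of_nat u) (Z.of_nat p)) 1 then unit_row_coef p chi (ZtoC e) s p nu m u 0 else nonunit_row_coef p chi g (ZtoC e) s p nu m u 0) (S n) = ZtoC T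
    /\ (P | T - Z.of_nat n * (-2) ^ Z.of_nat k)%Z) as H.
  { induction n; intros Hn.
    - cbn [csum]. destruct (Z.eqb (Z.gcd (Z.of_nat 0) (Z.of_nat p)) 1) eqn:E. apply Z.eqb_eq in E. simpl in E. lia.
      destruct nonunit_row_prime_constant as [z Hz]. exists (P * z)%Z. split. rewrite Hz, ZtoC_mul. ring. exists z. ring.
    - destruct IHn as [T [HT HD]]. lia.
      cbn [csum] in *. rewrite HT. clear HT. set (u := S n) in *.
      assert (Z.gcd (Z.of_nat u) P = 1%Z) as Hu.
      { destruct (Z.eq_dec (Z.gcd (Z.of_nat u) P) 1); auto. apply prime_row in n0; auto. discriminate. }
      unfold P in Hu. rewrite Hu. fold P in Hu. simpl Z.eqb. cbv iota.
      destruct (real_chi_int _ _ Hr (Z.of_nat u)) as [c Hc].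
      exists (T + c * (P - 2 * Z.of_nat u) ^ Z.of_nat k)%Z. split.
      + rewrite ZtoC_add, ZtoC_mul. f_equal. unfold unit_row_coef. rewrite split_pow_0_coef. fold k.
        rewrite (chi_nonunit (Z.of_nat p) chi (Z.of_nat 0)) by (try apply Hr; simpl; lia).
        unfold s; rewrite (scaled_eis_coef_unit_const p P 2 u) by (unfold P; lia). rewrite ZtoC_pow, Hc. ring.
      + replace (T + c * (P - 2 * Z.of_nat u) ^ Z.of_nat k - Z.of_nat u * (-2) ^ Z.of_nat k)%Z with
          ((T - Z.of_nat n * (-2) ^ Z.of_nat k) + (c * ((P - 2 * Z.of_nat u) ^ Z.of_nat k - (-2 * Z.of_nat u) ^ Z.of_nat k)
             + (-2) ^ Z.of_nat k * (c * Z.of_nat u ^ Z.of_nat k - 1)))%Z.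
        2:{ rewrite Z.pow_mul_l. unfold u. rewrite Nat2Z.inj_succ. unfold Z.succ. ring. }
        apply Z.divide_add_r; auto. apply Z.divide_add_r.
        * apply Z.divide_mul_r. apply pow_sub_dvd. exists 1%Z. ring.
        * apply Z.divide_mul_r. now apply Heuler. }
  destruct (H (p - 1)%nat ltac:(lia)) as [T [HT HD]]. replace (S (p - 1)) with p in HT by lia.
  exists T. split. exact HT.
  apply Zgcd_1_rel_prime. apply rel_prime_sym. apply rel_prime_Zpower_r. lia.
  apply rel_prime_sym. apply prime_rel_prime. exact Hp.
  intros HT2.
  assert (P | (-2) ^ Z.of_nat k)%Z as H2.
  { replace ((-2) ^ Z.of_nat k)%Z with (P * (-2) ^ Z.of_nat k + ((T - Z.of_nat (p - 1) * (-2) ^ Z.of_nat k) - T))%Z.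
    apply Z.divide_add_r. exists ((-2) ^ Z.of_nat k)%Z; ring. now apply Z.divide_sub_r.
    unfold P. replace (Z.of_nat (p - 1)) with (Z.of_nat p - 1)%Z by lia. ring. }
  assert (rel_prime P ((-2) ^ Z.of_nat k)) as H3.
  { apply rel_prime_Zpower_r. lia. apply prime_rel_prime. exact Hp. intros H3. apply Z.divide_opp_r in H3.
    apply Z.divide_pos_le in H3; unfold P in H3; lia. }
  destruct H3 as [_ _ H3]. specialize (H3 P (Z.divide_refl P) H2). apply Z.divide_1_r in H3. unfold P in H3. lia.
Qed.

End PrimeLevel.

(** * Divisibility at level four *)

Section LevelFour.

Variables (k : nat) (chi : Z -> C) (g : C) (e : Z).
Hypothesis Hk : Nat.Odd k.
Hypothesis Hk3 : (2 <= k)%nat.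
Hypothesis Hr : real_character 4 chi.
Hypothesis Hchi3 : chi 3%Z = (- (1))%C.
Hypothesis HG : gauss_sum 4 chi g.

Lemma unit_row_four_multiple : forall u n, (u < 4)%nat -> Z.gcd (Z.of_nat u) 4 = 1%Z -> (1 <= n)%nat ->
  in_multiples 4 (unit_row_coef 4 chi (ZtoC e) (ZtoC 2) 1 0 k u n).
Proof.
  intros u n Hu Hg Hn. apply unit_row_coef_multiple; auto.
  apply (split_pow_ideal constant_int constant_int_subring 1 0 k 4 (fun i _ => scaled_eis_coef 4 (ZtoC 2) u 0 i)); auto.
  - now exists 4%Z.
  - exists (2 - 1 * Z.of_nat u)%Z. intros _. apply scaled_eis_coef_unit_const; auto. destruct u; [discriminate|lia].
  - intros i Hi. apply (scaled_eis_coef_high constant_int constant_int_subring 4 2 u (fun _ => 0%Z)); auto. apply constant_int_unity_root_0. lia.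
Qed.

(** For [x = i] or [-i] one has [(1 + x) / (1 - x) = x]. *)
Lemma icot_quarter : forall v, Z.gcd v 4 = 1%Z -> icot (ZtoC v / RtoC (INR 4)) = unity_root 4 v.
Proof.
  intros v Hv. pose proof (unity_root_unit_neq1 4 v ltac:(lia) Hv) as Hn. pose proof (unity_root_pow_N 4 v ltac:(lia)) as E.
  change (icot (ZtoC v / RtoC (INR 4))) with ((1 + unity_root 4 v) / (1 - unity_root 4 v))%C.
  assert ((1 + unity_root 4 v)%C <> RtoC 0) as Hn2.
  { intros h. assert (unity_root 4 v ^ 2 = 1)%C as E2.
    { replace (unity_root 4 v) with (- (1))%C. ring. transitivity (- (1) + (1 + unity_root 4 v))%C. rewrite h; ring. ring. }
    unfold unity_root in E2. rewrite <- e2pi_pow in E2.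
    revert E2. intros E2. assert ((1 - e2pi (RtoC (INR 2) * (ZtoC v / RtoC (INR 4))))%C <> RtoC 0) as H.
    { apply nonint_e2pi. intros n En.
      assert (v = 2 * n)%Z as Ev.
      { apply ZtoC_inj. rewrite ZtoC_mul, <- En. change (ZtoC 2) with (RtoC 2).
        replace (RtoC (INR 2)) with (RtoC 2) by (f_equal; simpl; ring). replace (RtoC (INR 4)) with (RtoC 4) by (f_equal; simpl; ring).
        field. }
      subst v. assert (2 | 1)%Z as h2. { rewrite <- Hv. apply Z.gcd_greatest. exists n; ring. now exists 2%Z. }
      apply Z.divide_1_r in h2. lia. }
    apply H. rewrite E2. ring. }
  assert (((1 + unity_root 4 v) * (1 + unity_root 4 v * unity_root 4 v))%C = RtoC 0) as H0.
  { assert ((1 - unity_root 4 v) * ((1 + unity_root 4 v) * (1 + unity_root 4 v * unity_root 4 v)) = 1 - unity_root 4 v ^ 4)%C as h by (simpl; ring).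
    rewrite E in h. replace (1 - 1)%C with (RtoC 0) in h by ring.
    transitivity ((1 - unity_root 4 v) * ((1 + unity_root 4 v) * (1 + unity_root 4 v * unity_root 4 v)) / (1 - unity_root 4 v))%C. field; auto. rewrite h. field; auto. }
  assert (unity_root 4 v * unity_root 4 v = - (1))%C as H1.
  { transitivity ((1 + unity_root 4 v) * (1 + unity_root 4 v * unity_root 4 v) / (1 + unity_root 4 v) - 1)%C. field; auto. rewrite H0. field; auto. }
  transitivity ((unity_root 4 v - unity_root 4 v * unity_root 4 v) / (1 - unity_root 4 v))%C. rewrite H1. f_equal. ring. field; auto.
Qed.

(** After scaling by [2] every coefficient in these rows is even, so a [k]-th
    power is divisible by [2^k]. *)
Lemma nonunit_row_four_multiple : forall u n, (u = 0 \/ u = 2)%nat -> in_multiples 4 (nonunit_row_coef 4 chi g (ZtoC e) (ZtoC 2) 1 0 k u n).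
Proof.
  intros u n Hu. pose proof (cyclo_subring 4) as HO.
  apply (nonunit_row_coef_multiple 4 chi g e (ZtoC 2) 1 0 k 4 u n
    (fun i v => match i with O => if Nat.eqb u 0 then ZtoC 2 * unity_root 4 v else 0 | _ => scaled_eis_coef 4 (ZtoC 2) u v i end)%C); auto.
  - intros v [|i] Hv; auto. unfold scaled_eis_coef, eis_coef. destruct Hu as [-> | ->]; cbn [Nat.eqb].
    + rewrite icot_quarter by auto. simpl (INR 0). unfold Cdiv. ring.
    + replace (RtoC (INR 2)) with (RtoC 2) by (f_equal; simpl; ring). replace (RtoC (INR 4)) with (RtoC 4) by (f_equal; simpl; ring).
      field.
  - apply (ideal_mult_dvd _ HO 4 (2 ^ Z.of_nat k)).
    { exists (2 ^ (Z.of_nat k - 2))%Z. change 4%Z with (2 ^ 2)%Z. rewrite <- Z.pow_add_r by lia. f_equal. lia. }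
    unfold split_pow. cbn [iterated_pow].
    apply (series_pow_all _ HO 2 (fun i v => match i with O => if Nat.eqb u 0 then ZtoC 2 * unity_root 4 v else 0 | _ => scaled_eis_coef 4 (ZtoC 2) u v i end)%C).
    intros [|i].
    + destruct (Nat.eqb u 0). exists (unity_root 4). split. apply cyclo_unity_root. reflexivity. apply (ideal_mult_zero _ HO).
    + apply (ideal_mult_dvd _ HO 2 (2 * 2)). now exists 2%Z.
      apply (scaled_eis_coef_high _ HO 4 2 u (fun v => v)); auto. lia. apply cyclo_unity_root.
Qed.

Lemma form_coef_four_multiple : forall n, (1 <= n)%nat -> in_multiples 4 (form_coef 4 chi g (ZtoC e) (ZtoC 2) 1 0 k n).
Proof.
  intros n Hn. unfold form_coef. apply in_multiples_csum. intros u Hu.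
  destruct u as [|[|[|[|u]]]]; try lia; simpl Z.eqb; cbv iota.
  - apply nonunit_row_four_multiple. auto.
  - apply unit_row_four_multiple; auto.
  - apply nonunit_row_four_multiple. auto.
  - apply unit_row_four_multiple; auto.
Qed.

(** The rows [u = 1] and [u = 3] have constant terms [1] and [-1] after
    scaling; for odd [k] and [chi 3 = -1] their contributions add up to [2]. *)
Lemma form_coef_four_constant : exists T, form_coef 4 chi g (ZtoC e) (ZtoC 2) 1 0 k 0 = (ZtoC 2 * ZtoC T)%C /\ Z.gcd 2 T = 1%Z.
Proof.
  destruct (nonunit_row_four_multiple 0 0 ltac:(auto)) as [a Ha]. destruct (nonunit_row_four_multiple 2 0 ltac:(auto)) as [b Hb].
  exists (1 + 2 * (a + b))%Z. split.
  - unfold form_coef. cbn [csum]. simpl Z.eqb. cbv iota. rewrite Ha, Hb.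
    unfold unit_row_coef. rewrite !split_pow_0_coef. rewrite (scaled_eis_coef_unit_const 4 2 1 1), (scaled_eis_coef_unit_const 4 2 1 3) by lia.
    rewrite (chi_nonunit 4 chi (Z.of_nat 0)) by (try apply Hr; simpl; lia).
    change (Z.of_nat 1) with 1%Z. change (Z.of_nat 3) with 3%Z. rewrite Hchi3, (chi_1 4 chi) by (try apply Hr; lia).
    change (2 - 1 * 1)%Z with 1%Z. change (2 - 1 * 3)%Z with (- (1))%Z.
    rewrite <- !ZtoC_pow. replace (1 ^ 0 * k)%nat with k by (simpl; lia).
    rewrite Z.pow_1_l by lia. rewrite Z.pow_opp_odd, Z.pow_1_l by (try lia; destruct Hk as [h ->]; exists (Z.of_nat h); lia).
    change (ZtoC 4) with (ZtoC (2 * 2)). rewrite ZtoC_opp, ZtoC_add, !ZtoC_mul, ZtoC_add, ZtoC_1.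
    change (ZtoC 2) with (RtoC 2). replace (RtoC 2) with (1 + 1)%C by (rewrite <- RtoC_plus; f_equal; ring). ring.
  - apply Zgcd_1_rel_prime. apply bezout_rel_prime. apply (Bezout_intro _ _ _ (- (a + b)) 1). ring.
Qed.

End LevelFour.

(** * The sign condition for the Eisenstein form *)

Definition supported_on (d : nat) (a : nat -> C) : Prop := forall n, ~ Nat.divide d n -> a n = RtoC 0.

Lemma supported_series_pow : forall d a k, supported_on d a -> supported_on d (series_pow a k).
Proof.
  intros d a k Ha. induction k; intros n Hn.
  - destruct n; [destruct Hn; now exists 0%nat | reflexivity].
  - cbn [series_pow]. unfold cauchy_prod. apply csum_eq0. intros i Hi.
    destruct (classic (Nat.divide d i)) as [h|h]; [|rewrite Ha by auto; ring].
    rewrite IHk; [ring|]. intros h2. apply Hn. replace n with (i + (n - i))%nat by lia. now apply Nat.divide_add_r.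
Qed.

Lemma supported_split_pow : forall d p t m a, supported_on d a -> supported_on d (split_pow p t m a).
Proof.
  intros d p t m a Ha. unfold split_pow. apply supported_series_pow. revert a Ha.
  induction t; intros a Ha; cbn [iterated_pow]; auto. apply IHt. now apply supported_series_pow.
Qed.

Lemma geom_coef_supported : forall d mu y, Nat.divide d mu -> supported_on d (geom_coef mu y).
Proof.
  intros d mu y Hd n Hn. unfold geom_coef. destruct (Nat.eqb n 0); auto.
  destruct (Nat.eqb (n mod mu) 0) eqn:E; auto. exfalso. apply Hn. apply Nat.eqb_eq in E.
  destruct mu as [|mu]. simpl in E. subst. now exists 0%nat.
  apply Nat.Div0.mod_divides in E. destruct E as [c ->]. now apply Nat.divide_mul_l.
Qed.

(** All exponents [mN + u] and [mN - u] are divisible by a common divisor of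
    [u] and [N]. *)
Lemma scaled_eis_coef_supported : forall d N s u v, Nat.divide d N -> Nat.divide d u -> supported_on d (scaled_eis_coef N s u v).
Proof.
  intros d N s u v HN Hu n Hn. unfold scaled_eis_coef, eis_coef. destruct n as [|n]. destruct Hn; now exists 0%nat.
  unfold lambert_coef. rewrite csum_eq0. ring. intros [|m] _; unfold lambert_term.
  now apply (geom_coef_supported d).
  rewrite !(geom_coef_supported d) by (auto; try apply Nat.divide_add_r; try apply Nat.divide_sub_r; auto; now apply Nat.divide_mul_r). ring.
Qed.

Lemma Zdivide_to_nat : forall d n, (0 < d)%Z -> (d | Z.of_nat n)%Z -> Nat.divide (Z.to_nat d) n.
Proof. intros d n Hd [q Hq]. exists (Z.to_nat q). nia. Qed.

(** The unit rows vanish through the factor [1 + ep chi(n)]. A nonunit row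
    involves only exponents that share a factor with [N], and [n] is prime to
    [N]. *)
Lemma form_coef_sign : forall N chi g ep s p t m n, (1 < N)%nat -> real_character (Z.of_nat N) chi -> (ep * ep = 1)%C ->
  chi (Z.of_nat n) = (- ep)%C -> form_coef N chi g ep s p t m n = RtoC 0.
Proof.
  intros N chi g ep s p t m n HN Hr Hep Hn. unfold form_coef. apply csum_eq0. intros u Hu.
  destruct (Z.eqb (Z.gcd (Z.of_nat u) (Z.of_nat N)) 1) eqn:E.
  - unfold unit_row_coef. rewrite Hn. replace (1 + ep * - ep)%C with (1 - ep * ep)%C by ring. rewrite Hep. ring.
  - apply Z.eqb_neq in E.
    assert (Z.gcd (Z.of_nat n) (Z.of_nat N) = 1%Z) as Hg.
    { apply (proj2 (proj2 (proj1 Hr))). rewrite Hn. intros h.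
      assert (ep = RtoC 0) as h0. { transitivity (- - ep)%C. ring. rewrite h. ring. }
      rewrite h0 in Hep. apply (f_equal fst) in Hep. simpl in Hep. lra. }
    unfold nonunit_row_coef. rewrite csum_eq0. ring. intros v _.
    set (d := Z.gcd (Z.of_nat u) (Z.of_nat N)) in *.
    assert (0 < d)%Z as Hd0. { pose proof (Z.gcd_nonneg (Z.of_nat u) (Z.of_nat N)). enough (d <> 0)%Z by lia. intros h. apply Z.gcd_eq_0_r in h. lia. }
    rewrite (supported_split_pow (Z.to_nat d)). ring.
    + apply scaled_eis_coef_supported; apply Zdivide_to_nat; auto. apply Z.gcd_divide_r. apply Z.gcd_divide_l.
    + intros [q Hq]. apply E. assert (d | 1)%Z as H1.
      { rewrite <- Hg. apply Z.gcd_greatest. exists (Z.of_nat q). lia. apply Z.gcd_divide_r. }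
      apply Z.divide_1_r_nonneg in H1; auto. lia.
Qed.

(** * Gauss sums *)

Definition gsum (N : nat) (chi : Z -> C) (n : nat) : C :=
  csum (fun j => chi (Z.of_nat j) * e2pi (RtoC (INR j) / RtoC (INR N)) ^ n)%C N.

Lemma gsum_unit : forall N chi n, (1 < N)%nat -> real_character (Z.of_nat N) chi -> Z.gcd (Z.of_nat n) (Z.of_nat N) = 1%Z ->
  gsum N chi n = (gsum N chi 1 * chi (Z.of_nat n))%C.
Proof.
  intros N chi n HN Hr Hg.
  assert (RtoC (INR N) <> RtoC 0) as H0 by (intros E'; apply RtoC_inj in E'; apply (not_0_INR N); auto; lia).
  set (F := fun j => (chi j * e2pi (ZtoC j / RtoC (INR N)))%C).
  assert (gsum N chi 1 = csum (fun j => F (Z.of_nat n * Z.of_nat j + 0)%Z) N) as E.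
  { rewrite csum_affine; auto; try lia.
    - unfold gsum. apply csum_ext. intros j _. unfold F. rewrite ZtoC_nat. simpl. ring.
    - intros j. unfold F. f_equal. apply Hr. rewrite ZtoC_add, ZtoC_nat.
      replace ((ZtoC j + RtoC (INR N)) / RtoC (INR N))%C with (ZtoC j / RtoC (INR N) + ZtoC 1)%C by (rewrite ZtoC_1; field; auto).
      apply e2pi_addZ. }
  rewrite E, Cmult_comm, <- csum_scal. apply csum_ext. intros j _. unfold F.
  rewrite Z.add_0_r, (proj1 (proj1 Hr)), <- e2pi_pow, ZtoC_mul, !ZtoC_nat.
  rewrite (Cmult_assoc (chi (Z.of_nat n))), (Cmult_assoc (chi (Z.of_nat n))).
  destruct Hr as [Hd Hsq]. rewrite (Hsq _ Hg). rewrite Cmult_1_l. f_equal. f_equal. field. auto.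
Qed.

(** If [g] were zero, all Fourier coefficients of [chi] would vanish;
    inverting the transform at [1] recovers [N chi(1)], which is not zero. *)
Lemma gsum_neq0 : forall N chi, (1 < N)%nat -> dirichlet_character (Z.of_nat N) chi ->
  (forall n, gsum N chi n = gsum N chi 1 * chi (Z.of_nat n))%C -> gsum N chi 1 <> RtoC 0.
Proof.
  intros N chi HN Hd HG H.
  assert (csum (fun n => e2pi (RtoC (INR n) / RtoC (INR N)) ^ (N - 1) * gsum N chi n)%C N = RtoC 0) as E.
  { apply csum_eq0. intros n _. rewrite HG, H. ring. }
  assert (RtoC (INR N) <> RtoC 0) as H0 by (intros E'; apply RtoC_inj in E'; apply (not_0_INR N); auto; lia).
  assert (csum (fun n => e2pi (RtoC (INR n) / RtoC (INR N)) ^ (N - 1) * gsum N chi n)%C N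
    = csum (fun j => chi (Z.of_nat j) * csum (fun n => e2pi (RtoC (INR n) / RtoC (INR N)) ^ (j + (N - 1))) N)%C N) as E2.
  { rewrite (csum_ext _ (fun n => csum (fun j => chi (Z.of_nat j) * e2pi (RtoC (INR n) / RtoC (INR N)) ^ (j + (N - 1))) N)%C).
    rewrite csum_swap. apply csum_ext. intros j _.
    apply (csum_scal (chi (Z.of_nat j)) (fun n => e2pi (RtoC (INR n) / RtoC (INR N)) ^ (j + (N - 1)))%C).
    intros n _. unfold gsum. rewrite <- csum_scal. apply csum_ext. intros j _. rewrite Cpow_add_r.
    replace (e2pi (RtoC (INR j) / RtoC (INR N)) ^ n)%C with (e2pi (RtoC (INR n) / RtoC (INR N)) ^ j)%C. ring.
    rewrite <- !e2pi_pow. f_equal. field. auto. }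
  rewrite E2 in E. rewrite (csum_single _ _ 1%nat) in E; [|lia|].
  - rewrite unit_sum_mod in E by lia. replace (1 + (N - 1))%nat with (1 * N)%nat in E by lia.
    rewrite Nat.Div0.mod_mul in E. cbn [Nat.eqb] in E.
    change (Z.of_nat 1) with 1%Z in E. rewrite (chi_1 (Z.of_nat N)) in E by (auto; lia).
    apply H0. rewrite <- E. ring.
  - intros j Hj Hj1. rewrite unit_sum_mod by lia.
    destruct (Nat.eqb ((j + (N - 1)) mod N) 0) eqn:Em; [|ring]. exfalso. apply Nat.eqb_eq in Em.
    apply Nat.Div0.mod_divides in Em. destruct Em as [c Hc]. destruct c as [|[|c]]; nia.
Qed.

Lemma gauss_sum_intro : forall N chi, (1 < N)%nat -> real_character (Z.of_nat N) chi ->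
  (forall n, Z.gcd (Z.of_nat n) (Z.of_nat N) <> 1%Z -> gsum N chi n = RtoC 0) -> gauss_sum N chi (gsum N chi 1).
Proof.
  intros N chi HN Hr H0.
  assert (forall n, gsum N chi n = gsum N chi 1 * chi (Z.of_nat n))%C as HG.
  { intros n. destruct (Z.eq_dec (Z.gcd (Z.of_nat n) (Z.of_nat N)) 1) as [h|h].
    now apply gsum_unit. rewrite H0, (chi_nonunit (Z.of_nat N) chi) by (auto; apply Hr). ring. }
  split; auto. apply gsum_neq0; auto. apply Hr.
Qed.

Lemma csum_character : forall N chi a, (0 < N)%nat -> dirichlet_character (Z.of_nat N) chi -> Z.gcd a (Z.of_nat N) = 1%Z ->
  chi a <> RtoC 1 -> csum (fun j => chi (Z.of_nat j)) N = RtoC 0.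
Proof.
  intros N chi a HN Hd Hg Ha. set (S := csum _ N).
  assert (chi a * S = S)%C as E.
  { unfold S. rewrite <- csum_scal.
    transitivity (csum (fun j => chi (a * Z.of_nat j + 0)%Z) N).
    - apply csum_ext. intros j _. rewrite Z.add_0_r. symmetry. apply Hd.
    - apply csum_affine; auto. apply Hd. }
  assert ((chi a - 1)%C <> RtoC 0) as H1.
  { intros h. apply Ha. transitivity (chi a - 1 + 1)%C. ring. rewrite h. ring. }
  transitivity ((chi a * S - S) / (chi a - 1))%C. field; auto. rewrite E. field; auto.
Qed.

Lemma gauss_sum_prime : forall p chi a, prime (Z.of_nat p) -> real_character (Z.of_nat p) chi ->
  Z.gcd a (Z.of_nat p) = 1%Z -> chi a <> RtoC 1 -> exists g, gauss_sum p chi g.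
Proof.
  intros p chi a Hp Hr Hg Ha. pose proof (prime_ge_2 _ Hp). exists (gsum p chi 1). apply gauss_sum_intro; auto. lia.
  intros n Hn. unfold gsum.
  assert (Z.of_nat p | Z.of_nat n)%Z as [c Hc].
  { apply NNPP. intros h. apply Hn. rewrite Z.gcd_comm. apply Zgcd_1_rel_prime. now apply prime_rel_prime. }
  rewrite (csum_ext _ (fun j => chi (Z.of_nat j))). apply (csum_character p chi a); auto. lia. apply Hr.
  intros j _. rewrite <- e2pi_pow. rewrite <- !ZtoC_nat, Hc, ZtoC_mul.
  assert (ZtoC (Z.of_nat p) <> RtoC 0) as H0 by (apply ZtoC_neq0; lia).
  replace (ZtoC c * ZtoC (Z.of_nat p) * (ZtoC (Z.of_nat j) / ZtoC (Z.of_nat p)))%C with (ZtoC (c * Z.of_nat j)) by (rewrite ZtoC_mul; field; auto).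
  rewrite e2pi_Z. ring.
Qed.

Lemma gauss_sum_four : forall chi, real_character 4 chi -> chi 3%Z = (- (1))%C -> exists g, gauss_sum 4 chi g.
Proof.
  intros chi Hr H3. exists (gsum 4 chi 1). apply gauss_sum_intro; auto. 
  intros n Hn. assert (exists h, n = 2 * h)%nat as [h ->].
  { destruct (Nat.Even_or_Odd n) as [[h Hh]|[h Hh]]. now exists h. exfalso. apply Hn.
    subst n. rewrite Z.gcd_comm. change (Z.of_nat 4) with (2 * 2)%Z. 
    apply Zgcd_1_rel_prime. apply rel_prime_sym. apply rel_prime_mult; apply bezout_rel_prime;
    apply (Bezout_intro _ _ _ 1 (- Z.of_nat h)); lia. }
  unfold gsum. cbn [csum]. change (Z.of_nat 3) with 3%Z. change (Z.of_nat 1) with 1%Z. rewrite H3, (chi_1 4 chi) by first [exact (proj1 Hr) | lia].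
  rewrite (chi_nonunit 4 chi (Z.of_nat 0)), (chi_nonunit 4 chi (Z.of_nat 2)) by first [exact (proj1 Hr) | cbv; discriminate].
  fold iota4. replace (e2pi (RtoC (INR 3) / RtoC (INR 4))) with (iota4 * iota4 * iota4)%C.
  - rewrite !Cpow_mult_r. replace (iota4 ^ 2)%C with (- (1))%C by (rewrite <- iota4_sq; simpl; ring).
    replace ((iota4 * iota4 * iota4) ^ 2)%C with (- (1))%C.
    ring. transitivity ((iota4 * iota4) * (iota4 * iota4) * (iota4 * iota4))%C. rewrite iota4_sq; ring. simpl; ring.
  - transitivity (iota4 ^ 3)%C. simpl; ring. unfold iota4. rewrite <- e2pi_pow. f_equal. simpl INR.
    replace (1 + 1 + 1 + 1) with 4 by ring. replace (1 + 1 + 1) with 3 by ring. field.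
Qed.

(** * Quadratic characters and primitive roots *)

Lemma quadratic_real : forall N chi, quadratic_character N chi -> real_character N chi.
Proof. intros N chi [H1 [H2 _]]. now split. Qed.

(** Of the two units modulo 4 only [3] can carry a nontrivial value. *)
Lemma chi4_3 : forall chi, quadratic_character 4 chi -> chi 3%Z = (- (1))%C.
Proof.
  intros chi H. pose proof (quadratic_real _ _ H) as Hr. destruct H as [Hd [Hsq [a [Ha Hne]]]].
  assert (chi a = chi (a mod 4)%Z) as E.
  { rewrite (Z.div_mod a 4) at 1 by lia. rewrite Z.add_comm, Z.mul_comm. now apply chi_period_mul. }
  assert (chi 3%Z <> RtoC 1) as H3.
  { intros h. apply Hne. rewrite E. pose proof (Z.mod_pos_bound a 4 ltac:(lia)) as Hb.
    assert (Z.gcd (a mod 4) 4 = 1%Z) as Hg by (rewrite Z.gcd_mod, Z.gcd_comm by lia; auto).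
    assert (a mod 4 = 0 \/ a mod 4 = 1 \/ a mod 4 = 2 \/ a mod 4 = 3)%Z as [h0|[h0|[h0|h0]]] by lia; rewrite h0 in *; try discriminate; auto.
    apply (chi_1 4); auto. lia. }
  destruct (chi_vals 4 chi 3 Hr) as [h|[h|h]]; auto; [|contradiction]. exfalso.
  apply (proj2 (proj2 Hd) 3%Z); auto.
Qed.

Lemma prime_divisors_single : forall N p, (0 < N)%Z -> prime p -> (p | N)%Z -> (forall q, prime q -> (q | N)%Z -> q = p) ->
  Defs.prime_divisors N = p :: nil.
Proof.
  intros N p HN Hp Hd Hu.
  assert (forall q, In q (Defs.prime_divisors N) <-> (prime q /\ (q | N)%Z)) as HI.
  { intros q. unfold Defs.prime_divisors. rewrite filter_In, in_map_iff. split.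
    - intros [_ H]. destruct (prime_dec q); try discriminate. destruct (Zdivide_dec q N); try discriminate. auto.
    - intros [Hq Hq2]. pose proof (prime_ge_2 q Hq). split.
      + exists (Z.to_nat q). split. lia. apply in_seq. apply Z.divide_pos_le in Hq2; lia.
      + destruct (prime_dec q); try contradiction. destruct (Zdivide_dec q N); auto. }
  assert (NoDup (Defs.prime_divisors N)) as HND.
  { unfold Defs.prime_divisors. apply NoDup_filter. apply NoDup_map_NoDup_ForallPairs. intros x y _ _ h; lia. apply seq_NoDup. }
  destruct (Defs.prime_divisors N) as [|q l].
  - exfalso. apply (proj2 (HI p)); auto.
  - assert (q = p) as -> by (apply Hu; apply HI; now left).
    f_equal. destruct l as [|r l]; auto. exfalso. inversion HND; subst. apply H1.
    assert (r = p) as -> by (apply Hu; apply HI; right; now left). now left.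
Qed.

Lemma local_component_single : forall N p chi chip, (0 < N)%Z -> prime p -> (p | N)%Z -> (forall q, prime q -> (q | N)%Z -> q = p) ->
  local_components N chi chip -> forall n, chip p n = chi n.
Proof.
  intros N p chi chip HN Hp Hd Hu [_ H] n. rewrite H, (prime_divisors_single N p) by auto. simpl. ring.
Qed.

Lemma least_nat : forall P : nat -> Prop, (exists n, P n) -> exists n, P n /\ forall m, (m < n)%nat -> ~ P m.
Proof.
  intros P [n Hn]. revert Hn. induction n as [n IH] using (well_founded_induction lt_wf). intros Hn.
  destruct (classic (exists m, (m < n)%nat /\ P m)) as [[m [H1 H2]]|H].
  - now apply (IH m).
  - exists n. split; auto. intros m Hm Pm. apply H. now exists m.
Qed.

Section PrimitiveRoot.

Variables (p t : Z).
Hypothesis Hp : prime p.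
Hypothesis Ht : primitive_root p t.

Lemma root_power_unit : forall i : nat, rel_prime p (t ^ Z.of_nat i).
Proof. intros i. apply rel_prime_Zpower_r. lia. apply Zgcd_1_rel_prime. rewrite Z.gcd_comm. apply Ht. Qed.

Lemma root_cancel : forall (i : nat) x, (p | t ^ Z.of_nat i * x)%Z -> (p | x)%Z.
Proof. intros i x H. apply (Gauss p (t ^ Z.of_nat i)); auto. apply root_power_unit. Qed.

(** The powers of [t] below an exponent [i] with [t^i = 1] represent all
    units, so there are at least [p - 1] of them. *)
Lemma primitive_root_order : forall i : nat, (0 < i)%nat -> (p | t ^ Z.of_nat i - 1)%Z -> (p - 1 <= Z.of_nat i)%Z.
Proof.
  pose proof (prime_ge_2 p Hp) as Hp2.
  intros i0 Hi0 Hi0d. set (d := i0).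
  set (L := map (fun i => (t ^ Z.of_nat i mod p)%Z) (seq 0 d)).
  assert (incl (map Z.of_nat (seq 1 (Z.to_nat (p - 1)))) L) as Hincl.
  { intros a Ha. apply in_map_iff in Ha. destruct Ha as [n [Hn Hin]]. apply in_seq in Hin.
    assert (Z.gcd a p = 1%Z) as Hg.
    { apply Zgcd_1_rel_prime. apply rel_prime_le_prime; auto. lia. }
    destruct Ht as [_ Hc]. destruct (Hc a Hg) as [j [Hj Hd]].
    apply in_map_iff. exists (Z.to_nat j mod d)%nat. split.
    - assert (p | t ^ Z.of_nat (Z.to_nat j mod d) - a)%Z as H.
      { pose proof (Nat.div_mod (Z.to_nat j) d ltac:(unfold d; lia)) as E. set (q := (Z.to_nat j / d)%nat) in *. set (r := (Z.to_nat j mod d)%nat) in *.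
        replace (t ^ Z.of_nat r - a)%Z with ((t ^ j - a) - t ^ Z.of_nat r * (t ^ (Z.of_nat d * Z.of_nat q) - 1))%Z.
        - apply Z.divide_sub_r; auto. apply Z.divide_mul_r. rewrite Z.pow_mul_r by lia.
          replace (((t ^ Z.of_nat d) ^ Z.of_nat q - 1)%Z) with ((t ^ Z.of_nat d) ^ Z.of_nat q - 1 ^ Z.of_nat q)%Z by (rewrite Z.pow_1_l; lia).
          now apply pow_sub_dvd.
        - rewrite Z.mul_sub_distr_l, <- Z.pow_add_r by lia. replace (Z.of_nat r + Z.of_nat d * Z.of_nat q)%Z with j by lia. ring. }
      destruct H as [c Hc']. replace (t ^ Z.of_nat (Z.to_nat j mod d))%Z with (a + c * p)%Z by lia.
      rewrite Z.mod_add by lia. apply Z.mod_small. lia.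
    - apply in_seq. pose proof (Nat.mod_upper_bound (Z.to_nat j) d ltac:(unfold d; lia)). lia. }
  apply NoDup_incl_length in Hincl.
  - unfold L in Hincl. rewrite !length_map, !length_seq in Hincl. unfold d in Hincl. lia.
  - apply NoDup_map_NoDup_ForallPairs. intros x y _ _ h; lia. apply seq_NoDup.
Qed.

(** The powers below the order of [t] are pairwise distinct units, hence the
    order is at most [p - 1]; with [primitive_root_order] it is equal to [p -
    1]. *)
Lemma primitive_root_fermat : (p | t ^ (p - 1) - 1)%Z.
Proof.
  pose proof (prime_ge_2 p Hp) as Hp2.
  destruct (least_nat (fun i => (0 < i)%nat /\ (p | t ^ Z.of_nat i - 1)%Z)) as [d [[Hd0 Hd] Hmin]].
  { destruct Ht as [Hg Hc].
    apply Zgcd_1_rel_prime in Hg. apply rel_prime_bezout in Hg. destruct Hg as [u v Huv].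
    assert (Z.gcd u p = 1%Z) as Hgu. { apply Zgcd_1_rel_prime. apply bezout_rel_prime. apply (Bezout_intro _ _ _ t v). lia. }
    destruct (Hc u Hgu) as [j [Hj [c Hd]]]. exists (S (Z.to_nat j)). split. lia.
    rewrite Nat2Z.inj_succ, Z2Nat.id, Z.pow_succ_r by lia. exists (t * c - v)%Z.
    replace (t ^ j)%Z with (u + c * p)%Z by lia. lia. }
  pose proof (primitive_root_order d Hd0 Hd) as Hle.
  set (L := map (fun i => (t ^ Z.of_nat i mod p)%Z) (seq 0 d)).
  assert (NoDup L) as HL.
  { unfold L. assert (forall x y, (x < y)%nat -> (y < d)%nat -> (t ^ Z.of_nat x mod p)%Z <> (t ^ Z.of_nat y mod p)%Z) as Hlt.
    { intros x y Hxy Hy E. apply (Hmin (y - x)%nat). lia. split. lia.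
      apply (root_cancel x). rewrite Z.mul_sub_distr_l, <- Z.pow_add_r by lia.
      replace (Z.of_nat x + Z.of_nat (y - x))%Z with (Z.of_nat y) by lia. rewrite Z.mul_1_r.
      apply Z.mod_divide. lia. rewrite Zminus_mod, E, Z.sub_diag. apply Z.mod_0_l. lia. }
    apply NoDup_map_NoDup_ForallPairs; [|apply seq_NoDup]. intros x y Hx Hy E. apply in_seq in Hx, Hy.
    destruct (Nat.lt_trichotomy x y) as [h|[h|h]]; auto; exfalso.
    apply (Hlt x y); auto; lia. apply (Hlt y x); auto; lia. }
  assert (incl L (map Z.of_nat (seq 1 (Z.to_nat (p - 1))))) as Hincl.
  { intros a Ha. apply in_map_iff in Ha. destruct Ha as [i [<- _]].
    apply in_map_iff. exists (Z.to_nat (t ^ Z.of_nat i mod p)).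
    pose proof (Z.mod_pos_bound (t ^ Z.of_nat i) p ltac:(lia)) as Hb. split. lia.
    apply in_seq. enough (t ^ Z.of_nat i mod p <> 0)%Z by lia.
    intros h. apply Z.mod_divide in h; [|lia]. assert (p | 1)%Z as h1 by (apply (root_cancel i); now rewrite Z.mul_1_r).
    apply Z.divide_1_r in h1. lia. }
  apply NoDup_incl_length in Hincl; auto. unfold L in Hincl. rewrite !length_map, !length_seq in Hincl.
  replace (p - 1)%Z with (Z.of_nat d) by lia. exact Hd.
Qed.

Lemma prime_half : (2 < p)%Z -> (p - 1 = 2 * ((p - 1) / 2))%Z.
Proof.
  intros Hp2. destruct (Z.Even_or_Odd p) as [[c Hc]|[c Hc]].
  - exfalso. assert (2 | p)%Z as Hd by (exists c; lia). apply (Znumtheory.prime_divisors _ Hp) in Hd. lia.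
  - rewrite Hc. replace (2 * c + 1 - 1)%Z with (c * 2)%Z by ring. rewrite Z.div_mul; lia.
Qed.

(** [t^((p-1)/2)] is a square root of [1] other than [1]. *)
Lemma primitive_root_half : (2 < p)%Z -> (p | t ^ ((p - 1) / 2) + 1)%Z.
Proof.
  intros Hp2. set (h := ((p - 1) / 2)%Z).
  assert (p - 1 = 2 * h)%Z as E by now apply prime_half.
  pose proof primitive_root_fermat as HF.
  replace (t ^ (p - 1) - 1)%Z with ((t ^ h - 1) * (t ^ h + 1))%Z in HF.
  2:{ rewrite E, (Z.mul_comm 2 h), Z.pow_mul_r by lia. ring. }
  apply prime_mult in HF; auto. destruct HF as [HF|HF]; auto. exfalso.
  replace h with (Z.of_nat (Z.to_nat h)) in HF by lia. apply primitive_root_order in HF; lia.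
Qed.

Lemma primitive_root_nontrivial : forall chi, quadratic_character p chi -> chi t <> RtoC 1.
Proof.
  intros chi [Hd [Hsq [a [Ha Hne]]]] h. apply Hne.
  destruct Ht as [_ Hc]. destruct (Hc a Ha) as [j [Hj [c Hjc]]].
  replace a with (t ^ Z.of_nat (Z.to_nat j) + (- c) * p)%Z by (rewrite Z2Nat.id; lia).
  rewrite chi_period_mul by auto.
  pose proof (prime_ge_2 p Hp). generalize (Z.to_nat j). intros i. induction i.
  apply (chi_1 p); auto. lia. rewrite Nat2Z.inj_succ, Z.pow_succ_r, (proj1 Hd), h, IHi by lia. ring.
Qed.

Lemma chi_root_power : forall chi (i : nat), dirichlet_character p chi -> chi t = RtoC (-1) -> chi (t ^ Z.of_nat i)%Z = (ZtoC (-1) ^ i)%C.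
Proof.
  intros chi i Hd Hchi. pose proof (prime_ge_2 p Hp). induction i. apply (chi_1 p); auto; lia.
  rewrite Nat2Z.inj_succ, Z.pow_succ_r, (proj1 Hd), Hchi, IHi by lia. reflexivity.
Qed.

(** With [h = (p-1)/2] the gcd condition says that [k] is an odd multiple of
    [h], so [t^k] is [-1] modulo [p]. For [u = t^i] both [chi(u)] and [u^k]
    are then [(-1)^i]. *)
Lemma euler_criterion : forall chi (k : nat), (2 < p)%Z -> real_character p chi -> chi t = RtoC (-1) ->
  Z.gcd (p - 1) (Z.of_nat k) = ((p - 1) / 2)%Z ->
  forall u c, Z.gcd u p = 1%Z -> chi u = ZtoC c -> (p | c * u ^ Z.of_nat k - 1)%Z.
Proof.
  intros chi k Hp2 Hr Hchi Hk u c Hu Hc.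
  pose proof (primitive_root_half Hp2) as Hhalf. set (h := ((p - 1) / 2)%Z) in *.
  assert (1 <= h)%Z as Hh1 by (unfold h; apply Z.div_le_lower_bound; lia).
  destruct (Z.gcd_divide_r (p - 1) (Z.of_nat k)) as [w Hw]. rewrite Hk in Hw.
  assert (2 * h <= p - 1)%Z as H2h by (unfold h; apply Z.mul_div_le; lia).
  assert (Z.Odd w) as [v Hv].
  { destruct (Z.Even_or_Odd w) as [[v Hv]|]; auto. exfalso.
    assert (p - 1 = 2 * h)%Z as E by now apply prime_half.
    assert (p - 1 | h)%Z as H. { rewrite <- Hk. apply Z.gcd_greatest. apply Z.divide_refl. exists v. rewrite Hw, Hv, E. ring. }
    apply Z.divide_pos_le in H; lia. }
  assert (p | t ^ Z.of_nat k - (-1))%Z as Htk.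
  { assert (0 <= w)%Z as Hw0 by nia.
    assert ((-1) ^ w = -1)%Z as Em. { rewrite Hv, Z.pow_add_r, Z.pow_mul_r by lia. change ((-1) ^ 2)%Z with 1%Z. rewrite Z.pow_1_l by lia. reflexivity. }
    rewrite Hw, (Z.mul_comm w h), Z.pow_mul_r by lia. rewrite <- Em at 1.
    replace w with (Z.of_nat (Z.to_nat w)) by lia. apply pow_sub_dvd. now replace (t ^ h - -1)%Z with (t ^ h + 1)%Z by ring. }
  destruct Ht as [_ Hcov]. destruct (Hcov u Hu) as [j [Hj [y Hy]]].
  set (i := Z.to_nat j). replace j with (Z.of_nat i) in Hy by (unfold i; lia).
  assert (c = (-1) ^ Z.of_nat i)%Z as ->.
  { apply ZtoC_inj. rewrite <- Hc, ZtoC_pow. replace u with (t ^ Z.of_nat i + (- y) * p)%Z by lia.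
    rewrite chi_period_mul by apply Hr. apply chi_root_power; auto. apply Hr. }
  replace ((-1) ^ Z.of_nat i * u ^ Z.of_nat k - 1)%Z with ((-1) ^ Z.of_nat i * (u ^ Z.of_nat k - (t ^ Z.of_nat i) ^ Z.of_nat k)
    + (-1) ^ Z.of_nat i * ((t ^ Z.of_nat k) ^ Z.of_nat i - (-1) ^ Z.of_nat i))%Z.
  - apply Z.divide_add_r; apply Z.divide_mul_r; apply pow_sub_dvd; auto. exists (- y)%Z. lia.
  - rewrite <- !Z.pow_mul_r, (Z.mul_comm (Z.of_nat i)) by lia.
    assert ((-1) ^ Z.of_nat i * (-1) ^ Z.of_nat i = 1)%Z as E. { rewrite <- Z.pow_mul_l. apply Z.pow_1_l. lia. }
    rewrite !Z.mul_sub_distr_l, E. ring.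
Qed.

End PrimitiveRoot.

(** * The congruence for the reduced form of order zero *)

Lemma qseries_of_laurent : forall f a, q_expansion f a -> (forall n, (n < 0)%Z -> a n = RtoC 0) ->
  qseries (fun n => a (Z.of_nat n)) f.
Proof.
  intros f a Hf Ha tau Ht. destruct (laurent_from 1 f a Hf) as [n0 H]. destruct (H (Z.min n0 0) ltac:(lia)) as [_ H1].
  specialize (H1 tau Ht). set (m := Z.to_nat (- Z.min n0 0)).
  pose proof (cser_tail _ _ m H1) as H2. rewrite csum_eq0 in H2.
  - replace (f tau) with (f tau - 0)%C by ring. eapply cser_ext; [|exact H2]. intros n. cbv beta.
    replace (Z.min n0 0 + Z.of_nat (m + n))%Z with (Z.of_nat n) by (unfold m; lia).
    f_equal. rewrite <- e2pi_pow, ZtoC_nat, ZtoC_1. f_equal. field.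
  - intros i Hi. rewrite Ha. ring. unfold m in Hi. lia.
Qed.

(** The part common to prime level and level four: the space is closed under
    linear combinations, has the vanishing property, and contains the
    Eisenstein form. *)
Lemma constant_term_divisibility : forall (N k : nat) chi chip eps p0 g s1 p t m D1 D T, (1 < N)%nat ->
  real_character (Z.of_nat N) chi -> gauss_sum N chi g ->
  prime p0 -> (p0 | Z.of_nat N)%Z -> (forall q, prime q -> (q | Z.of_nat N)%Z -> q = p0) ->
  (forall n, chip p0 n = chi n) -> (eps p0 = 1 \/ eps p0 = -1)%Z ->
  (forall ep, (ep * ep = 1)%C -> exists C0, 0 <= C0 /\ forall b f, qseries b f -> modular N k chi f -> sign_supported chi ep b ->
    cusp_controlled N k C0 b f) ->
  k = (p ^ t * m)%nat -> s1 <> RtoC 0 -> D1 <> 0%Z ->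
  (forall n, (1 <= n)%nat -> in_multiples (D1 * D) (form_coef N chi g (ZtoC (eps p0)) s1 p t m n)) ->
  form_coef N chi g (ZtoC (eps p0)) s1 p t m 0 = (ZtoC D1 * ZtoC T)%C -> Z.gcd D T = 1%Z ->
  (forall (m : Z) (f : C -> C) (a : Z -> C),
       reduced_form (Z.of_nat N) (Z.of_nat k) chi chip eps m f a ->
       forall n : Z, exists z : Z, (ZtoC (s (Z.of_nat N) m) * a n)%C = ZtoC z) ->
  forall f0 a0, reduced_form (Z.of_nat N) (Z.of_nat k) chi chip eps 0 f0 a0 ->
  forall n, (0 < n)%Z -> int_divides D (ZtoC (s (Z.of_nat N) 0) * a0 n)%C.
Proof.
  intros N k chi chip eps p0 g s1 p t m D1 D T HN Hr HG Hp0 Hd0 Hu0 Hchip Heps Hcc Hk Hs1 HD1 Hhigh Hconst HDT Hint f0 a0 Hred.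
  set (ep := ZtoC (eps p0)) in *.
  assert (ep * ep = 1)%C as Hep.
  { unfold ep. rewrite <- ZtoC_mul. destruct Heps as [-> | ->]; reflexivity. }
  assert (ep <> RtoC 0) as Hep0. { intros h. rewrite h in Hep. apply (f_equal fst) in Hep. simpl in Hep. lra. }
  set (V := fun a => exists f, in_A_eps (Z.of_nat N) (Z.of_nat k) chi chip eps f a).
  destruct (Hcc ep Hep) as [C0 [HC0 Hcontrol]].
  destruct (vanishing N k C0 ltac:(lia) HC0) as [B0 [HB0 Hvan]].
  assert (forall mm a, reduced V (s (Z.of_nat N)) mm a <-> exists f, reduced_form (Z.of_nat N) (Z.of_nat k) chi chip eps mm f a) as Hequiv.
  { intros mm a. split.
    - intros [[f Hf] [H1 [H2 H3]]]. exists f. split; [|split; [|split]]; auto.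
      intros n Hn Hne [g' [b [Hg' [Hb1 Hb2]]]]. apply (H3 n Hn Hne). exists b. split; auto. now exists g'.
    - intros [f [Hf [H1 [H2 H3]]]]. split; [|split; [|split]]; auto. now exists f.
      intros n Hn Hne [b [[g' Hg'] Hb]]. apply (H3 n Hn Hne). now exists g', b. }
  intros n Hn.
  apply (reduced_divisibility V) with (B0 := Z.of_nat B0) (E := zero_extension (form_coef N chi g ep s1 p t m)) (D1 := D1) (T := T); auto.
  - intros a b c [f Hf] [f' Hf']. exists (lcomb c f f'). now apply in_A_eps_lcomb.
  - intros a [f [_ [[n0 [H0 _]] _]]]. now exists n0.
  - intros a [f [[_ [_ Hmod]] [Hq Hsup]]] Hlow.
    assert (forall n, a (Z.of_nat n) = RtoC 0) as Hnat.
    { apply (Hvan (fun n => a (Z.of_nat n)) f).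
      - apply qseries_of_laurent; auto. intros; apply Hlow; lia.
      - apply Hcontrol.
        + apply qseries_of_laurent; auto. intros; apply Hlow; lia.
        + intros a' b' c' d' tau Hdet Hc Ht. rewrite <- Cpow_Z_nat. now apply Hmod.
        + intros j Hj. destruct (classic (chi (Z.of_nat j) = ep)) as [h|h]. now rewrite h.
          rewrite (Hsup (Z.of_nat j) p0); auto. ring. rewrite Hchip, ZtoC_opp. fold ep.
          destruct (chi_vals _ chi (Z.of_nat j) Hr) as [e|[e|e]]; [contradiction| |];
          rewrite e in *; unfold ep in *; destruct Heps as [E|E]; rewrite E in *; change (-1)%Z with (- (1))%Z in *;
          rewrite ?ZtoC_opp, ?ZtoC_1 in *; try (exfalso; apply h; reflexivity); try ring.
      - intros j Hj. apply Hlow. lia. }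
    intros j. destruct (Z_lt_ge_dec j 0). apply Hlow; lia. rewrite <- (Z2Nat.id j) by lia. apply Hnat.
  - intros mm. unfold s. apply Z.pow_nonzero; lia.
  - intros mm a Ha. apply Hequiv in Ha. destruct Ha as [f Hf]. now apply (Hint mm f a).
  - apply Hequiv. now exists f0.
  - set (kap := (s1 ^ k / (ep * g))%C). exists (eis_form N chi k (ep * g) kap). destruct HG as [Hg HGn].
    assert (kap <> RtoC 0) as Hkap.
    { intros h. apply (Cpow_nz s1 k Hs1). transitivity (kap * (ep * g))%C. unfold kap. field; auto. rewrite h. ring. }
    split; [|split].
    + now apply eis_form_weakly_holomorphic.
    + apply expn_laurent. lia.
      apply (expn_ext 1 (fun n => kap * (/ kap * form_coef N chi g ep s1 p t m n))%C _ (eis_form N chi k (ep * g) kap)); auto.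
      * intros j. field. auto.
      * apply (eis_form_expn N chi k (ep * g) kap (fun n => / kap * form_coef N chi g ep s1 p t m n)%C); auto.
        assert (gauss_sum N chi g) as HG by now split.
        pose proof (form_coef_expn N chi g ep s1 p t m HN Hr HG Hep) as HE. rewrite <- Hk in HE. fold kap in HE.
        apply (expn_ext _ _ _ _ _ (fun _ => eq_refl) ) with (2 := expn_scal (Z.of_nat N) (/ kap)%C _ _ HE).
        intros z _. field. auto.
    + intros j q Hq Hqd Hj. apply Hu0 in Hq; auto. subst q. rewrite Hchip, ZtoC_opp in Hj. fold ep in Hj.
      unfold zero_extension. destruct (j <? 0)%Z eqn:Ej; auto. apply Z.ltb_ge in Ej.
      apply form_coef_sign; auto. rewrite Z2Nat.id by lia. auto.
  - intros j Hj. unfold zero_extension. destruct (j <? 0)%Z eqn:Ej. apply in_multiples_zero. apply Z.ltb_ge in Ej. apply Hhigh. lia.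
Qed.

Open Scope Z_scope.

Theorem theorem4p2 :
  forall (N k : Z) (chi : Z -> C) (chip : Z -> Z -> C) (eps : Z -> Z),
    1 < N -> prime_power N ->
    primitive_character N chi -> quadratic_character N chi ->
    local_components N chi chip ->
    2 <= k ->
    sign_vector N eps ->
    (forall (m : Z) (f : C -> C) (a : Z -> C),
       reduced_form N k chi chip eps m f a ->
       forall n : Z, exists z : Z, (ZtoC (s N m) * a n)%C = ZtoC z) ->
    forall (f0 : C -> C) (a0 : Z -> C),
      reduced_form N k chi chip eps 0 f0 a0 ->
      forall n : Z, 0 < n ->
        (forall p nu t : Z,
           N = p -> prime p -> 2 < p ->
           exactly_divides p nu k ->
           primitive_root p t ->
           (chi t = RtoC 1 /\ (p - 1 | k)) \/
           (chi t = RtoC (-1) /\ Z.gcd (p - 1) k = (p - 1) / 2) ->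
           int_divides (p ^ (nu + 1)) (ZtoC (s N 0) * a0 n)%C)
        /\
        (N = 4 -> ~ (2 | k) ->
           int_divides 2 (ZtoC (s N 0) * a0 n)%C).
Proof.
  intros N k chi chip eps HN _ _ Hquad Hloc Hk Heps Hint f0 a0 Hred n Hn.
  pose proof (quadratic_real _ _ Hquad) as Hr. split.
  - intros p nu t -> Hp Hp2 [Hnu [[c Hc] _]] Ht [[H1 _]|[H1 Hgcd]].
    (* A real character with value [1] at a primitive root is trivial. *)
    { exfalso. now apply (primitive_root_nontrivial p t Hp Ht chi Hquad). }
    assert (forall q, prime q -> (q | p) -> q = p) as Huniq.
    { intros q Hq Hqd. now apply prime_div_prime. }
    pose proof (local_component_single p p chi chip ltac:(lia) Hp (Z.divide_refl p) Huniq Hloc) as Hchip.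
    pose proof Hquad as [_ [_ [b [Hb Hbne]]]].
    replace p with (Z.of_nat (Z.to_nat p)) in * by lia.
    set (P := Z.to_nat p) in *.
    assert (0 <= c)%Z as Hc0 by (assert (0 < Z.of_nat P ^ nu)%Z by (apply Z.pow_pos_nonneg; lia); nia).
    assert (k = Z.of_nat (P ^ Z.to_nat nu * Z.to_nat c))%Z as Ek.
    { rewrite Nat2Z.inj_mul, Nat2Z.inj_pow, !Z2Nat.id by lia. rewrite Hc. ring. }
    set (K := (P ^ Z.to_nat nu * Z.to_nat c)%nat) in *. rewrite Ek in *.
    destruct (gauss_sum_prime P chi b Hp Hr Hb Hbne) as [g HG].
    destruct (form_coef_prime_constant P (Z.to_nat nu) (Z.to_nat c) chi g (eps (Z.of_nat P)) Hp ltac:(lia) Hr HG ltac:(fold K; lia)) as [T [HT1 HT2]].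
    { intros u d Hu Hd. fold K. apply (euler_criterion (Z.of_nat P) t Hp Ht chi K); auto. }
    rewrite Z2Nat.id in HT2 by auto.
    apply (constant_term_divisibility P K chi chip eps (Z.of_nat P) g (ZtoC (Z.of_nat P)) P (Z.to_nat nu) (Z.to_nat c) 1 _ T) with (f0 := f0); auto.
    + lia.
    + apply Z.divide_refl.
    + apply Heps; auto. apply Z.divide_refl.
    + intros ep Hep. apply (cusp_controlled_prime P K chi g ep); auto. lia.
    + apply ZtoC_neq0. lia.
    + lia.
    + intros i Hi. rewrite Z.mul_1_l.
      pose proof (form_coef_prime_multiple P (Z.to_nat nu) (Z.to_nat c) chi g (eps (Z.of_nat P)) Hp ltac:(lia) Hr HG i Hi) as H.
      now rewrite Z2Nat.id in H by auto.
    + rewrite HT1, ZtoC_1. ring.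
  - intros -> Hodd. pose proof (chi4_3 chi Hquad) as H3.
    assert (forall q, prime q -> (q | 4) -> q = 2) as Huniq.
    { intros q Hq Hqd. apply (prime_power_prime q 2 2); auto; try lia. apply prime_2. }
    pose proof (local_component_single 4 2 chi chip ltac:(lia) prime_2 ltac:(now exists 2) Huniq Hloc) as Hchip.
    destruct (gauss_sum_four chi Hr H3) as [g HG].
    replace k with (Z.of_nat (Z.to_nat k)) in * by lia. set (K := Z.to_nat k) in *.
    assert (Nat.Odd K) as HK.
    { destruct (Nat.Even_or_Odd K) as [[h Hh]|]; auto. exfalso. apply Hodd. exists (Z.of_nat h). lia. }
    destruct (form_coef_four_constant K chi g (eps 2) HK ltac:(lia) Hr H3 HG) as [T [HT1 HT2]].
    apply (constant_term_divisibility 4 K chi chip eps 2 g (ZtoC 2) 1 0 K 2 2 T) with (f0 := f0); auto.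
    + apply prime_2.
    + now exists 2.
    + apply Heps. apply prime_2. now exists 2.
    + intros ep Hep. now apply cusp_controlled_4.
    + simpl. lia.
    + apply ZtoC_neq0. lia.
    + lia.
    + intros i Hi. apply form_coef_four_multiple; auto. lia.
Qed.
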